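(* Let $R$ be a semilocal commutative ring with $2\in R^\times$ and let $T$ be a quadratic étale $R$-algebra with standard involution $\theta$. Let $\lambda\in T$ be an element such that $\lambda^2\in R^\times$ and $T=R\oplus\lambda R$ (such $\lambda$ always exists). Then the sequence of Witt groups $$0\to W_1(T,\theta)\xrightarrow{\mathrm{Tr}}W_1(R,\mathrm{id}_R)\xrightarrow{\lambda\rho}W_1(T,\mathrm{id}_T)\xrightarrow{\mathrm{Tr}}W_1(R,\mathrm{id}_R)\xrightarrow{\lambda\rho}W_{-1}(T,\theta)\to0$$ is exact, where $\mathrm{Tr}$ sends the class of $(Q,g)$ to the class of $(Q,\mathrm{Tr}_{T/R}\circ g)$, and $\lambda\rho$ sends the class of $(V,f)$ to the class of $(V\otimes_RT,\lambda\cdot\rho f)$, with $\rho f$ the base change of $f$ along the inclusion $\rho$ of $(R,\mathrm{id}_R)$ into $(T,\mathrm{id}_T)$ in the first occurrence and into $(T,\theta)$ in the second.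
   Context: Conventions. Rings are commutative and unital, and $2$ is invertible in all of them. A quadratic étale $R$-algebra is a finite étale (commutative) $R$-algebra $T$ of constant rank $2$; its standard involution is $x^\theta=\mathrm{Tr}_{T/R}(x)-x$, the unique $R$-involution with fixed ring $R$. Hermitian forms. For a ring (or algebra) with involution $(A,\sigma)$ and a central $\varepsilon$ with $\varepsilon^\sigma\varepsilon=1$, a unimodular $\varepsilon$-hermitian space is a pair $(P,f)$ with $P$ a finitely generated projective right $A$-module and $f:P\times P\to A$ biadditive with $f(xa,yb)=a^\sigma f(x,y)b$, $f(x,y)=\varepsilon f(y,x)^\sigma$ and $x\mapsto f(x,-):P\to\mathrm{Hom}_A(P,A)$ bijective. It is hyperbolic if $P=L\oplus M$ with $f(L,L)=f(M,M)=0$. $W_\varepsilon(A,\sigma)$ is the Grothendieck group of unimodular $\varepsilon$-hermitian spaces over $(A,\sigma)$ (orthogonal sum) modulo the subgroup generated by hyperbolic ones. Base change: for $(V,f)$ over $(R,\mathrm{id}_R)$ and $\kappa\in\{\mathrm{id}_T,\theta\}$, the base change of $f$ to $(T,\kappa)$ is $(\rho f)(x\otimes a,y\otimes b)=a^{\kappa}f(x,y)b$ on $V\otimes_RT$; and $(\lambda\cdot\rho f)(x,y)=\lambda\,(\rho f)(x,y)$, which is $1$-hermitian over $(T,\mathrm{id}_T)$, respectively $(-1)$-hermitian over $(T,\theta)$. *)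

(* Defs.v *)
From HB Require Import structures.
From mathcomp Require Import all_boot all_order all_algebra.
From mathcomp Require Import generic_quotient.
From mathcomp Require Import boolp classical_sets cardinality.

Set Implicit Arguments.
Unset Strict Implicit.
Unset Printing Implicit Defensive.

Import GRing.Theory.
Local Open Scope ring_scope.
Local Open Scope quotient_scope.

(* A type of modules lives in a universe too large to carry any instance of
   the algebraic hierarchy, so that neither [{eq_quot _}] nor [zmodType] can be
   used for Witt groups: equivalence classes are taken as sets. *)

Definition class_of (X : Type) (e : X -> X -> Prop) : Type :=
  {A : X -> Prop | exists x, A = e x}.

(* Locked, so that unification never compares representatives. *)
HB.lock Definition cls (X : Type) (e : X -> X -> Prop) (x : X) : class_of e :=
  exist _ (e x) (ex_intro _ x erefl).

HB.lock Definition rep (X : Type) (e : X -> X -> Prop) (c : class_of e) : X :=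
  projT1 (cid (projT2 c)).

Definition equivalence (X : Type) (e : X -> X -> Prop) : Prop :=
  [/\ forall x, e x x, forall x y, e x y -> e y x
    & forall x y z, e x y -> e y z -> e x z].

Lemma repK (X : Type) (e : X -> X -> Prop) (c : class_of e) :
  cls e (rep c) = c.
Proof.
rewrite rep.unlock cls.unlock; case: c => A hA /=; case: cid => x /= Ax; subst A.
by congr exist; exact: Prop_irrelevance.
Qed.

Lemma cls_eq (X : Type) (e : X -> X -> Prop) (x y : X) : equivalence e ->
  cls e x = cls e y <-> e x y.
Proof.
move=> [er es et]; rewrite cls.unlock; split=> [[xy]|xy].
  by rewrite xy.
have exy : e x = e y.
  by apply/funext => z; apply/propext; split; apply: et => //; exact: es.
move: (ex_intro _ x _) (ex_intro _ y _); rewrite exy => p q.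
by congr exist; exact: Prop_irrelevance.
Qed.

Lemma rep_cls (X : Type) (e : X -> X -> Prop) (x : X) : equivalence e ->
  e x (rep (cls e x)).
Proof. by move=> he; apply/cls_eq => //; rewrite repK. Qed.

Definition finitely_generated (A : comNzRingType) (P : lmodType A) : Prop :=
  exists (n : nat) (e : 'I_n -> P),
    forall x, exists a : 'I_n -> A, x = \sum_(i < n) a i *: e i.

Definition projective (A : comNzRingType) (P : lmodType A) : Prop :=
  forall (M N : lmodType A) (g : {linear M -> N}) (h : {linear P -> N}),
    (forall y, exists x, g x = y) ->
    exists k : {linear P -> M}, forall x, g (k x) = h x.

Definition fg_projective (A : comNzRingType) (P : lmodType A) : Prop :=
  finitely_generated P /\ projective P.

Record coord_system (A : comNzRingType) (P : lmodType A) := CoordSystem {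
  cs_size : nat;
  cs_vec : 'I_cs_size -> P;
  cs_coord : 'I_cs_size -> {scalar P};
  cs_spec : forall x, x = \sum_(i < cs_size) cs_coord i x *: cs_vec i }.

Arguments cs_vec {A P} c i.
Arguments cs_coord {A P} c i.

Definition cs_trace (A : comNzRingType) (P : lmodType A) (b : coord_system P)
  (u : P -> P) : A := \sum_i cs_coord b i (u (cs_vec b i)).

(* The trace of an endomorphism of a finitely generated projective module; it
   is 0 by convention if [P] has no coordinate system. *)
Definition mod_trace (A : comNzRingType) (P : lmodType A) (u : P -> P) : A :=
  if pselect (inhabited (coord_system P)) is left h
  then cs_trace (inhabited_witness h) u else 0.

Lemma cs_trace_eq (A : comNzRingType) (P : lmodType A)
    (b c : coord_system P) (u : {linear P -> P}) : cs_trace b u = cs_trace c u.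
Proof.
rewrite /cs_trace.
transitivity (\sum_i \sum_j cs_coord c j (cs_vec b i) * cs_coord b i (u (cs_vec c j))).
  apply: eq_bigr => i _; rewrite {1}(cs_spec c (cs_vec b i)).
  by rewrite !linear_sum; apply: eq_bigr => j _; rewrite !linearZ.
rewrite exchange_big; apply: eq_bigr => j _ /=.
rewrite [in RHS](cs_spec b (u (cs_vec c j))) linear_sum /=.
by apply: eq_bigr => i _; rewrite linearZ /= mulrC.
Qed.

Lemma mod_traceE (A : comNzRingType) (P : lmodType A) (b : coord_system P)
    (u : {linear P -> P}) : mod_trace u = cs_trace b u.
Proof.
rewrite /mod_trace; case: pselect => [h|[]]; last by constructor.
exact: cs_trace_eq.
Qed.

Lemma fg_projective_coord_system (A : comNzRingType) (P : lmodType A) :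
  fg_projective P -> inhabited (coord_system P).
Proof.
move=> [[n [e he]] proj].
pose g (v : 'rV[A]_n) : P := \sum_i v 0 i *: e i.
have g_lin : linear g.
  move=> a u v; rewrite /g scaler_sumr -big_split; apply: eq_bigr => i _ /=.
  by rewrite !mxE scalerDl scalerA.
pose gM := GRing.isLinear.Build _ _ _ _ g g_lin.
pose gL : {linear 'rV[A]_n -> P} := HB.pack g gM.
have [|k hk] := proj _ _ gL idfun.
  move=> x; have [a ->] := he x; exists (\row_i a i).
  by apply: eq_bigr => i _; rewrite mxE.
pose c i (x : P) : A := k x 0 i.
have c_lin i : scalar (c i) by move=> a x y; rewrite /c linearP !mxE.
pose cL i : {scalar P} := HB.pack (c i) (GRing.isLinear.Build _ _ _ _ (c i) (c_lin i)).
by constructor; apply: (@CoordSystem _ _ n e cL) => x; rewrite -[LHS]hk.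
Qed.

(* The tensor product of [V] and [M] over [R]: finite formal sums of pure
   tensors, two of them being identified when every bilinear map takes the same
   value on both. *)
Section Tensor.
Context {R : comNzRingType} (V M : lmodType R).

Definition is_bilinear (N : lmodType R) (b : V -> M -> N) : Prop :=
  (forall m, linear (fun v => b v m)) /\ (forall v, linear (b v)).

Definition eval_sum (N : lmodType R) (b : V -> M -> N) (s : seq (V * M)) : N :=
  \sum_(p <- s) b p.1 p.2.

Definition tens_rel (s s' : seq (V * M)) : bool :=
  `[< forall (N : lmodType R) (b : V -> M -> N),
        is_bilinear b -> eval_sum b s = eval_sum b s' >].

Lemma tens_rel_refl : reflexive tens_rel.
Proof. by move=> s; apply/asboolP. Qed.
Lemma tens_rel_sym : symmetric tens_rel.
Proof.
by move=> s s'; apply/idP/idP => /asboolP h; apply/asboolP => N b hb; rewrite h.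
Qed.
Lemma tens_rel_trans : transitive tens_rel.
Proof.
move=> s2 s1 s3 /asboolP h1 /asboolP h2; apply/asboolP => N b hb.
by rewrite h1 // h2.
Qed.

Canonical tens_equiv :=
  EquivRel tens_rel tens_rel_refl tens_rel_sym tens_rel_trans.

Definition tens : Type := {eq_quot tens_rel}.
HB.instance Definition _ := Choice.on tens.
HB.instance Definition _ := EqQuotient.on tens.

Definition tens_sum (s : seq (V * M)) : tens := \pi_tens s.

Lemma tens_sumP s s' : tens_sum s = tens_sum s' <->
  forall (N : lmodType R) (b : V -> M -> N),
    is_bilinear b -> eval_sum b s = eval_sum b s'.
Proof.
split=> [/eqP|h]; first by rewrite eqmodE => /asboolP.
by apply/eqP; rewrite eqmodE; apply/asboolP.
Qed.

Lemma tens_sumK (x : tens) : tens_sum (repr x) = x.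
Proof. exact: reprK. Qed.

Definition tens_add (x y : tens) : tens := tens_sum (repr x ++ repr y).
Definition tens_opp (x : tens) : tens := tens_sum [seq (p.1, - p.2) | p <- repr x].

Lemma eval_repr (N : lmodType R) (b : V -> M -> N) s :
  is_bilinear b -> eval_sum b (repr (tens_sum s)) = eval_sum b s.
Proof. by move=> hb; have /tens_sumP := tens_sumK (tens_sum s); apply. Qed.

Lemma eval_cat (N : lmodType R) (b : V -> M -> N) s s' :
  eval_sum b (s ++ s') = eval_sum b s + eval_sum b s'.
Proof. exact: big_cat. Qed.

Lemma tens_addE s s' : tens_add (tens_sum s) (tens_sum s') = tens_sum (s ++ s').
Proof. by apply/tens_sumP => N b hb; rewrite !eval_cat !eval_repr. Qed.

Lemma tens_addA : associative tens_add.
Proof.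
move=> x y z; rewrite -[x]tens_sumK -[y]tens_sumK -[z]tens_sumK.
by rewrite !tens_addE catA.
Qed.

Lemma tens_addC : commutative tens_add.
Proof.
move=> x y; rewrite -[x]tens_sumK -[y]tens_sumK !tens_addE.
by apply/tens_sumP => N b hb; rewrite !eval_cat addrC.
Qed.

Lemma tens_add0 : left_id (tens_sum [::]) tens_add.
Proof. by move=> x; rewrite -[x]tens_sumK tens_addE. Qed.

Lemma bilinearN (N : lmodType R) (b : V -> M -> N) v m :
  is_bilinear b -> b v (- m) = - b v m.
Proof.
move=> [_ hb]; pose bM := GRing.isLinear.Build _ _ _ _ (b v) (hb v).
exact: (raddfN (HB.pack (b v) bM : {linear M -> N})).
Qed.

Lemma tens_addN : left_inverse (tens_sum [::]) tens_opp tens_add.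
Proof.
move=> x; rewrite -{2}[x]tens_sumK /tens_opp tens_addE.
apply/tens_sumP => N b hb; rewrite eval_cat /eval_sum big_map big_nil.
by rewrite -big_split big1 // => p _ /=; rewrite bilinearN // addNr.
Qed.

HB.instance Definition _ :=
  GRing.isZmodule.Build tens tens_addA tens_addC tens_add0 tens_addN.

Definition pure (v : V) (m : M) : tens := tens_sum [:: (v, m)].

Lemma tens_sum_pure s : tens_sum s = \sum_(p <- s) pure p.1 p.2.
Proof.
elim: s => [|p s IH]; first by rewrite big_nil.
rewrite big_cons -IH [RHS]tens_addE; by case: p.
Qed.

Lemma tensP (x : tens) : x = \sum_(p <- repr x) pure p.1 p.2.
Proof. by rewrite -tens_sum_pure tens_sumK. Qed.

Lemma eval_repr_pure (N : lmodType R) (b : V -> M -> N) v m :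
  is_bilinear b -> eval_sum b (repr (pure v m)) = b v m.
Proof. by move=> hb; rewrite eval_repr // /eval_sum big_seq1. Qed.

End Tensor.

Notation "v ⊗ m" := (pure v m) (at level 40, left associativity) : ring_scope.

(* If the right factor is an [R]-algebra [T], then [V ⊗ T] is a [T]-module. *)
Section ExtScalars.
Context {R : comNzRingType} (V : lmodType R) (T : comAlgType R).

Definition ext_scalars : Type := tens V T.
HB.instance Definition _ := GRing.Zmodule.on ext_scalars.

Definition ext_scale (t : T) (x : ext_scalars) : ext_scalars :=
  tens_sum [seq (p.1, t * p.2) | p <- repr x].

Lemma bilinear_scale (N : lmodType R) (b : V -> T -> N) (t : T) :
  is_bilinear b -> is_bilinear (fun v a => b v (t * a)).
Proof.
move=> [hl hr]; split=> [m|v] a x y; first exact: hl.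
by rewrite mulrDr -scalerAr hr.
Qed.

Lemma ext_scaleE t s :
  ext_scale t (tens_sum s) = tens_sum [seq (p.1, t * p.2) | p <- s].
Proof.
apply/tens_sumP => N b hb; rewrite /eval_sum !big_map /=.
exact: (eval_repr s (bilinear_scale t hb)).
Qed.

Fact ext_scalerA a b v : ext_scale a (ext_scale b v) = ext_scale (a * b) v.
Proof.
rewrite -[v]tens_sumK !ext_scaleE -map_comp.
by congr tens_sum; apply: eq_map => p /=; rewrite mulrA.
Qed.

Fact ext_scale1r : left_id 1 ext_scale.
Proof.
move=> v; rewrite -[v]tens_sumK ext_scaleE; congr tens_sum.
by rewrite -[RHS]map_id; apply: eq_map => -[x a] /=; rewrite mul1r.
Qed.

Fact ext_scalerDr : right_distributive ext_scale +%R.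
Proof.
move=> a x y; rewrite -[x]tens_sumK -[y]tens_sumK.
by rewrite [_ + _]tens_addE !ext_scaleE map_cat [RHS]tens_addE.
Qed.

Fact ext_scalerDl v : {morph ext_scale^~ v : a b / a + b}.
Proof.
move=> a b; rewrite -[v]tens_sumK !ext_scaleE [RHS]tens_addE.
apply/tens_sumP => N h hb; rewrite eval_cat /eval_sum !big_map -big_split.
apply: eq_bigr => p _ /=; rewrite mulrDl; case: hb => _ hr.
by have := hr p.1 1 (a * p.2) (b * p.2); rewrite !scale1r.
Qed.

HB.instance Definition _ := GRing.Zmodule_isLmodule.Build T ext_scalars
  ext_scalerA ext_scale1r ext_scalerDr ext_scalerDl.

Lemma ext_scale_pure (t : T) v a :
  t *: (v ⊗ a : ext_scalars) = v ⊗ (t * a).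
Proof. exact: ext_scaleE. Qed.

End ExtScalars.

Section ResScalars.
Context {R : comNzRingType} (T : comAlgType R) (Q : lmodType T).

Definition res_scalars : Type := Q.
HB.instance Definition _ := GRing.Zmodule.on res_scalars.

Definition res_scale (a : R) (x : res_scalars) : res_scalars :=
  (a%:A : T) *: (x : Q).

Fact res_scalerA a b v : res_scale a (res_scale b v) = res_scale (a * b) v.
Proof. by rewrite /res_scale scalerA -scalerAl mul1r scalerA. Qed.
Fact res_scale1r : left_id 1 res_scale.
Proof. by move=> v; rewrite /res_scale !scale1r. Qed.
Fact res_scalerDr : right_distributive res_scale +%R.
Proof. by move=> a x y; rewrite /res_scale scalerDr. Qed.
Fact res_scalerDl v : {morph res_scale^~ v : a b / a + b}.
Proof. by move=> a b; rewrite /res_scale !scalerDl. Qed.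

HB.instance Definition _ := GRing.Zmodule_isLmodule.Build R res_scalars
  res_scalerA res_scale1r res_scalerDr res_scalerDl.

End ResScalars.

Definition is_ideal (R : comNzRingType) (I : set R) : Prop :=
  [/\ I 0, forall x y, I x -> I y -> I (x + y) & forall a x, I x -> I (a * x)].

Definition is_maximal_ideal (R : comNzRingType) (I : set R) : Prop :=
  [/\ is_ideal I, ~ I 1
    & forall J : set R, is_ideal J -> ~ J 1 -> (I `<=` J)%classic -> J = I].

Definition semilocal (R : comNzRingType) : Prop :=
  finite_set [set I : set R | is_maximal_ideal I]%classic.

Definition is_unit (R : comNzRingType) (x : R) : Prop := exists y, y * x = 1.

Definition is_field (K : comNzRingType) : Prop :=
  forall x : K, x != 0 -> is_unit x.

(* The rank of [P] at a point of Spec R is the dimension of its fibre there;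
   as dimension is invariant under field extension, all fields over [R] may be
   used in place of the residue fields alone. *)
Definition constant_rank (R : comNzRingType) (P : lmodType R) (n : nat) : Prop :=
  forall K : comAlgType R, is_field K ->
    exists f : {linear ext_scalars P K -> 'rV[K]_n}, bijective f.

(* Unique lifting along surjections of [R]-algebras with square-zero kernel *)
Definition formally_etale (R : comNzRingType) (T : comAlgType R) : Prop :=
  forall (C D : comAlgType R) (p : {lrmorphism C -> D}) (g : {lrmorphism T -> D}),
    (forall d, exists c, p c = d) ->
    (forall x y, p x = 0 -> p y = 0 -> x * y = 0) ->
    exists h : {lrmorphism T -> C}, p \o h =1 g /\
      forall h' : {lrmorphism T -> C}, p \o h' =1 g -> h' =1 h.

(* A finite algebra is étale (that is, formally étale and finitely presented)
   iff it is formally étale and its underlying module is projective. *)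
Definition quadratic_etale (R : comNzRingType) (T : comAlgType R) : Prop :=
  [/\ fg_projective T, formally_etale T & constant_rank T 2].

Section StandardInvolution.
Context {R : comNzRingType} (T : comAlgType R).

Definition alg_trace (x : T) : R := mod_trace (fun y : T => x * y).

Fact alg_trace_is_scalar : scalar alg_trace.
Proof.
move=> a x y; rewrite /alg_trace /mod_trace; case: pselect => [h|_].
  rewrite /cs_trace mulr_sumr -big_split; apply: eq_bigr => i _ /=.
  by rewrite mulrDl -scalerAl linearP.
by rewrite mulr0 addr0.
Qed.
HB.instance Definition _ :=
  GRing.isLinear.Build R T R _ alg_trace alg_trace_is_scalar.

Definition std_inv (x : T) : T := (alg_trace x)%:A - x.

Fact std_inv_is_linear : linear std_inv.
Proof.
move=> a x y; rewrite /std_inv linearP scalerBr !scalerDl -!scalerA opprD.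
by rewrite addrACA.
Qed.
HB.instance Definition _ := GRing.isLinear.Build R T T _ std_inv std_inv_is_linear.

End StandardInvolution.

Arguments alg_trace {R} T x.
Arguments std_inv {R} T x.

(* As rings are commutative, right modules are written as left modules. *)
Record form_module (A : comNzRingType) := FormModule {
  fm_car : lmodType A;
  fm_val : fm_car -> fm_car -> A }.
Arguments FormModule {A} fm_car fm_val.

Record sesquilinear (A : comNzRingType) (s : A -> A) (F : form_module A) : Prop := {
  sesq_addl : forall x x' y : fm_car F,
    fm_val (x + x') y = fm_val x y + fm_val x' y;
  sesq_addr : forall x y y' : fm_car F,
    fm_val x (y + y') = fm_val x y + fm_val x y';
  sesq_scale : forall (a b : A) (x y : fm_car F),
    fm_val (a *: x) (b *: y) = s a * fm_val x y * b }.

Definition hermitian (A : comNzRingType) (s : A -> A) (e : A)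
    (F : form_module A) : Prop :=
  sesquilinear s F /\ forall x y : fm_car F, fm_val x y = e * s (fm_val y x).

Definition unimodular (A : comNzRingType) (F : form_module A) : Prop :=
  forall phi : {scalar fm_car F}, exists! x : fm_car F,
    forall y, fm_val x y = phi y.

Definition unimodular_hermitian (A : comNzRingType) (s : A -> A) (e : A)
    (F : form_module A) : Prop :=
  [/\ fg_projective (fm_car F), hermitian s e F & unimodular F].

Definition isometric (A : comNzRingType) (F G : form_module A) : Prop :=
  exists u : {linear fm_car F -> fm_car G},
    bijective u /\ forall x y, fm_val (u x) (u y) = fm_val x y.

Definition is_submodule (A : comNzRingType) (P : lmodType A) (L : set P) : Prop :=
  L 0 /\ forall a x y, L x -> L y -> L (a *: x + y).

Definition hyperbolic (A : comNzRingType) (F : form_module A) : Prop :=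
  exists L M : set (fm_car F),
    [/\ is_submodule L /\ is_submodule M,
        forall x, exists l m, [/\ L l, M m & x = l + m],
        forall x, L x -> M x -> x = 0,
        forall x y, L x -> L y -> fm_val x y = 0
      & forall x y, M x -> M y -> fm_val x y = 0].

Definition orth_sum (A : comNzRingType) (F G : form_module A) : form_module A :=
  FormModule (fm_car F * fm_car G)%type
    (fun x y => fm_val x.1 y.1 + fm_val x.2 y.2).

Definition zero_form (A : comNzRingType) : form_module A :=
  FormModule 'rV[A]_0 (fun _ _ => 0).

Section FormFacts.
Context {A : comNzRingType}.

Definition mk_linear (P Q : lmodType A) (u : P -> Q) (hu : linear u) :
  {linear P -> Q} := HB.pack u (GRing.isLinear.Build _ _ _ _ u hu).
Definition mk_scalar (P : lmodType A) (u : P -> A) (hu : scalar u) :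
  {scalar P} := HB.pack u (GRing.isLinear.Build _ _ _ _ u hu).

Lemma prod_fg_projective (P Q : lmodType A) :
  fg_projective P -> fg_projective Q -> fg_projective (P * Q)%type.
Proof.
move=> [[m [e he]] hP] [[n [f hf]] hQ]; split.
  exists (m + n)%N, (fun i => match split i with
                              | inl j => (e j, 0) | inr k => (0, f k) end).
  move=> [x y]; have [a ->] := he x; have [b ->] := hf y.
  exists (fun i => match split i with inl j => a j | inr k => b k end).
  rewrite big_split_ord /=.
  have sl (i : 'I_m) : split (lshift n i) = inl i := unsplitK (inl i).
  have sr (i : 'I_n) : split (rshift m i) = inr i := unsplitK (inr i).
  under [X in _ = X + _]eq_bigr => i _ do rewrite sl.
  under [X in _ = _ + X]eq_bigr => i _ do rewrite sr.
  apply/eqP; rewrite xpair_eqE; apply/andP; split; apply/eqP => /=.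
    rewrite (raddf_sum fst) (raddf_sum fst) /= [X in _ + X]big1 ?addr0 //.
    by move=> i _; rewrite scaler0.
  rewrite (raddf_sum snd) (raddf_sum snd) /= [X in X + _]big1 ?add0r //.
  by move=> i _; rewrite scaler0.
move=> M N g h g_surj.
have h1_lin : linear (fun x : P => h (x, 0)).
  move=> a x x'; rewrite -linearP; congr (h _).
  by apply/eqP; rewrite xpair_eqE /= scaler0 addr0 !eqxx.
have h2_lin : linear (fun y : Q => h (0, y)).
  move=> a x x'; rewrite -linearP; congr (h _).
  by apply/eqP; rewrite xpair_eqE /= scaler0 addr0 !eqxx.
have [k1 hk1] := hP M N g (mk_linear h1_lin) g_surj.
have [k2 hk2] := hQ M N g (mk_linear h2_lin) g_surj.
have k_lin : linear (fun z : P * Q => k1 z.1 + k2 z.2).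
  by move=> a x x' /=; rewrite !linearP scalerDr addrACA.
exists (mk_linear k_lin) => -[x y] /=.
rewrite linearD hk1 hk2 /= -linearD; congr (h _).
by apply/eqP; rewrite xpair_eqE /= addr0 add0r !eqxx.
Qed.

Lemma sesq0r (s : A -> A) (F : form_module A) (x : fm_car F) :
  sesquilinear s F -> fm_val x 0 = 0.
Proof.
by move=> hF; apply: (addrI (fm_val x 0)); rewrite -(sesq_addr hF) !addr0.
Qed.

Lemma orth_sum_unimodular_hermitian (s : {additive A -> A}) (e : A)
    (F G : form_module A) :
  unimodular_hermitian s e F -> unimodular_hermitian s e G ->
  unimodular_hermitian s e (orth_sum F G).
Proof.
move=> [pF [sF hF] uF] [pG [sG hG] uG]; split.
- exact: prod_fg_projective.
- split; first split=> /=.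
  + by move=> x x' y; rewrite (sesq_addl sF) (sesq_addl sG) addrACA.
  + by move=> x y y'; rewrite (sesq_addr sF) (sesq_addr sG) addrACA.
  + by move=> a b x y; rewrite (sesq_scale sF) (sesq_scale sG) mulrDr mulrDl.
  by move=> x y /=; rewrite hF hG raddfD mulrDr.
- move=> phi.
  have phi1_lin : scalar (fun x : fm_car F => phi (x, 0)).
    move=> a x x'; rewrite -linearP; congr (phi _).
    by apply/eqP; rewrite xpair_eqE /= scaler0 addr0 !eqxx.
  have phi2_lin : scalar (fun y : fm_car G => phi (0, y)).
    move=> a x x'; rewrite -linearP; congr (phi _).
    by apply/eqP; rewrite xpair_eqE /= scaler0 addr0 !eqxx.
  have [x [hx ux]] := uF (mk_scalar phi1_lin).
  have [y [hy uy]] := uG (mk_scalar phi2_lin).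
  exists (x, y); split.
    move=> [x' y'] /=; rewrite hx hy /= -linearD; congr (phi _).
    by apply/eqP; rewrite xpair_eqE /= addr0 add0r !eqxx.
  move=> [x' y'] h; congr pair; [apply: ux|apply: uy] => z /=.
    by rewrite -h /= (sesq0r y' sG) addr0.
  by rewrite -h /= (sesq0r x' sF) add0r.
Qed.

Lemma zero_form_unimodular_hermitian (s : {additive A -> A}) (e : A) :
  unimodular_hermitian s e (zero_form A).
Proof.
split.
- split.
    exists 0%N, (fun=> 0) => x; exists (fun=> 0).
    by rewrite big_ord0; apply/matrixP => i [].
  move=> M N g h _.
  have k_lin : linear (fun _ : 'rV[A]_0 => 0 : M) by move=> a x y /=; rewrite scaler0 addr0.
  exists (mk_linear k_lin) => x /=; rewrite raddf0 (_ : x = 0) ?raddf0 //.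
  by apply/matrixP => i [].
- split; first split=> /= *; rewrite ?addr0 ?mulr0 ?mul0r //.
  by move=> *; rewrite /= raddf0 mulr0.
- move=> phi; exists 0; split=> [y|x _]; last by apply/matrixP => i [].
  by rewrite (_ : y = 0) ?raddf0 //; apply/matrixP => i [].
Qed.

Lemma isometric_equivalence : equivalence (@isometric A).
Proof.
split.
- by move=> F; exists idfun; split=> //; exists id.
- move=> F G [u [[v uK vK] hu]].
  have v_lin : linear v.
    by move=> a x y; apply: (can_inj uK); rewrite linearP !vK.
  exists (mk_linear v_lin); split; first by exists u.
  by move=> x y /=; rewrite -hu !vK.
- move=> F G H [u [bu hu]] [v [bv hv]]; exists (v \o u); split.
    exact: bij_comp.
  by move=> x y /=; rewrite hv hu.
Qed.

Lemma orth_sum_isometric (F F' G G' : form_module A) :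
  isometric F F' -> isometric G G' ->
  isometric (orth_sum F G) (orth_sum F' G').
Proof.
move=> [u [[u' uK u'K] hu]] [v [[v' vK v'K] hv]].
have w_lin : linear (fun z : fm_car F * fm_car G => (u z.1, v z.2)).
  by move=> a x y /=; rewrite !linearP.
exists (mk_linear w_lin); split.
  by exists (fun z => (u' z.1, v' z.2)) => -[x y] /=; rewrite ?uK ?vK ?u'K ?v'K.
by move=> x y /=; rewrite hu hv.
Qed.

Lemma orth_sumA (F G H : form_module A) :
  isometric (orth_sum F (orth_sum G H)) (orth_sum (orth_sum F G) H).
Proof.
have w_lin : linear (fun z : fm_car F * (fm_car G * fm_car H) =>
  ((z.1, z.2.1), z.2.2)) by [].
exists (mk_linear w_lin); split; last by move=> x y /=; rewrite addrA.
by exists (fun z => (z.1.1, (z.1.2, z.2))) => [[x [y z]]|[[x y] z]].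
Qed.

Lemma orth_sumC (F G : form_module A) : isometric (orth_sum F G) (orth_sum G F).
Proof.
have w_lin : linear (fun z : fm_car F * fm_car G => (z.2, z.1)) by [].
exists (mk_linear w_lin); split; last by move=> x y /=; rewrite addrC.
by exists (fun z => (z.2, z.1)) => -[x y].
Qed.

Lemma orth_sum0 (F : form_module A) : isometric (orth_sum (zero_form A) F) F.
Proof.
have w_lin : linear (fun z : 'rV[A]_0 * fm_car F => z.2) by [].
exists (mk_linear w_lin); split; last by move=> x y /=; rewrite add0r.
exists (fun z => (0, z)) => [[x y]|//] /=.
by congr pair; apply/matrixP => i [].
Qed.

Lemma orth_sum_hyperbolic (F G : form_module A) :
  hyperbolic F -> hyperbolic G -> hyperbolic (orth_sum F G).
Proof.
move=> [L [M [[[L0 LD] [M0 MD]] LM LM0 fL fM]]].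
move=> [L' [M' [[[L'0 L'D] [M'0 M'D]] LM' LM'0 fL' fM']]].
exists (fun z => L z.1 /\ L' z.2), (fun z => M z.1 /\ M' z.2); split.
- split; split=> //= a x y [? ?] [? ?]; split; by [apply: LD|apply: L'D|apply: MD|apply: M'D].
- move=> [x y]; have [l [m [hl hm ->]]] := LM x.
  have [l' [m' [hl' hm' ->]]] := LM' y.
  by exists (l, l'), (m, m').
- by move=> [x y] /= [? ?] [? ?]; rewrite (LM0 x) // (LM'0 y).
- by move=> x y [? ?] [? ?] /=; rewrite fL // fL' // addr0.
- by move=> x y [? ?] [? ?] /=; rewrite fM // fM' // addr0.
Qed.

Lemma zero_form_hyperbolic : hyperbolic (zero_form A).
Proof.
exists setT, setT; split=> //; first by move=> x; exists 0, x; rewrite add0r.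
by move=> x _ _; apply/matrixP => i [].
Qed.

End FormFacts.

(* [s] is meant to be an involution and [e] an element with [s e * e = 1];
   additivity of [s] is all that orthogonal sums require. *)
Section WittGroup.
Context {A : comNzRingType} (s : {additive A -> A}) (e : A).

Record space := Space {
  sp_form :> form_module A;
  sp_prop : unimodular_hermitian s e sp_form }.

Definition sp_sum (S S' : space) : space :=
  Space (orth_sum_unimodular_hermitian (sp_prop S) (sp_prop S')).
Definition sp_zero : space := Space (zero_form_unimodular_hermitian s e).

Definition sp_iso (S S' : space) : Prop := isometric S S'.

Lemma sp_iso_equivalence : equivalence sp_iso.
Proof.
have [er es et] := @isometric_equivalence A.
by split=> [S|S S'|S S' S'']; [exact: er|exact: es|exact: et].
Qed.

Definition iso_classes : Type := class_of sp_iso.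
Definition iso_class (S : space) : iso_classes := cls sp_iso S.
Definition iso_add (c d : iso_classes) : iso_classes :=
  iso_class (sp_sum (rep c) (rep d)).
Definition iso_hyp (c : iso_classes) : Prop :=
  exists2 S : space, hyperbolic S & c = iso_class S.

Lemma iso_addE S S' : iso_add (iso_class S) (iso_class S') = iso_class (sp_sum S S').
Proof.
apply/cls_eq; first exact: sp_iso_equivalence.
have [_ es _] := sp_iso_equivalence.
by apply: orth_sum_isometric; apply: es; apply: rep_cls; exact: sp_iso_equivalence.
Qed.

Lemma iso_classP (c : iso_classes) : exists S, c = iso_class S.
Proof. by exists (rep c); rewrite /iso_class repK. Qed.

Lemma iso_addA : associative iso_add.
Proof.
move=> a b c; have [F ->] := iso_classP a; have [G ->] := iso_classP b.
have [H ->] := iso_classP c; rewrite !iso_addE.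
by apply/cls_eq; [exact: sp_iso_equivalence|exact: orth_sumA].
Qed.

Lemma iso_addC : commutative iso_add.
Proof.
move=> a b; have [F ->] := iso_classP a; have [G ->] := iso_classP b.
rewrite !iso_addE.
by apply/cls_eq; [exact: sp_iso_equivalence|exact: orth_sumC].
Qed.

Lemma iso_add0 : left_id (iso_class sp_zero) iso_add.
Proof.
move=> a; have [F ->] := iso_classP a; rewrite iso_addE.
by apply/cls_eq; [exact: sp_iso_equivalence|exact: orth_sum0].
Qed.


HB.instance Definition _ := Monoid.isComLaw.Build
  iso_classes (iso_class sp_zero) iso_add iso_addA iso_addC iso_add0.

Lemma iso_hyp_add c d : iso_hyp c -> iso_hyp d -> iso_hyp (iso_add c d).
Proof.
move=> [S hS ->] [S' hS' ->]; rewrite iso_addE; exists (sp_sum S S') => //.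
exact: orth_sum_hyperbolic.
Qed.

Lemma iso_hyp0 : iso_hyp (iso_class sp_zero).
Proof. by exists sp_zero => //; exact: zero_form_hyperbolic. Qed.

(* The pair (a, b) stands for the formal difference [a] - [b]. In the
   Grothendieck group, ([a] - [b]) - ([c] - [d]) belongs to the subgroup
   generated by the hyperbolic classes iff it is of the form [h'] - [h] with [h]
   and [h'] hyperbolic, since sums of hyperbolic spaces are hyperbolic; and
   equality there is isometry after adding some [k] to both sides. *)
Definition witt_rel (p q : iso_classes * iso_classes) : Prop :=
  exists h h' k, [/\ iso_hyp h, iso_hyp h' &
    iso_add (iso_add (iso_add p.1 q.2) h) k =
    iso_add (iso_add (iso_add q.1 p.2) h') k].

Lemma witt_rel_equivalence : equivalence witt_rel.
Proof.
split.
- move=> p; exists (iso_class sp_zero), (iso_class sp_zero), (iso_class sp_zero).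
  by by split; first exact: iso_hyp0; first exact: iso_hyp0.
- by move=> p q [h [h' [k [hh hh' E]]]]; exists h', h, k; split.
- move=> [a b] [c d] [u v] [h1 [h1' [k1 [hh1 hh1' E1]]]].
  move=> [h2 [h2' [k2 [hh2 hh2' E2]]]]; rewrite /= in E1 E2.
  exists (iso_add h1 h2), (iso_add h1' h2').
  exists (iso_add (iso_add c d) (iso_add k1 k2)).
  split; [exact: iso_hyp_add|exact: iso_hyp_add|].
  rewrite [LHS](AC (2*2*(2*2)) ((1*6*3*7)*(5*2*4*8))).
  rewrite [RHS](AC (2*2*(2*2)) ((5*2*3*7)*(1*6*4*8))) /=.
  by rewrite E1 E2.
Qed.

Definition witt : Type := class_of witt_rel.
Definition witt_diff (a b : iso_classes) : witt := cls witt_rel (a, b).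

Definition witt_class (S : space) : witt :=
  witt_diff (iso_class S) (iso_class sp_zero).

Definition witt0 : witt := witt_class sp_zero.
Definition witt_add (x y : witt) : witt :=
  witt_diff (iso_add (rep x).1 (rep y).1) (iso_add (rep x).2 (rep y).2).
Definition witt_opp (x : witt) : witt := witt_diff (rep x).2 (rep x).1.

Lemma witt_diffP (x : witt) : exists a b, x = witt_diff a b.
Proof. by exists (rep x).1, (rep x).2; rewrite /witt_diff -surjective_pairing repK. Qed.

Lemma witt_diff_eq a b c d :
  witt_diff a b = witt_diff c d <-> witt_rel (a, b) (c, d).
Proof. exact: cls_eq witt_rel_equivalence. Qed.

Lemma iso_add_eq_rel a b c d : iso_add a d = iso_add c b -> witt_rel (a, b) (c, d).
Proof.
move=> E; exists (iso_class sp_zero), (iso_class sp_zero), (iso_class sp_zero).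
by split; [exact: iso_hyp0|exact: iso_hyp0|rewrite /= E].
Qed.

Lemma rep_witt_diff a b :
  exists p, rep (witt_diff a b) = p /\ witt_rel (a, b) p.
Proof. by exists (rep (witt_diff a b)); split=> //; exact: rep_cls witt_rel_equivalence. Qed.

Lemma witt_addE a b c d : witt_add (witt_diff a b) (witt_diff c d) =
  witt_diff (iso_add a c) (iso_add b d).
Proof.
rewrite /witt_add.
have [[a' b'] [-> [h1 [h1' [k1 [hh1 hh1' /= E1]]]]]] := rep_witt_diff a b.
have [[c' d'] [-> [h2 [h2' [k2 [hh2 hh2' /= E2]]]]]] := rep_witt_diff c d.
apply/witt_diff_eq; exists (iso_add h1' h2'), (iso_add h1 h2), (iso_add k1 k2).
split; [exact: iso_hyp_add|exact: iso_hyp_add|] => /=.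
rewrite [LHS](AC ((2*2)*2*2) ((1*3*5*7)*(2*4*6*8))).
rewrite [RHS](AC ((2*2)*2*2) ((1*3*5*7)*(2*4*6*8))) /=.
by rewrite E1 E2.
Qed.

Lemma witt_oppE a b : witt_opp (witt_diff a b) = witt_diff b a.
Proof.
rewrite /witt_opp.
have [[a' b'] [-> [h [h' [k [hh hh' /= E]]]]]] := rep_witt_diff a b.
apply/witt_diff_eq; exists h, h', k; split; [by []|by []|].
by rewrite /= (iso_addC b' a) E (iso_addC b a').
Qed.


Lemma witt_addA : associative witt_add.
Proof.
move=> x y z; have [a [a' ->]] := witt_diffP x; have [b [b' ->]] := witt_diffP y.
have [c [c' ->]] := witt_diffP z.
rewrite (witt_addE b b' c c') (witt_addE a a' (iso_add b c) (iso_add b' c')).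
rewrite (witt_addE a a' b b') (witt_addE (iso_add a b) (iso_add a' b') c c').
by rewrite (iso_addA a b c) (iso_addA a' b' c').
Qed.

Lemma witt_addC : commutative witt_add.
Proof.
move=> x y; have [a [a' ->]] := witt_diffP x; have [b [b' ->]] := witt_diffP y.
rewrite (witt_addE a a' b b') (witt_addE b b' a a').
by rewrite (iso_addC a b) (iso_addC a' b').
Qed.

Lemma witt_add0 : left_id witt0 witt_add.
Proof.
move=> x; have [a [a' ->]] := witt_diffP x.
by rewrite /witt0 /witt_class (witt_addE _ _ a a') (iso_add0 a) (iso_add0 a').
Qed.

Lemma witt_addN : left_inverse witt0 witt_opp witt_add.
Proof.
move=> x; have [a [a' ->]] := witt_diffP x; rewrite witt_oppE witt_addE.
by apply/witt_diff_eq/iso_add_eq_rel; rewrite (iso_addC a' a) iso_addC.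
Qed.

Lemma witt_class_sum (S S' : space) :
  witt_class (sp_sum S S') = witt_add (witt_class S) (witt_class S').
Proof. by rewrite /witt_class witt_addE iso_addE iso_add0. Qed.

Lemma witt_class_hyperbolic (S : space) : hyperbolic S -> witt_class S = witt0.
Proof.
move=> hS; apply/witt_diff_eq.
exists (iso_class sp_zero), (iso_class S), (iso_class sp_zero).
split; [exact: iso_hyp0|by exists S|] => /=.
by rewrite !iso_add0 !(iso_addC _ (iso_class sp_zero)) !iso_add0.
Qed.

Lemma witt_generated (x : witt) :
  exists S S', x = witt_add (witt_class S) (witt_opp (witt_class S')).
Proof.
have [a [b ->]] := witt_diffP x.
have [S ->] := iso_classP a; have [S' ->] := iso_classP b; exists S, S'.
by rewrite /witt_class witt_oppE witt_addE iso_add0 iso_addC iso_add0.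
Qed.

End WittGroup.

Section WittMaps.
Context {A B : comNzRingType} {s : {additive A -> A}} {e : A}
  {s' : {additive B -> B}} {e' : B}.

Definition witt_hom (f : witt s e -> witt s' e') : Prop :=
  forall x y, f (witt_add x y) = witt_add (f x) (f y).

(* [f] is the homomorphism sending the class of every space [S] to that of
   [Phi S]; in particular, [Phi S] is again a unimodular hermitian space. *)
Definition witt_hom_induced_by (Phi : form_module A -> form_module B)
    (f : witt s e -> witt s' e') : Prop :=
  witt_hom f /\ forall S : space s e,
    exists h : unimodular_hermitian s' e' (Phi S), f (witt_class S) = witt_class (Space h).

Lemma witt_hom0 f : witt_hom f -> f (witt0 s e) = witt0 s' e'.
Proof.
move=> hf; have := hf (witt0 s e) (witt0 s e); rewrite witt_add0.
move: (f _) => z E; rewrite -[LHS](witt_add0 z) -(witt_addN z).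
by rewrite -witt_addA -E.
Qed.

Lemma witt_homN f x : witt_hom f -> f (witt_opp x) = witt_opp (f x).
Proof.
move=> hf; have := hf (witt_opp x) x; rewrite witt_addN (witt_hom0 hf).
move: (f _) (f x) => y z E; rewrite -[RHS]witt_add0 E -witt_addA.
by rewrite (witt_addC z) witt_addN witt_addC witt_add0.
Qed.

Lemma witt_hom_induced_by_unique Phi f g :
  witt_hom_induced_by Phi f -> witt_hom_induced_by Phi g -> f =1 g.
Proof.
move=> [hf f_Phi] [hg g_Phi] x; have [S [S' ->]] := witt_generated x.
rewrite hf hg !witt_homN //.
have [h ->] := f_Phi S; have [k ->] := g_Phi S; rewrite (Prop_irrelevance k h).
have [h' ->] := f_Phi S'; have [k' ->] := g_Phi S'.
by rewrite (Prop_irrelevance k' h').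
Qed.

End WittMaps.

Definition witt_exact (A B C : comNzRingType)
    (s : {additive A -> A}) (e : A) (s' : {additive B -> B}) (e' : B)
    (s'' : {additive C -> C}) (e'' : C)
    (f : witt s e -> witt s' e') (g : witt s' e' -> witt s'' e'') : Prop :=
  forall y, g y = witt0 s'' e'' <-> exists x, f x = y.

Section TransferBaseChange.
Context {R : comNzRingType} (T : comAlgType R).

Definition trace_form (G : form_module T) : form_module R :=
  FormModule (res_scalars (fm_car G)) (fun x y => alg_trace T (fm_val x y)).

(* On pure tensors: (v ⊗ a, w ⊗ b) is sent to k a * f(v, w) * b. *)
Definition base_change_val (k : T -> T) (F : form_module R)
    (x y : ext_scalars (fm_car F) T) : T :=
  \sum_(p <- repr x) \sum_(q <- repr y)
    k p.2 * (fm_val p.1 q.1)%:A * q.2.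

Definition base_change (k : T -> T) (F : form_module R) : form_module T :=
  FormModule (ext_scalars (fm_car F) T) (@base_change_val k F).

Definition scale_form (lam : T) (G : form_module T) : form_module T :=
  FormModule (fm_car G) (fun x y => lam * fm_val x y).

Definition scaled_base_change (lam : T) (k : T -> T) (F : form_module R) :
    form_module T := scale_form lam (base_change k F).

Definition quadratic_generator (lam : T) : Prop :=
  (exists2 r : R, is_unit r & lam ^+ 2 = r%:A) /\
  forall t : T, exists! p : R * R, t = p.1%:A + p.2 *: lam.

Lemma base_change_val_pure (k : {linear T -> T}) (F : form_module R) v a w b :
  sesquilinear idfun F ->
  base_change_val k (v ⊗ a : ext_scalars (fm_car F) T) (w ⊗ b) =
  k a * (fm_val v w)%:A * b.
Proof.
move=> sF.
have blr (p : fm_car F * T) :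
    is_bilinear (fun (w' : fm_car F) b' => k p.2 * (fm_val p.1 w')%:A * b' : T).
  split=> [m|w'] c x y /=; last by rewrite mulrDr scalerAr.
  rewrite (sesq_addr sF) -[X in fm_val X (c *: x)]scale1r (sesq_scale sF) /=.
  by rewrite mul1r (mulrC (fm_val p.1 x)) scalerDl mulrDr mulrDl -scalerA -scalerAr -scalerAl.
have bll : is_bilinear (fun (v' : fm_car F) a' => k a' * (fm_val v' w)%:A * b : T).
  split=> [m|v'] c x y /=; last by rewrite linearP !mulrDl -!scalerAl.
  rewrite (sesq_addl sF) -[X in fm_val _ X + _]scale1r (sesq_scale sF) /=.
  by rewrite mulr1 scalerDl mulrDr mulrDl -scalerA -scalerAr -scalerAl.
rewrite -(eval_repr_pure v a bll); apply: eq_bigr => p _.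
exact: (eval_repr_pure w b (blr p)).
Qed.

End TransferBaseChange.

(* Main.v *)
(* A hyperbolic space (2 being invertible) is one carrying a skew-adjoint operator s with
   s^2 = 1, and for lam with lam^2 = d, a module over T = R[lam] is an R-module with an
   operator squaring to d.  Each exactness statement thereby becomes the problem of
   improving an operator: given s on a space over R, make it commute with lam, or split
   the space into a part where it commutes and a part where it anticommutes with lam; or
   find on a space whose base change is hyperbolic an operator J with J^2 = d.  Over a
   semilocal ring one works at one primitive idempotent e at a time and inducts on the
   projection p cutting out the space (its rank at a residue field drops): a vector with
   suitable values at all residue fields is found by the Chinese remainder theorem,
   corrected to an exactly isotropic one using the Lagrangian s = -1, and the plane that it
   generates is split off by Witt cancellation.  The same cancellation shows that a space
   with trivial class in W(R) is itself hyperbolic. *)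
From HB Require Import structures.
From mathcomp Require Import all_boot all_order all_algebra.
From mathcomp Require Import ring.
From mathcomp Require Import boolp.
From mathcomp Require generic_quotient ring_quotient classical_sets cardinality.
Require Import Defs.

Set Implicit Arguments.
Unset Strict Implicit.
Unset Printing Implicit Defensive.

Import GRing.Theory.
Local Open Scope ring_scope.

(** * Residue fields of a semilocal ring *)

(** Two obstacles shape the proof. The residue fields may have only three elements, so no vector can
    be chosen generically: each local existence lemma is a case analysis by polarisation and by
    exchanging [x + y] with [x - y]. Several of these need enough room, and the small ranks left
    over are settled by hand. Residue fields are introduced for R alone, so full cancellation is
    available over R and not over T, whereas a trivial class in a Witt group of T yields only stable
    hyperbolicity. For W_{-1}(T, theta) the transfer brings the problem down to R and the
    cancellation happens there. For W_1(T, id) nothing is cancelled: the space over R is enlarged by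
    a hyperbolic one whose base change contains the stabilising space as an orthogonal summand. The
    one cancellation made over T removes a plane for which a vector in general position is produced
    explicitly. Summands are self-adjoint projections of a single ambient module, and the ring eR is
    never formed: [e] takes the place of 1 in all formulas. *)

Section SemilocalResidues.
Import generic_quotient ring_quotient classical_sets cardinality.
Local Open Scope quotient_scope.

Section ResidueField.
Context {R : comNzRingType} (I : set R) (maxI : is_maximal_ideal I).

Definition maxI_mem : R -> bool := fun x => `[< I x >].

Lemma maxI_mem_closed : idealr_closed maxI_mem.
Proof.
have [[I0 ID IM] I1 _] := maxI.
split; [exact/asboolP|exact/asboolPn|].
by move=> a x y /asboolP Ix /asboolP Iy; apply/asboolP; apply: ID => //; exact: IM.
Qed.
Definition maxI_ideal : idealr R :=
  HB.pack maxI_mem (isIdealr.Build R maxI_mem maxI_mem_closed).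

Local Notation Q := {ideal_quot maxI_ideal}.

Lemma residue_eq0 x : \pi_Q x = 0 <-> I x.
Proof.
rewrite -(rmorph0 (\pi_Q)); split=> [/eqP|Ix]; last apply/eqP.
  by rewrite -Quotient.idealrBE subr0 => /asboolP.
by rewrite -Quotient.idealrBE subr0; apply/asboolP.
Qed.

Lemma residue_inv (y : Q) : exists z, (y != 0 -> z * y = 1) /\ (y = 0 -> z = 0).
Proof.
have [->|y0] := eqVneq y 0; first by exists 0.
have [[I0 ID IM] I1 maxJ] := maxI.
rewrite -[y]reprK in y0 *; move: (repr y) y0 => {y} a a0.
pose J : set R := fun x => exists2 i, I i & exists b, x = i + b * a.
have J1 : J 1.
  apply: contrapT => nJ1; move/eqP: a0; apply; apply/residue_eq0.
  have <- : J = I.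
    apply: maxJ => //; last by move=> i Ii; exists i => //; exists 0; rewrite mul0r addr0.
    split; first by exists 0 => //; exists 0; rewrite mul0r addr0.
      move=> _ _ [i Ii [b ->]] [j Ij [c ->]]; exists (i + j); first exact: ID.
      by exists (b + c); rewrite mulrDl addrACA.
    move=> c _ [i Ii [b ->]]; exists (c * i); first exact: IM.
    by exists (c * b); rewrite mulrDr mulrA.
  by exists 0 => //; exists 1; rewrite mul1r add0r.
have [i Ii [b E]] := J1; exists (\pi_Q b).
split=> [_|E0]; last by rewrite E0 eqxx in a0.
transitivity (\pi_Q (i + b * a)); last by rewrite -E; exact: rmorph1.
rewrite rmorphD rmorphM; set u := (X in _ = X + _).
by rewrite (_ : u = 0) ?add0r //; exact: (residue_eq0 i).2.
Qed.

Definition residue_invr (y : Q) : Q := projT1 (cid (residue_inv y)).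

Lemma residue_mulVf (y : Q) : y != 0 -> residue_invr y * y = 1.
Proof. exact: (projT2 (cid (residue_inv y))).1. Qed.

Lemma residue_invr0 : residue_invr 0 = 0.
Proof. exact: (projT2 (cid (residue_inv 0))).2. Qed.

Definition residue_field : fieldType :=
  HB.pack Q (GRing.ComNzRing_isField.Build Q residue_mulVf residue_invr0).

Definition to_residue : {rmorphism R -> residue_field} := \pi_Q.

Lemma to_residue_surj (y : residue_field) : exists x, to_residue x = y.
Proof. by exists (repr y); exact: reprK. Qed.

Lemma to_residue_eq0 x : to_residue x = 0 <-> I x.
Proof. exact: residue_eq0. Qed.

End ResidueField.

(** What is retained of semilocality: finitely many residue fields, independent enough for the
    Chinese remainder theorem, which detect units. Ideals do not appear after this point. *)
Record residue_system (R : comNzRingType) (I : finType) (K : I -> fieldType)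
    (chi : forall i, {rmorphism R -> K i}) : Prop := {
  res_surj : forall i (y : K i), exists x, chi i x = y;
  res_sep : forall i j, i != j -> exists2 x, chi i x != 0 & chi j x = 0;
  res_unit : forall x, (forall i, chi i x != 0) -> exists y, y * x = 1 }.

(** Zorn's lemma is applied to the sets whose union with [J] is a proper ideal, rather than to
    ideals containing [J], so that the empty union arising from the empty chain qualifies as
    well. *)
Lemma maximal_ideal_above (R : comNzRingType) (J : set R) :
  is_ideal J -> ~ J 1 -> exists I, is_maximal_ideal I /\ (J `<=` I)%classic.
Proof.
move=> iJ J1; pose P : set (set R) := fun A => is_ideal (A `|` J)%classic /\ ~ (A `|` J)%classic 1.
have [F FP Ftot|A [[iA A1] Amax]] := Zorn_bigcup (P := P).
  have [[X0 FX0]|F0] := pselect (exists X, F X); last first.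
    have -> : (\bigcup_(X in F) X)%classic = set0.
      by apply/seteqP; split=> // x [X FX]; case: F0; exists X.
    by rewrite /P set0U.
  have [J0 JD JM] := iJ.
  split; last by move=> [[X FX X1]|//]; have [_] := FP X FX; apply; left.
  split; first by right.
    move=> x y [[X FX Xx]|Jx] [[Y FY Yy]|Jy].
    - have [XY|YX] := Ftot X Y FX FY.
        have [[_ YD _] _] := FP Y FY.
        by have [?|] := YD x y (or_introl (XY _ Xx)) (or_introl Yy); [left; exists Y|right].
      have [[_ XD _] _] := FP X FX.
      by have [?|] := XD x y (or_introl Xx) (or_introl (YX _ Yy)); [left; exists X|right].
    - have [[_ XD _] _] := FP X FX.
      by have [?|] := XD x y (or_introl Xx) (or_intror Jy); [left; exists X|right].
    - have [[_ XD _] _] := FP Y FY.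
      by have [?|] := XD x y (or_intror Jx) (or_introl Yy); [left; exists Y|right].
    - by right; exact: JD.
  move=> a x [[X FX Xx]|Jx]; last by right; exact: JM.
  have [[_ _ XM] _] := FP X FX.
  by have [?|] := XM a x (or_introl Xx); [left; exists X|right].
exists (A `|` J)%classic; split; last by right.
split=> // B iB B1 AJB; apply/seteqP; split=> // x Bx; left.
apply: contrapT => nAx; apply: (Amax B).
  by split; [move=> y Ay; apply: AJB; left|move=> /(_ x Bx)].
by rewrite /P; have -> : (B `|` J = B)%classic; first by apply/setUidPl => y Jy; apply: AJB; right.
Qed.

Lemma semilocal_residue_system (R : comNzRingType) : semilocal R ->
  exists (I : finType) (K : I -> fieldType) (chi : forall i, {rmorphism R -> K i}),
    residue_system chi.
Proof.
move=> /finite_seqP [s sE].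
have maxs (i : seq_sub s) : is_maximal_ideal (val i).
  have : [set` s]%classic (val i) by exact: (ssvalP i).
  by rewrite -sE.
exists (seq_sub s), (fun i => residue_field (maxs i)), (fun i => to_residue (maxs i)).
split.
- by move=> i; exact: to_residue_surj.
- move=> i j ij; have [iI I1 Imax] := maxs i; have [jI J1 Jmax] := maxs j.
  have [x [xj xi]] : exists x, val j x /\ ~ val i x.
    apply: contrapT => nx; move/eqP: ij; apply; apply/val_inj/(Jmax (val i)) => // x jx.
    by apply: contrapT => ix; apply: nx; exists x.
  by exists x; [apply/eqP => /to_residue_eq0|apply/to_residue_eq0].
- move=> x x0; pose J : set R := fun y => exists z, y = z * x.
  have iJ : is_ideal J.
    split; first by exists 0; rewrite mul0r.
      by move=> _ _ [a ->] [b ->]; exists (a + b); rewrite mulrDl.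
    by move=> a _ [b ->]; exists (a * b); rewrite mulrA.
  apply: contrapT => nu; have [|M [maxM JM]] := maximal_ideal_above iJ.
    by move=> [y E]; apply: nu; exists y; rewrite -E.
  have Ms : M \in s by change ([set` s]%classic M); rewrite -sE.
  have /eqP := x0 (SeqSub Ms); apply; apply/to_residue_eq0.
  by apply: JM; exists 1; rewrite mul1r.
Qed.

End SemilocalResidues.

(** * Symmetric spaces and hyperbolic operators *)

(** Behind the tactic [lc]: multiples of known equations are added to a goal until it becomes a
    polynomial identity. The sequences of [lc] below are explicit ideal membership certificates. *)
Lemma lin_comb (A : pzRingType) (l r : A) (lr : l = r) (c a b : A) :
  a + c * r = b + c * l -> a = b.
Proof. by rewrite lr => /addIr. Qed.

Tactic Notation "lc" uconstr(c) constr(H) := refine (lin_comb H (c:=c) _).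

(** The dual basis in the last field replaces finite generation, projectivity and unimodularity at
    once: it writes the identity as a finite sum of rank one maps given by the form. *)
Record sym_space (A : comNzRingType) (V : lmodType A) (f : V -> V -> A) : Prop := {
  sym_spC : forall x y, f x y = f y x;
  sym_spD : forall x y z, f (x + y) z = f x z + f y z;
  sym_spZ : forall a x y, f (a *: x) y = a * f x y;
  sym_sp_dual : exists n (v z : 'I_n -> V), forall x, x = \sum_i f (z i) x *: v i }.

Section SymSpace.
Context {A : comNzRingType} {V : lmodType A} (f : V -> V -> A).

(** Orthogonal summands are represented by self-adjoint idempotents of the ambient module, so that
    passing to a summand changes neither the module nor the form. *)
Definition is_proj (p : V -> V) : Prop :=
  (forall x y, f (p x) y = f x (p y)) /\ forall x, p (p x) = p x.

(* A decomposition of the image of the projection [s \o s] into two totally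
   isotropic submodules, on which [s] is 1 and -1 respectively. *)
Record is_hyp (p s : V -> V) : Prop := {
  hyp_skew : forall x y, f (s x) y = - f x (s y);
  hyp_sq : forall x, s (s x) = p x;
  hyp_sp : forall x, s (p x) = s x }.

Hypothesis Vf : sym_space f.
Variable h : A.
Hypothesis h2 : h * 2%:R = 1.

Lemma fC x y : f x y = f y x. Proof. exact: sym_spC. Qed.
Lemma fDl x y z : f (x + y) z = f x z + f y z. Proof. exact: sym_spD. Qed.
Lemma fZl a x y : f (a *: x) y = a * f x y. Proof. exact: sym_spZ. Qed.
Lemma fDr x y z : f x (y + z) = f x y + f x z.
Proof. by rewrite fC fDl ![f _ x]fC. Qed.
Lemma fZr a x y : f x (a *: y) = a * f x y.
Proof. by rewrite fC fZl fC. Qed.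
Lemma fNl x y : f (- x) y = - f x y.
Proof. by rewrite -scaleN1r fZl mulN1r. Qed.
Lemma fNr x y : f x (- y) = - f x y.
Proof. by rewrite fC fNl fC. Qed.
Lemma f0l y : f 0 y = 0.
Proof. by rewrite -(scale0r (0 : V)) fZl mul0r. Qed.
Lemma f0r y : f y 0 = 0.
Proof. by rewrite fC f0l. Qed.

Definition fE := (fDl, fDr, fNl, fNr, fZl, fZr, f0l, f0r).

Lemma fsuml (I : Type) (r : seq I) (P : pred I) (F : I -> V) y :
  f (\sum_(i <- r | P i) F i) y = \sum_(i <- r | P i) f (F i) y.
Proof. by elim/big_rec2: _ => [|i u w _ <-]; rewrite ?fE. Qed.

Lemma fext x y : (forall z, f x z = f y z) -> x = y.
Proof.
have [n [v [z dual]]] := sym_sp_dual Vf.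
by move=> xy; rewrite [LHS]dual [RHS]dual; apply: eq_bigr => i _; rewrite !(fC (z i)) xy.
Qed.

Lemma eqN0 (x : A) : x = - x -> x = 0.
Proof.
move=> xN; have x2 : 2%:R * x = 0 by rewrite mulr_natl mulr2n {1}xN addNr.
by rewrite -[x]mul1r -h2 -mulrA x2 mulr0.
Qed.

(** A map that has an adjoint is linear because the form is nondegenerate. For this reason the
    operators below are bare functions subject to an adjointness condition only. *)
Lemma adj_lin (u w : V -> V) : (forall x y, f (u x) y = f x (w y)) ->
  (forall x y, u (x + y) = u x + u y) * (forall a x, u (a *: x) = a *: u x) *
  (forall x, u (- x) = - u x) * (u 0 = 0).
Proof.
move=> uw; split; first split; first split.
- by move=> x y; apply: fext => z; rewrite uw !fE !uw.
- by move=> x y; apply: fext => z; rewrite uw !fE !uw.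
- by move=> x; apply: fext => z; rewrite uw !fE !uw.
- by apply: fext => z; rewrite uw !fE.
Qed.

Section Hyp.
Variables (p s : V -> V).
Hypothesis ps : is_hyp p s.

Lemma hyp_proj : is_proj p.
Proof.
case: ps => sk sq sp; split=> [x y|x]; first by rewrite -!sq !sk opprK.
by rewrite -sq sp sq.
Qed.

Lemma hyp_ps x : p (s x) = s x.
Proof. by rewrite -(hyp_sq ps (s x)) (hyp_sq ps x) (hyp_sp ps). Qed.

Lemma hyp_lin :
  (forall x y, s (x + y) = s x + s y) * (forall a x, s (a *: x) = a *: s x) *
  (forall x, s (- x) = - s x) * (s 0 = 0).
Proof.
apply: (@adj_lin s (fun x => - s x)) => x y; by rewrite (hyp_skew ps) fNr.
Qed.

End Hyp.

Lemma proj_lin p : is_proj p ->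
  (forall x y, p (x + y) = p x + p y) * (forall a x, p (a *: x) = a *: p x) *
  (forall x, p (- x) = - p x) * (p 0 = 0).
Proof. by case=> pa _; apply: (adj_lin pa). Qed.

Lemma hyp0 : is_hyp (fun=> 0) (fun=> 0).
Proof. by split=> // x y; rewrite !fE oppr0. Qed.

Lemma proj_sub p p' : is_proj p -> is_proj p' -> (forall x, p (p' x) = p' x) ->
  is_proj (fun x => p x - p' x).
Proof.
move=> hp hp' pp'; have [pa pp] := hp; have [pa' pp'0] := hp'.
have p'p x : p' (p x) = p' x.
  by apply: fext => z; rewrite pa' pa pp' pa'.
split=> [x y|x]; first by rewrite !fE pa pa'.
by rewrite !(proj_lin hp) !(proj_lin hp') pp pp' p'p pp'0 subrr subr0.
Qed.

Lemma proj_comm p p' : is_proj p -> is_proj p' -> (forall x, p (p' x) = p' x) ->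
  forall x, p' (p x) = p' x.
Proof.
by move=> [pa pp] [pa' pp'0] pp' x; apply: fext => z; rewrite pa' pa pp' pa'.
Qed.

Lemma hyp_add p s p' s' : is_hyp p s -> is_hyp p' s' -> (forall x, p (p' x) = 0) ->
  is_hyp (fun x => p x + p' x) (fun x => s x + s' x).
Proof.
move=> hp hp' pp'; have pa := (hyp_proj hp).1; have pa' := (hyp_proj hp').1.
have p'p x : p' (p x) = 0 by apply: fext => z; rewrite pa' pa pp' !fE.
have ss' x : s (s' x) = 0.
  by rewrite -(hyp_sp hp) -(hyp_ps hp') pp' (hyp_lin hp).
have s's x : s' (s x) = 0.
  by rewrite -(hyp_sp hp') -(hyp_ps hp) p'p (hyp_lin hp').
have sp' x : s (p' x) = 0 by rewrite -(hyp_sp hp) pp' (hyp_lin hp).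
have s'p x : s' (p x) = 0 by rewrite -(hyp_sp hp') p'p (hyp_lin hp').
split=> [x y|x|x].
- by rewrite !fE (hyp_skew hp) (hyp_skew hp') opprD.
- by rewrite !(hyp_lin hp) !(hyp_lin hp') ss' s's (hyp_sq hp) (hyp_sq hp') addr0 add0r.
- by rewrite !(hyp_lin hp) !(hyp_lin hp') sp' s'p (hyp_sp hp) (hyp_sp hp') addr0 add0r.
Qed.

Lemma hyp_sub p s p' s' : is_hyp p s -> is_hyp p' s' ->
  (forall x, s (p' x) = s' x) -> is_hyp (fun x => p x - p' x) (fun x => s x - s' x).
Proof.
move=> hp hp' sp'.
have pa := (hyp_proj hp).1; have pa' := (hyp_proj hp').1.
have s'E x : p' (s x) = s' x.
  by apply: fext => z; rewrite pa' (hyp_skew hp) sp' (hyp_skew hp').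
have ss' x : s (s' x) = p' x by rewrite -(hyp_ps hp') sp' (hyp_sq hp').
have s's x : s' (s x) = p' x by rewrite -(hyp_sp hp') s'E (hyp_sq hp').
have s'p x : s' (p x) = s' x.
  apply: fext => z.
  by rewrite (hyp_skew hp') pa -(hyp_sq hp) ss' sp' (hyp_skew hp').
split=> [x y|x|x].
- by rewrite !fE (hyp_skew hp) (hyp_skew hp') opprB; ring.
- rewrite !(hyp_lin hp) !(hyp_lin hp') ss' s's (hyp_sq hp) (hyp_sq hp').
  by rewrite subrr subr0.
- rewrite !(hyp_lin hp) !(hyp_lin hp') sp' s'p (hyp_sp hp) (hyp_sp hp').
  by rewrite subrr subr0.
Qed.

(** For a hyperbolic pair [w], [w'] this is the orthogonal projection on its span, and [plane_sg] is
    the operator on the span that fixes [w] and negates [w']. *)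
Definition plane (w w' x : V) : V := f w' x *: w + f w x *: w'.
Definition plane_sg (w w' x : V) : V := f w' x *: w - f w x *: w'.

Lemma plane_hyp e w w' : f w w = 0 -> f w' w' = 0 -> f w w' = e ->
  e *: w = w -> e *: w' = w' -> is_hyp (plane w w') (plane_sg w w').
Proof.
move=> ww ww' wew ew ew'; rewrite /plane /plane_sg.
have fe x : e * f w x = f w x by rewrite -fZl ew.
have fe' x : e * f w' x = f w' x by rewrite -fZl ew'.
have w'w : f w' w = e by rewrite fC.
split=> [x y|x|x].
- by rewrite !fE [f x w]fC [f x w']fC; ring.
- apply: fext => z; rewrite !fE ww ww' wew w'w.
  lc (f w z) (fe' x); lc (f w' z) (fe x); ring.
- apply: fext => z; rewrite !fE ww ww' wew w'w.
  lc (f w z) (fe' x); lc (- f w' z) (fe x); ring.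
Qed.

(* Witt cancellation of a hyperbolic plane with an isotropic vector [w] in
   general position with respect to the Lagrangian [s = -1]. *)
Lemma hyp_cancel_plane q s e w w' m : is_hyp q s ->
  (forall x, e *: q x = q x) ->
  f w w = 0 -> f w' w' = 0 -> f w w' = e -> q w = w -> q w' = w' ->
  s m = - m -> f w m = e ->
  exists s', is_hyp (fun x => q x - plane w w' x) s'.
Proof.
move=> hq eq ww w'w' ww' qw qw' sm wm.
have hqp := hyp_proj hq; have [qa qq] := hqp.
have qm : q m = m by rewrite -(hyp_sq hq) sm (hyp_lin hq) sm opprK.
have ew : e *: w = w by rewrite -{1}qw eq.
have ew' : e *: w' = w' by rewrite -{1}qw' eq.
have em : e *: m = m by rewrite -{1}qm eq.
have hpl := plane_hyp ww w'w' ww' ew ew'.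
have [p pE] : exists p, p = fun x => q x - plane w w' x by eexists.
have pxE x : p x = q x - plane w w' x by rewrite pE.
have hp : is_proj p.
  rewrite pE; apply: (proj_sub hqp (hyp_proj hpl)) => x.
  by rewrite /plane !(proj_lin hqp) qw qw'.
rewrite -pE {pE}; have [pa pp] := hp.
have qp x : q (p x) = p x.
  by rewrite pxE /plane !(proj_lin hqp) qq qw qw'.
have pq x : p (q x) = p x by exact: (proj_comm hqp hp).
have qE x : q x = p x + (f w' x *: w + f w x *: w') by rewrite pxE /plane subrK.
have ee : e * e = e by rewrite -{2}ww' -fZl ew ww'.
have pw : p w = 0 by rewrite pxE /plane qw ww [f w' w]fC ww' ew scale0r addr0 subrr.
have pw' : p w' = 0 by rewrite pxE /plane qw' w'w' ww' ew' scale0r add0r subrr.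
pose k := p (s w); pose b := p m; pose k' := p (s w').
pose c := f w' (s w).
have few x : e * f w x = f w x by rewrite -fZl ew.
have few' x : e * f w' x = f w' x by rewrite -fZl ew'.
have ec : e * c = c by exact: few'.
have skew0 x : f x (s x) = 0.
  by apply: eqN0; rewrite -(hyp_skew hq) fC.
have sw : s w = k + c *: w.
  rewrite -[LHS](hyp_ps hq) qE skew0 scale0r addr0 //.
have sw' : s w' = k' - c *: w'.
  rewrite -[LHS](hyp_ps hq) qE skew0 scale0r add0r.
  by rewrite -[f w (s w')]opprK -(hyp_skew hq) (fC (s w)) scaleNr.
have kE : k = s w - c *: w by rewrite sw addrK.
have psk : p (s k) = - c *: k.
  by rewrite {1}kE !(hyp_lin hq) (hyp_sq hq) !(proj_lin hp) pq pw add0r scaleNr.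
have psk' : p (s k') = c *: k'.
  have kE' : k' = s w' + c *: w' by rewrite sw' subrK.
  by rewrite {1}kE' !(hyp_lin hq) (hyp_sq hq) !(proj_lin hp) pq pw' add0r.
have [al [mE eal]] : exists al, m = b + al *: w + w' /\ e * al = al.
  by exists (f w' m); rewrite few' -addrA -[LHS]qm qE wm ew'.
have psb : p (s b) = - b - al *: k - k'.
  have bE : b = m - al *: w - w' by rewrite mE (addrAC _ w') !addrK.
  by rewrite {1}bE !(hyp_lin hq) sm !(proj_lin hp).
have fpw x : f (p x) w = 0 by rewrite pa pw !fE.
have fpw' x : f (p x) w' = 0 by rewrite pa pw' !fE.
have kk : f k k = 0.
  rewrite {2}/k -pa /k pp -/k.
  have -> : f k (s w) = f (s w) (s w) - c * f w (s w) by rewrite {1}kE !fE.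
  by rewrite skew0 (hyp_skew hq) (hyp_sq hq) qw ww; ring.
have [eb ek] : e *: b = b /\ e *: k = k by rewrite -[b]qp -[k]qp !eq.
have [kw kw' bw bw'] : [/\ f k w = 0, f k w' = 0, f b w = 0 & f b w' = 0].
  by rewrite /k /b !fpw !fpw'.
have [pk pk' pb] : [/\ p k = k, p k' = k' & p b = b] by rewrite /k /k' /b !pp.
move: (k) (k') (b) kk kw kw' bw bw' pk pk' pb eb ek sw sw' psk psk' psb mE.
move=> {kE fpw fpw'} {}k {}k' {}b kk kw kw' bw bw' pk pk' pb eb ek sw sw' psk psk' psb mE.
have kb : f k b = e - c.
  have E : f w (s m) = - e by rewrite sm fNr wm.
  have : f w (s m) = - f (s w) m by rewrite (hyp_skew hq) opprK.
  rewrite E sw {1}mE !fE (fC w b) kw kw' bw ww ww' => H.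
  lc 1 H; lc (-1) ec; ring.
have bb : f b b = - (2%:R * al).
  have mm : f m m = 0.
    by apply: eqN0; rewrite -{1}[m]opprK -sm fNl (hyp_skew hq) sm fNr opprK.
  move: mm; rewrite mE !fE (fC w b) (fC w' b) bw bw' ww w'w' (fC w' w) ww' => H.
  lc 1 H; lc (- 2%:R) eal; ring.
(* The compression of [s] to the image of [p] is skew-adjoint but squares to the identity only up to
   the terms in [k] and [k'] computed in [E1]. The skew-adjoint rank two operator built from [b] and
   [k] compensates them. *)
have [s' s'E] : exists s', forall x, s' x = p (s (p x)) - f b x *: k + f k x *: b.
  by exists (fun x => p (s (p x)) - f b x *: k + f k x *: b).
have ps' x : p (s' x) = s' x.
  by rewrite s'E !(proj_lin hp) pp pk pb.
have s'p x : s' (p x) = s' x.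
  by rewrite !s'E pp -!pa pk pb.
exists s'; split=> [x y|x|x]; last exact: s'p.
- rewrite !s'E !fE pa (hyp_skew hq) pa (fC x (p _)) pa (fC (s _)) (fC x k) (fC x b); ring.
- have psw : p (s w) = k by rewrite sw !(proj_lin hp) pw pk scaler0 addr0.
  have psw' : p (s w') = k' by rewrite sw' !(proj_lin hp) pw' pk' scaler0 subr0.
  have fwp z y : p z = z -> f z (p y) = f z y by move=> {2}<-; rewrite pa.
  have fw'sp : f w' (s (p x)) = - f k' x.
    rewrite -[LHS]opprK -(hyp_skew hq) sw' -pa !(proj_lin hp) pk' pw' scaler0 subr0 //.
  have fwsp : f w (s (p x)) = - f k x.
    by rewrite -[LHS]opprK -(hyp_skew hq) sw -pa !(proj_lin hp) pk pw scaler0 addr0.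
  have E1 : p (s (p (s (p x)))) = p x + f k' x *: k + f k x *: k'.
    rewrite (pxE (s (p x))) /plane fwsp fw'sp !(hyp_lin hq) !(proj_lin hp) psw psw'.
    by rewrite (hyp_ps hq) (hyp_sq hq) pq pp !scaleNr opprD !opprK addrA.
  have fbs : f b (p (s (p x))) = f b x + al * f k x + f k' x.
    rewrite -pa pb -[LHS]opprK -(hyp_skew hq) -pa psb !fE; ring.
  have fks : f k (p (s (p x))) = c * f k x.
    by rewrite -pa pk -[LHS]opprK -(hyp_skew hq) -pa psk fE mulNr opprK.
  have fek z : e * f k z = f k z by rewrite -fZl ek.
  have feb z : e * f b z = f b z by rewrite -fZl eb.
  have fbs' : f b (s' x) = f b x + al * f k x + f k' x - f b x * (e - c) - f k x * (2%:R * al).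
    by rewrite s'E !fE fbs bb (fC b k) kb; ring.
  have fks' : f k (s' x) = c * f k x + f k x * (e - c).
    by rewrite s'E !fE fks kk kb; ring.
  have ps's : p (s (s' x)) = p x + f k' x *: k + f k x *: k' + (f b x * c) *: k
      + f k x *: (- b - al *: k - k').
    rewrite s'E !(hyp_lin hq) !(proj_lin hp) E1 psk psb.
    by rewrite scalerA mulrN scaleNr opprK.
  apply: fext => z; rewrite (s'E (s' x)) ps' ps's fbs' fks' !fE.
  lc (f k z) (feb x); lc (f b z) (fek x); ring.
Qed.
End SymSpace.

(** * Decomposition along idempotents *)

(** Multiplying (1 - E)E = 0 by the adjugate of 1 - E shows that the determinant kills E. This
    idempotent cuts out the part of the spectrum where E vanishes. *)
Lemma idem_mx_det (A : comNzRingType) n (E : 'M[A]_n) : E *m E = E ->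
  \det (1%:M - E) * \det (1%:M - E) = \det (1%:M - E) /\ \det (1%:M - E) *: E = 0.
Proof.
move=> EE; have FE : (1%:M - E) *m E = 0 by rewrite mulmxBl mul1mx EE subrr.
split; first by rewrite -det_mulmx mulmxBr mulmx1 FE subr0.
by rewrite -mul_scalar_mx -mul_adj_mx -mulmxA FE mulmx0.
Qed.

(** Primitive idempotents correspond to the connected components of the spectrum that are open. *)
Definition primitive_idem (R : comNzRingType) (e : R) : Prop :=
  [/\ e * e = e, e != 0 & forall j, j * j = j -> j * e = j -> j = 0 \/ j = e].

Section Residues.
Context {R : comNzRingType} {I : finType} {K : I -> fieldType}.
Context (chi : forall i, {rmorphism R -> K i}).
Hypothesis res : residue_system chi.

Lemma res_delta : exists eps : I -> R, forall i j, chi j (eps i) = (i == j)%:R.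
Proof.
suff H i : exists r, forall j, chi j r = (i == j)%:R.
  by exists (fun i => projT1 (cid (H i))) => i; exact: projT2 (cid (H i)).
have sep j : exists x, j != i -> chi i x != 0 /\ chi j x = 0.
  have [->|ji] := eqVneq j i; first by exists 0.
  by have [|x x0 x1] := res_sep res (i := i) (j := j); [rewrite eq_sym|exists x].
pose y := \prod_(j | j != i) projT1 (cid (sep j)).
have yi : chi i y != 0.
  rewrite rmorph_prod; apply/prodf_neq0 => j ji.
  by have [] := projT2 (cid (sep j)) ji.
have yj j : j != i -> chi j y = 0.
  move=> ji; rewrite rmorph_prod (bigD1 j) //=.
  by have [_ ->] := projT2 (cid (sep j)) ji; rewrite mul0r.
have [r ri] := res_surj res (chi i y)^-1.
exists (r * y) => j; rewrite rmorphM; have [<-|ij] := eqVneq i j.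
  by rewrite ri mulVf.
by rewrite yj ?mulr0 // eq_sym.
Qed.

Lemma crt (a : I -> R) : exists r, forall i, chi i r = chi i (a i).
Proof.
have [eps epsE] := res_delta; exists (\sum_i eps i * a i) => i.
rewrite rmorph_sum (bigD1 i) //= rmorphM epsE eqxx mul1r big1 ?addr0 // => j ji.
by rewrite rmorphM epsE (negPf ji) mul0r.
Qed.

Lemma res_idem e i : e * e = e -> chi i e = 0 \/ chi i e = 1.
Proof.
move=> /(congr1 (chi i)); rewrite rmorphM => /eqP.
rewrite -subr_eq0 -[X in _ - X]mulr1 -mulrBr mulf_eq0 subr_eq0.
by case/orP => /eqP; [left|right].
Qed.

Lemma res_idem0 e : e * e = e -> (forall i, chi i e = 0) -> e = 0.
Proof.
move=> ee e0; have [|y y1] := res_unit res (x := 1 - e).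
  by move=> i; rewrite rmorphB rmorph1 e0 subr0 oner_eq0.
by rewrite -[e]mul1r -y1 -mulrA mulrBl mul1r ee subrr mulr0.
Qed.

(** Inversion in the ring eR, obtained by inverting e u + (1 - e) in R. *)
Lemma res_eunit e u : e * e = e -> (forall i, chi i e = 1 -> chi i u != 0) ->
  exists2 v, u * v = e & e * v = v.
Proof.
move=> ee u0; have [|y y1] := res_unit res (x := e * u + (1 - e)).
  move=> i; rewrite rmorphD rmorphM rmorphB rmorph1.
  by case: (res_idem i ee) => E; rewrite E; [rewrite mul0r add0r subr0 oner_eq0
    |rewrite mul1r subrr addr0 u0].
exists (e * y); last by rewrite mulrA ee.
rewrite -[RHS]mulr1 -y1.
by lc (y - y * u) ee; ring.
Qed.

(** 1 is a finite orthogonal sum of primitive idempotents. Since an idempotent vanishing at all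
    residue fields is 0, a proper splitting of [e] lowers the number of residue fields at which it
    is nonzero, and the induction runs on that number. *)
Lemma idem_ind (P : R -> Prop) : P 0 ->
  (forall e e', e * e = e -> e' * e' = e' -> e * e' = 0 -> P e -> P e' -> P (e + e')) ->
  (forall e, primitive_idem e -> P e) -> P 1.
Proof.
move=> P0 PD Pprim.
suff H n e : e * e = e -> (#|[pred i | chi i e != 0%R]| <= n)%N -> P e.
  exact: (H _ _ (mulr1 1) (leqnn _)).
elim: n e => [|n IH] e ee en.
  have -> : e = 0; last by [].
  apply: res_idem0 => // i; apply/eqP; move: en; rewrite leqn0 => /eqP/card0_eq/(_ i).
  by rewrite inE => /negbFE.
have [->|e0] := eqVneq e 0; first by [].
have [hp|hp] := pselect (primitive_idem e); first exact: Pprim.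
have [j [jj je j0 jne]] : exists j, [/\ j * j = j, j * e = j, j <> 0 & j <> e].
  apply: contrapT => nj; apply: hp; split=> // j jj je.
  apply: contrapT => nj'; apply: nj; exists j; split=> // jE; apply: nj'; by [left|right].
have kk : (e - j) * (e - j) = e - j.
  by lc 1 ee; lc 1 jj; lc (- 2%:R) je; ring.
have jk : j * (e - j) = 0 by rewrite mulrBr je jj subrr.
have -> : e = j + (e - j) by ring.
have sub a b : a * a = a -> b * b = b -> a * b = 0 -> a + b = e -> b <> 0 ->
    (#|[pred i | chi i a != 0%R]| <= n)%N.
  move=> aa bb ab abe b0; rewrite -ltnS; apply: leq_trans en; apply/proper_card/properP.
  split.
    apply/subsetP => i; rewrite !inE; apply: contra => /eqP ei.
    have <- : e * a = a by rewrite -abe; lc 1 aa; lc 1 ab; ring.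
    by rewrite rmorphM ei mul0r.
  have [i bi] : exists i, chi i b != 0.
    apply: contrapT => nb; apply: b0; apply: res_idem0 => // i; apply/eqP.
    by apply: contrapT => /negP bi; apply: nb; exists i.
  exists i; rewrite !inE.
    apply: contra bi => /eqP ei; have <- : e * b = b by rewrite -abe; lc 1 bb; lc 1 ab; ring.
    by rewrite rmorphM ei mul0r.
  rewrite negbK; have := congr1 (chi i) ab; rewrite rmorphM rmorph0 => /eqP.
  by rewrite mulf_eq0 (negPf bi) orbF.
apply: PD => //; apply: IH => //.
  by apply: (sub _ (e - j)) => //; [ring|move/subr0_eq/esym].
by apply: (sub _ j) => //; [rewrite mulrC|ring].
Qed.

Section Form.
Context {V : lmodType R} {f : V -> V -> R}.
Hypothesis Vf : sym_space f.

Lemma vcrt (x : I -> V) : exists y, forall i z, chi i (f y z) = chi i (f (x i) z).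
Proof.
have [eps epsE] := res_delta; exists (\sum_i eps i *: x i) => i z.
rewrite (fsuml Vf) rmorph_sum (bigD1 i) //= (fZl Vf) rmorphM epsE eqxx mul1r.
rewrite big1 ?addr0 // => j ji.
by rewrite (fZl Vf) rmorphM epsE (negPf ji) mul0r.
Qed.

Variable e : R.
Hypothesis prim : primitive_idem e.

Definition eproj (p : V -> V) : Prop := is_proj f p /\ forall x, e *: p x = p x.

(** Constancy of the rank on a connected spectrum. If [p] vanished at the residue field [i], then
    det(1 - E) for its matrix E would be 1 there while killing [p]; its product with [e] is an
    idempotent below [e], hence 0 or [e], and neither is possible. *)
Lemma proj_nonzero p i : eproj p -> (exists x, p x != 0) -> chi i e = 1 ->
  exists x y, chi i (f (p x) y) != 0.
Proof.
move=> [hp ep] [x0 px0] ei; have [pa pp] := hp; have [ee e0 eprim] := prim.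
apply: contrapT => npxy.
have p0 x y : chi i (f (p x) y) = 0.
  by apply/eqP; apply: contrapT => /negP xy; apply: npxy; exists x, y.
have [n [v [z dual]]] := sym_sp_dual Vf.
pose E : 'M[R]_n := \matrix_(i, j) f (z i) (p (v j)).
have pE x : p x = \sum_j f (z j) x *: p (v j).
  rewrite {1}[x]dual; elim/big_rec2: _ => [|j u w _ <-]; first by rewrite (proj_lin Vf hp).
  by rewrite !(proj_lin Vf hp).
have EE : E *m E = E.
  apply/matrixP => a b; rewrite !mxE -[in RHS]pp [in RHS]pE (fC Vf) (fsuml Vf).
  by apply: eq_bigr => j _; rewrite !mxE (fZl Vf) (fC Vf (p _)) mulrC.
have [dd dE] := idem_mx_det EE; set d := \det _ in dd dE.
have d1 : chi i d = 1.
  rewrite -det_map_mx (_ : map_mx _ _ = 1%:M) ?det1 //; apply/matrixP => a b.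
  by rewrite !mxE rmorphB (fC Vf) p0 subr0 rmorph_nat.
have dp x : d *: p x = 0.
  rewrite [p x]dual scaler_sumr big1 // => j _; rewrite scalerA.
  suff -> : d * f (z j) (p x) = 0 by rewrite scale0r.
  rewrite pE (fC Vf) (fsuml Vf) mulr_sumr big1 // => a _.
  have := congr1 (fun M : 'M_n => M j a) dE; rewrite !mxE => dEja.
  by rewrite (fZl Vf) mulrCA (fC Vf (p _)) dEja mulr0.
have [||ed0|ede] := eprim (e * d).
- by lc (d * d) ee; lc e dd; ring.
- by lc d ee; ring.
- have := congr1 (chi i) ed0; rewrite rmorphM ei d1 mul1r rmorph0 => /eqP.
  by rewrite oner_eq0.
- by move/eqP: px0; apply; rewrite -ep -ede -scalerA dp scaler0.
Qed.

Lemma prim_res : exists i, chi i e = 1.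
Proof.
have [ee e0 _] := prim; apply: contrapT => ni; move/eqP: e0; apply.
by apply: res_idem0 => // i; case: (res_idem i ee) => // ei; case: ni; exists i.
Qed.

(** A single residue field suffices to measure the rank: the difference of a projection and a proper
    subprojection is a nonzero projection, hence nonzero at that field by [proj_nonzero]. *)
Lemma proj_ind (P : (V -> V) -> Prop) :
  (forall p, eproj p ->
    (forall p', eproj p' -> (forall x, p (p' x) = p' x) -> (exists x, p x != p' x) -> P p') ->
    P p) ->
  forall p, eproj p -> P p.
Proof.
move=> IHP; have [i ei] := prim_res; have [n [v [z dual]]] := sym_sp_dual Vf.
pose E (p : V -> V) : 'M[K i]_n := \matrix_(a, b) chi i (f (z a) (p (v b))).
have pE p x : is_proj f p -> p x = \sum_j f (z j) x *: p (v j).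
  move=> hp; rewrite {1}[x]dual; elim/big_rec2: _ => [|j u w _ <-].
    by rewrite (proj_lin Vf hp).
  by rewrite !(proj_lin Vf hp).
have Ecomp p p' : is_proj f p -> E p *m E p' = E (p \o p').
  move=> hp; apply/matrixP => a b; rewrite !mxE /= (pE p (p' _)) // (fC Vf) (fsuml Vf) rmorph_sum.
  by apply: eq_bigr => j _; rewrite !mxE (fZl Vf) rmorphM mulrC (fC Vf (p _)).
have rank_lt p p' : eproj p -> eproj p' -> (forall x, p (p' x) = p' x) ->
    (exists x, p x != p' x) -> (\rank (E p') < \rank (E p))%N.
  move=> hp hp' pp' [x px]; have p'p := proj_comm Vf hp.1 hp'.1 pp'.
  apply: rank_ltmx; rewrite /ltmx.
  have -> : (E p' <= E p)%MS.
    apply/submxP; exists (E p'); rewrite Ecomp; last exact: hp'.1.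
    by congr E; apply/funext => y /=.
  apply/negP => /submxP [D DE].
  pose q y := p y - p' y.
  have hq : eproj q.
    split; first exact: (proj_sub Vf hp.1 hp'.1).
    by move=> y; rewrite /q scalerBr hp.2 hp'.2.
  (* If the row space of [E p] lay in that of [E p'], then E q = E p E q would be a multiple of E p'
     E q, which vanishes because [q] is orthogonal to [p']. *)
  have Eq0 : E q = 0.
    have -> : E q = E p *m E q.
      rewrite Ecomp; last exact: hp.1.
      by congr E; apply/funext => y /=; rewrite /q !(proj_lin Vf hp.1) hp.1.2 pp'.
    rewrite DE -mulmxA Ecomp; last exact: hp'.1.
    rewrite (_ : E _ = 0) ?mulmx0 //; apply/matrixP => a b; rewrite !mxE /= /q.
    by rewrite !(proj_lin Vf hp'.1) p'p hp'.1.2 subrr (f0r Vf) rmorph0.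
  have [|y [w]] := proj_nonzero hq _ ei; first by exists x; rewrite subr_eq0.
  apply/negP/negPn/eqP; rewrite (pE q y hq.1) (fsuml Vf) rmorph_sum big1 // => b _.
  rewrite (fZl Vf) rmorphM; suff -> : chi i (f (q (v b)) w) = 0 by rewrite mulr0.
  rewrite [q (v b)]dual (fsuml Vf) rmorph_sum big1 // => a _.
  rewrite (fZl Vf) rmorphM.
  by have := congr1 (fun M : 'M_n => M a b) Eq0; rewrite !mxE => ->; rewrite mul0r.
suff H m p : eproj p -> (\rank (E p) <= m)%N -> P p.
  by move=> p hp; exact: (H _ _ hp (leqnn _)).
elim: m p => [|m IH] p hp rm; apply: IHP => // p' hp' pp' px.
  by have := leq_trans (rank_lt _ _ hp hp' pp' px) rm.
by apply: IH => //; rewrite -ltnS; exact: leq_trans (rank_lt _ _ hp hp' pp' px) rm.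
Qed.
End Form.
End Residues.

(** * Cancellation of hyperbolic spaces *)

Section Cancellation.
Context {R : comNzRingType} {I : finType} {K : I -> fieldType}.
Context {chi : forall i, {rmorphism R -> K i}}.
Hypothesis res : residue_system chi.
Variable h : R.
Hypothesis h2 : h * 2%:R = 1.

Lemma chi2 i : (2%:R : K i) != 0.
Proof.
apply/eqP => E; have := congr1 (chi i) h2.
by rewrite rmorphM rmorph1 rmorph_nat E mulr0 => /eqP; rewrite eq_sym oner_eq0.
Qed.

Variable e : R.
Hypothesis prim : primitive_idem e.

Lemma prim_ee : e * e = e. Proof. by case: prim. Qed.

Section Form.
Context {V : lmodType R} {f : V -> V -> R}.
Hypothesis Vf : sym_space f.
Local Notation eproj := (eproj (f := f) e).

(** The global vector is compared with the local choices only through the functionals that they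
    define at the residue fields, so that the fibres of [V] need not be formed. *)
Lemma crt_choose (Q : forall i, V -> Prop) : (forall i, exists x, Q i x) ->
  exists y x_, (forall i, Q i (x_ i)) /\ forall i z, chi i (f y z) = chi i (f (x_ i) z).
Proof.
move=> H; have [y yE] := vcrt res Vf (fun i => projT1 (cid (H i))).
by exists y, (fun i => projT1 (cid (H i))); split=> // i; exact: projT2 (cid (H i)).
Qed.

Lemma crt_choose2 (Q : forall i, V -> V -> Prop) : (forall i, exists x y, Q i x y) ->
  exists x y x_ y_, [/\ forall i, Q i (x_ i) (y_ i),
    forall i z, chi i (f x z) = chi i (f (x_ i) z)
    & forall i z, chi i (f y z) = chi i (f (y_ i) z)].
Proof.
move=> H; have [x [x_ [Qx xE]]] := crt_choose H.
have [y [y_ [Qy yE]]] := crt_choose (Q := fun i => Q i (x_ i)) Qx.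
by exists x, y, x_, y_.
Qed.

Lemma eproj_sub p p' : eproj p -> eproj p' -> (forall x, p (p' x) = p' x) ->
  eproj (fun x => p x - p' x).
Proof.
move=> [hp ep] [hp' ep'] pp'; split; first exact: (proj_sub Vf).
by move=> x; rewrite scalerBr ep ep'.
Qed.

Lemma proj_eq0 (p : V -> V) : ~ (exists x, p x != 0) -> p = fun=> 0.
Proof.
move=> np; apply/funext => x; apply/eqP; apply: contrapT => /negP px.
by apply: np; exists x.
Qed.

(** A nonzero projection is nonzero at each residue field where [e] is 1, and polarisation, 2 being
    invertible, gives an anisotropic vector there. The local vectors are then lifted together. *)
Lemma eproj_anisotropic p : eproj p -> (exists x, p x != 0) ->
  exists x v, [/\ p x = x, f x x * v = e & e * v = v].
Proof.
move=> hp p0; have [[pa pp] ep] := hp.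
have H i : exists x, chi i e = 1 -> chi i (f (p x) (p x)) != 0.
  have [ei|ei] := pselect (chi i e = 1); last by exists 0 => /ei.
  have [x [y xy]] := proj_nonzero Vf prim hp p0 ei.
  apply: contrapT => nx.
  have q0 z : chi i (f (p z) (p z)) = 0.
    by apply/eqP; apply: contrapT => /negP nz; apply: nx; exists z.
  have := q0 (x + y); rewrite !(proj_lin Vf hp.1) !(fE Vf) !rmorphD !q0.
  rewrite (fC Vf (p y)) add0r addr0 -mulr2n -mulr_natl => /eqP.
  by rewrite mulf_eq0 (negPf (chi2 i)) /= -pa pp (negPf xy).
have [y [x_ [Qx yE]]] := crt_choose H.
have [i ei|v v1 v2] := res_eunit res (u := f (p y) (p y)) prim_ee.
  rewrite pa pp yE (fC Vf) pa yE -pp -pa; exact: Qx.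
by exists (p y), v; rewrite pp.
Qed.

(** With [v] an inverse of [f x x], the orthogonal projection on the span of [x]. *)
Definition line (v : R) (x z : V) : V := (v * f x z) *: x.

Lemma line_eproj x v : f x x * v = e -> e *: x = x -> eproj (line v x).
Proof.
move=> xv ex; rewrite /line; split; first split=> [y z|z].
- by rewrite !(fE Vf) (fC Vf y); ring.
- rewrite (fE Vf) -[X in _ = _ *: X]ex scalerA; congr (_ *: _).
  by lc (v * f x z) xv; ring.
- by move=> z; rewrite scalerA (mulrC e) -(scalerA _ e) ex.
Qed.

Section Hyp.
Variables (p s : V -> V).
Hypotheses (hps : is_hyp f p s) (hp : eproj p).

Lemma hyp_adjL x y : f (p x + s x) y = f x (p y - s y).
Proof. by rewrite !(fE Vf) hp.1.1 (hyp_skew hps). Qed.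

Lemma hyp_adjM x y : f (p x - s x) y = f x (p y + s y).
Proof. by rewrite !(fE Vf) hp.1.1 (hyp_skew hps) opprK. Qed.

Lemma hyp_sL x : s (p x + s x) = p x + s x.
Proof. by rewrite !(hyp_lin Vf hps) (hyp_sp hps) (hyp_sq hps) addrC. Qed.

Lemma hyp_sM x : s (p x - s x) = - (p x - s x).
Proof. by rewrite !(hyp_lin Vf hps) (hyp_sp hps) (hyp_sq hps) opprB. Qed.

Lemma hyp_isoL u u' : s u = u -> s u' = u' -> f u u' = 0.
Proof.
by move=> su su'; apply: (eqN0 h2); rewrite -{1}su (hyp_skew hps) su'.
Qed.

Lemma hyp_isoM u u' : s u = - u -> s u' = - u' -> f u u' = 0.
Proof.
move=> su su'; apply: (eqN0 h2).
by rewrite -{1}[u]opprK -su (fNl Vf) (hyp_skew hps) su' !(fNr Vf) opprK.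
Qed.

Lemma hyp_local i : (exists x, p x != 0) -> chi i e = 1 ->
  exists x y, chi i (f (p x + s x) (p y - s y)) != 0.
Proof.
move=> p0 ei; have [x [y xy]] := proj_nonzero Vf prim hp p0 ei.
apply: contrapT => nxy.
have q0 z t : chi i (f (p z + s z) (p t - s t)) = 0.
  by apply/eqP; apply: contrapT => /negP nz; apply: nxy; exists z, t.
move/negP: xy; apply; apply/eqP.
(* The part of the pairing that involves [s] is antisymmetric in [x] and [y], so symmetrising
   removes it. *)
have E : f (p x + s x) (p y - s y) + f (p y + s y) (p x - s x) = 4%:R * f (p x) y.
  have E0 z t : f (p z + s z) (p t - s t) = 2%:R * (f (p z) t - f z (s t)).
    rewrite !(fE Vf) -hp.1.1 hp.1.2 !(hyp_skew hps) (hyp_sq hps) !hp.1.1.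
    by rewrite (hyp_ps hps) (hyp_sp hps); ring.
  rewrite !E0 (fC Vf y (s x)) (hyp_skew hps) (fC Vf (p y)) hp.1.1; ring.
have /(congr1 (chi i)) := E; rewrite rmorphD !q0 addr0 rmorphM => /esym/eqP.
rewrite mulf_eq0 (natrM _ 2 2) rmorphM rmorph_nat mulf_eq0 !(negPf (chi2 i)) /=.
by move=> /eqP.
Qed.

Lemma hyp_dual_pair : (exists x, p x != 0) ->
  exists u w, [/\ s u = u, s w = - w, f u w = e, e *: u = u & e *: w = w].
Proof.
move=> p0.
have H i : exists x y, chi i e = 1 -> chi i (f (p x + s x) (p y - s y)) != 0.
  have [ei|ei] := pselect (chi i e = 1); last by exists 0, 0 => /ei.
  by have [x [y xy]] := hyp_local p0 ei; exists x, y.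
have [x [y [x_ [y_ [Qxy xE yE]]]]] := crt_choose2 H.
have es z : e *: s z = s z by rewrite -(hyp_ps hps) hp.2.
have [i ei|v v1 v2] := res_eunit res (u := f (p x + s x) (p y - s y)) prim_ee.
  by rewrite hyp_adjL xE -hyp_adjL (fC Vf) hyp_adjM yE -hyp_adjM (fC Vf); exact: Qxy.
exists (p x + s x), (v *: (p y - s y)); split.
- exact: hyp_sL.
- by rewrite (hyp_lin Vf hps) hyp_sM scalerN.
- by rewrite (fZr Vf) mulrC.
- by rewrite scalerDr hp.2 es.
- by rewrite scalerA v2.
Qed.

End Hyp.

Lemma plane_id w w' : f w w = 0 -> f w w' = e -> e *: w = w -> plane f w w' w = w.
Proof. by move=> ww ww' ew; rewrite /plane ww (fC Vf) ww' ew scale0r addr0. Qed.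

Lemma plane_id' w w' : f w' w' = 0 -> f w w' = e -> e *: w' = w' -> plane f w w' w' = w'.
Proof. by move=> ww ww' ew; rewrite /plane ww ww' ew scale0r add0r. Qed.

Lemma plane_eproj w w' : f w w = 0 -> f w' w' = 0 -> f w w' = e ->
  e *: w = w -> e *: w' = w' -> eproj (plane f w w').
Proof.
move=> ww w'w' ww' ew ew'; split.
  exact: (hyp_proj (plane_hyp Vf ww w'w' ww' ew ew')).
by move=> x; rewrite /plane scalerDr !scalerA !(mulrC e) -!scalerA ew ew'.
Qed.

Lemma plane_sub q w w' x : is_proj f q -> q w = w -> q w' = w' ->
  q (plane f w w' x) = plane f w w' x.
Proof. by move=> hq qw qw'; rewrite /plane !(proj_lin Vf hq) qw qw'. Qed.

(** The vector [u] need not be in general position with respect to the Lagrangian s = -1. This is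
    repaired by conjugating [s] with the reflection [t] in a suitable anisotropic vector [r], after
    which [hyp_cancel_plane] applies. *)
Lemma hyp_cancel_pair q s u w : is_hyp f q s -> eproj q ->
  f u u = 0 -> f w w = 0 -> f u w = e -> q u = u -> q w = w ->
  exists s', is_hyp f (fun x => q x - plane f u w x) s'.
Proof.
move=> hqs hq uu ww uw qu qw.
have eu : e *: u = u by rewrite -qu hq.2.
have ew : e *: w = w by rewrite -qw hq.2.
pose p x := q x - plane f u w x.
have hp : eproj p.
  by apply: eproj_sub => //; [exact: plane_eproj|move=> x; exact: (plane_sub _ hq.1)].
have [p0|/proj_eq0 p0] := pselect (exists x, p x != 0); last first.
  by exists (fun=> 0); rewrite -/p p0; exact: hyp0.
have qp x : q (p x) = p x.
  by rewrite /p /plane !(proj_lin Vf hq.1) hq.1.2 qu qw.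
have pu : p u = 0 by rewrite /p plane_id // qu subrr.
(* [D r m] is [f r r] times the pairing of [u] with the image of [m] under the reflection in [r]. It
   avoids inverting [f r r], so it can be evaluated at a residue field. *)
pose D r m := f r r * f u m - 2%:R * f r u * f r m.
have H i : exists x y, chi i e = 1 ->
    chi i (f (q x) (q x)) != 0 /\ chi i (D (q x) (q y - s y)) != 0.
  have [ei|ei] := pselect (chi i e = 1); last by exists 0, 0 => /ei.
  have [[y yi]|ny] := pselect (exists y, chi i (f u (q y - s y)) != 0).
    (* [u] already pairs nontrivially with the Lagrangian at [i]: a reflection in a vector
       orthogonal to [u] does no harm. *)
    have [x [v [px xv _]]] := eproj_anisotropic hp p0.
    have x0 : chi i (f x x) != 0.
      have := congr1 (chi i) xv; rewrite rmorphM ei; apply: contra_eq_neq => ->.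
      by rewrite mul0r eq_sym oner_eq0.
    exists x, y => _; have qx : q x = x by rewrite -px qp.
    have xu : f x u = 0 by rewrite -px hp.1.1 pu (f0r Vf).
    by rewrite qx /D xu mulr0 mul0r subr0 rmorphM mulf_neq0.
  have u0 y : chi i (f u (q y - s y)) = 0.
    by apply/eqP; apply: contrapT => /negP nz; apply: ny; exists y.
  (* [u] is orthogonal to the Lagrangian at [i]. The reflection in [u - w] exchanges [u] with [w],
     which is not orthogonal to it. *)
  exists (u - w), u => _.
  have -> : q (u - w) = u - w by rewrite !(proj_lin Vf hq.1) qu qw.
  have E1 : f (u - w) (u - w) = - (2%:R * e).
    by rewrite !(fE Vf) uu ww uw (fC Vf w) uw; ring.
  have E2 : f (u - w) u = - e by rewrite !(fE Vf) uu (fC Vf w) uw add0r.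
  split; first by rewrite E1 rmorphN rmorphM ei mulr1 oppr_eq0 rmorph_nat chi2.
  have su : chi i (f w (s u)) = - 1.
    have := u0 w; rewrite !(fE Vf) qw uw -(hyp_skew hqs) rmorphD ei (fC Vf (s u)) => /eqP.
    by rewrite addrC addr_eq0 => /eqP.
  have E3 : chi i (f w (q u - s u)) = 2%:R.
    by rewrite !(fE Vf) qu (fC Vf w u) uw rmorphB ei su opprK.
  rewrite /D rmorphB !rmorphM u0 mulr0 sub0r E2 rmorphN ei (fDl Vf) (fNl Vf).
  by rewrite rmorphB u0 E3 rmorph_nat sub0r mulrN1 mulrNN oppr_eq0 mulf_neq0 ?chi2.
have [x [y [x_ [y_ [Qxy xE yE]]]]] := crt_choose2 H.
set r := q x; set m := q y - s y.
have qr : q r = r by rewrite /r hq.1.2.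
have er : e *: r = r by rewrite /r hq.2.
have sm : s m = - m by exact: (hyp_sM hqs).
have fr i z : chi i (f r z) = chi i (f (q (x_ i)) z) by rewrite /r !hq.1.1 xE.
have fm i z : chi i (f m z) = chi i (f (q (y_ i) - s (y_ i)) z).
  by rewrite /m !(hyp_adjM hqs hq) yE.
have rr i : chi i (f r r) = chi i (f (q (x_ i)) (q (x_ i))) by rewrite fr (fC Vf) fr.
have [i ei|v v1 v2] := res_eunit res (u := f r r) prim_ee.
  by rewrite rr; have [] := Qxy i ei.
have Di i : chi i (D r m) = chi i (D (q (x_ i)) (q (y_ i) - s (y_ i))).
  rewrite /D !rmorphB !rmorphM rr fr (fC Vf u m) fm (fC Vf u) fr.
  by rewrite (fC Vf (q (x_ i)) m) fm (fC Vf (q (x_ i)) (q _ - _)).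
have [t tE] : exists t, forall z, t z = z - (2%:R * v * f r z) *: r by eexists.
have ta z z' : f (t z) z' = f z (t z').
  by rewrite !tE !(fE Vf) (fC Vf z r); ring.
have tt z : t (t z) = z.
  apply: (fext Vf) => z'; rewrite !tE !(fE Vf).
  lc (4%:R * v * f r z * f r z') v1; lc (4%:R * f r z * f r z') v2; ring.
have qt z : q (t z) = t (q z).
  by rewrite !tE !(proj_lin Vf hq.1) qr -hq.1.1 qr.
have hqt : is_hyp f q (fun z => t (s (t z))).
  split=> [z z'|z|z]; first by rewrite ta (hyp_skew hqs) ta.
    by rewrite tt (hyp_sq hqs) qt tt.
  by rewrite -qt (hyp_sp hqs).
have utm : f u (t m) = f u m - 2%:R * v * f r u * f r m.
  by rewrite !tE !(fE Vf) (fC Vf u r); ring.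
have [i ei|c c1 c2] := res_eunit res (u := f u (t m)) prim_ee.
  have [r0 D0] := Qxy i ei; rewrite -Di in D0.
  have : chi i (f r r * f u (t m)) = chi i (D r m).
    rewrite utm (_ : _ * _ = f r r * f u m - 2%:R * (f r r * v) * f r u * f r m); last by ring.
    by rewrite v1 /D !rmorphB !rmorphM ei mulr1.
  by rewrite rmorphM => E; apply: contraNneq D0 => E0; rewrite -E E0 mulr0.
apply: (hyp_cancel_plane Vf h2 (m := c *: t m) hqt hq.2 uu ww uw qu qw).
  by rewrite (adj_lin Vf ta) tt (hyp_lin Vf hqs) sm scalerN (adj_lin Vf ta) (adj_lin Vf ta).
by rewrite (fZr Vf) mulrC.
Qed.

(** The operator on [p] supplies hyperbolic pairs, which are cancelled from [q] one plane at a time,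
    while [p] shrinks by the same planes. *)
Lemma hyp_cancel q s p s1 : is_hyp f q s -> eproj q -> is_hyp f p s1 -> eproj p ->
  (forall x, q (p x) = p x) -> exists s', is_hyp f (fun x => q x - p x) s'.
Proof.
move=> hqs hq hps hp; move: (p) hp q s s1 hqs hq hps.
apply: (proj_ind res Vf prim) => {}p hp IH q s s1 hqs hq hps qp.
have [p0|/proj_eq0 p0] := pselect (exists x, p x != 0); last first.
  exists s; rewrite p0 (_ : (fun x => _) = q) //.
  by apply/funext => x; rewrite subr0.
have [u [w [su sw uw eu ew]]] := hyp_dual_pair hps hp p0.
have uu := hyp_isoL hps su su; have ww := hyp_isoM hps sw sw.
have pu : p u = u by rewrite -su (hyp_ps hps).
have pw : p w = w by rewrite -[w]opprK -sw (proj_lin Vf hp.1) (hyp_ps hps).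
have qu : q u = u by rewrite -pu qp.
have qw : q w = w by rewrite -pw qp.
have [s' hq'] := hyp_cancel_pair hqs hq uu ww uw qu qw.
have hpl := plane_eproj uu ww uw eu ew.
have pl x : p (plane f u w x) = plane f u w x by exact: (plane_sub _ hp.1).
have ql x : q (plane f u w x) = plane f u w x by exact: (plane_sub _ hq.1).
have hpl' := plane_hyp Vf uu ww uw eu ew.
have hp' := eproj_sub hp hpl pl; have hq'' := eproj_sub hq hpl ql.
have lp := proj_comm Vf hp.1 hpl.1 pl.
have [||||s'' hs''] := IH (fun x => p x - plane f u w x) hp' _ _
    (fun x => q x - plane f u w x) s' (fun x => s1 x - plane_sg f u w x) hq' hq''.
- by move=> x; rewrite (proj_lin Vf hp.1) (proj_lin Vf hp.1) hp.1.2 pl.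
- exists u; rewrite pu plane_id // subrr; apply: contra_neq (_ : e != 0) => [u0|].
    by rewrite -uw u0 (f0l Vf).
  by case: prim.
- apply: (hyp_sub Vf hps hpl') => x.
  by rewrite /plane !(hyp_lin Vf hps) su sw scalerN.
- move=> x; rewrite (proj_lin Vf hq.1) (proj_lin Vf hq.1) qp ql.
  have lpl : plane f u w (plane f u w x) = plane f u w x by rewrite hpl.1.2.
  rewrite -[RHS]subr0; congr (_ - _).
  by rewrite (adj_lin Vf hpl.1.1) (adj_lin Vf hpl.1.1) lp lpl subrr.
exists s''; rewrite (_ : (fun x => _) = fun x => q x - plane f u w x - (p x - plane f u w x)) //.
by apply/funext => x; rewrite opprB addrA subrK.
Qed.
End Form.
End Cancellation.

(** * Hyperbolic spaces with a skew-adjoint operator *)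

Section Cores.
Context {R : comNzRingType} {I : finType} {K : I -> fieldType}.
Context {chi : forall i, {rmorphism R -> K i}}.
Hypothesis res : residue_system chi.
Variable h : R.
Hypothesis h2 : h * 2%:R = 1.
Variable e : R.
Hypothesis prim : primitive_idem e.
Let ee := prim_ee prim.
Let two_n0 i := chi2 (chi := chi) h2 i.

Section Form.
Context {V : lmodType R} {f : V -> V -> R}.
Hypothesis Vf : sym_space f.
Local Notation eproj := (eproj (f := f) e).

(** The lifted vector is corrected by a multiple of a vector [m] of the Lagrangian that pairs with
    it to a unit of eR. The coefficient is proportional to [f w w], hence zero at every residue
    field where [e] is 1, so the conditions [Q] imposed there survive. *)
Lemma isotropic_lift p s (Q : forall i, V -> Prop) : is_hyp f p s -> eproj p ->
  (forall i, exists x y, chi i e = 1 -> [/\ Q i (p x), chi i (f (p x) (p x)) = 0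
    & chi i (f (p x) (p y - s y)) != 0]) ->
  exists w x_, [/\ p w = w, f w w = 0 & forall i, chi i e = 1 ->
    Q i (x_ i) /\ forall z, chi i (f w z) = chi i (f (x_ i) z)].
Proof.
move=> hps hp H; have [x [y [x_ [y_ [Qxy xE yE]]]]] := crt_choose2 res Vf H.
set w := p x; set m := p y - s y.
have fw i z : chi i (f w z) = chi i (f (p (x_ i)) z) by rewrite /w !hp.1.1 xE.
have fm i z : chi i (f m z) = chi i (f (p (y_ i) - s (y_ i)) z).
  by rewrite /m !(hyp_adjM Vf hps hp) yE.
have [i ei|v v1 v2] := res_eunit res (u := f w m) ee.
  by rewrite fw (fC Vf) fm (fC Vf); have [] := Qxy i ei.
have mm : f m m = 0 by apply: (hyp_isoM h2 Vf hps); exact: (hyp_sM Vf hps).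
have ew : e * f w w = f w w by rewrite -(fZl Vf) hp.2.
have pm : p m = m.
  by rewrite /m (proj_lin Vf hp.1) (proj_lin Vf hp.1) hp.1.2 (hyp_ps hps).
have pw : p w = w by exact: hp.1.2.
clearbody w m.
exists (w - (h * v * f w w) *: m), (fun i => p (x_ i)); split.
- by rewrite (proj_lin Vf hp.1) -scaleNr (proj_lin Vf hp.1) pm pw.
- rewrite !(fE Vf) mm (fC Vf m w).
  by lc (- 2%:R * h * f w w) v1; lc (- 2%:R * h) ew; lc (- f w w) h2; ring.
- move=> i ei; have [Qx x0 _] := Qxy i ei; split=> // z.
  have ww0 : chi i (f w w) = 0 by rewrite fw (fC Vf) fw.
  by rewrite !(fE Vf) rmorphD rmorphN !rmorphM ww0 mulr0 mul0r subr0 fw.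
Qed.

(** At a residue field the Lagrangian s = -1 is its own orthogonal, so vectors orthogonal to it lie
    in it and are orthogonal to each other. *)
Lemma residue_isoM p s i x y : is_hyp f p s -> eproj p -> p x = x -> p y = y ->
  (forall z, chi i (f x (p z - s z)) = 0) -> (forall z, chi i (f y (p z - s z)) = 0) ->
  chi i (f x y) = 0.
Proof.
move=> hps hp px py x0 y0.
have E1 : chi i (f x y) = chi i (f x (s y)).
  by have /eqP := x0 y; rewrite (fDr Vf) (fNr Vf) rmorphB py subr_eq0 => /eqP.
have E2 : chi i (f x y) = - chi i (f x (s y)).
  have /eqP := y0 x; rewrite (fDr Vf) (fNr Vf) rmorphB px subr_eq0 => /eqP.
  by rewrite (fC Vf y x) (fC Vf y) (hyp_skew hps) rmorphN.
have /eqP : 2%:R * chi i (f x y) = 0 by rewrite mulr_natl mulr2n {1}E2 E1 addNr.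
by rewrite mulf_eq0 (negPf (two_n0 i)) => /eqP.
Qed.

Lemma hyp_nonzero_ex i (P : V -> Prop) (g : V -> R) :
  ~ (exists z, P z /\ chi i (g z) != 0) -> forall z, P z -> chi i (g z) = 0.
Proof.
move=> nz z Pz; apply/eqP; apply: contrapT => /negP gz; apply: nz.
by exists z.
Qed.

Section Skew.
Variables (lam : V -> V) (d d' : R).
Hypothesis dd' : d * d' = 1.
Hypothesis lamS : forall x y, f (lam x) y = - f x (lam y).
Hypothesis lam2 : forall x, lam (lam x) = d *: x.

Lemma lam_lin :
  (forall x y, lam (x + y) = lam x + lam y) * (forall a x, lam (a *: x) = a *: lam x) *
  (forall x, lam (- x) = - lam x) * (lam 0 = 0).
Proof. by apply: (adj_lin Vf (w := fun x => - lam x)) => x y; rewrite lamS (fNr Vf). Qed.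

Lemma lam_self0 x : f x (lam x) = 0.
Proof. by apply: (eqN0 h2); rewrite -lamS (fC Vf). Qed.

Lemma lam_lam x y : f (lam x) (lam y) = - (d * f x y).
Proof. by rewrite lamS lam2 (fZr Vf). Qed.

(** Up to the unit [d], the norm of f(x, y) + d^{-1} f(x, lam y) lam, which is twice the value at
    (x, y) of the hermitian form over R[lam] with trace [f]. Its being nonzero means that [x] and
    [y] pair to a unit over R[lam]. *)
Definition skew_norm (x y : V) : R := d * f x y ^+ 2 - f x (lam y) ^+ 2.

Lemma chid i : chi i d != 0.
Proof.
apply/eqP => d0; have := congr1 (chi i) dd'; rewrite rmorphM d0 mul0r rmorph1 => /eqP.
by rewrite eq_sym oner_eq0.
Qed.

Lemma chi_skew_norm i x y : chi i (skew_norm x y) =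
  chi i d * chi i (f x y) ^+ 2 - chi i (f x (lam y)) ^+ 2.
Proof. by rewrite /skew_norm rmorphB rmorphM !rmorphXn. Qed.

Section Local.
Variables (p s : V -> V) (i : I).
Hypotheses (hps : is_hyp f p s) (hp : eproj p) (ei : chi i e = 1).
Hypothesis plam : forall x, p (lam x) = lam (p x).

(** If [x] lies in the Lagrangian at [i], it is replaced by an isotropic vector [y2] of the plane
    that it spans with [y] over R[lam]. Both cannot lie in the Lagrangian, since they pair
    nontrivially. *)
Lemma skew_local_general : (exists x, [/\ p x = x, chi i (f x x) = 0 &
    exists y, p y = y /\ chi i (skew_norm x y) != 0]) ->
  exists x y, [/\ exists2 z, p z = z & chi i (skew_norm (p x) z) != 0,
    chi i (f (p x) (p x)) = 0 & chi i (f (p x) (p y - s y)) != 0].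
Proof.
move=> [x [px x0 [y [py xy]]]].
have [[z [_ xz]]|nz] := pselect (exists z, True /\ chi i (f x (p z - s z)) != 0).
  by exists x, z; rewrite px; split=> //; exists y.
have {}nz z := hyp_nonzero_ex nz (z := z) Logic.I.
set D := skew_norm x y in xy *.
(* [y] is multiplied by a conjugate of its hermitian product with [x], which makes the new product
   lie in R. Then [y2] is made isotropic by subtracting a multiple of [x]. *)
have [y' y'E] : exists z, z = (d * f x y) *: y - f x (lam y) *: lam y by eexists.
have [y2 y2E] : exists z, z = (2%:R * D) *: y' - f y' y' *: x by eexists.
have xy' : f x y' = D by rewrite y'E /D /skew_norm !(fE Vf); ring.
have xly' : f x (lam y') = 0.
  by rewrite y'E !lam_lin lam2 !(fE Vf); ring.
have xy2 : chi i (f x y2) = 2%:R * chi i D ^+ 2.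
  rewrite y2E !(fE Vf) xy' rmorphB !rmorphM x0 mulr0 subr0 rmorph_nat; ring.
have py' : p y' = y'.
  by rewrite y'E (proj_lin Vf hp.1) -scaleNr !(proj_lin Vf hp.1) plam py.
have py2 : p y2 = y2.
  by rewrite y2E (proj_lin Vf hp.1) -scaleNr !(proj_lin Vf hp.1) py' px.
have xly2 : f x (lam y2) = 0.
  by rewrite y2E !lam_lin !(fE Vf) xly' lam_self0; ring.
have y2y2 : chi i (f y2 y2) = 0.
  have -> : f y2 y2 = f y' y' ^+ 2 * f x x.
    by rewrite y2E !(fE Vf) (fC Vf y' x) xy'; ring.
  by rewrite rmorphM x0 mulr0.
have [[z [_ yz]]|nz'] := pselect (exists z, True /\ chi i (f y2 (p z - s z)) != 0).
  exists y2, z; rewrite py2; split=> //; exists x => //.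
  rewrite /skew_norm (fC Vf y2 x) (fC Vf y2) lamS xly2 rmorphB rmorphM !rmorphXn xy2.
  by rewrite rmorphN rmorph0 oppr0 expr0n subr0 mulf_neq0 ?chid // expf_neq0 // mulf_neq0 ?expf_neq0 ?two_n0.
have {}nz' z := hyp_nonzero_ex nz' (z := z) Logic.I.
have := residue_isoM hps hp px py2 nz nz'; rewrite xy2 => /eqP.
by rewrite mulf_eq0 expf_eq0 (negPf xy) (negPf (two_n0 i)).
Qed.

(** When d = t^2 at [i], the norm is minus the product of two linear forms in [y]. If each of them
    is nonzero somewhere, both are nonzero at one of [y1], [y2], [y1 + y2]. *)
Lemma skew_norm_split t x y1 y2 : chi i d = chi i t ^+ 2 -> p x = x ->
  p y1 = y1 -> p y2 = y2 ->
  chi i (f (lam x + t *: x) y1) != 0 -> chi i (f (lam x - t *: x) y2) != 0 ->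
  exists y, p y = y /\ chi i (skew_norm x y) != 0.
Proof.
move=> dt px py1 py2 xy1 xy2.
have NE y : chi i (skew_norm x y) =
    - (chi i (f (lam x + t *: x) y) * chi i (f (lam x - t *: x) y)).
  rewrite /skew_norm rmorphB rmorphM !rmorphXn dt !(fE Vf) !rmorphD !rmorphN !rmorphM.
  by rewrite lamS rmorphN; ring.
have [y1x|y1x] := eqVneq (chi i (f (lam x - t *: x) y1)) 0; last first.
  by exists y1; split=> //; rewrite NE oppr_eq0 mulf_neq0.
have [y2x|y2x] := eqVneq (chi i (f (lam x + t *: x) y2)) 0; last first.
  by exists y2; split=> //; rewrite NE oppr_eq0 mulf_neq0.
exists (y1 + y2); split; first by rewrite (proj_lin Vf hp.1) py1 py2.
rewrite NE !(fDr Vf) !rmorphD y1x y2x addr0 add0r oppr_eq0.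
by rewrite mulf_neq0.
Qed.

Variables (l0 m0 l1 m1 : V).
Hypotheses (sl0 : s l0 = l0) (sm0 : s m0 = - m0) (lm00 : f l0 m0 = e).
Hypotheses (sl1 : s l1 = l1) (sm1 : s m1 = - m1) (lm11 : f l1 m1 = e).
Hypotheses (lm01 : f l0 m1 = 0) (lm10 : f l1 m0 = 0).

Let pl l : s l = l -> p l = l.
Proof. by move=> <-; exact: (hyp_ps hps). Qed.
Let pm l : s l = - l -> p l = l.
Proof. by move=> sl; rewrite -[l]opprK -sl (proj_lin Vf hp.1) (hyp_ps hps). Qed.

(** Here d = t^2 at [i] and the Lagrangian s = 1 consists of eigenvectors for [t], so its vectors
    lack a component for -t. Adding (lam - t) m0, an eigenvector for -t, to [l1] supplies one, and
    the sum stays isotropic because [l1] is orthogonal to [m0]. This is where two hyperbolic planes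
    are required: in rank two the isotropic lines are the two eigenlines. *)
Lemma skew_local_eigen t : chi i d = chi i t ^+ 2 ->
  (forall l, s l = l -> forall y, chi i (f (lam l - t *: l) y) = 0) ->
  exists x, [/\ p x = x, chi i (f x x) = 0 &
    exists y, p y = y /\ chi i (skew_norm x y) != 0].
Proof.
move=> dt Lt.
have t0 : chi i t != 0 by have := chid i; rewrite dt expf_eq0.
have fl l y : s l = l -> chi i (f (lam l) y) = chi i t * chi i (f l y).
  move=> sl; have /eqP := Lt l sl y.
  by rewrite !(fE Vf) rmorphB rmorphM subr_eq0 => /eqP.
have m00 := hyp_isoM h2 Vf hps sm0 sm0; have l11 := hyp_isoL h2 hps sl1 sl1.
have [x xE] : exists x, x = l1 + lam m0 - t *: m0 by eexists.
have px : p x = x.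
  by rewrite xE -scaleNr !(proj_lin Vf hp.1) plam (pl sl1) (pm sm0).
have l1lm0 : chi i (f l1 (lam m0)) = 0.
  by rewrite -[f _ _]opprK -lamS rmorphN fl // lm10 rmorph0 mulr0 oppr0.
exists x; split=> //.
  rewrite xE !(fE Vf) l11 (fC Vf (lam m0) l1) (fC Vf m0 l1) lm10 lam_lam m00.
  rewrite (fC Vf (lam m0) m0) lam_self0 !(mulr0, oppr0, addr0, add0r).
  by rewrite rmorphD l1lm0 addr0.
apply: (@skew_norm_split t x m1 l0 dt px); [exact: pm|exact: pl| |].
- have -> : lam x + t *: x = (lam l1 + t *: l1) + (d - t ^+ 2) *: m0.
    rewrite xE !lam_lin lam2; apply: (fext Vf) => z; rewrite !(fE Vf); ring.
  rewrite !(fE Vf) !rmorphD !rmorphM fl // lm11 rmorphB rmorphXn dt subrr mul0r addr0.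
  by rewrite ei !mulr1 -mulr2n -mulr_natl mulf_neq0 ?two_n0.
- have -> : lam x - t *: x = (lam l1 - t *: l1) + (d + t ^+ 2) *: m0 - (2%:R * t) *: lam m0.
    rewrite xE !lam_lin lam2; apply: (fext Vf) => z; rewrite !(fE Vf); ring.
  rewrite (fC Vf) (fDr Vf) (fDr Vf) rmorphD rmorphD (fC Vf l0) Lt // add0r.
  rewrite !(fE Vf) lm00 rmorphM rmorphD rmorphN rmorphXn dt rmorphM ei.
  rewrite -[f l0 _]opprK -lamS !rmorphN fl // lm00 ei rmorphM rmorph_nat.
  by rewrite (_ : _ + _ = 2%:R * 2%:R * chi i t * chi i t) ?mulf_neq0 ?two_n0 //; ring.
Qed.

(** If [d] is not a square at [i], the norm of a hyperbolic pair cannot vanish. If d = t^2, either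
    some vector of the Lagrangian s = 1 has both eigencomponents nonzero, or the whole Lagrangian
    lies in a single eigenspace and [skew_local_eigen] applies to [t] or to -t. *)
Lemma skew_local_ex : exists x, [/\ p x = x, chi i (f x x) = 0 &
    exists y, p y = y /\ chi i (skew_norm x y) != 0].
Proof.
have [[t dt]|nsq] := pselect (exists t, chi i d = chi i t ^+ 2); last first.
  exists l0; split; [exact: pl|by rewrite (hyp_isoL h2 hps) // rmorph0|].
  exists m0; split; first exact: pm.
  rewrite /skew_norm lm00 rmorphB rmorphM !rmorphXn ei expr1n mulr1 subr_eq0.
  by apply/eqP => E; apply: nsq; eexists; exact: E.
have [|n1] := pselect (exists l y1 y2, [/\ s l = l, p y1 = y1, p y2 = y2,
    chi i (f (lam l + t *: l) y1) != 0 & chi i (f (lam l - t *: l) y2) != 0]).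
  move=> [l [y1 [y2 [sl py1 py2 ly1 ly2]]]]; exists l.
  split; [exact: pl|by rewrite (hyp_isoL h2 hps) // rmorph0|].
  exact: (skew_norm_split dt (pl sl) py1 py2).
have [[l [y [sl ly]]]|Lt] := pselect (exists l y, s l = l /\ chi i (f (lam l - t *: l) y) != 0);
    last first.
  apply: (skew_local_eigen dt) => l sl y.
  by apply/eqP; apply: contrapT => /negP ly; apply: Lt; exists l, y.
apply: (@skew_local_eigen (- t)); first by rewrite rmorphN sqrrN.
have pe l2 u y2 : s l2 = l2 -> f (lam l2 + u *: l2) y2 = f (lam l2 + u *: l2) (p y2).
  by move=> sl2; rewrite -hp.1.1 !(proj_lin Vf hp.1) plam pl.
have Lp l2 : s l2 = l2 -> chi i (f (lam l2 - t *: l2) y) = 0 ->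
    forall y2, chi i (f (lam l2 + t *: l2) y2) = 0.
  move=> sl2 l2y y2; apply/eqP; apply: contrapT => /negP l2y2.
  have [lt|lt] := eqVneq (chi i (f (lam l + t *: l) y2)) 0; last first.
    apply: n1; exists l, (p y2), (p y); rewrite -pe // -scaleNr -pe // scaleNr.
    by rewrite !hp.1.2; split.
  (* A sum of one vector from each eigenspace has both components nonzero: a space is not the union
     of two proper subspaces. *)
  apply: n1; exists (l + l2), (p y2), (p y).
  have sll : s (l + l2) = l + l2 by rewrite (hyp_lin Vf hps) sl sl2.
  rewrite -pe // -scaleNr -pe // scaleNr !hp.1.2; split=> //.
    have -> : lam (l + l2) + t *: (l + l2) = (lam l + t *: l) + (lam l2 + t *: l2).
      by rewrite lam_lin scalerDr addrACA.
    by rewrite (fDl Vf) rmorphD lt add0r.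
  have -> : lam (l + l2) - t *: (l + l2) = (lam l - t *: l) + (lam l2 - t *: l2).
    by rewrite lam_lin scalerDr opprD addrACA.
  by rewrite (fDl Vf) rmorphD l2y addr0.
move=> l2 sl2 y2; rewrite scaleNr opprK.
have [l2y|l2y] := eqVneq (chi i (f (lam l2 - t *: l2) y)) 0; first exact: Lp.
apply/eqP; apply: contrapT => /negP l2y2; apply: n1; exists l2, (p y2), (p y).
by rewrite -pe // -scaleNr -pe // scaleNr !hp.1.2; split.
Qed.

End Local.

(** For a hyperbolic pair [x], [y] of the hermitian form over R[lam], this is the projection on the
    span of x, y, lam x, lam y. The companion [quad_plane_sg] fixes x and lam x and negates y and
    lam y, so it commutes with [lam]. *)
Definition quad_plane (x y z : V) : V :=
  f y z *: x + f x z *: y - (d' * f (lam y) z) *: lam x - (d' * f (lam x) z) *: lam y.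
Definition quad_plane_sg (x y z : V) : V :=
  f y z *: x - f x z *: y - (d' * f (lam y) z) *: lam x + (d' * f (lam x) z) *: lam y.

Lemma quad_plane_hyp x y : f x x = 0 -> f y y = 0 -> f x y = e -> f x (lam y) = 0 ->
  e *: x = x -> e *: y = y -> is_hyp f (quad_plane x y) (quad_plane_sg x y).
Proof.
move=> xx yy xy xly ex ey; have lx := lam_self0 x; have ly := lam_self0 y.
have yx : f y x = e by rewrite (fC Vf).
have lxy : f (lam x) y = 0 by rewrite lamS xly oppr0.
have ylx : f y (lam x) = 0 by rewrite (fC Vf).
have lyx : f (lam y) x = 0 by rewrite (fC Vf).
have lxx : f (lam x) x = 0 by rewrite (fC Vf).
have lyy : f (lam y) y = 0 by rewrite (fC Vf).
have eE z : (e * f x z = f x z) * (e * f y z = f y z) *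
    (e * f (lam x) z = f (lam x) z) * (e * f (lam y) z = f (lam y) z).
  by rewrite -!(fZl Vf) -!lam_lin ex ey.
rewrite /quad_plane /quad_plane_sg; split=> [z z'|z|z].
- by rewrite !(fE Vf) !(fC Vf z); ring.
- apply: (fext Vf) => z'; rewrite !(fE Vf) !lam_lam xx yy xy yx xly lx ly lxy ylx lyx lxx lyy.
  have [[[e1 e2] e3] e4] := eE z; have [[[e1' e2'] e3'] e4'] := eE z'.
  lc (f x z') e2; lc (f y z') e1; lc (- d' * f (lam x) z') e4; lc (- d' * f (lam y) z') e3.
  lc (- d' * e * f (lam y) z * f (lam x) z') dd'.
  by lc (- d' * e * f (lam x) z * f (lam y) z') dd'; ring.
- apply: (fext Vf) => z'; rewrite !(fE Vf) !lam_lam xx yy xy yx xly lx ly lxy ylx lyx lxx lyy.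
  have [[[e1 e2] e3] e4] := eE z; have [[[e1' e2'] e3'] e4'] := eE z'.
  lc (f x z') e2; lc (- f y z') e1; lc (- d' * f (lam x) z') e4; lc (d' * f (lam y) z') e3.
  lc (- d' * e * f (lam y) z * f (lam x) z') dd'.
  by lc (d' * e * f (lam x) z * f (lam y) z') dd'; ring.
Qed.

Lemma quad_plane_lam x y z : quad_plane x y (lam z) = lam (quad_plane x y z).
Proof.
rewrite /quad_plane !lam_lin !lam2; apply: (fext Vf) => z'; rewrite !(fE Vf) !lam_lam.
rewrite -[f y (lam z)]opprK -[f x (lam z)]opprK -!lamS.
lc (f (lam y) z * f x z' + f (lam x) z * f y z') dd'.
by lc (f y z * f (lam x) z' + f x z * f (lam y) z') dd'; ring.
Qed.

Lemma quad_plane_sg_lam x y z : quad_plane_sg x y (lam z) = lam (quad_plane_sg x y z).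
Proof.
rewrite /quad_plane_sg !lam_lin !lam2; apply: (fext Vf) => z'; rewrite !(fE Vf) !lam_lam.
rewrite -[f y (lam z)]opprK -[f x (lam z)]opprK -!lamS.
lc (f (lam y) z * f x z' - f (lam x) z * f y z') dd'.
by lc (f y z * f (lam x) z' - f x z * f (lam y) z') dd'; ring.
Qed.

(** A hermitian space over R[lam] whose trace form is hyperbolic is hyperbolic over R[lam]. In rank
    at least four a hermitian hyperbolic pair exists and its span is cancelled; the smaller ranks
    need no construction. *)
Theorem skew_hyp_commute p : eproj p -> (forall x, p (lam x) = lam (p x)) ->
  forall s, is_hyp f p s ->
  exists s', is_hyp f p s' /\ forall x, s' (lam x) = lam (s' x).
Proof.
move: p; apply: (proj_ind res Vf prim) => p hp IH plam s hps.
have [p0|/proj_eq0 p0] := pselect (exists x, p x != 0); last first.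
  by exists (fun=> 0); rewrite p0 lam_lin; split=> //; exact: (hyp0 Vf).
have [l0 [m0 [sl0 sm0 lm0 el0 em0]]] := hyp_dual_pair res h2 prim Vf hps hp p0.
have pl l : s l = l -> p l = l by move=> <-; exact: (hyp_ps hps).
have pm l : s l = - l -> p l = l.
  by move=> sl; rewrite -[l]opprK -sl (proj_lin Vf hp.1) (hyp_ps hps).
have l00 := hyp_isoL h2 hps sl0 sl0; have m00 := hyp_isoM h2 Vf hps sm0 sm0.
have hpl := plane_eproj Vf l00 m00 lm0 el0 em0.
have hpl' := plane_hyp Vf l00 m00 lm0 el0 em0.
have pp0 x : p (plane f l0 m0 x) = plane f l0 m0 x.
  by apply: (plane_sub Vf _ hp.1); [exact: pl|exact: pm].
have hp1 := eproj_sub Vf hp hpl pp0.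
have hps1 : is_hyp f (fun x => p x - plane f l0 m0 x) (fun x => s x - plane_sg f l0 m0 x).
  apply: (hyp_sub Vf hps hpl') => x.
  by rewrite /plane !(hyp_lin Vf hps) sl0 sm0 scalerN.
have [p1|/proj_eq0 p1] := pselect (exists x, p x - plane f l0 m0 x != 0); last first.
  have pE x : p x = plane f l0 m0 x.
    by have := congr1 (fun u => u x) p1 => /subr0_eq.
  (* On a single plane, [lam l0] is orthogonal to [l0] and [lam m0] to [m0], so both isotropic lines
     are stable under [lam] and the given [s] already commutes with it. *)
  exists s; split=> // x.
  pose t := f (lam l0) m0.
  have ll : lam l0 = t *: l0.
    have E : p (lam l0) = lam l0 by rewrite plam pl.
    by rewrite -E pE /plane lam_self0 scale0r addr0 (fC Vf m0).
  have lm : lam m0 = - t *: m0.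
    have E : p (lam m0) = lam m0 by rewrite plam pm.
    by rewrite -E pE /plane lam_self0 scale0r add0r /t lamS opprK.
  rewrite -(hyp_sp hps) plam -[in RHS](hyp_sp hps) pE /plane.
  rewrite !lam_lin ll lm !(hyp_lin Vf hps) sl0 sm0 !lam_lin ll lm.
  by rewrite !(scalerN, scaleNr) opprK.
have [l1 [m1 [sl1 sm1 lm1 el1 em1]]] := hyp_dual_pair res h2 prim Vf hps1 hp1 p1.
have p1l l : p l - plane f l0 m0 l = l -> [/\ p l = l, f l0 l = 0 & f m0 l = 0].
  move=> El; have fl z : p z = z -> plane f l0 m0 z = z -> f z l = 0.
    by move=> pz plz; rewrite -El (fDr Vf) (fNr Vf) -hp.1.1 -hpl.1.1 pz plz subrr.
  have fl0 := fl l0 (pl _ sl0) (plane_id Vf l00 lm0 el0).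
  have fm0 := fl m0 (pm _ sm0) (plane_id' m00 lm0 em0).
  by split=> //; rewrite -[RHS]El /plane fl0 fm0 !scale0r addr0 subr0.
have hp1l l : s l - plane_sg f l0 m0 l = l \/ s l - plane_sg f l0 m0 l = - l ->
    [/\ p l = l, f l0 l = 0, f m0 l = 0 & s l = s l - plane_sg f l0 m0 l].
  move=> sl; have [pll fl0 fm0] : [/\ p l = l, f l0 l = 0 & f m0 l = 0].
    apply: p1l; pose s1 x := s x - plane_sg f l0 m0 x.
    have s1N : s1 (- l) = - s1 l := (hyp_lin Vf hps1).1.2 l.
    have <- : s1 (s1 l) = p l - plane f l0 m0 l := hyp_sq hps1 l.
    by case: sl => sl; rewrite [s1 l]sl ?s1N [s1 l]sl ?opprK.
  by split=> //; rewrite /plane_sg fl0 fm0 !scale0r subrr subr0.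
have [pl1 l01 m01 sl1E] := hp1l _ (or_introl sl1).
have [pm1 l0m1 m0m1 sm1E] := hp1l _ (or_intror sm1).
have [w [x_ [pw ww wQ]]] : exists w x_, [/\ p w = w, f w w = 0 & forall i, chi i e = 1 ->
    (exists z, p z = z /\ chi i (skew_norm (x_ i) z) != 0) /\
    forall z, chi i (f w z) = chi i (f (x_ i) z)].
  apply: (isotropic_lift (Q := fun i x =>
    exists z, p z = z /\ chi i (skew_norm x z) != 0) hps hp) => i.
  have [ei|ei] := pselect (chi i e = 1); last by exists 0, 0 => /ei.
  have [] := @skew_local_general p s i hps hp plam.
    apply: (@skew_local_ex p s i hps hp ei plam l0 m0 l1 m1) => //.
    - by rewrite sl1E sl1.
    - by rewrite sm1E sm1.
    - by rewrite (fC Vf).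
  by move=> x [y [[z pz xz] xx xy]]; exists x, y => _; split=> //; exists z.
have [y0 [y_ [Qy yE]]] : exists y y_, (forall i, chi i e = 1 -> p (y_ i) = y_ i /\
    chi i (skew_norm w (y_ i)) != 0) /\ forall i z, chi i (f y z) = chi i (f (y_ i) z).
  apply: (crt_choose (Q := fun i z => chi i e = 1 ->
    p z = z /\ chi i (skew_norm w z) != 0) res Vf) => i.
  have [ei|ei] := pselect (chi i e = 1); last by exists 0 => /ei.
  have [[z [pz xz]] xE] := wQ i ei; exists z => _; split=> //.
  by move: xz; rewrite !chi_skew_norm !xE.
pose y := p y0.
have [i ei|v v1 v2] := res_eunit res (u := skew_norm w y) ee.
  have [py] := Qy i ei; rewrite !chi_skew_norm.
  have E1 : chi i (f w y) = chi i (f w (y_ i)).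
    by rewrite /y (fC Vf) hp.1.1 yE (fC Vf) pw.
  have E2 : chi i (f w (lam y)) = chi i (f w (lam (y_ i))).
    rewrite -[f w (lam y)]opprK -[f w (lam (y_ i))]opprK -!lamS !rmorphN; congr (- _).
    by rewrite /y (fC Vf) hp.1.1 yE (fC Vf) plam pw.
  by rewrite E1 E2.
have py : p y = y by exact: hp.1.2.
clearbody y.
have [y' y'E] : exists z, z = (v * d * f w y) *: y - (v * f w (lam y)) *: lam y by eexists.
have py' : p y' = y'.
  by rewrite y'E (proj_lin Vf hp.1) -scaleNr !(proj_lin Vf hp.1) plam py.
have wy' : f w y' = e by rewrite -v1 y'E !(fE Vf) /skew_norm; ring.
have wly' : f w (lam y') = 0 by rewrite y'E !lam_lin lam2 !(fE Vf); ring.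
have [z zE] : exists z, z = y' - (h * f y' y') *: w by eexists.
have pz : p z = z by rewrite zE (proj_lin Vf hp.1) -scaleNr (proj_lin Vf hp.1) py' pw.
have ew : e *: w = w by rewrite -pw hp.2.
have ez : e *: z = z by rewrite -pz hp.2.
have wz : f w z = e by rewrite zE !(fE Vf) ww wy'; ring.
have wlz : f w (lam z) = 0 by rewrite zE !lam_lin !(fE Vf) wly' lam_self0; ring.
have zz : f z z = 0.
  have ey' : e * f y' y' = f y' y' by rewrite -(fZl Vf) -py' hp.2.
  rewrite zE !(fE Vf) ww (fC Vf y' w) wy'.
  by lc (- 2%:R * h) ey'; lc (- f y' y') h2; ring.
have hH := quad_plane_hyp ww zz wz wlz ew ez.
have pH x : p (quad_plane w z x) = quad_plane w z x.
  rewrite /quad_plane -!scaleNr.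
  by rewrite !(proj_lin Vf hp.1) !plam pw pz.
have eH : eproj (quad_plane w z).
  split; first exact: (hyp_proj hH).
  by move=> x; rewrite -pH hp.2.
have [s1 hs1] := hyp_cancel res h2 prim Vf hps hp hH eH pH.
have Hw : quad_plane w z w = w.
  rewrite /quad_plane (fC Vf z) wz ww ew (fC Vf _ w) wlz (fC Vf _ w) lam_self0.
  by rewrite !mulr0 !scale0r addr0 !subr0.
have hp' := eproj_sub Vf hp eH pH.
have [|||s2 [hs2 s2lam]] := IH _ hp' _ _ _ s1 hs1.
- by move=> x; rewrite (proj_lin Vf hp.1) (proj_lin Vf hp.1) pH hp.1.2.
- exists w; rewrite pw Hw subrr; apply: contraTneq isT => w0; case: prim => _ /eqP e0 _.
  by case: e0; rewrite -wz w0 (f0l Vf).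
- by move=> x; rewrite plam quad_plane_lam (lam_lin.1.1.1 (p x)) lam_lin.
exists (fun x => quad_plane_sg w z x + s2 x); split; last first.
  by move=> x; rewrite quad_plane_sg_lam s2lam lam_lin.
rewrite (_ : p = fun x => quad_plane w z x + (p x - quad_plane w z x)); last first.
  by apply/funext => x; rewrite addrC subrK.
apply: (hyp_add Vf hH hs2) => x.
rewrite (adj_lin Vf eH.1.1) (adj_lin Vf eH.1.1) eH.1.2.
by rewrite (proj_comm Vf hp.1 eH.1 pH) subrr.
Qed.

(** Hermitian forms over R[lam] can be diagonalised. With N the span over R of an orthogonal basis,
    [t] is 1 on N and -1 on lam N, so its fixed vectors form an R-structure of the hermitian
    space. *)
Theorem skew_diag p : eproj p -> (forall x, p (lam x) = lam (p x)) ->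
  exists t : V -> V, [/\ forall x y, f (t x) y = f x (t y), forall x, t (t x) = p x,
    forall x, t (p x) = t x & forall x, t (lam x) = - lam (t x)].
Proof.
move: p; apply: (proj_ind res Vf prim) => p hp IH plam.
have [p0|/proj_eq0 p0] := pselect (exists x, p x != 0); last first.
  exists (fun=> 0); rewrite p0; split=> // *; by rewrite ?(fE Vf) ?lam_lin ?oppr0.
have [x [v [px xv ev]]] := eproj_anisotropic res h2 prim Vf hp p0.
have xlx := lam_self0 x; have lxlx := lam_lam x x.
have lxx : f (lam x) x = 0 by rewrite (fC Vf).
have ex : e *: x = x by rewrite -px hp.2.
(* Projection on the span of the orthogonal vectors [x] and [lam x]. The second coefficient inverts
   f(lam x, lam x) = - d f(x, x). *)
have [H HE] : exists H, forall z, H z = (v * f x z) *: x - (v * d' * f (lam x) z) *: lam x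
  by eexists.
have [t tE] : exists t, forall z, t z = (v * f x z) *: x + (v * d' * f (lam x) z) *: lam x
  by eexists.
have ta z z' : f (t z) z' = f z (t z').
  by rewrite !tE !(fE Vf) !(fC Vf z); ring.
have tt z : t (t z) = H z.
  apply: (fext Vf) => z'; rewrite !(tE, HE) !(fE Vf) lxlx xlx lxx.
  have P (a b z1 z2 : R) : v * (v * a * f x x) * z1 + v * d' * (v * d' * b * (- (d * f x x))) * z2
      = v * a * z1 - v * d' * b * z2.
    lc (v * a * z1 - v * d' * b * z2) xv; lc (a * z1 - d' * b * z2) ev.
    by lc (- v * d' * v * b * f x x * z2) dd'; ring.
  by rewrite !mulr0 addr0 add0r P.
have tl z : t (lam z) = - lam (t z).
  rewrite !tE !lam_lin lam2; apply: (fext Vf) => z'; rewrite !(fE Vf) lam_lam.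
  rewrite -[f x (lam z)]opprK -lamS.
  by lc (v * f (lam x) z * f x z' - v * f x z * f (lam x) z') dd'; ring.
have Ha z z' : f (H z) z' = f z (H z') by rewrite -!tt ta ta.
have elx : e *: lam x = lam x by rewrite -lam_lin ex.
have et z : e *: t z = t z.
  by rewrite !tE scalerDr !scalerA !(mulrC e) -!scalerA elx ex.
have tx : t x = x by rewrite !tE lxx mulr0 scale0r addr0 mulrC xv ex.
have tlx : t (lam x) = - lam x by rewrite tl tx.
have tZ := adj_lin Vf ta.
have tH z : t (H z) = t z.
  by rewrite HE !tZ tx tlx scalerN opprK.
have pt z : p (t z) = t z by rewrite !tE !(proj_lin Vf hp.1) plam px.
have pH z : p (H z) = H z by rewrite -tt pt.
have eH : eproj H.
  by split; [split=> // z; rewrite -{1}tt tH tt|move=> z; rewrite -tt et].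
have Hl z : H (lam z) = lam (H z) by rewrite -!tt !tl tZ tl opprK.
have hp' := eproj_sub Vf hp eH pH.
have HZ := adj_lin Vf Ha.
have [|||t2 [t2a t22 t2p t2l]] := IH _ hp'.
- by move=> z; rewrite (proj_lin Vf hp.1) (proj_lin Vf hp.1) pH hp.1.2.
- exists x; rewrite px -tt !tx subrr; apply: contraTneq isT => x0; case: prim => _ /eqP e0 _.
  by case: e0; rewrite -xv x0 (f0l Vf) mul0r.
- by move=> z; rewrite plam Hl (lam_lin.1.1.1 (p z)) lam_lin.
have Hp z : H (p z) = H z by exact: (proj_comm Vf hp.1 eH.1 pH).
have Ht2 z : H (t2 z) = 0.
  have -> : t2 z = p (t2 z) - H (t2 z) by rewrite -(t22 (t2 z)) (t22 z) t2p.
  by rewrite !HZ Hp eH.1.2 subrr.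
have tt2 z : t (t2 z) = 0 by rewrite -tH Ht2 tZ.
have t2t z : t2 (t z) = 0.
  by rewrite -t2p pt -(tt (t z)) (tt z) tH subrr (adj_lin Vf t2a).2.
exists (fun z => t z + t2 z); split.
- by move=> z z'; rewrite !(fE Vf) ta t2a.
- move=> z; rewrite tZ (adj_lin Vf t2a) tt tt2 t2t t22 addr0 add0r addrC subrK //.
- move=> z; rewrite -[in LHS](tH (p z)) Hp tH; congr (_ + _).
  by rewrite -t2p Hp hp.1.2 t2p.
- by move=> z; rewrite tl t2l lam_lin opprD.
Qed.

End Skew.
End Form.
End Cores.

(** * Hyperbolic spaces with a self-adjoint operator *)

Section SelfAdjoint.
Context {R : comNzRingType} {I : finType} {K : I -> fieldType}.
Context {chi : forall i, {rmorphism R -> K i}}.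
Hypothesis res : residue_system chi.
Variable h : R.
Hypothesis h2 : h * 2%:R = 1.
Variable e : R.
Hypothesis prim : primitive_idem e.
Let ee := prim_ee prim.
Let two_n0 i := chi2 (chi := chi) h2 i.

Context {V : lmodType R} {f : V -> V -> R}.
Hypothesis Vf : sym_space f.
Local Notation eproj := (eproj (f := f) e).

Variables (lam : V -> V) (d d' : R).
Hypothesis dd' : d * d' = 1.
Hypothesis lamA : forall x y, f (lam x) y = f x (lam y).
Hypothesis lam2 : forall x, lam (lam x) = d *: x.

Let lamZ := adj_lin Vf lamA.

Section Local.
Variables (p s : V -> V) (i : I).
Hypotheses (hps : is_hyp f p s) (hp : eproj p) (ei : chi i e = 1).
Hypothesis plam : forall x, p (lam x) = lam (p x).

Let pl l : s l = l -> p l = l.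
Proof. by move=> <-; exact: (hyp_ps hps). Qed.
Let pm l : s l = - l -> p l = l.
Proof. by move=> sl; rewrite -[l]opprK -sl (proj_lin Vf hp.1) (hyp_ps hps). Qed.

(** Both [x] and [lam x] are isotropic at [i] and have the required pairing; since they are not
    orthogonal to each other, they cannot both lie in the Lagrangian s = -1. *)
Lemma sa_local_general : (exists x, [/\ p x = x, chi i (f x x) = 0 & chi i (f x (lam x)) != 0]) ->
  exists x y, [/\ chi i (f (p x) (lam (p x))) != 0,
    chi i (f (p x) (p x)) = 0 & chi i (f (p x) (p y - s y)) != 0].
Proof.
move=> [x [px xx xlx]].
have [[z [_ xz]]|nz] := pselect (exists z, True /\ chi i (f x (p z - s z)) != 0).
  by exists x, z; rewrite px.
have {}nz z := hyp_nonzero_ex nz (z := z) Logic.I.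
have [[z [_ xz]]|nz'] := pselect (exists z, True /\ chi i (f (lam x) (p z - s z)) != 0).
  exists (lam x), z; rewrite plam px; split=> //.
    by rewrite lam2 (fZr Vf) rmorphM lamA mulf_neq0 ?(chid dd').
  by rewrite lamA lam2 (fZr Vf) rmorphM xx mulr0.
have {}nz' z := hyp_nonzero_ex nz' (z := z) Logic.I.
move/negP: xlx; case; apply/eqP.
by apply: (residue_isoM h2 Vf hps hp) => //; rewrite plam px.
Qed.

Variables (l0 m0 : V).
Hypotheses (sl0 : s l0 = l0) (sm0 : s m0 = - m0) (lm0 : f l0 m0 = e).

(** The hypotheses force [lam] to act on the Lagrangian s = 1 as a scalar [t] at [i]. As lam - t
    then maps everything into that Lagrangian, (lam - t)^2 = 0, and together with lam^2 = d this
    gives 2 t lam = d + t^2, so [lam] is scalar on the whole image of [p]. *)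
Lemma sa_local_scalar :
  (forall l, s l = l -> chi i (f l (lam l)) = 0) ->
  (forall l m, s l = l -> s m = - m -> chi i (f l m) = 0 -> chi i (f (lam l) m) = 0) ->
  exists t, forall x y, chi i (f (lam (p x)) y) = chi i t * chi i (f (p x) y).
Proof.
move=> n1 n2; pose t := f (lam l0) m0.
have smm m a : s m = - m -> s (m - a *: m0) = - (m - a *: m0).
  by move=> sm; rewrite (hyp_lin Vf hps) -scaleNr (hyp_lin Vf hps) sm sm0 scalerN opprD.
have sll l a : s l = l -> s (l - a *: l0) = l - a *: l0.
  by move=> sl; rewrite (hyp_lin Vf hps) -scaleNr (hyp_lin Vf hps) sl sl0.
have A0 m : s m = - m -> chi i (f (lam l0) m) = chi i t * chi i (f l0 m).
  move=> sm; have := n2 l0 (m - f l0 m *: m0) sl0 (smm m (f l0 m) sm).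
  rewrite !(fE Vf) lm0 !(rmorphB, rmorphM) ei mulr1 subrr.
  by move=> /(_ erefl)/eqP; rewrite subr_eq0 mulrC => /eqP.
have A1 l m : s l = l -> s m = - m -> chi i (f l m0) = 0 ->
    chi i (f (lam l) m) = chi i t * chi i (f l m).
  move=> sl sm lm; have ll0 : chi i (f (lam l) m0) = 0 by exact: n2.
  have sl' : s (l0 + l) = l0 + l by rewrite (hyp_lin Vf hps) sl0 sl.
  have := n2 (l0 + l) (m - (f l0 m + f l m) *: m0) sl' (smm _ _ sm).
  rewrite !lamZ !(fE Vf) lm0 !(rmorphB, rmorphD, rmorphM) lm ei ll0 -/t A0 // => H.
  by apply: subr0_eq; rewrite -[RHS]H; ring.
have A2 l m : s l = l -> s m = - m -> chi i (f (lam l) m) = chi i t * chi i (f l m).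
  move=> sl sm; have := A1 (l - f l m0 *: l0) m (sll _ _ sl) sm.
  rewrite !lamZ !(fE Vf) lm0 !(rmorphB, rmorphD, rmorphM) ei mulr1 subrr A0 // => /(_ erefl) H.
  by lc 1 H; ring.
have L0 l l' : s l = l -> s l' = l' -> chi i (f (lam l) l') = 0.
  move=> sl sl'; have := n1 (l + l'); rewrite (hyp_lin Vf hps) sl sl' lamZ !(fE Vf) !rmorphD !n1 //.
  rewrite add0r addr0 -lamA (fC Vf l') -mulr2n -mulr_natl => /(_ erefl)/eqP.
  by rewrite mulf_eq0 (negPf (two_n0 i)) => /eqP.
have half z : 2%:R *: p z = (p z + s z) + (p z - s z).
  by rewrite addrACA subrr addr0 scaler_nat mulr2n.
have A3 l z : s l = l -> chi i (f (lam l) z) = chi i t * chi i (f l z).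
  move=> sl; apply: (mulfI (two_n0 i)).
  have fp x : p x = x -> 2%:R * chi i (f x z) = chi i (f x (p z + s z)) + chi i (f x (p z - s z)).
    by move=> px; rewrite -rmorphD -(fDr Vf) -half (fZr Vf) rmorphM rmorph_nat -hp.1.1 px.
  have sL := hyp_sL Vf hps z; have sM := hyp_sM Vf hps z.
  rewrite mulrCA fp; last by rewrite plam pl.
  rewrite fp; last exact: pl.
  rewrite L0 // A2 // add0r mulrDr.
  by rewrite (hyp_isoL h2 hps sl sL) rmorph0 mulr0 add0r.
(* [u] is orthogonal to the Lagrangian s = 1 at [i], hence lies in it there, and [A3] applies to
   it. *)
have A4 x z : chi i (f (lam (lam (p x)) - t *: lam (p x)) z)
    = chi i t * chi i (f (lam (p x) - t *: p x) z).
  have [u uE] : exists u, u = lam (p x) - t *: p x by eexists.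
  have pu : p u = u by rewrite uE (proj_lin Vf hp.1) -scaleNr (proj_lin Vf hp.1) plam hp.1.2.
  have -> : lam (lam (p x)) - t *: lam (p x) = lam u.
    by rewrite uE !lamZ.
  have uL l : s l = l -> chi i (f u l) = 0.
    move=> sl; rewrite (fC Vf) uE !(fE Vf) -lamA rmorphB A3 // rmorphM subrr //.
  have ul y : 2%:R * chi i (f u y) = chi i (f (p u + s u) y).
    rewrite (hyp_adjL Vf hps hp) -{1}pu hp.1.1 -(rmorph_nat (chi i)) -rmorphM -(fZr Vf) half.
    by rewrite (fDr Vf) rmorphD uL ?add0r ?(hyp_sL Vf hps).
  rewrite -uE; apply: (mulfI (two_n0 i)).
  by rewrite lamA ul -lamA A3 ?(hyp_sL Vf hps) // mulrCA ul.
have A5 x z : 2%:R * chi i t * chi i (f (lam (p x)) z) = (chi i d + chi i t ^+ 2) * chi i (f (p x) z).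
  have := A4 x z; rewrite lam2 !(fE Vf) !rmorphB !rmorphM => E.
  by lc (-1) E; ring.
have t0 : chi i t != 0.
  apply/eqP => t0; have /eqP := A5 l0 m0; rewrite t0 mulr0 mul0r expr0n addr0 pl // lm0 ei mulr1.
  by rewrite eq_sym (negPf (chid dd' i)).
have [t' t'E] := res_surj res ((chi i d + chi i t ^+ 2) / (2%:R * chi i t)).
exists t' => x y; rewrite t'E; apply: (mulfI (x := 2%:R * chi i t)); first by rewrite mulf_neq0 ?two_n0.
by rewrite A5 mulrA mulrCA mulfV ?mulf_neq0 ?two_n0 // mulr1.
Qed.

Lemma sa_local : (exists t, forall x y, chi i (f (lam (p x)) y) = chi i t * chi i (f (p x) y)) \/
  exists x y, [/\ chi i (f (p x) (lam (p x))) != 0,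
    chi i (f (p x) (p x)) = 0 & chi i (f (p x) (p y - s y)) != 0].
Proof.
have [[l [sl ll]]|n1] := pselect (exists l, s l = l /\ chi i (f l (lam l)) != 0).
  right; apply: sa_local_general; exists l; split=> //; first exact: pl.
  by rewrite (hyp_isoL h2 hps) // rmorph0.
have {}n1 := hyp_nonzero_ex n1.
have [[l [m [sl sm lm llm]]]|n2] := pselect (exists l m, [/\ s l = l, s m = - m,
    chi i (f l m) = 0 & chi i (f (lam l) m) != 0]).
  right; apply: sa_local_general.
  have ll := hyp_isoL h2 hps sl sl; have mm := hyp_isoM h2 Vf hps sm sm.
  (* Both l + m and l - m are isotropic at [i], and the values of f(x, lam x) at them differ by 4
     f(lam l, m), so one of them serves. *)
  have [E|E] := eqVneq (chi i (f (l + m) (lam (l + m)))) 0; last first.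
    exists (l + m); split=> //; first by rewrite (proj_lin Vf hp.1) pl // pm.
    by rewrite !(fE Vf) ll mm (fC Vf m l) addr0 add0r rmorphD lm addr0.
  exists (l - m); split=> //; first by rewrite !(proj_lin Vf hp.1) pl // pm.
    by rewrite !(fE Vf) ll mm (fC Vf m l) !rmorphD !rmorphN lm rmorph0 !oppr0 !addr0.
  apply/eqP => E'; move/negP: llm; apply; apply/eqP.
  have E4 : 2%:R * 2%:R * f (lam l) m = f (l + m) (lam (l + m)) - f (l - m) (lam (l - m)).
    by rewrite !lamZ !(fE Vf) (fC Vf m (lam l)) -!lamA; ring.
  have := congr1 (chi i) E4; rewrite rmorphB E E' subrr !rmorphM rmorph_nat => /eqP.
  by rewrite !mulf_eq0 !(negPf (two_n0 i)) => /eqP.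
left; apply: sa_local_scalar => // l m sl sm lm; apply/eqP; apply: contrapT => /negP llm.
by apply: n2; exists l, m.
Qed.

End Local.

(** Being scalar at one residue field must propagate to the whole summand. For trace forms of spaces
    over T this comes from the idempotents of eT. *)
Hypothesis scalar_res : forall p i t, eproj p -> (forall x, p (lam x) = lam (p x)) ->
  (exists x, p x != 0) -> chi i e = 1 ->
  (forall x y, chi i (f (lam (p x)) y) = chi i t * chi i (f (p x) y)) ->
  exists t0, forall x, lam (p x) = t0 *: p x.

(** As long as [lam] is not scalar, there is an isotropic [w] for which f(w, lam w) is a unit of eR.
    On the plane of w and lam w, the operator fixing w and negating lam w anticommutes with [lam].
    When [lam] has become scalar, the remaining operator commutes with it. *)
Theorem sa_hyp_split p : eproj p -> (forall x, p (lam x) = lam (p x)) ->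
  forall s, is_hyp f p s ->
  exists p1 p2 s1 s2, [/\ is_hyp f p1 s1 /\ is_hyp f p2 s2,
    forall x, s1 (lam x) = - lam (s1 x), forall x, s2 (lam x) = lam (s2 x),
    forall x, p x = p1 x + p2 x & forall x, p1 (p2 x) = 0].
Proof.
move: p; apply: (proj_ind res Vf prim) => p hp IH plam s hps.
have [p0|/proj_eq0 p0] := pselect (exists x, p x != 0); last first.
  exists (fun=> 0), (fun=> 0), (fun=> 0), (fun=> 0); rewrite p0.
  by split=> //= *; rewrite ?lamZ ?oppr0 ?addr0 //; split; exact: (hyp0 Vf).
have [[t0 lp]|nsc] := pselect (exists t0, forall x, lam (p x) = t0 *: p x).
  exists (fun=> 0), p, (fun=> 0), s; split=> //= *; rewrite ?lamZ ?oppr0 ?add0r //.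
    by split=> //; exact: (hyp0 Vf).
  rewrite -(hyp_sp hps) plam lp (hyp_lin Vf hps) (hyp_sp hps).
  by rewrite -[in RHS](hyp_ps hps) lp (hyp_ps hps).
have [l0 [m0 [sl0 sm0 lm0 el0 em0]]] := hyp_dual_pair res h2 prim Vf hps hp p0.
have [w [x_ [pw ww wQ]]] : exists w x_, [/\ p w = w, f w w = 0 & forall i, chi i e = 1 ->
    chi i (f (x_ i) (lam (x_ i))) != 0 /\ forall z, chi i (f w z) = chi i (f (x_ i) z)].
  apply: (isotropic_lift res h2 prim Vf (Q := fun i x => chi i (f x (lam x)) != 0) hps hp) => i.
  have [ei|ei] := pselect (chi i e = 1); last by exists 0, 0 => /ei.
  have [[t tp]|[x [y [? ? ?]]]] := @sa_local p s i hps hp ei plam l0 m0 sl0 sm0 lm0.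
    by case: nsc; exact: (scalar_res hp plam p0 ei tp).
  by exists x, y => _.
have [i ei|v v1 v2] := res_eunit res (u := f w (lam w)) ee.
  have [Qi wE] := wQ i ei.
  by rewrite wE -lamA (fC Vf) wE (fC Vf) lamA.
have ew : e *: w = w by rewrite -pw hp.2.
have [w' w'E] : exists w', w' = v *: lam w by eexists.
have ew' : e *: w' = w' by rewrite w'E scalerA v2.
have ww' : f w w' = e by rewrite w'E (fZr Vf) mulrC.
have lww : f (lam w) (lam w) = 0 by rewrite lamA lam2 (fZr Vf) ww mulr0.
have w'w' : f w' w' = 0 by rewrite w'E !(fE Vf) lww !mulr0.
have pw' : p w' = w' by rewrite w'E (proj_lin Vf hp.1) plam pw.
have hH := plane_hyp Vf ww w'w' ww' ew ew'.
have eH := plane_eproj Vf ww w'w' ww' ew ew'.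
have pH x : p (plane f w w' x) = plane f w w' x by exact: (plane_sub Vf _ hp.1).
have Hl x : plane f w w' (lam x) = lam (plane f w w' x).
  rewrite /plane w'E !lamZ lam2 !(fE Vf) lamA lamA lam2 (fZr Vf) -lamA.
  by rewrite addrC !scalerA; congr (_ *: _ + _ *: _); ring.
have Sl x : plane_sg f w w' (lam x) = - lam (plane_sg f w w' x).
  rewrite /plane_sg w'E !lamZ lam2 !(fE Vf) lamA lamA lam2 (fZr Vf) -lamA.
  by rewrite opprB !scalerA; congr (_ *: _ - _ *: _); ring.
have [s' hs'] := hyp_cancel res h2 prim Vf hps hp hH eH pH.
have hp' := eproj_sub Vf hp eH pH.
have HZ := adj_lin Vf eH.1.1.
have [|||p1 [p2 [s1 [s2 [[hs1 hs2] s1l s2l pE p12]]]]] := IH _ hp' _ _ _ s' hs'.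
- by move=> x; rewrite (proj_lin Vf hp.1) (proj_lin Vf hp.1) pH hp.1.2.
- exists w; rewrite pw (plane_id Vf ww ww' ew) subrr; apply: contraTneq isT => w0; case: prim => _ /eqP e0 _.
  by case: e0; rewrite -ww' w0 (f0l Vf).
- by move=> x; rewrite plam Hl (lamZ.1.1.1 (p x)) lamZ.
have Hp x : plane f w w' (p x - plane f w w' x) = 0.
  by rewrite HZ HZ eH.1.2 (proj_comm Vf hp.1 eH.1 pH) subrr.
have hp1 := hyp_proj hs1; have hp2 := hyp_proj hs2.
have p21 x : p2 (p1 x) = 0.
  by apply: (fext Vf) => z; rewrite hp2.1 hp1.1 p12 (f0l Vf) (f0r Vf).
have Hp1 x : plane f w w' (p1 x) = 0.
  by have := Hp (p1 x); rewrite pE p21 hp1.2 addr0.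
have Hp2 x : plane f w w' (p2 x) = 0.
  by have := Hp (p2 x); rewrite pE p12 hp2.2 add0r.
exists (fun x => plane f w w' x + p1 x), p2, (fun x => plane_sg f w w' x + s1 x), s2; split=> //.
- by split=> //; exact: (hyp_add Vf hH hs1).
- by move=> x; rewrite Sl s1l lamZ opprD.
- by move=> x; rewrite -addrA -pE addrC subrK.
- by move=> x; rewrite Hp2 p12 addr0.
Qed.
End SelfAdjoint.

(** * Norm forms *)

Lemma sym_space_prod (A : comNzRingType) (V W : lmodType A) (f : V -> V -> A)
    (g : W -> W -> A) : sym_space f -> sym_space g ->
  sym_space (fun x y : V * W => f x.1 y.1 + g x.2 y.2).
Proof.
move=> Vf Wg; split=> [x y|x y z|a x y|].
- by rewrite (fC Vf) (fC Wg).
- by rewrite /= (fDl Vf) (fDl Wg) addrACA.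
- by rewrite /= (fZl Vf) (fZl Wg) mulrDr.
have [m [v [z dV]]] := sym_sp_dual Vf; have [n [v' [z' dW]]] := sym_sp_dual Wg.
pose F (u : 'I_m -> V) (u' : 'I_n -> W) (i : 'I_(m + n)) : V * W :=
  match split i with inl j => (u j, 0) | inr k => (0, u' k) end.
have sl (i : 'I_m) : split (lshift n i) = inl i := unsplitK (inl i).
have sr (i : 'I_n) : split (rshift m i) = inr i := unsplitK (inr i).
exists (m + n)%N, (F v v'), (F z z') => -[x y].
rewrite big_split_ord /= /F.
under [X in _ = X + _]eq_bigr => i _ do rewrite sl /= (f0l Wg) addr0.
under [X in _ = _ + X]eq_bigr => i _ do rewrite sr /= (f0l Vf) add0r.
apply/eqP; rewrite xpair_eqE; apply/andP; split; apply/eqP => /=.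
  rewrite !(raddf_sum fst) /= -dV [X in _ + X]big1 ?addr0 //.
  by move=> i _; rewrite scaler0.
rewrite !(raddf_sum snd) /= -dW [X in X + _]big1 ?add0r //.
by move=> i _; rewrite scaler0.
Qed.

Lemma sym_space_scale (A : comNzRingType) (V : lmodType A) (f : V -> V -> A) (c c' : A) :
  c * c' = 1 -> sym_space f -> sym_space (fun x y => c * f x y).
Proof.
move=> cc' Vf; split=> [x y|x y z|a x y|].
- by rewrite (fC Vf).
- by rewrite (fDl Vf) mulrDr.
- by rewrite (fZl Vf) mulrCA.
have [m [v [z dV]]] := sym_sp_dual Vf; exists m, v, (fun i => c' *: z i) => x.
rewrite {1}[x]dV; apply: eq_bigr => i _; congr (_ *: _).
by rewrite (fZl Vf) mulrA cc' mul1r.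
Qed.

Section Doubled.
Context {R : comNzRingType} {I : finType} {K : I -> fieldType}.
Context {chi : forall i, {rmorphism R -> K i}}.
Hypothesis res : residue_system chi.
Variable h : R.
Hypothesis h2 : h * 2%:R = 1.
Variable e : R.
Hypothesis prim : primitive_idem e.
Let ee := prim_ee prim.
Let two_n0 i := chi2 (chi := chi) h2 i.

Context {V : lmodType R} {f : V -> V -> R}.
Hypothesis Vf : sym_space f.
Local Notation eproj := (eproj (f := f) e).
Variables (d d' : R).
Hypothesis dd' : d * d' = 1.

(** The form f tensored with <1, -d>, which is half the trace form of the base change of [f] to T
    with its standard involution. *)
Definition norm_form (x y : V * V) : R := f x.1 y.1 + - d * f x.2 y.2.
Local Notation F := norm_form.

Lemma norm_form_space : sym_space F.
Proof.
apply: (sym_space_prod (g := fun x y => - d * f x y)) => //; apply: (sym_space_scale (c' := - d')) => //.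
by rewrite mulrNN.
Qed.
Let XF := norm_form_space.

Definition dbl (p : V -> V) (x : V * V) : V * V := (p x.1, p x.2).

Lemma dbl_eproj p : eproj p -> is_proj F (dbl p) /\ forall x, e *: dbl p x = dbl p x.
Proof.
move=> [[pa pp] ep]; split; first split=> [x y|x].
- by rewrite /F /= !pa.
- by rewrite /dbl /= !pp.
- by move=> x; apply/eqP; rewrite xpair_eqE /= !ep !eqxx.
Qed.

Section Local.
Variables (p : V -> V) (s : V * V -> V * V) (i : I).
Hypotheses (hps : is_hyp F (dbl p) s) (hp : eproj p) (ei : chi i e = 1).

(** For a vector [w] isotropic for [norm_form], the Gram determinant of its two components. *)
Definition ndet (w : V * V) : R := d * f w.2 w.2 ^+ 2 - f w.1 w.2 ^+ 2.

Definition generic w := exists z, chi i (F w (dbl p z - s z)) != 0.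

Lemma generic_pair w w' : dbl p w = w -> dbl p w' = w' -> chi i (F w w') != 0 ->
  generic w \/ generic w'.
Proof.
move=> pw pw' ww'; apply: contrapT => /not_orP [nw nw']; move/negP: ww'; apply; apply/eqP.
have H u : ~ generic u -> forall z, chi i (F u (dbl p z - s z)) = 0.
  move=> nu z; apply/eqP; apply: contrapT => /negP uz; apply: nu; by exists z.
exact: (residue_isoM h2 XF hps (dbl_eproj hp) pw pw' (H _ nw) (H _ nw')).
Qed.

(** If (x, y) lies in the Lagrangian at [i], a modified vector with the same properties does not:
    (x, -y) when f(y, y) is nonzero, and otherwise (y, x) or (y, -x), whose pairings with (x, y) add
    up to 2 f(x, y). *)
Lemma dbl_local_general x y : p x = x -> p y = y ->
  chi i (f x x) = chi i d * chi i (f y y) -> chi i (ndet (x, y)) != 0 ->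
  exists w, [/\ dbl p w = w, chi i (ndet w) != 0, chi i (F w w) = 0 & generic w].
Proof.
move=> px py xx D0.
have XX : chi i (F (x, y) (x, y)) = 0.
  by rewrite /F /= rmorphD rmorphM rmorphN xx; ring.
have [y0|y0] := eqVneq (chi i (f y y)) 0; last first.
  have [|||gen|gen] := @generic_pair (x, y) (x, - y).
  - by rewrite /dbl /= px py.
  - by rewrite /dbl /= px (proj_lin Vf hp.1) py.
  - rewrite /F /= (fNr Vf) mulrNN rmorphD rmorphM xx -mulrDl -mulr2n -mulr_natl.
    by rewrite !mulf_neq0 // ?(chid dd') ?two_n0.
  - by exists (x, y); rewrite /dbl /= px py.
  - exists (x, - y); rewrite /dbl /= px (proj_lin Vf hp.1) py; split=> //.
      by move: D0; rewrite /ndet /= !(fE Vf) opprK sqrrN.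
    by rewrite -[RHS]XX /F /= !(fE Vf) opprK.
have x0 : chi i (f x x) = 0 by rewrite xx y0 mulr0.
have c0 : chi i (f x y) != 0.
  move: D0; rewrite /ndet /= rmorphB rmorphM !rmorphXn y0 expr0n mulr0 sub0r oppr_eq0.
  by rewrite expf_eq0.
have good (u : V) : u = x \/ u = - x -> generic (y, u) ->
    exists w, [/\ dbl p w = w, chi i (ndet w) != 0, chi i (F w w) = 0 & generic w].
  move=> uE gu; exists (y, u); split=> //.
  - by case: uE => ->; rewrite /dbl /= py ?(proj_lin Vf hp.1) px.
  - rewrite /ndet /= rmorphB rmorphM !rmorphXn (_ : chi i (f u u) = 0); last first.
      by case: uE => ->; rewrite ?(fE Vf) ?opprK.
    rewrite expr0n mulr0 sub0r oppr_eq0 expf_eq0 /=.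
    by case: uE => ->; rewrite (fC Vf) ?(fE Vf) ?rmorphN ?oppr_eq0.
  - rewrite /F /= rmorphD rmorphM y0 add0r.
    by case: uE => ->; rewrite ?(fE Vf) ?opprK x0 mulr0.
have [E|E] := eqVneq (chi i (F (x, y) (y, x))) 0.
  have [|||gen|gen] := @generic_pair (x, y) (y, - x).
  - by rewrite /dbl /= px py.
  - by rewrite /dbl /= py (proj_lin Vf hp.1) px.
  - apply/eqP => E'; move/negP: c0; apply; apply/eqP.
    have : chi i (F (x, y) (y, x) + F (x, y) (y, - x)) = 0 by rewrite rmorphD E E' addr0.
    rewrite /F /= (fNr Vf) (fC Vf y x) mulrN addrACA subrr addr0 rmorphD => /eqP.
    by rewrite -mulr2n -mulr_natl mulf_eq0 (negPf (two_n0 i)) => /eqP.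
  - by exists (x, y); rewrite /dbl /= px py.
  - by apply: (good (- x)) => //; right.
have [|||gen|gen] := @generic_pair (x, y) (y, x) => //.
- by rewrite /dbl /= px py.
- by rewrite /dbl /= py px.
- by exists (x, y); rewrite /dbl /= px py.
- by apply: (good x) => //; left.
Qed.

Variables (x1 x2 : V) (u w : V * V).
Hypotheses (px1 : p x1 = x1) (px2 : p x2 = x2) (x12 : f x1 x2 = 0).
Hypotheses (x1n : chi i (f x1 x1) != 0) (x2n : chi i (f x2 x2) != 0).
Hypotheses (pu : dbl p u = u) (pw : dbl p w = w) (uu : F u u = 0) (uw : F u w = e).

(** When [d] is a square at [i], two orthogonal anisotropic vectors suffice. When it is not, the
    isotropic vector [u] works unless its components are isotropic at [i]; one of these is then
    isotropic and outside the radical, and yields a suitable pair. *)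
Lemma dbl_local : exists w, [/\ dbl p w = w, chi i (ndet w) != 0, chi i (F w w) = 0 & generic w].
Proof.
have [[t dt]|nsq] := pselect (exists t, chi i d = chi i t ^+ 2).
  have t0 : chi i t != 0 by have := chid (chi := chi) dd' i; rewrite dt expf_eq0.
  (* With a1 and a2 the values of [f] at [x1] and [x2], the Gram determinant is d (a1 + a2)^2 - d
     (a1 - a2)^2 = 4 d a1 a2. *)
  apply: (@dbl_local_general (t *: (x1 - x2)) (x1 + x2)).
  - by rewrite !(proj_lin Vf hp.1) px1 px2.
  - by rewrite !(proj_lin Vf hp.1) px1 px2.
  - by rewrite dt !(fE Vf) (fC Vf x2 x1) x12 !(rmorphM, rmorphD, rmorphN, rmorph0); ring.
  - rewrite /ndet /= rmorphB rmorphM !rmorphXn dt !(fE Vf) (fC Vf x2 x1) x12.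
    rewrite !(rmorphM, rmorphD, rmorphN, rmorph0).
    rewrite (_ : _ - _ = 2%:R * 2%:R * chi i t ^+ 2 * chi i (f x1 x1) * chi i (f x2 x2)).
      by rewrite !mulf_neq0 ?two_n0 ?expf_neq0.
    by ring.
have [u1 u2] : p u.1 = u.1 /\ p u.2 = u.2 by rewrite -[in RHS]pu -[X in _ /\ _ = X.2]pu.
have uE : f u.1 u.1 = d * f u.2 u.2 by lc 1 uu; rewrite /F; ring.
have [D0|D0] := eqVneq (chi i (ndet (u.1, u.2))) 0; last first.
  by apply: dbl_local_general D0 => //; rewrite uE rmorphM.
have isotropic z z' : p z = z -> p z' = z' -> chi i (f z z) = 0 -> chi i (f z z') != 0 ->
    exists w, [/\ dbl p w = w, chi i (ndet w) != 0, chi i (F w w) = 0 & generic w].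
  move=> pz pz' zz zz'.
  (* The first component is the second isotropic vector of the plane of [z] and [z'], scaled to
     avoid a division. *)
  apply: (@dbl_local_general ((2%:R * f z z') *: z' - f z' z' *: z) z) => //.
  - by rewrite (proj_lin Vf hp.1) -scaleNr !(proj_lin Vf hp.1) pz pz'.
  - rewrite zz mulr0 (_ : f _ _ = f z' z' ^+ 2 * f z z) ?rmorphM ?zz ?mulr0 //.
    by rewrite !(fE Vf) (fC Vf z' z); ring.
  - rewrite /ndet /= rmorphB rmorphM !rmorphXn zz !(fE Vf) (fC Vf z' z).
    rewrite expr0n mulr0 sub0r oppr_eq0 rmorphB !rmorphM zz mulr0 subr0 rmorph_nat.
    by rewrite expf_neq0 // !mulf_neq0 ?two_n0.
(* Otherwise the vanishing of [ndet] would exhibit [d] as the square of a quotient. *)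
have a0 : chi i (f u.2 u.2) = 0.
  apply/eqP; apply: contrapT => /negP a0; apply: nsq.
  have [t tE] := res_surj res (chi i (f u.1 u.2) / chi i (f u.2 u.2)).
  exists t; rewrite tE expr_div_n; apply: (canRL (mulfK _)); first by rewrite expf_neq0.
  by apply/eqP; rewrite -subr_eq0 -!rmorphXn -rmorphM -rmorphB; apply/eqP.
have uu1 : chi i (f u.1 u.1) = 0 by rewrite uE rmorphM a0 mulr0.
have [E1|E1] := eqVneq (chi i (f u.1 w.1)) 0; last first.
  by apply: (isotropic _ w.1) E1 => //; rewrite -[in RHS]pw.
have [E2|E2] := eqVneq (chi i (f u.2 w.2)) 0; last first.
  by apply: (isotropic _ w.2) E2 => //; rewrite -[in RHS]pw.
have := congr1 (chi i) uw; rewrite /F rmorphD rmorphM E1 E2 mulr0 addr0 ei => /eqP.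
by rewrite eq_sym oner_eq0.
Qed.

End Local.

(* The plane spanned by [x, y] with the operator exchanging [y] to [x] and [x] to [d y]. *)
Section GenericPlane.
Variables (x y : V) (v : R).
Let a := f y y.
Let c := f x y.
Hypotheses (xx : f x x = d * a) (vD : (d * a ^+ 2 - c ^+ 2) * v = e).
Hypotheses (ex : e *: x = x) (ey : e *: y = y).

(** The coefficients come from Cramer's rule, [v] inverting the Gram determinant of [x] and [y]. *)
Definition gplane (z : V) : V :=
  (v * (a * f x z - c * f y z)) *: x + (v * (d * a * f y z - c * f x z)) *: y.
Definition gplane_op (z : V) : V :=
  (v * (d * a * f y z - c * f x z)) *: x + (d * v * (a * f x z - c * f y z)) *: y.

Lemma gplane_opA z z' : f (gplane_op z) z' = f z (gplane_op z').
Proof. by rewrite /gplane_op !(fE Vf) !(fC Vf z); ring. Qed.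

Lemma gplaneA z z' : f (gplane z) z' = f z (gplane z').
Proof. by rewrite /gplane !(fE Vf) !(fC Vf z); ring. Qed.

Lemma gplane_x : gplane x = x.
Proof.
rewrite /gplane xx (fC Vf y x) -/c -[RHS]ex -vD.
have -> : v * (d * a * c - c * (d * a)) = 0 by ring.
by rewrite scale0r addr0; congr (_ *: _); ring.
Qed.

Lemma gplane_y : gplane y = y.
Proof.
rewrite /gplane -/a -/c -[RHS]ey -vD.
have -> : v * (a * c - c * a) = 0 by ring.
by rewrite scale0r add0r; congr (_ *: _); ring.
Qed.

Lemma gplane_op_x : gplane_op x = d *: y.
Proof.
rewrite /gplane_op xx (fC Vf y x) -/c -[in RHS]ey scalerA -vD.
have -> : v * (d * a * c - c * (d * a)) = 0 by ring.
by rewrite scale0r add0r; congr (_ *: _); ring.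
Qed.

Lemma gplane_op_y : gplane_op y = x.
Proof.
rewrite /gplane_op -/a -/c -[RHS]ex -vD.
have -> : d * v * (a * c - c * a) = 0 by ring.
by rewrite scale0r addr0; congr (_ *: _); ring.
Qed.

Lemma gplane_op_gplane z : gplane_op (gplane z) = gplane_op z.
Proof.
rewrite [X in gplane_op X = _]/gplane !(adj_lin Vf gplane_opA) gplane_op_x gplane_op_y.
by rewrite addrC /gplane_op scalerA; congr (_ + _ *: _); ring.
Qed.

Lemma gplane_op2 z : gplane_op (gplane_op z) = d *: gplane z.
Proof.
rewrite [X in gplane_op X = _]/gplane_op !(adj_lin Vf gplane_opA) gplane_op_x gplane_op_y.
by rewrite addrC /gplane scalerDr !scalerA; congr (_ *: _ + _ *: _); ring.
Qed.

Lemma gplane_eproj : eproj gplane.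
Proof.
split; last first.
  by move=> z; rewrite /gplane scalerDr !scalerA !(mulrC e) -2!(scalerA _ e) ex ey.
split=> [|z]; first exact: gplaneA.
by rewrite [X in gplane X = _]/gplane !(adj_lin Vf gplaneA) gplane_x gplane_y.
Qed.

End GenericPlane.

(** Identifying V * V with V + lam V, the operator is [J] tensored with multiplication by
    lam^{-1}. *)
Lemma norm_form_hyp p J : (forall x y, f (J x) y = f x (J y)) ->
  (forall x, J (J x) = d *: p x) -> (forall x, J (p x) = J x) ->
  is_hyp F (dbl p) (fun z => (J z.2, d' *: J z.1)).
Proof.
move=> Ja J2 Jp; have JZ := adj_lin Vf Ja.
split=> [z z'|z|z].
- by rewrite /F /= !(fE Vf) !Ja; lc (- f z.1 (J z'.2) - f z.2 (J z'.1)) dd'; ring.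
- apply/eqP; rewrite xpair_eqE /= !JZ !J2 !scalerA (mulrC d') dd' !scale1r.
  by rewrite !eqxx.
- by rewrite /dbl /= !Jp.
Qed.

(** In rank at least two a plane stable under an operator with square [d] is found and its double is
    cancelled from the norm form. In rank one the hyperbolicity of <a, -a d> makes [d] a square in
    eR, and [J] is multiplication by a square root. *)
Theorem norm_hyp_sa p : eproj p -> forall s, is_hyp F (dbl p) s ->
  exists J : V -> V, [/\ forall x y, f (J x) y = f x (J y),
    forall x, J (J x) = d *: p x & forall x, J (p x) = J x].
Proof.
move: p; apply: (proj_ind res Vf prim) => p hp IH s hps.
have [p0|/proj_eq0 p0] := pselect (exists x, p x != 0); last first.
  by exists (fun=> 0); rewrite p0; split=> // *; rewrite ?(fE Vf) ?scaler0.
have [x1 [v1 [px1 xv1 ev1]]] := eproj_anisotropic res h2 prim Vf hp p0.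
have ex1 : e *: x1 = x1 by rewrite -px1 hp.2.
have hXp := dbl_eproj hp.
have Xp0 : exists z, dbl p z != 0.
  have [x px] := p0; exists (x, 0); apply: contraNneq px => E.
  by have := congr1 fst E => /= ->.
have [u [w [su sw uw eu ew]]] := hyp_dual_pair res h2 prim XF hps hXp Xp0.
have pu : dbl p u = u by rewrite -su (hyp_ps hps).
have pw : dbl p w = w by rewrite -[w]opprK -sw (proj_lin XF hXp.1) (hyp_ps hps).
have uu := hyp_isoL h2 hps su su; have ww := hyp_isoM h2 XF hps sw sw.
have hl := line_eproj Vf xv1 ex1.
have pl z : p (line (f := f) v1 x1 z) = line (f := f) v1 x1 z by rewrite /line (proj_lin Vf hp.1) px1.
have hp1 := eproj_sub Vf hp hl pl.
have [p1|/proj_eq0 p1] := pselect (exists x, p x - line (f := f) v1 x1 x != 0); last first.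
  have pE x : p x = line (f := f) v1 x1 x.
    by have := congr1 (fun u => u x) p1 => /subr0_eq.
  have xE (z : V * V) : dbl p z = z ->
      z.1 = (v1 * f x1 z.1) *: x1 /\ z.2 = (v1 * f x1 z.2) *: x1.
    move=> pz; have e1 := congr1 fst pz; have e2 := congr1 snd pz.
    by split; [rewrite -{1}e1|rewrite -{1}e2]; exact: pE.
  have [u1 u2] := xE u pu; have [w1 w2] := xE w pw.
  move: uu uw ww; rewrite /F u1 u2 w1 w2 !(fE Vf).
  set P := v1 * f x1 u.1; set r := v1 * f x1 u.2.
  set P' := v1 * f x1 w.1; set r' := v1 * f x1 w.2; set al := f x1 x1 => uu uw ww.
  (* Comparing the Gram determinant of the hyperbolic pair [u], [w] with that of diag(al, - al d)
     gives d (al D)^2 = e, where D is the determinant of their coordinates; hence al d D is a square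
     root of d e. *)
  pose k := al * d * (r * P' - r' * P).
  have X2 : e * e = - 2%:R * al * d * r * r' * e.
    lc (- (al * (P * P' - d * r * r') + e + 2%:R * al * d * r * r')) uw.
    by lc (al * P' ^+ 2) uu; lc (al * d * r ^+ 2) ww; ring.
  have kk : k * k = d * e.
    have k2 : k * k = - 2%:R * al * d ^+ 2 * r * r' * e.
      rewrite /k; lc (- 2%:R * al * d ^+ 2 * r * r') uw.
      by lc (al * d ^+ 2 * r' ^+ 2) uu; lc (al * d ^+ 2 * r ^+ 2) ww; ring.
    by rewrite k2 -{2}ee X2; ring.
  exists (fun x => k *: p x); split=> [z z'|z|z].
  - by rewrite !(fE Vf) hp.1.1.
  - by rewrite (proj_lin Vf hp.1) hp.1.2 scalerA kk -scalerA hp.2.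
  - by rewrite hp.1.2.
have [x2 [v2 [px2 xv2 ev2]]] := eproj_anisotropic res h2 prim Vf hp1 p1.
have x12 : f x1 x2 = 0.
  rewrite -px2 (fDr Vf) (fNr Vf) -hp.1.1 -hl.1.1 px1 /line (mulrC v1) xv1 ex1.
  by rewrite subrr.
have ppx2 : p x2 = x2 by rewrite -{1}px2 (proj_lin Vf hp.1) (proj_lin Vf hp.1) hp.1.2 pl.
have unit_res i x v : chi i e = 1 -> f x x * v = e -> chi i (f x x) != 0.
  move=> ei xv; have := congr1 (chi i) xv; rewrite rmorphM ei; apply: contra_eq_neq => ->.
  by rewrite mul0r eq_sym oner_eq0.
have [g [x_ [pg gg gQ]]] : exists g x_, [/\ dbl p g = g, F g g = 0 & forall i, chi i e = 1 ->
    chi i (ndet (x_ i)) != 0 /\ forall z, chi i (F g z) = chi i (F (x_ i) z)].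
  apply: (isotropic_lift res h2 prim XF (Q := fun i x => chi i (ndet x) != 0) hps hXp) => i.
  have [ei|ei] := pselect (chi i e = 1); last by exists 0, 0 => /ei.
  have [x [px Dx xx [y xy]]] := @dbl_local p s i hps hp ei x1 x2 u w px1 ppx2 x12
     (unit_res _ _ _ ei xv1) (unit_res _ _ _ ei xv2) pu pw uu uw.
  by exists x, y; rewrite px.
case: g pg gg gQ => x y pg gg gQ.
have [px py] : p x = x /\ p y = y by have := pg; rewrite /dbl /= => -[-> ->].
have xx : f x x = d * f y y by lc 1 gg; rewrite /F /=; ring.
have [i ei|v v1D v2D] := res_eunit res (u := d * f y y ^+ 2 - f x y ^+ 2) ee.
  have [D0 gE] := gQ i ei.
  have E1 z : chi i (f x z) = chi i (f (x_ i).1 z).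
    by have := gE (z, 0); rewrite /F /= !(f0r Vf) !mulr0 !addr0.
  have E2 z : chi i (f y z) = chi i (f (x_ i).2 z).
    have := gE (0, z); rewrite /F /= !(f0r Vf) !add0r !rmorphM => /mulfI; apply.
    by rewrite rmorphN oppr_eq0 (chid dd').
  suff -> : chi i (d * f y y ^+ 2 - f x y ^+ 2) = chi i (ndet (x_ i)) by [].
  rewrite /ndet !rmorphB !(rmorphM _ d) !rmorphXn E1 E2 (fC Vf (x_ i).2) E2.
  by rewrite (fC Vf (x_ i).1) E2 (fC Vf (x_ i).1).
have ex : e *: x = x by rewrite -px hp.2.
have ey : e *: y = y by rewrite -py hp.2.
have hH := gplane_eproj xx v1D ex ey.
have JA := gplane_opA x y v.
have J2 := gplane_op2 xx v1D ex ey; have JH := gplane_op_gplane xx v1D ex ey.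
have hXH := norm_form_hyp JA J2 JH.
have pH z : p (gplane x y v z) = gplane x y v z.
  by rewrite /gplane !(proj_lin Vf hp.1) px py.
have XpH z : dbl p (dbl (gplane x y v) z) = dbl (gplane x y v) z by rewrite /dbl /= !pH.
have [s' hs'] := hyp_cancel res h2 prim XF hps hXp hXH (dbl_eproj hH) XpH.
have hp' := eproj_sub Vf hp hH pH.
have {}hs' : is_hyp F (dbl (fun z => p z - gplane x y v z)) s' by [].
have [||J' [J'a J'2 J'p]] := IH _ hp' _ _ s' hs'.
- by move=> z; rewrite (proj_lin Vf hp.1) (proj_lin Vf hp.1) pH hp.1.2.
- exists y; rewrite py gplane_y // subrr; apply: contraTneq isT => y0; case: prim => _ /eqP e0 _.
  by case: e0; rewrite -v1D y0 !(fE Vf) expr2 !(mulr0, mul0r) subrr mul0r.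
have Hp z : gplane x y v (p z) = gplane x y v z by exact: (proj_comm Vf hp.1 hH.1 pH).
have JHZ := adj_lin Vf JA; have J'Z := adj_lin Vf J'a; have HZ := adj_lin Vf hH.1.1.
have J'H z : J' (gplane x y v z) = 0.
  by rewrite -J'p pH hH.1.2 subrr J'Z.
have HJ' z : gplane x y v (J' z) = 0.
  by apply: (fext Vf) => z'; rewrite hH.1.1 J'a J'H (f0l Vf) (f0r Vf).
have JJ' z : gplane_op x y v (J' z) = 0 by rewrite -JH HJ' JHZ.
have HJ z : gplane x y v (gplane_op x y v z) = gplane_op x y v z.
  by apply: (fext Vf) => z'; rewrite hH.1.1 !JA JH.
have J'J z : J' (gplane_op x y v z) = 0 by rewrite -HJ J'H.
exists (fun z => gplane_op x y v z + J' z); split=> [z z'|z|z].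
- by rewrite (fDl Vf) (fDr Vf) JA J'a.
- by rewrite JHZ J'Z J2 JJ' J'J J'2 addr0 add0r scalerBr addrC subrK.
- rewrite -[in LHS](JH (p z)) Hp JH; congr (_ + _).
  by rewrite -[RHS]J'p J'Z [J' (- _)]J'Z J'H subr0.
Qed.
End Doubled.

(** * Base changes that become hyperbolic *)

(** A hyperbolic plane does not contain three pairwise orthogonal anisotropic vectors. *)
Lemma rank_two_det (K : fieldType) (u1 u2 u3 w1 w2 w3 : K) : (2%:R : K) != 0 ->
  u1 * w2 + w1 * u2 = 0 -> u1 * w3 + w1 * u3 = 0 -> u2 * w3 + w2 * u3 = 0 ->
  u1 * w1 != 0 -> u2 * w2 != 0 -> u3 * w3 != 0 -> False.
Proof.
move=> two0 H12 H13 H23 n1 n2 n3.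
have H : 2%:R * (u1 * w1) * (u2 * w2) * (u3 * w3) = 0.
  lc (u2 * w3 * (w1 * u3)) H12; lc (- (w1 * u2) * (w1 * u3)) H23.
  by lc (w1 * u2 * (w2 * u3)) H13; ring.
have /eqP := mulf_neq0 (mulf_neq0 (mulf_neq0 two0 n1) n2) n3; exact.
Qed.

Section Local.
Context {R : comNzRingType} {K : fieldType} (ch : {rmorphism R -> K}).
Hypothesis ch_surj : forall y, exists x, ch x = y.
Variable h : R.
Hypothesis h2 : h * 2%:R = 1.
Context {V : lmodType R} {f : V -> V -> R}.
Hypothesis Vf : sym_space f.
Variables (d : R) (p s0 s1 : V -> V).
Hypothesis hp : is_proj f p.
Hypotheses (s0S : forall x y, f (s0 x) y = - f x (s0 y)) (s1S : forall x y, f (s1 x) y = - f x (s1 y)).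
Hypotheses (s0p : forall x, s0 (p x) = s0 x) (s1p : forall x, s1 (p x) = s1 x).

Local Notation b x y := (ch (f x y)).

(** This is the degenerate case of the application, where s = s0 + lam s1 on V + lam V. The
    Lagrangian s = 1 is spanned by the vectors v + s v and their multiples by lam, whose imaginary
    parts are s1 v and v + s0 v; the three hypotheses say that these imaginary parts form a totally
    isotropic space at the residue field. *)
Hypothesis N11 : forall v v', b (s1 v) (s1 v') = 0.
Hypothesis N10 : forall v v', p v' = v' -> b (s1 v) (v' + s0 v') = 0.
Hypothesis N00 : forall v v', p v = v -> p v' = v' -> b (v + s0 v) (v' + s0 v') = 0.

Lemma two0 : (2%:R : K) != 0.
Proof.
apply/eqP => E; have := congr1 ch h2.
by rewrite rmorphM rmorph1 rmorph_nat E mulr0 => /eqP; rewrite eq_sym oner_eq0.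
Qed.

Let chh : ch h * 2%:R = 1.
Proof. by rewrite -(rmorph_nat ch) -rmorphM h2 rmorph1. Qed.

Let skew_lin (u : V -> V) (uS : forall x y, f (u x) y = - f x (u y)) :
  (forall x y, u (x + y) = u x + u y) * (forall a x, u (a *: x) = a *: u x) *
  (forall x, u (- x) = - u x) * (u 0 = 0).
Proof. by apply: (adj_lin Vf (w := fun x => - u x)) => x y; rewrite uS (fNr Vf). Qed.

Lemma bs0s0 v v' : p v = v -> p v' = v' -> b (s0 v) (s0 v') = - b v v'.
Proof.
move=> pv pv'; have := N00 pv pv'; rewrite !(fE Vf) !rmorphD s0S rmorphN => E.
by apply: subr0_eq; rewrite opprK -[RHS]E; ring.
Qed.

Lemma ps0 x : p (s0 x) = s0 x.
Proof. by apply: (fext Vf) => z; rewrite hp.1 !s0S s0p. Qed.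

Lemma ps1 x : p (s1 x) = s1 x.
Proof. by apply: (fext Vf) => z; rewrite hp.1 !s1S s1p. Qed.

(** Eigenvectors of [s0] at the residue field, tested against the form. By [bs0s0] the operator [s0]
    squares to the identity there, so it has the two eigenspaces 1 and -1. *)
Definition eigen (c : K) (x : V) : Prop := p x = x /\ forall y, b y (s0 x) = c * b y x.

Lemma eigen1 v : p v = v -> eigen 1 (v + s0 v).
Proof.
move=> pv; split; first by rewrite (proj_lin Vf hp) pv ps0.
move=> y; rewrite mul1r (skew_lin s0S) !(fDr Vf) !rmorphD addrC; congr (_ + _).
have -> : f y (s0 (s0 v)) = - f (s0 (p y)) (s0 v) by rewrite s0p s0S opprK.
by rewrite rmorphN bs0s0 ?hp.2 // opprK hp.1 pv.
Qed.

Lemma eigenN1 v : p v = v -> eigen (-1) (v - s0 v).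
Proof.
move=> pv; split; first by rewrite !(proj_lin Vf hp) pv ps0.
move=> y; rewrite mulN1r !(skew_lin s0S) !(fE Vf) rmorphB rmorphB opprB; congr (_ - _).
have -> : f y (s0 (s0 v)) = - f (s0 (p y)) (s0 v) by rewrite s0p s0S opprK.
by rewrite rmorphN bs0s0 ?hp.2 // opprK hp.1 pv.
Qed.

Lemma eigenZ c a x : eigen c x -> eigen c (a *: x).
Proof.
move=> [px xE]; split; first by rewrite (proj_lin Vf hp) px.
by move=> y; rewrite (skew_lin s0S) !(fZr Vf) !rmorphM xE; ring.
Qed.

Lemma eigen_iso c x y : c != 0 -> eigen c x -> eigen c y -> b x y = 0.
Proof.
move=> c0 [px xE] [py yE].
have E1 := yE x; have := xE y; rewrite (fC Vf y (s0 x)) s0S rmorphN E1 (fC Vf y x) => /eqP.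
rewrite eq_sym -subr_eq0 opprK -mulr2n -mulr_natl !mulf_eq0 (negPf two0) (negPf c0) /=.
by move/eqP.
Qed.

Lemma s1_eigen1 x y : eigen 1 x -> b x (s1 y) = 0.
Proof.
move=> [px xE]; have := N10 y px; rewrite !(fE Vf) rmorphD xE mul1r (fC Vf _ x).
by rewrite -mulr2n -mulr_natl => /eqP; rewrite mulf_eq0 (negPf two0) => /eqP.
Qed.

(** From two orthogonal hyperbolic pairs one takes X1 + t d Z1 and X2 - t Z2, which are orthogonal
    with values 2 t d and - 2 t, and then adds corrections by [s1]. *)
Lemma isotropic_of_eigen X1 X2 Z1 Z2 : eigen 1 X1 -> eigen 1 X2 -> eigen (-1) Z1 -> eigen (-1) Z2 ->
  b X1 Z1 = 1 -> b X2 Z2 = 1 -> b X1 Z2 = 0 -> b X2 Z1 = 0 ->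
  exists x y z, [/\ p x = x /\ p y = y, b x x + ch d * b y y = 0, b x y = 0, b y y != 0 &
    p z = z /\
    ch (f x (z - s0 z) - d * f y (s1 z)) ^+ 2 - ch d * ch (f y (z - s0 z) - f x (s1 z)) ^+ 2 != 0].
Proof.
move=> EX1 EX2 EZ1 EZ2 B11 B22 B12 B21.
have n1 : (1 : K) != 0 by exact: oner_neq0.
have m1 : (-1 : K) != 0 by rewrite oppr_eq0.
have X11 := eigen_iso n1 EX1 EX1; have X12 := eigen_iso n1 EX1 EX2.
have X22 := eigen_iso n1 EX2 EX2.
have Z11 := eigen_iso m1 EZ1 EZ1; have Z12 := eigen_iso m1 EZ1 EZ2.
have Z22 := eigen_iso m1 EZ2 EZ2.
have XS1 y := s1_eigen1 y EX1; have XS2 y := s1_eigen1 y EX2.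
have s1self z : b z (s1 z) = 0.
  by rewrite (eqN0 h2 (x := f z (s1 z))) ?rmorph0 // -s1S (fC Vf).
pose k := b (s1 Z1) Z2.
have k1 : b Z1 (s1 Z2) = - k by rewrite /k s1S rmorphN opprK.
have k2 : b Z2 (s1 Z1) = k by rewrite /k (fC Vf).
(* The terms in [s1] are chosen so that the two quantities in the final norm, evaluated at Z1,
   become exactly 2 and 0, whatever the value of [k]. *)
pose x t := X1 + (t * d) *: Z1 + (h * t * d) *: s1 Z2.
pose y t := X2 - (h * t * d) *: s1 Z1 - t *: Z2.
have XZ (X Z : V) : b Z X = b X Z by rewrite (fC Vf).
have xx t : b (x t) (x t) = 2%:R * ch t * ch d - ch t ^+ 2 * ch d ^+ 2 * k.
  rewrite /x !(fE Vf) !(rmorphD, rmorphM) (XZ X1 Z1) (XZ X1 (s1 Z2)).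
  rewrite (XZ Z1 (s1 Z2)) X11 Z11 B11 XS1 k1 N11.
  by lc (- ch t ^+ 2 * ch d ^+ 2 * k) chh; ring.
have yy t : b (y t) (y t) = - (2%:R * ch t) + ch t ^+ 2 * ch d * k.
  rewrite /y !(fE Vf) !(rmorphD, rmorphN, rmorphM) (XZ X2 Z2) (XZ X2 (s1 Z1)).
  rewrite (XZ Z2 (s1 Z1)) k2 X22 Z22 B22 XS2 N11.
  by lc (ch t ^+ 2 * ch d * k) chh; ring.
have xy t : b (x t) (y t) = 0.
  rewrite /x /y !(fE Vf) !(rmorphD, rmorphN, rmorphM) X12 XS1 B12 (XZ X2 Z1) B21 Z12.
  by rewrite (XZ X2 (s1 Z2)) XS2 (XZ Z2 (s1 Z2)) !s1self N11; ring.
have px t : p (x t) = x t.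
  by rewrite /x !(proj_lin Vf hp) ps1 EX1.1 EZ1.1.
have py t : p (y t) = y t.
  by rewrite /y -!scaleNr !(proj_lin Vf hp) ps1 EX2.1 EZ2.1.
have last t : ch (f (x t) (Z1 - s0 Z1) - d * f (y t) (s1 Z1)) ^+ 2
    - ch d * ch (f (y t) (Z1 - s0 Z1) - f (x t) (s1 Z1)) ^+ 2 != 0.
  have E1 u : ch (f u (Z1 - s0 Z1)) = 2%:R * b u Z1.
    by rewrite (fDr Vf) (fNr Vf) rmorphB EZ1.2; ring.
  have -> : ch (f (x t) (Z1 - s0 Z1) - d * f (y t) (s1 Z1)) = 2%:R.
    rewrite rmorphB rmorphM E1 /x /y !(fE Vf) !(rmorphD, rmorphN, rmorphM) B11 Z11.
    rewrite (XZ Z1 (s1 Z2)) k1 XS2 N11 k2.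
    by lc (- ch t * ch d * k) chh; ring.
  have -> : ch (f (y t) (Z1 - s0 Z1) - f (x t) (s1 Z1)) = 0.
    rewrite rmorphB E1 /x /y !(fE Vf) !(rmorphD, rmorphN, rmorphM) B21 (XZ Z1 (s1 Z1)) !s1self.
    by rewrite (XZ Z1 Z2) Z12 XS1 N11; ring.
  by rewrite expr0n mulr0 subr0 expf_neq0 // two0.
(* The values of f(y, y) at t = 1 and t = -1 differ by 4, so they do not both vanish. *)
have [y1|y1] := eqVneq (b (y 1) (y 1)) 0; last first.
  exists (x 1), (y 1), Z1; split=> //; first by rewrite xx yy; ring.
  by split=> //; exact: EZ1.1.
exists (x (-1)), (y (-1)), Z1; split=> //; first by rewrite xx yy; ring.
  apply/eqP => ym1; have : (2%:R * 2%:R : K) = 0.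
    lc (-1) y1; lc 1 ym1; rewrite !yy rmorphN rmorph1; ring.
  by move/eqP; rewrite mulf_eq0 (negPf two0).
by split=> //; exact: EZ1.1.
Qed.

(** The pairings of y + s0 y with z - s0 z and of z + s0 z with y - s0 y add up to 4 f(y, z), so one
    of them is nonzero. The last clause records that eigenvectors orthogonal to [y] and [z] are
    orthogonal to the new pair. *)
Lemma eigen_pair_ex y z : p y = y -> p z = z -> b y z != 0 ->
  exists X Z, [/\ eigen 1 X, eigen (-1) Z, b X Z = 1 &
    forall X1 Z1, eigen 1 X1 -> eigen (-1) Z1 -> b y X1 = 0 -> b y Z1 = 0 ->
      b z X1 = 0 -> b z Z1 = 0 -> b X Z1 = 0 /\ b X1 Z = 0].
Proof.
move=> py pz yz.
have main u v : p u = u -> p v = v -> b (u + s0 u) (v - s0 v) != 0 ->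
  exists X Z, [/\ eigen 1 X, eigen (-1) Z, b X Z = 1 &
    forall X1 Z1, eigen 1 X1 -> eigen (-1) Z1 -> b u X1 = 0 -> b u Z1 = 0 ->
      b v X1 = 0 -> b v Z1 = 0 -> b X Z1 = 0 /\ b X1 Z = 0].
  move=> pu pv uv; have [c cE] := ch_surj (b (u + s0 u) (v - s0 v))^-1.
  exists (c *: (u + s0 u)), (v - s0 v); split.
  - exact/eigenZ/eigen1.
  - exact: eigenN1.
  - by rewrite (fZl Vf) rmorphM cE mulVf.
  - move=> X1 Z1 EX1 EZ1 uX1 uZ1 vX1 vZ1.
    rewrite !(fE Vf) !(rmorphM, rmorphD, rmorphN) s0S rmorphN EZ1.2 uZ1.
    rewrite (fC Vf X1 v) vX1 -[f X1 (s0 v)]opprK -s0S (fC Vf (s0 X1)) rmorphN EX1.2 vX1.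
    by split; ring.
have [E|E] := eqVneq (b (y + s0 y) (z - s0 z)) 0; last by exact: main.
have [|X [Z [EX EZ XZ H]]] := main z y pz py.
  apply: contraNneq yz => E'; apply/eqP.
  have : 2%:R * 2%:R * b y z = 0.
    have zy : b (s0 z) (s0 y) = - b y z by rewrite bs0s0 // (fC Vf).
    move: E E'; rewrite !(fE Vf) !(rmorphD, rmorphN) zy bs0s0 // !s0S !rmorphN (fC Vf z y).
    by move=> E E'; lc 1 E; lc 1 E'; rewrite -[f z (s0 y)]opprK -s0S (fC Vf (s0 z)) rmorphN; ring.
  by move/eqP; rewrite !mulf_eq0 (negPf two0) => /eqP.
by exists X, Z; split=> // *; apply: H.
Qed.

(** The three vectors ensure that the orthogonal of a first hyperbolic pair of eigenvectors is
    nonzero: otherwise the form would be that of a hyperbolic plane, against [rank_two_det]. A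
    second pair is found in this orthogonal. *)
Lemma local_isotropic x1 x2 x3 : p x1 = x1 -> p x2 = x2 -> p x3 = x3 ->
  b x1 x1 != 0 -> b x2 x2 != 0 -> b x3 x3 != 0 -> b x1 x2 = 0 -> b x1 x3 = 0 -> b x2 x3 = 0 ->
  exists x y z, [/\ p x = x /\ p y = y, b x x + ch d * b y y = 0, b x y = 0, b y y != 0 &
    p z = z /\
    ch (f x (z - s0 z) - d * f y (s1 z)) ^+ 2 - ch d * ch (f y (z - s0 z) - f x (s1 z)) ^+ 2 != 0].
Proof.
move=> px1 px2 px3 n1 n2 n3 x12 x13 x23.
have [X1 [Z1 [EX1 EZ1 XZ1 _]]] := eigen_pair_ex px1 px1 n1.
have X11 := eigen_iso (oner_neq0 _) EX1 EX1.
have Z11 : b Z1 Z1 = 0 by apply: (eigen_iso _ EZ1 EZ1); rewrite oppr_eq0 oner_neq0.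
have [o oE] : exists o, forall x, o x = x - f x Z1 *: X1 - f x X1 *: Z1 by eexists.
have po x : p x = x -> p (o x) = o x.
  by move=> px; rewrite oE -!scaleNr !(proj_lin Vf hp) px EX1.1 EZ1.1.
have oX x : b (o x) X1 = 0.
  by rewrite oE !(fE Vf) !(rmorphD, rmorphN, rmorphM) X11 (fC Vf Z1) XZ1; ring.
have oZ x : b (o x) Z1 = 0.
  by rewrite oE !(fE Vf) !(rmorphD, rmorphN, rmorphM) Z11 XZ1; ring.
have ofE x y : b (o x) (o y) = b x y - (b x Z1 * b y X1 + b x X1 * b y Z1).
  rewrite {1}(oE y) !(fE Vf) !(rmorphD, rmorphN, rmorphM) oX oZ.
  rewrite oE !(fE Vf) !(rmorphD, rmorphN, rmorphM) (fC Vf X1 y) (fC Vf Z1 y); ring.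
have [x [y [px py xy]]] : exists x y, [/\ p x = x, p y = y & b (o x) (o y) != 0].
  apply: contrapT => no.
  have o0 x y : p x = x -> p y = y -> b x y = b x Z1 * b y X1 + b x X1 * b y Z1.
    move=> px py; apply/eqP; rewrite -subr_eq0 -ofE; apply/eqP; apply: contrapT => /eqP nxy.
    by apply: no; exists x, y.
  have two x : p x = x -> b x x != 0 -> b x Z1 * b x X1 != 0.
    move=> px; rewrite o0 // => H; apply: contraNneq H => H.
    by rewrite H mulrC H addr0.
  move: x12 x13 x23; rewrite (o0 _ _ px1 px2) (o0 _ _ px1 px3) (o0 _ _ px2 px3) => x12 x13 x23.
  by apply: (rank_two_det two0 x12 x13 x23); exact: two.
have [X2 [Z2 [EX2 EZ2 XZ2 H]]] := eigen_pair_ex (po _ px) (po _ py) xy.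
have [X2Z1 X1Z2] := H X1 Z1 EX1 EZ1 (oX _) (oZ _) (oX _) (oZ _).
exact: (isotropic_of_eigen EX1 EX2 EZ1 EZ2 XZ1 XZ2 X1Z2 X2Z1).
Qed.

End Local.

(** * Quadratic algebras *)

Section QuadraticGenerator.
Context {R : comNzRingType} {T : comAlgType R}.

Record quad_basis (lam : T) (d d' : R) (re im : T -> R) : Prop := {
  qb_unit : d * d' = 1;
  qb_sq : lam * lam = d%:A;
  qb_eq : forall t, t = (re t)%:A + im t *: lam;
  qb_re : forall a b, re (a%:A + b *: lam) = a;
  qb_im : forall a b, im (a%:A + b *: lam) = b }.

Lemma quadratic_generator_basis (lam : T) : quadratic_generator lam ->
  exists d d' re im, quad_basis lam d d' re im.
Proof.
move=> [[d [d' dd'] lam2] bas].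
have bas' t : exists p : R * R, t = p.1%:A + p.2 *: lam by have [p [pE _]] := bas t; exists p.
pose c t := projT1 (cid (bas' t)).
have cE t : t = (c t).1%:A + (c t).2 *: lam := projT2 (cid (bas' t)).
have uniq (p q : R * R) : p.1%:A + p.2 *: lam = q.1%:A + q.2 *: lam -> p = q.
  by move=> E; have [p0 [_ H]] := bas (p.1%:A + p.2 *: lam); rewrite -(H p erefl) -(H q E).
exists d, d', (fun t => (c t).1), (fun t => (c t).2); split=> //.
- by rewrite mulrC.
- by move=> a b; rewrite -(uniq (a, b) _ (cE _)).
- by move=> a b; rewrite -(uniq (a, b) _ (cE _)).
Qed.

Variables (lam : T) (d d' : R) (re im : T -> R).
Hypothesis qb : quad_basis lam d d' re im.

Lemma qb_ext s t : re s = re t -> im s = im t -> s = t.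
Proof. by move=> E E'; rewrite (qb_eq qb s) (qb_eq qb t) E E'. Qed.

Lemma qb_reim_eq (t : T) (a b : R) : t = a%:A + b *: lam -> re t = a /\ im t = b.
Proof. by move=> ->; rewrite (qb_re qb) (qb_im qb). Qed.

Lemma qbD s t : re (s + t) = re s + re t /\ im (s + t) = im s + im t.
Proof.
apply: qb_reim_eq; rewrite {1}(qb_eq qb s) {1}(qb_eq qb t) addrACA.
by rewrite -!scalerDl.
Qed.

Lemma qbZ a t : re (a *: t) = a * re t /\ im (a *: t) = a * im t.
Proof.
by apply: qb_reim_eq; rewrite {1}(qb_eq qb t) scalerDr !scalerA.
Qed.

Lemma qbN t : re (- t) = - re t /\ im (- t) = - im t.
Proof. by have := qbZ (-1) t; rewrite scaleN1r !mulN1r. Qed.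

Lemma qb_alg a : re a%:A = a /\ im a%:A = 0.
Proof. by apply: qb_reim_eq; rewrite scale0r addr0. Qed.

Lemma qb_lam : re lam = 0 /\ im lam = 1.
Proof. by apply: qb_reim_eq; rewrite scale0r add0r scale1r. Qed.

Lemma qbM s t : re (s * t) = re s * re t + d * im s * im t /\
  im (s * t) = re s * im t + im s * re t.
Proof.
apply: qb_reim_eq; rewrite {1}(qb_eq qb s) {1}(qb_eq qb t) mulrDl !mulrDr.
rewrite -!scalerAl !mul1r -!scalerAr !mulr1 (qb_sq qb) !scalerA !scalerDl.
rewrite (mulrC d) -[_ * d * _]mulrA (mulrC d).
by rewrite mulrA addrACA [X in _ + X = _]addrC addrACA; congr (_ + _); rewrite addrC // mulrAC.
Qed.

Lemma qb1 : re 1 = 1 /\ im 1 = 0.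
Proof. by have := qb_alg 1; rewrite scale1r. Qed.

Lemma qb0 : re 0 = 0 /\ im 0 = 0.
Proof. by have := qb_alg 0; rewrite scale0r. Qed.

Definition qbE := ((fun s t => (qbD s t).1), (fun s t => (qbD s t).2),
  (fun s t => (qbM s t).1), (fun s t => (qbM s t).2),
  (fun s t => (qbZ s t).1), (fun s t => (qbZ s t).2),
  (fun t => (qbN t).1), (fun t => (qbN t).2),
  (fun t => (qb_alg t).1), (fun t => (qb_alg t).2), qb_lam.1, qb_lam.2,
  qb1.1, qb1.2, qb0.1, qb0.2).

Definition qconj (t : T) : T := (re t)%:A - im t *: lam.

Lemma qb_alg_trace t : alg_trace T t = 2%:R * re t.
Proof.
pose v (i : 'I_2) : T := if i == 0 then 1 else lam.
have re_lin : scalar re by move=> a x y; rewrite (qbD _ _).1 (qbZ _ _).1.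
have im_lin : scalar im by move=> a x y; rewrite (qbD _ _).2 (qbZ _ _).2.
pose c (i : 'I_2) : {scalar T} := if i == 0 then mk_scalar re_lin else mk_scalar im_lin.
have cs_spec x : x = \sum_(i < 2) c i x *: v i.
  by rewrite big_ord_recl big_ord1 /c /v /= -(qb_eq qb).
have m_lin : linear (fun y : T => t * y) by move=> a x y; rewrite mulrDr scalerAr.
rewrite /alg_trace (mod_traceE (CoordSystem cs_spec) (mk_linear m_lin)) /cs_trace /=.
rewrite big_ord_recl big_ord1 /c /v /= mulr1 !qbE.
by rewrite mulr_natl mulr2n; congr (_ + _); ring.
Qed.

Lemma qb_std_inv t : std_inv T t = qconj t.
Proof.
rewrite /std_inv qb_alg_trace /qconj {2}(qb_eq qb t) opprD addrA -scalerBl.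
by congr (_%:A - _); ring.
Qed.

Lemma std_inv_re t : re (std_inv T t) = re t.
Proof. by rewrite qb_std_inv /qconj !qbE; ring. Qed.

Lemma std_inv_im t : im (std_inv T t) = - im t.
Proof. by rewrite qb_std_inv /qconj !qbE; ring. Qed.

End QuadraticGenerator.

(** The tensor product of [V] with T, presented as V + lam V with coordinates. The abstract form
    covers products of base changes as well. *)
Record ext_mod (R : comNzRingType) (T : comAlgType R) (lam : T) (V : lmodType R)
    (W : lmodType T) (io : V -> W) (vre vim : W -> V) : Prop := {
  em_add : forall x y, io (x + y) = io x + io y;
  em_scale : forall a x, io (a *: x) = a%:A *: io x;
  em_eq : forall w, w = io (vre w) + lam *: io (vim w);
  em_re : forall x y, vre (io x + lam *: io y) = x;
  em_im : forall x y, vim (io x + lam *: io y) = y }.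

Section ExtMod.
Context {R : comNzRingType} {T : comAlgType R} (lam : T) (d d' : R) (re im : T -> R).
Hypothesis qb : quad_basis lam d d' re im.
Context {V : lmodType R} {W : lmodType T} (io : V -> W) (vre vim : W -> V).
Hypothesis em : ext_mod lam io vre vim.

Lemma em_ext w w' : vre w = vre w' -> vim w = vim w' -> w = w'.
Proof. by move=> E E'; rewrite (em_eq em w) (em_eq em w') E E'. Qed.

Lemma em_reim_eq w x y : w = io x + lam *: io y -> vre w = x /\ vim w = y.
Proof. by move=> ->; rewrite (em_re em) (em_im em). Qed.

Lemma emD w w' : vre (w + w') = vre w + vre w' /\ vim (w + w') = vim w + vim w'.
Proof.
apply: em_reim_eq; rewrite {1}(em_eq em w) {1}(em_eq em w') addrACA.
by rewrite -scalerDr -!(em_add em).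
Qed.

Lemma emZ t w : vre (t *: w) = re t *: vre w + (d * im t) *: vim w /\
  vim (t *: w) = re t *: vim w + im t *: vre w.
Proof.
apply: em_reim_eq; rewrite {1}(em_eq em w) {1}(qb_eq qb t) !(em_add em) !(em_scale em).
rewrite !scalerDl !scalerDr !scalerA; rewrite -!addrA; congr (_ + _).
rewrite [LHS]addrC [X in X + _]addrC -addrA; congr (_ + _).
  by rewrite -scalerAl (qb_sq qb) scalerA mulrC.
by rewrite addrC; congr (_ *: _ + _ *: _); rewrite -?scalerAr ?mulr1 // mulrC -scalerAr mulr1.
Qed.

Lemma em_io x : vre (io x) = x /\ vim (io x) = 0.
Proof.
apply: em_reim_eq.
by rewrite -(scale0r (0 : V)) (em_scale em) !scale0r scaler0 addr0.
Qed.

Lemma em0 : vre 0 = 0 /\ vim 0 = 0.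
Proof. by have := emZ 0 0; rewrite scale0r !(qbE qb) mulr0 !scale0r addr0. Qed.

Lemma emN w : vre (- w) = - vre w /\ vim (- w) = - vim w.
Proof.
have := emZ (-1) w; rewrite scaleN1r !(qbE qb) oppr0 mulr0 !scale0r !addr0.
by rewrite !scaleN1r.
Qed.

Lemma emlam w : vre (lam *: w) = d *: vim w /\ vim (lam *: w) = vre w.
Proof. by have := emZ lam w; rewrite !(qbE qb) mulr1 !scale0r !add0r scale1r. Qed.

Definition emE := ((fun s t => (emD s t).1), (fun s t => (emD s t).2),
  (fun t => (emN t).1), (fun t => (emN t).2),
  (fun t => (em_io t).1), (fun t => (em_io t).2), em0.1, em0.2,
  (fun s => (emlam s).1), (fun s => (emlam s).2),
  (fun s t => (emZ s t).1), (fun s t => (emZ s t).2)).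

Definition ext_op (p : V -> V) (w : W) : W := io (p (vre w)) + lam *: io (p (vim w)).

Lemma ext_opE p w : vre (ext_op p w) = p (vre w) /\ vim (ext_op p w) = p (vim w).
Proof. exact: em_reim_eq. Qed.

Section Form.
Variables (f : V -> V -> R) (F : W -> W -> T).
Hypotheses (Vf : sym_space f) (WF : sym_space F).
Hypothesis Fio : forall x y, F (io x) (io y) = (f x y)%:A.

Lemma ext_formE w w' : re (F w w') = f (vre w) (vre w') + d * f (vim w) (vim w') /\
  im (F w w') = f (vre w) (vim w') + f (vim w) (vre w').
Proof.
have -> : F w w' = F (io (vre w) + lam *: io (vim w)) (io (vre w') + lam *: io (vim w')).
  by rewrite -!(em_eq em).
by rewrite !(fE WF) !Fio !(qbE qb); split; ring.
Qed.

(** The restriction of [s] to [V] is s0 + lam s1 with s0 = [hyp_re] and s1 = [hyp_im], both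
    skew-adjoint for [f]. *)
Definition hyp_re (s : W -> W) (v : V) := vre (s (io v)).
Definition hyp_im (s : W -> W) (v : V) := vim (s (io v)).

Section Hyp.
Variables (p : V -> V) (s : W -> W).
Hypotheses (hp : is_proj f p) (hps : is_hyp F (ext_op p) s).
Local Notation s0 := (hyp_re s).
Local Notation s1 := (hyp_im s).

Lemma hyp_io v : s (io v) = io (s0 v) + lam *: io (s1 v).
Proof. exact: (em_eq em). Qed.

Lemma hyp_reimE w : vre (s w) = s0 (vre w) + d *: s1 (vim w) /\
  vim (s w) = s0 (vim w) + s1 (vre w).
Proof.
rewrite [in s w](em_eq em w) !(hyp_lin WF hps) !hyp_io !emE; split.
- by rewrite scaler0 addr0 add0r.
- by rewrite scaler0 add0r addr0 addrC.
Qed.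

Lemma hyp_re_skew x y : f (s0 x) y = - f x (s0 y).
Proof.
have := congr1 re (hyp_skew hps (io x) (io y)).
by rewrite (qbN qb _).1 !(ext_formE _ _).1 !emE !(fE Vf) !mulr0 !addr0.
Qed.

Lemma hyp_im_skew x y : f (s1 x) y = - f x (s1 y).
Proof.
have := congr1 im (hyp_skew hps (io x) (io y)).
by rewrite (qbN qb _).2 !(ext_formE _ _).2 !emE !(fE Vf) !add0r !addr0.
Qed.

Lemma ext_op_io v : ext_op p (io v) = io (p v).
Proof. by apply: em_ext; rewrite ?(ext_opE _ _).1 ?(ext_opE _ _).2 !emE ?(proj_lin Vf hp). Qed.

Lemma hyp_re_p x : s0 (p x) = s0 x.
Proof. by rewrite /hyp_re -ext_op_io (hyp_sp hps). Qed.

Lemma hyp_im_p x : s1 (p x) = s1 x.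
Proof. by rewrite /hyp_im -ext_op_io (hyp_sp hps). Qed.

Lemma hyp_reim_sq v : s0 (s0 v) + d *: s1 (s1 v) = p v /\ s0 (s1 v) + s1 (s0 v) = 0.
Proof.
have E := hyp_sq hps (io v); have [E1 E2] := hyp_reimE (s (io v)).
by rewrite -E1 -E2 E ext_op_io !emE.
Qed.
End Hyp.
End Form.
End ExtMod.

(* [J] makes the image of the projection [p] a hermitian module over [R[X]/(X^2 - d)]. *)
Record is_cplx (A : comNzRingType) (V : lmodType A) (f : V -> V -> A) (d : A) (p J : V -> V) : Prop := {
  cplx_skew : forall x y, f (J x) y = - f x (J y);
  cplx_sq : forall x, J (J x) = d *: p x;
  cplx_sp : forall x, J (p x) = J x }.

Section Cplx.
Context {A : comNzRingType} {V : lmodType A} {f : V -> V -> A}.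
Hypothesis Vf : sym_space f.
Variables (d d' : A).
Hypothesis dd' : d * d' = 1.

Lemma cplx_lin p J : is_cplx f d p J ->
  (forall x y, J (x + y) = J x + J y) * (forall a x, J (a *: x) = a *: J x) *
  (forall x, J (- x) = - J x) * (J 0 = 0).
Proof.
by move=> hJ; apply: (adj_lin Vf (w := fun x => - J x)) => x y; rewrite (cplx_skew hJ) (fNr Vf).
Qed.

Lemma cplx_pE p J : is_cplx f d p J -> forall x, p x = d' *: J (J x).
Proof. by move=> hJ x; rewrite (cplx_sq hJ) scalerA mulrC dd' scale1r. Qed.

Lemma cplx_proj p J : is_cplx f d p J -> is_proj f p.
Proof.
move=> hJ; have pE := cplx_pE hJ; split=> [x y|x].
  by rewrite !pE !(fE Vf) !(cplx_skew hJ) opprK.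
by rewrite (pE (p x)) (cplx_sp hJ) -pE.
Qed.

Lemma cplx0 : is_cplx f d (fun=> 0) (fun=> 0).
Proof. by split=> [x y|x|x]; rewrite ?(fE Vf) ?oppr0 ?scaler0. Qed.

Lemma cplx_pJ p J : is_cplx f d p J -> forall x, p (J x) = J x.
Proof.
move=> hJ x; apply: (fext Vf) => z.
by rewrite (cplx_proj hJ).1 !(cplx_skew hJ) (cplx_sp hJ).
Qed.

Lemma cplx_add p J p' J' : is_cplx f d p J -> is_cplx f d p' J' -> (forall x, p (p' x) = 0) ->
  is_cplx f d (fun x => p x + p' x) (fun x => J x + J' x).
Proof.
move=> hJ hJ' pp'; have pa := (cplx_proj hJ).1; have pa' := (cplx_proj hJ').1.
have p'p x : p' (p x) = 0 by apply: (fext Vf) => z; rewrite pa' pa pp' !(fE Vf).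
have JJ' x : J (J' x) = 0.
  by rewrite -(cplx_sp hJ) -(cplx_pJ hJ') pp' (cplx_lin hJ).
have J'J x : J' (J x) = 0.
  by rewrite -(cplx_sp hJ') -(cplx_pJ hJ) p'p (cplx_lin hJ').
have Jp' x : J (p' x) = 0 by rewrite -(cplx_sp hJ) pp' (cplx_lin hJ).
have J'p x : J' (p x) = 0 by rewrite -(cplx_sp hJ') p'p (cplx_lin hJ').
split=> [x y|x|x].
- by rewrite !(fE Vf) (cplx_skew hJ) (cplx_skew hJ') opprD.
- by rewrite !(cplx_lin hJ) !(cplx_lin hJ') JJ' J'J (cplx_sq hJ) (cplx_sq hJ') addr0 add0r scalerDr.
- by rewrite !(cplx_lin hJ) !(cplx_lin hJ') Jp' J'p (cplx_sp hJ) (cplx_sp hJ') addr0 add0r.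
Qed.
End Cplx.

(** * Splitting a space whose base change is hyperbolic *)

Section Main.
Context {R : comNzRingType} {I : finType} {K : I -> fieldType}.
Context {chi : forall i, {rmorphism R -> K i}}.
Hypothesis res : residue_system chi.
Variable h : R.
Hypothesis h2 : h * 2%:R = 1.
Variable e : R.
Hypothesis prim : primitive_idem e.
Let ee := prim_ee prim.
Let two_n0 i := chi2 (chi := chi) h2 i.
Context {T : comAlgType R} {lam : T} {d d' : R} {re im : T -> R}.
Hypothesis qb : quad_basis lam d d' re im.
Context {V : lmodType R} {W : lmodType T} {io : V -> W} {vre vim : W -> V}.
Hypothesis em : ext_mod lam io vre vim.
Context {f : V -> V -> R} {F : W -> W -> T}.
Hypotheses (Vf : sym_space f) (WF : sym_space F).
Hypothesis Fio : forall x y, F (io x) (io y) = (f x y)%:A.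
Local Notation eproj := (eproj (f := f) e).
Local Notation ext_op := (ext_op lam io vre vim).
Local Notation line := (line (f := f)).
Let dd' := qb_unit qb.

(* The plane spanned by [x] and [y], which is [W]-isotropic at [x + lam y]. *)
Section CplxPlane.
Variables (x y : V) (v : R).
Hypotheses (av : f y y * v = e) (xx : f x x = - d * f y y) (xy : f x y = 0).
Hypotheses (ex : e *: x = x) (ey : e *: y = y) (ev : e * v = v).

Definition cplane (z : V) : V := (v * f y z) *: y - (v * d' * f x z) *: x.
Definition cplane_op (z : V) : V := (v * f y z) *: x - (v * f x z) *: y.

Lemma cplane_op_skew z z' : f (cplane_op z) z' = - f z (cplane_op z').
Proof. by rewrite !(fE Vf) (fC Vf z x) (fC Vf z y); ring. Qed.

Let yx : f y x = 0. Proof. by rewrite (fC Vf). Qed.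

Lemma cplane_op_x : cplane_op x = d *: y.
Proof.
rewrite /cplane_op yx xx mulr0 scale0r add0r -scaleNr -[in RHS]ey scalerA.
by congr (_ *: _); rewrite -av; ring.
Qed.

Lemma cplane_op_y : cplane_op y = x.
Proof. by rewrite /cplane_op xy mulr0 scale0r subr0 mulrC av ex. Qed.

Lemma cplane_cplx : is_cplx f d cplane cplane_op.
Proof.
have lin := adj_lin Vf (w := fun z => - cplane_op z) (u := cplane_op).
have {}lin := lin (fun x y => etrans (cplane_op_skew x y) (esym (fNr Vf x (cplane_op y)))).
have sq z : cplane_op (cplane_op z) = d *: cplane z.
  rewrite [X in cplane_op X = _]/cplane_op !lin cplane_op_x cplane_op_y /cplane.
  rewrite scalerBr !scalerA; congr (_ *: _ - _ *: _); first by ring.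
  by lc (v * f x z) (esym dd'); ring.
have cx : cplane x = x.
  rewrite -[cplane x]scale1r -dd' mulrC -scalerA -sq cplane_op_x lin cplane_op_y scalerA.
  by rewrite mulrC dd' scale1r.
have cy : cplane y = y.
  rewrite -[cplane y]scale1r -dd' mulrC -scalerA -sq cplane_op_y cplane_op_x scalerA.
  by rewrite mulrC dd' scale1r.
split=> [||z]; [exact: cplane_op_skew|exact: sq|].
rewrite [X in cplane_op X = _]/cplane !lin cplane_op_x cplane_op_y /cplane_op scalerA.
by congr (_ - _ *: _); lc (v * f x z) dd'; ring.
Qed.

(** [w'] is the conjugate of [w] scaled so that the two form a hyperbolic pair. Their plane over T
    is therefore defined over R, as the base change of [cplane]. *)
Lemma cplane_ext (w := io x + lam *: io y) (w' := (- (h * v * d'))%:A *: (io x - lam *: io y)) w0 :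
  plane F w w' w0 = ext_op cplane w0.
Proof.
have [wre wim] : vre w = x /\ vim w = y by rewrite (em_re em) (em_im em).
have [w're w'im] : vre w' = - (h * v * d') *: x /\ vim w' = (h * v * d') *: y.
  rewrite /w' !(emE qb em) !(qbE qb).
  by rewrite !(mulr0, mulr1, scale0r, scaler0, addr0, add0r, subr0, scalerN, scaleNr, opprK).
move: (w) (w') wre wim w're w'im => {}w {}w' wre wim w're w'im.
have [F1 F2] := ext_formE qb em WF Fio w w0; have [G1 G2] := ext_formE qb em WF Fio w' w0.
apply: (em_ext em); rewrite ?(ext_opE em _ _).1 ?(ext_opE em _ _).2 /plane !(emE qb em).
  rewrite F1 F2 G1 G2 wre wim w're w'im /cplane.
  apply: (fext Vf) => z; rewrite !(fE Vf).
  lc (- (v * d' * f x (vre w0) * f x z) + d * d' * v * f y (vre w0) * f y z) h2.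
  by lc (v * f y (vre w0) * f y z) dd'; ring.
rewrite F1 F2 G1 G2 wre wim w're w'im /cplane.
apply: (fext Vf) => z; rewrite !(fE Vf).
lc (- (v * d' * f x (vim w0) * f x z) + d * d' * v * f y (vim w0) * f y z) h2.
by lc (v * f y (vim w0) * f y z) dd'; ring.
Qed.

End CplxPlane.

Let hT : h%:A * 2%:R = 1 :> T.
Proof. by rewrite mulr_natr -scaler_nat scalerA mulrC h2 scale1r. Qed.

Section Local.
Variables (p : V -> V) (s : W -> W) (i : I).
Hypotheses (hps : is_hyp F (ext_op p) s) (hp : is_proj f p).
Local Notation s0 := (hyp_re io vre s).
Local Notation s1 := (hyp_im io vim s).
Let hs0 := hyp_re_skew qb em Vf WF Fio hps.
Let hs1 := hyp_im_skew qb em Vf WF Fio hps.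

Let skew0 (u : V -> V) x : (forall x y, f (u x) y = - f x (u y)) -> f x (u x) = 0.
Proof. by move=> uS; apply: (eqN0 h2); rewrite -uS (fC Vf). Qed.

(** The last condition says that the value of [F] at x + lam y and z - s z has nonzero norm at [i].
    A vector of the Lagrangian s = 1 whose imaginary part is anisotropic provides everything; if
    there is none, the imaginary parts form a totally isotropic space and [local_isotropic] takes
    over. *)
Lemma cplx_local x1 x2 x3 : p x1 = x1 -> p x2 = x2 -> p x3 = x3 ->
  chi i (f x1 x1) != 0 -> chi i (f x2 x2) != 0 -> chi i (f x3 x3) != 0 ->
  chi i (f x1 x2) = 0 -> chi i (f x1 x3) = 0 -> chi i (f x2 x3) = 0 ->
  exists x y z, [/\ p x = x /\ p y = y, chi i (f x x) + chi i d * chi i (f y y) = 0,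
    chi i (f x y) = 0, chi i (f y y) != 0 &
    p z = z /\ chi i (f x (z - s0 z) - d * f y (s1 z)) ^+ 2
      - chi i d * chi i (f y (z - s0 z) - f x (s1 z)) ^+ 2 != 0].
Proof.
move=> px1 px2 px3 n1 n2 n3 x12 x13 x23.
have [[l [sl ll]]|nl] := pselect (exists l, s l = l /\ chi i (f (vim l) (vim l)) != 0).
  have pl : ext_op p l = l by rewrite -{1}sl (hyp_ps hps).
  have [E0 E1] := hyp_reimE qb em WF hps l; rewrite sl in E0 E1.
  have Fll : F l l = 0 by exact: (hyp_isoL hT hps).
  have [Fre Fim] := ext_formE qb em WF Fio l l.
  rewrite Fll !(qbE qb) in Fre Fim.
  have xy : f (vre l) (vim l) = 0 by apply: (eqN0 h2); lc (-1) Fim; rewrite (fC Vf (vim l)); ring.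
  have px : p (vre l) = vre l by rewrite -(ext_opE em p l).1 pl.
  have py : p (vim l) = vim l by rewrite -(ext_opE em p l).2 pl.
  exists (vre l), (vim l), (vim l); split=> //.
  - by rewrite -rmorphM -rmorphD -Fre rmorph0.
  - by rewrite xy rmorph0.
  split=> //; move: (vre l) (vim l) E0 E1 Fre xy ll => x y E0 E1 Fre xy ll.
  have -> : f x (y - s0 y) - d * f y (s1 y) = 0.
    rewrite !(fE Vf) (skew0 _ hs1) xy -[f x (s0 y)]opprK -hs0.
    have := congr1 (fun u => f u y) E0; rewrite !(fE Vf) (fC Vf (s1 y)) (skew0 _ hs1) xy => E.
    by lc (-1) E; ring.
  have -> : f y (y - s0 y) - f x (s1 y) = 2%:R * f y y.
    rewrite !(fE Vf) (skew0 _ hs0) -hs1.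
    have := congr1 (fun u => f u y) E1; rewrite !(fE Vf) (fC Vf (s0 y)) (skew0 _ hs0) => E.
    by lc (-1) E; ring.
  rewrite rmorph0 expr0n sub0r oppr_eq0 rmorphM rmorph_nat.
  by rewrite mulf_neq0 ?(chid (chi := chi) dd' i) // expf_neq0 // mulf_neq0 ?two_n0.
(* Polarisation of the absence of an anisotropic imaginary part. *)
have N u u' : s u = u -> s u' = u' -> chi i (f (vim u) (vim u')) = 0.
  move=> su su'.
  have H w : s w = w -> chi i (f (vim w) (vim w)) = 0.
    by move=> sw; apply/eqP; apply: contrapT => /negP ww; apply: nl; exists w.
  have := H (u + u'); rewrite (hyp_lin WF hps) su su' => /(_ erefl).
  rewrite !(emE qb em) !(fE Vf) !rmorphD (H u su) (H u' su') add0r addr0 (fC Vf (vim u')) => E.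
  have /eqP : 2%:R * chi i (f (vim u) (vim u')) = 0 by lc 1 E; ring.
  by rewrite mulf_eq0 (negPf (two_n0 i)) => /eqP.
have sL w : s (ext_op p w + s w) = ext_op p w + s w.
  by rewrite (hyp_lin WF hps) (hyp_sp hps) (hyp_sq hps) addrC.
have im1 v : vim (ext_op p (io v) + s (io v)) = s1 v.
  by rewrite (ext_op_io em Vf hp) !(emE qb em) add0r.
have [sLl imL] : (forall w, s w = w -> s (lam *: w) = lam *: w) /\
    forall v, p v = v -> vim (lam *: (ext_op p (io v) + s (io v))) = v + s0 v.
  split=> [w sw|v pv]; first by rewrite (hyp_lin WF hps) sw.
  by rewrite (ext_op_io em Vf hp) !(emE qb em) pv.
apply: (local_isotropic (res_surj res (i := i)) h2 Vf d hp hs0 hs1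
  (hyp_re_p em Vf hp hps) (hyp_im_p em Vf hp hps) _ _ _ px1 px2 px3) => //.
- by move=> v v'; rewrite -!im1; apply: N.
- by move=> v v' pv'; rewrite -imL // -im1; apply: N => //; apply: sLl.
- by move=> v v' pv pv'; rewrite -!imL //; apply: N => //; apply: sLl.
Qed.

End Local.


Definition cplx_split p := exists p1 p2 J s2, [/\ is_cplx f d p1 J, is_hyp f p2 s2,
  forall x, p x = p1 x + p2 x & forall x, p1 (p2 x) = 0].

Let skew0 (u : V -> V) x : (forall x y, f (u x) y = - f x (u y)) -> f x (u x) = 0.
Proof. by move=> uS; apply: (eqN0 h2); rewrite -uS (fC Vf). Qed.

(** A skew-adjoint operator on a module of rank one is zero, so both components of [s] vanish and so
    does its square [p]. *)
Lemma cplx_rank_one p s x v : is_hyp F (ext_op p) s -> is_proj f p ->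
  f x x * v = e -> p =1 line v x -> p x = x -> x = 0.
Proof.
move=> hps hp xv pE px.
have hs0 := hyp_re_skew qb em Vf WF Fio hps; have hs1 := hyp_im_skew qb em Vf WF Fio hps.
have z u : (forall x y, f (u x) y = - f x (u y)) -> (forall y, u (p y) = u y) -> u x = 0.
  move=> uS up.
  have -> : u x = p (u x) by apply: (fext Vf) => z; rewrite hp.1 !uS up.
  by rewrite pE /line (skew0 _ uS) mulr0 scale0r.
have [E _] := hyp_reim_sq qb em Vf WF hp hps x.
have s0l := adj_lin Vf (fun x y => etrans (hs0 x y) (esym (fNr Vf x _))).
have s1l := adj_lin Vf (fun x y => etrans (hs1 x y) (esym (fNr Vf x _))).
rewrite -px -E (z _ hs0 (hyp_re_p em Vf hp hps)) (z _ hs1 (hyp_im_p em Vf hp hps)).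
by rewrite s0l s1l scaler0 addr0.
Qed.

(** Skew-adjoint operators on a plane are multiples of a single one, so s0^2 and s1^2 are scalars on
    [p]. As s0 and s1 anticommute, one product of their coefficients is zero, and primitivity of [e]
    leaves two cases: s0 is a hyperbolic operator, or d s1 squares to [d]. *)
Lemma cplx_rank_two p s x1 x2 v1 v2 : is_hyp F (ext_op p) s -> eproj p ->
  f x1 x1 * v1 = e -> f x2 x2 * v2 = e -> p x1 = x1 -> p x2 = x2 -> f x1 x2 = 0 ->
  e * v1 = v1 -> e * v2 = v2 ->
  (forall z, p z = line v1 x1 z + line v2 x2 z) -> cplx_split p.
Proof.
move=> hps [hp ep] xv1 xv2 px1 px2 x12 ev1 ev2 pE.
have hs0 := hyp_re_skew qb em Vf WF Fio hps; have hs1 := hyp_im_skew qb em Vf WF Fio hps.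
have s0p := hyp_re_p em Vf hp hps; have s1p := hyp_im_p em Vf hp hps.
have Esq := hyp_reim_sq qb em Vf WF hp hps.
move: (hyp_re io vre s) (hyp_im io vim s) hs0 hs1 s0p s1p Esq => s0 s1 hs0 hs1 s0p s1p Esq.
have s0l := adj_lin Vf (fun x y => etrans (hs0 x y) (esym (fNr Vf x _))).
have s1l := adj_lin Vf (fun x y => etrans (hs1 x y) (esym (fNr Vf x _))).
have H u : (forall x y, f (u x) y = - f x (u y)) -> (forall y, u (p y) = u y) ->
  u x1 = (v2 * f x2 (u x1)) *: x2 /\ u x2 = - (v1 * f x2 (u x1)) *: x1.
  move=> uS up.
  have pu z : u z = p (u z) by apply: (fext Vf) => y; rewrite hp.1 !uS up.
  split; rewrite {1}pu pE /line (skew0 _ uS) mulr0 scale0r ?add0r ?addr0 //.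
  by rewrite -[f x1 _]opprK -uS (fC Vf (u x1)) mulrN.
have [E01 E02] := H _ hs0 s0p; have [E11 E12] := H _ hs1 s1p.
move: (f x2 (s0 x1)) (f x2 (s1 x1)) E01 E02 E11 E12 => t0 t1 E01 E02 E11 E12.
have ex1 : e *: x1 = x1 by rewrite -px1 ep.
have c00 z : s0 (s0 z) = (- (v1 * v2 * t0 ^+ 2)) *: p z.
  rewrite -[s0 z]s0p !pE /line !(s0l, E01, E02, scalerA, scalerDr).
  by congr (_ *: _ + _ *: _); ring.
have c11 z : s1 (s1 z) = (- (v1 * v2 * t1 ^+ 2)) *: p z.
  rewrite -[s1 z]s1p !pE /line !(s1l, E11, E12, scalerA, scalerDr).
  by congr (_ *: _ + _ *: _); ring.
have S1 : - (v1 * v2 * (t0 ^+ 2 + d * t1 ^+ 2)) = e.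
  have [E _] := Esq x1; move: E; rewrite c00 c11 px1 scalerA -scalerDl => E.
  have := congr1 (fun u => v1 * f x1 u) E; rewrite !(fE Vf) (mulrC v1 (f x1 x1)) xv1 => <-.
  by lc ((v2 * (t0 ^+ 2 + d * t1 ^+ 2))) ev1; lc (v1 * v2 * (t0 ^+ 2 + d * t1 ^+ 2)) xv1; ring.
have S2 : v1 * v2 * t0 * t1 = 0.
  have [_ E] := Esq x1; move: E; rewrite E01 E11 s0l s1l E02 E12 !scalerA -scalerDl => E.
  have := congr1 (fun u => v1 * f x1 u) E; rewrite !(fE Vf) mulr0 => {}E.
  apply: (eqN0 h2).
  by lc (-1) E; lc (- 2%:R * v2 * t0 * t1) ev1; lc (- 2%:R * v1 * v2 * t0 * t1) xv1; ring.
(* The scalar by which s0^2 acts. By [S1] and [S2] it is an idempotent below [e]. *)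
pose io0 := - (v1 * v2 * t0 ^+ 2).
have eio : io0 * e = io0 by rewrite /io0; lc (- v2 * t0 ^+ 2) ev1; ring.
have ioio : io0 * io0 = io0.
  rewrite -[RHS]eio -S1 /io0; lc (- v1 * v2 * t0 * t1 * d) S2; ring.
have [_ _ /(_ _ ioio eio)] := prim; case=> io0E.
  exists p, (fun=> 0), (fun x => d *: s1 x), (fun=> 0); split=> [||x|x]; last 1 first.
  - by rewrite (proj_lin Vf hp).
  - split=> [x y|x|x]; last by rewrite s1p.
      by rewrite !(fE Vf) hs1 mulrN.
    have c11E : d * (- (v1 * v2 * t1 ^+ 2)) = e by rewrite -S1; lc (-1) io0E; rewrite /io0; ring.
    by rewrite s1l c11 !scalerA -mulrA c11E -scalerA ep.
  - exact: (hyp0 Vf).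
  - by rewrite addr0.
exists (fun=> 0), p, (fun=> 0), s0; split=> [||x|x] //; first exact: (cplx0 Vf).
- by split=> // x; rewrite c00 -/io0 io0E ep.
- by rewrite add0r.
Qed.


Lemma ext_op_scale p : (forall x, e *: p x = p x) -> forall w, e%:A *: ext_op p w = ext_op p w.
Proof.
move=> ep w; have [Z1 Z2] := emZ qb em e%:A (ext_op p w).
have [E1 E2] := ext_opE em p w.
apply: (em_ext em); rewrite ?Z1 ?Z2 !(qbE qb) E1 E2 !mulr0 !scale0r !addr0 mulr1 ep //.
Qed.

Lemma qb_invert t v : (re t ^+ 2 - d * im t ^+ 2) * v = e ->
  t * (v%:A * ((re t)%:A - im t *: lam)) = e%:A.
Proof.
move=> tv; apply: (qb_ext qb); rewrite !(qbE qb); first by lc 1 tv; ring.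
ring.
Qed.

(** A cancellation over T. The vector [m] in general position is part of the data, so that
    [hyp_cancel_plane] applies without any residue field of T. *)
Lemma cplx_plane_isotropic x y v : f y y * v = e -> f x x = - d * f y y -> f x y = 0 ->
  e *: x = x -> e *: y = y -> e * v = v ->
  forall p s m, is_hyp F (ext_op p) s -> eproj p -> p x = x -> p y = y -> s m = - m ->
    F (io x + lam *: io y) m = e%:A ->
  exists s', is_hyp F (ext_op (fun z => p z - cplane x y v z)) s'.
Proof.
move=> yv xx xy ex ey ev p s m hps [hp ep] px py sm wm.
have [w wE] : exists w, w = io x + lam *: io y by eexists.
have [w' w'E] : exists w', w' = (- (h * v * d'))%:A *: (io x - lam *: io y) by eexists.
have [wx wy] : vre w = x /\ vim w = y by rewrite wE (em_re em) (em_im em).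
have [wx' wy'] : vre w' = - (h * v * d') *: x /\ vim w' = (h * v * d') *: y.
  rewrite w'E !(emE qb em) !(qbE qb).
  by rewrite !(mulr0, mulr1, scale0r, scaler0, addr0, add0r, subr0, scalerN, scaleNr, opprK).
have yx : f y x = 0 by rewrite (fC Vf).
have Fww : F w w = 0.
  apply: (qb_ext qb); rewrite ?(ext_formE qb em WF Fio _ _).1 ?(ext_formE qb em WF Fio _ _).2.
    by rewrite !(qbE qb) wx wy xx; ring.
  by rewrite !(qbE qb) wx wy xy yx; ring.
have Fw'w' : F w' w' = 0.
  apply: (qb_ext qb); rewrite ?(ext_formE qb em WF Fio _ _).1 ?(ext_formE qb em WF Fio _ _).2.
    by rewrite !(qbE qb) wx' wy' !(fE Vf) xx; ring.
  by rewrite !(qbE qb) wx' wy' !(fE Vf) xy yx; ring.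
have Fww' : F w w' = e%:A.
  apply: (qb_ext qb); rewrite ?(ext_formE qb em WF Fio _ _).1 ?(ext_formE qb em WF Fio _ _).2.
    rewrite !(qbE qb) wx' wy' wx wy !(fE Vf) xx.
    by lc (v * f y y) dd'; lc (d * d' * v * f y y) h2; lc 1 yv; ring.
  by rewrite !(qbE qb) wx' wy' wx wy !(fE Vf) xy yx; ring.
have pw : ext_op p w = w.
  by apply: (em_ext em); rewrite ?(ext_opE em _ _).1 ?(ext_opE em _ _).2 ?wx ?wy.
have pw' : ext_op p w' = w'.
  by apply: (em_ext em); rewrite ?(ext_opE em _ _).1 ?(ext_opE em _ _).2 ?wx' ?wy'
    (proj_lin Vf hp) ?px ?py.
rewrite -wE in wm.
have [s' hs'] := hyp_cancel_plane WF hT hps (ext_op_scale ep) Fww Fw'w' Fww' pw pw' sm wm.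
exists s'; suff -> : ext_op (fun z => p z - cplane x y v z) = fun w0 => ext_op p w0 - plane F w w' w0 by [].
apply/funext => w0; rewrite wE w'E cplane_ext //.
have [E1 E2] := ext_opE em p w0; have [E3 E4] := ext_opE em (cplane x y v) w0.
have [D1 D2] := emD em (ext_op p w0) (- ext_op (cplane x y v) w0).
have [N1 N2] := emN qb em (ext_op (cplane x y v) w0).
have [E5 E6] := ext_opE em (fun z => p z - cplane x y v z) w0.
by apply: (em_ext em); rewrite ?D1 ?D2 ?N1 ?N2 ?E1 ?E2 ?E3 ?E4 ?E5 ?E6.
Qed.

(** The local solutions are lifted to x + lam y, and this vector is made exactly isotropic over T
    with the help of a vector of the Lagrangian s = -1 pairing with it to a unit. *)
Lemma cplx_generic p s x1 x2 x3 : is_hyp F (ext_op p) s -> eproj p ->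
  p x1 = x1 -> p x2 = x2 -> p x3 = x3 ->
  (forall i, chi i e = 1 -> [/\ chi i (f x1 x1) != 0, chi i (f x2 x2) != 0 & chi i (f x3 x3) != 0]) ->
  f x1 x2 = 0 -> f x1 x3 = 0 -> f x2 x3 = 0 ->
  exists x y v, [/\ [/\ f y y * v = e, f x x = - d * f y y & f x y = 0],
    e * v = v, p x = x, p y = y &
    exists s', is_hyp F (ext_op (fun z => p z - cplane x y v z)) s'].
Proof.
move=> hps hep px1 px2 px3 n x12 x13 x23; have [hp ep] := hep.
have hs0 := hyp_re_skew qb em Vf WF Fio hps; have hs1 := hyp_im_skew qb em Vf WF Fio hps.
have s0p := hyp_re_p em Vf hp hps; have s1p := hyp_im_p em Vf hp hps.
have H i : exists t : V * V * V, chi i e = 1 ->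
  [/\ p t.1.1 = t.1.1 /\ p t.1.2 = t.1.2, chi i (f t.1.1 t.1.1) + chi i d * chi i (f t.1.2 t.1.2) = 0,
    chi i (f t.1.1 t.1.2) = 0, chi i (f t.1.2 t.1.2) != 0 &
    p t.2 = t.2 /\ chi i (f t.1.1 (t.2 - hyp_re io vre s t.2) - d * f t.1.2 (hyp_im io vim s t.2)) ^+ 2
      - chi i d * chi i (f t.1.2 (t.2 - hyp_re io vre s t.2) - f t.1.1 (hyp_im io vim s t.2)) ^+ 2 != 0].
  have [ei|ei] := pselect (chi i e = 1); last by exists (0, 0, 0).
  have [n1 n2 n3] := n i ei.
  have [||| x [y [z E]]] := cplx_local hps hp px1 px2 px3 n1 n2 n3; rewrite ?x12 ?x13 ?x23 ?rmorph0 //.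
  by exists (x, y, z).
have [t_ tE] := choice H.
have lift (g : I -> V) : (forall i, chi i e = 1 -> p (g i) = g i) ->
  exists y, p y = y /\ forall i, chi i e = 1 -> forall u, chi i (f y u) = chi i (f (g i) u).
  move=> pg; have [y yE] := vcrt res Vf g; exists (p y); split=> [|i ei u]; first by rewrite hp.2.
  by rewrite hp.1 yE -hp.1 pg.
have [x [px xE]] := lift (fun i => (t_ i).1.1) (fun i ei => let: And5 a _ _ _ _ := tE i ei in a.1).
have [y [py yE]] := lift (fun i => (t_ i).1.2) (fun i ei => let: And5 a _ _ _ _ := tE i ei in a.2).
have [z [pz zE]] := lift (fun i => (t_ i).2) (fun i ei => let: And5 _ _ _ _ a := tE i ei in a.1).
have xx i : chi i e = 1 -> chi i (f x x) + chi i d * chi i (f y y) = 0.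
  move=> ei; have [_ E _ _ _] := tE i ei.
  by rewrite xE // yE // (fC Vf _ x) (fC Vf _ y) xE // yE.
have xy i : chi i e = 1 -> chi i (f x y) = 0.
  move=> ei; have [_ _ E _ _] := tE i ei.
  by rewrite xE // (fC Vf _ y) yE // (fC Vf).
have yy i : chi i e = 1 -> chi i (f y y) != 0.
  by move=> ei; have [_ _ _ E _] := tE i ei; rewrite yE // (fC Vf _ y) yE.
have [m0 m0E] : exists m0, m0 = ext_op p (io z) - s (io z) by eexists.
have sm0 : s m0 = - m0 by rewrite m0E (hyp_sM WF hps).
have pT := proj_lin WF (hyp_proj hps).
have pm0 : ext_op p m0 = m0.
  by rewrite m0E pT.1.1.1 pT.1.2 (hyp_proj hps).2 (hyp_ps hps).
have [w0 w0E] : exists w0, w0 = io x + lam *: io y by eexists.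
have [w0x w0y] : vre w0 = x /\ vim w0 = y by rewrite w0E (em_re em) (em_im em).
have [m0x m0y] : vre m0 = z - hyp_re io vre s z /\ vim m0 = - hyp_im io vim s z.
  by rewrite m0E (ext_op_io em Vf hp) !(emE qb em) pz sub0r.
have [tre tim] := ext_formE qb em WF Fio w0 m0.
rewrite w0x w0y m0x m0y !(fNr Vf) mulrN in tre tim.
(* Invertibility in eT is tested on the norm, an element of R that can be evaluated at the residue
   fields of R. *)
have [v0 tv0 ev0] : exists2 v0, (re (F w0 m0) ^+ 2 - d * im (F w0 m0) ^+ 2) * v0 = e & e * v0 = v0.
  apply: (res_eunit res ee) => i ei; have [_ _ _ _ [_]] := tE i ei; congr (_ != 0).
  have mv (u : V) (g : I -> V) (r : V -> V) : (forall x y, f (r x) y = - f x (r y)) ->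
      (forall u', chi i (f u u') = chi i (f (g i) u')) ->
      chi i (f u (r z)) = chi i (f (g i) (r (t_ i).2)).
    move=> rS gE; rewrite gE -[f (g i) (r z)]opprK -rS (fC Vf _ z) rmorphN zE //.
    by rewrite (fC Vf _ (r _)) rS rmorphN opprK.
  have mv1 (u : V) (g : I -> V) : (forall u', chi i (f u u') = chi i (f (g i) u')) ->
      chi i (f u z) = chi i (f (g i) (t_ i).2).
    by move=> gE; rewrite gE (fC Vf _ z) zE // (fC Vf).
  have X0 := mv x (fun i => (t_ i).1.1) _ hs0 (xE i ei); have X1 := mv x (fun i => (t_ i).1.1) _ hs1 (xE i ei).
  have Y0 := mv y (fun i => (t_ i).1.2) _ hs0 (yE i ei); have Y1 := mv y (fun i => (t_ i).1.2) _ hs1 (yE i ei).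
  have X2 := mv1 x (fun i => (t_ i).1.1) (xE i ei); have Y2 := mv1 y (fun i => (t_ i).1.2) (yE i ei).
  rewrite tre tim !(fE Vf) !(rmorphB, rmorphXn, rmorphM, rmorphD, rmorphN) X0 X1 X2 Y0 Y1 Y2.
  by ring.
have [m mE] : exists m, m = (v0%:A * ((re (F w0 m0))%:A - im (F w0 m0) *: lam)) *: m0 by eexists.
have sm : s m = - m by rewrite mE (hyp_lin WF hps) sm0 scalerN.
have pm : ext_op p m = m by rewrite mE pT.1.1.2 pm0.
have wm : F w0 m = e%:A by rewrite mE (fZr WF) mulrC qb_invert.
have mm : F m m = 0 by exact: (hyp_isoM hT WF hps).
have pw0 : ext_op p w0 = w0.
  by apply: (em_ext em); rewrite ?(ext_opE em _ _).1 ?(ext_opE em _ _).2 ?w0x ?w0y.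
have [q qE] : exists q, q = F w0 w0 by eexists.
have [qre qim] := ext_formE qb em WF Fio w0 w0; rewrite -qE w0x w0y in qre qim.
have eq : e%:A * q = q by rewrite qE -(fZl WF) -pw0 ext_op_scale.
(* The correction has a coefficient [h%:A * q] whose coordinates vanish at the residue fields where
   [e] is 1, so the imaginary part of [w] stays anisotropic. *)
have [w wE] : exists w, w = w0 - (h%:A * q) *: m by eexists.
have pw : ext_op p w = w.
  by rewrite wE pT.1.1.1 pT.1.2 pT.1.1.2 pm pw0.
have ww : F w w = 0.
  rewrite wE !(fE WF) (fC WF m) wm mm -qE.
  by lc (-1) eq; lc (- (e%:A * q)) hT; ring.
have wm1 : F w m = e%:A by rewrite wE !(fE WF) wm mm; ring.
have [ure uim] : (forall i, chi i e = 1 -> chi i (re (h%:A * q)) = 0) /\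
    forall i, chi i e = 1 -> chi i (im (h%:A * q)) = 0.
  rewrite !(qbE qb) qre qim (fC Vf y x); split=> i ei.
    rewrite !mulr0 mul0r addr0 mulr1 rmorphM rmorphD [X in _ * (_ + X)]rmorphM xx ?mulr0 //.
  rewrite mulr0 mul0r addr0 mulr1 rmorphM rmorphD xy // addr0 mulr0 //.
have [px' py'] : p (vre w) = vre w /\ p (vim w) = vim w.
  by rewrite -(ext_opE em p w).1 -(ext_opE em p w).2 pw.
have [wre wim] := ext_formE qb em WF Fio w w; rewrite ww !(qbE qb) in wre wim.
have yyE i : chi i e = 1 -> chi i (f (vim w) (vim w)) != 0.
  move=> ei; have := yy i ei; congr (_ != 0).
  rewrite wE -scaleNr (emD em _ _).2 w0y (emZ qb em _ _).2 (qbN qb _).1 (qbN qb _).2.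
  by rewrite !(fE Vf) !(rmorphD, rmorphN, rmorphM) (ure i ei) (uim i ei); ring.
have [v yv ev] := res_eunit res ee yyE.
exists (vre w), (vim w), v; split=> //; first split=> //.
- by lc (-1) wre; ring.
- by apply: (eqN0 h2); lc (-1) wim; rewrite (fC Vf (vim w)); ring.
apply: (cplx_plane_isotropic yv _ _ _ _ ev hps hep px' py' sm) => //.
- by lc (-1) wre; ring.
- by apply: (eqN0 h2); lc (-1) wim; rewrite (fC Vf (vim w)); ring.
- by rewrite -px' ep.
- by rewrite -py' ep.
- by rewrite -(em_eq em).
Qed.

(** Rank one is impossible, rank two is [cplx_rank_two], and three orthogonal anisotropic vectors
    allow a plane with an operator of square [d] to be split off. *)
Theorem ext_hyp_split p : eproj p -> forall s, is_hyp F (ext_op p) s -> cplx_split p.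
Proof.
move: p; apply: (proj_ind res Vf prim) => p hp IH s hps.
have [p0|/proj_eq0 p0] := pselect (exists x, p x != 0); last first.
  exists (fun=> 0), (fun=> 0), (fun=> 0), (fun=> 0); split=> [||x|//].
  - exact: (cplx0 Vf).
  - exact: (hyp0 Vf).
  - by rewrite p0 addr0.
have [x1 [v1 [px1 xv1 ev1]]] := eproj_anisotropic res h2 prim Vf hp p0.
have ex1 : e *: x1 = x1 by rewrite -px1 hp.2.
have hl1 := line_eproj Vf xv1 ex1.
have pl1 z : p (line v1 x1 z) = line v1 x1 z by rewrite /line (proj_lin Vf hp.1) px1.
have hp1 := eproj_sub Vf hp hl1 pl1.
have [q0|/proj_eq0 q0] := pselect (exists x, p x - line v1 x1 x != 0); last first.
  have x10 : x1 = 0.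
    apply: (cplx_rank_one hps hp.1 xv1 _ px1) => z; apply/eqP; rewrite -subr_eq0.
    by rewrite (congr1 (fun g => g z) q0).
  case: (p0) => y /eqP; case; have [_ e0 _] := prim; move/eqP: e0; case.
  by rewrite -xv1 x10 (f0l Vf) mul0r.
have [x2 [v2 [qx2 xv2 ev2]]] := eproj_anisotropic res h2 prim Vf hp1 q0.
have x12 : f x1 x2 = 0.
  rewrite -qx2 -hp1.1.1 px1 /line (mulrC v1) xv1 ex1 subrr (f0l Vf) //.
have px2 : p x2 = x2 by rewrite -{2}qx2 /line x12 mulr0 scale0r subr0.
have ex2 : e *: x2 = x2 by rewrite -px2 hp.2.
have hl2 := line_eproj Vf xv2 ex2.
have pl2 z : p (line v2 x2 z) - line v1 x1 (line v2 x2 z) = line v2 x2 z.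
  have -> : line v1 x1 (line v2 x2 z) = 0 by rewrite /line (fZr Vf) x12 !mulr0 scale0r.
  by rewrite subr0 /line (proj_lin Vf hp.1) px2.
have hp2 := eproj_sub Vf hp1 hl2 pl2.
have [r0|/proj_eq0 r0] := pselect (exists x, p x - line v1 x1 x - line v2 x2 x != 0); last first.
  apply: (cplx_rank_two hps hp xv1 xv2 px1 px2 x12 ev1 ev2) => z.
  by apply/eqP; rewrite -subr_eq0 opprD addrA (congr1 (fun g => g z) r0).
have [x3 [v3 [rx3 xv3 ev3]]] := eproj_anisotropic res h2 prim Vf hp2 r0.
have x13 : f x1 x3 = 0.
  by rewrite -rx3 -hp2.1.1 px1 {1}/line (mulrC v1) xv1 ex1 subrr sub0r /line (fC Vf x2) x12 mulr0 scale0r oppr0 (f0l Vf).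
have x23 : f x2 x3 = 0.
  by rewrite -rx3 -hp2.1.1 px2 {1}/line x12 mulr0 scale0r subr0 /line (mulrC v2) xv2 ex2 subrr (f0l Vf).
have px3 : p x3 = x3 by rewrite -{2}rx3 /line x13 x23 !(mulr0, scale0r) !subr0.
have nz x v i : f x x * v = e -> chi i e = 1 -> chi i (f x x) != 0.
  move=> xv ei; apply: contraTneq isT => E; have := oner_neq0 (K i).
  by rewrite -ei -xv rmorphM E mul0r eqxx.
have [|x [y [v [[yv xx xy] ev px py [s' hs']]]]] := cplx_generic hps hp px1 px2 px3 _ x12 x13 x23.
  by move=> i ei; split; [apply: nz xv1 ei|apply: nz xv2 ei|apply: nz xv3 ei].
have ex : e *: x = x by rewrite -px hp.2.
have ey : e *: y = y by rewrite -py hp.2.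
have hJ := cplane_cplx yv xx xy ex ey.
have hc := cplx_proj Vf dd' hJ.
have hce : eproj (cplane x y v).
  by split=> // z; rewrite /cplane scalerBr !scalerA !(mulrC e) -!(scalerA _ e) ex ey.
have pc z : p (cplane x y v z) = cplane x y v z.
  by rewrite /cplane -!scaleNr !(proj_lin Vf hp.1) px py.
have hp' := eproj_sub Vf hp hce pc.
have [||p1 [p2 [J [s2 [hJ1 hs2 pE p12]]]]] := IH _ hp' _ _ s' hs'.
- by move=> z; rewrite (proj_lin Vf hp.1).1.1.1 (proj_lin Vf hp.1).1.2 hp.1.2 pc.
- exists y; rewrite py /cplane (mulrC v) yv ey xy mulr0 scale0r subr0 subrr.
  apply: contraTneq isT => y0; have [_ /eqP e0 _] := prim; case: e0.
  by rewrite -yv y0 (f0l Vf) mul0r.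
have hp1' := cplx_proj Vf dd' hJ1; have hp2' := hyp_proj hs2.
have p21 z : p2 (p1 z) = 0 by apply: (fext Vf) => u; rewrite hp2'.1 hp1'.1 p12 !(fE Vf).
have c0 z : cplane x y v (p z - cplane x y v z) = 0.
  rewrite (proj_lin Vf hc).1.1.1 (proj_lin Vf hc).1.2 hc.2.
  by rewrite (proj_comm Vf hp.1 hc pc) subrr.
have c1 z : cplane x y v (p1 z) = 0.
  have -> : p1 z = p (p1 z) - cplane x y v (p1 z) by rewrite pE hp1'.2 p21 addr0.
  exact: c0.
have c2 z : cplane x y v (p2 z) = 0.
  have -> : p2 z = p (p2 z) - cplane x y v (p2 z) by rewrite pE hp2'.2 p12 add0r.
  exact: c0.
exists (fun z => cplane x y v z + p1 z), p2, (fun z => cplane_op x y v z + J z), s2; split=> [||z|z] //.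
- exact: (cplx_add Vf dd' hJ hJ1 c1).
- by rewrite -addrA -pE addrC subrK.
- by rewrite c2 p12 addr0.
Qed.

End Main.

(** * Hermitian spaces *)

Section HermitianDual.
Context {A : comNzRingType} (s : {additive A -> A}) (e : A).

Definition has_dual (F : form_module A) : Prop :=
  exists n (v z : 'I_n -> fm_car F), forall x, x = \sum_i fm_val (z i) x *: v i.

Lemma unimodular_has_dual F : unimodular_hermitian s e F -> has_dual F.
Proof.
move=> [proj _ uF]; have [[n v c cE]] := fg_projective_coord_system proj.
have zE i : exists z, forall y, fm_val z y = c i y by have [z [zE _]] := uF (c i); exists z.
exists n, v, (fun i => projT1 (cid (zE i))) => x.
by rewrite {1}[x]cE; apply: eq_bigr => i _; rewrite (projT2 (cid (zE i))).
Qed.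

Hypotheses (sK : involutive s) (s1 : s 1 = 1).

Lemma fm_lin F (z : fm_car F) : sesquilinear s F -> scalar (fm_val z).
Proof.
move=> sF a x y; rewrite (sesq_addr sF) -{1}[z]scale1r (sesq_scale sF) s1 mul1r.
by rewrite mulrC.
Qed.

(** A dual basis makes the module a retract of a free one, and it represents every functional by an
    explicit vector. *)
Lemma has_dual_unimodular F : hermitian s e F -> has_dual F -> unimodular_hermitian s e F.
Proof.
move=> hF [n [v [z dual]]]; have [sF heF] := hF.
pose fz i := mk_scalar (fm_lin (z i) sF).
split=> //; first split.
- by exists n, v => x; exists (fun i => fm_val (z i) x).
- move=> M N g k g_surj.
  have [m mE] := boolp.choice (fun i => g_surj (k (v i))).
  have l_lin : linear (fun x => \sum_i fz i x *: m i).
    move=> a x y; rewrite scaler_sumr -big_split; apply: eq_bigr => i _.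
    by rewrite linearP scalerDl scalerA.
  exists (mk_linear l_lin) => x; rewrite [in RHS](dual x) !linear_sum.
  by apply: eq_bigr => i _; rewrite !linearZ /= mE.
- move=> phi; exists (\sum_i s (phi (v i)) *: z i).
  have addl : forall y, {morph (fun x : fm_car F => fm_val x y) : x x' / x + x'}.
    move=> y x x' /=.
     by rewrite (sesq_addl sF).
  have f0 y : fm_val (0 : fm_car F) y = 0.
    by apply: (addrI (fm_val 0 y)); rewrite -(sesq_addl sF) !addr0.
  have XE y : fm_val (\sum_i s (phi (v i)) *: z i) y = phi y.
    rewrite (big_morph _ (addl y) (f0 y)) [in RHS](dual y) linear_sum.
    apply: eq_bigr => i _; rewrite linearZ /= -[y in LHS]scale1r (sesq_scale sF) sK mulr1.
    by rewrite mulrC.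
  split=> // x xE; rewrite [LHS]dual [RHS]dual; apply: eq_bigr => i _; congr (_ *: _).
  by rewrite heF XE -xE -heF.
Qed.

End HermitianDual.

Section Symmetric.
Context {A : comNzRingType}.

Lemma id_sym_space (F : form_module A) : unimodular_hermitian (@idfun A) 1 F ->
  sym_space (@fm_val A F).
Proof.
move=> uF; have [_ [sF hF] _] := uF; split=> [x y|x y z|a x y|].
- by rewrite hF mul1r.
- exact: (sesq_addl sF).
- by rewrite -{1}[y]scale1r (sesq_scale sF) mulr1.
- exact: unimodular_has_dual uF.
Qed.

Lemma sym_space_id (V : lmodType A) (f : V -> V -> A) : sym_space f ->
  unimodular_hermitian (@idfun A) 1 (FormModule V f).
Proof.
move=> Vf; apply: has_dual_unimodular => //; last exact: sym_sp_dual Vf.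
split=> [|x y] /=; last by rewrite mul1r (fC Vf).
by split=> /= *; rewrite !(fE Vf) //; ring.
Qed.

End Symmetric.

Section HypOperator.
Context {A : comNzRingType} (s : {additive A -> A}).
Variable h : A.
Hypothesis h2 : h * 2%:R = 1.

(* The involution with value 1 on [L] and -1 on [M]. *)
Definition hyp_op (F : form_module A) (t : fm_car F -> fm_car F) : Prop :=
  [/\ linear t, involutive t & forall x y, fm_val (t x) y = - fm_val x (t y)].

Lemma hyp_op_hyperbolic (F : form_module A) t : sesquilinear s F -> s 1 = 1 ->
  @hyp_op F t -> hyperbolic F.
Proof.
move=> sF s1 [t_lin tK tS].
have tL a x y : t (a *: x + y) = a *: t x + t y := t_lin a x y.
have tD (x y : fm_car F) : t (x + y) = t x + t y by rewrite -[x]scale1r tL !scale1r.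
have tN (x : fm_car F) : t (- x) = - t x by rewrite -scaleN1r -[-1 *: x]addr0 tL scaleN1r
  (_ : t 0 = 0) ?addr0 //; apply: (addrI (t 0)); rewrite -tD !addr0.
have t0 : t 0 = 0 by apply: (addrI (t 0)); rewrite -tD !addr0.
have fN (x y : fm_car F) : fm_val x (- y) = - fm_val x y.
  by rewrite -[X in fm_val X _ = _]scale1r -scaleN1r (sesq_scale sF) s1 mul1r mulrN1.
have fN' (x y : fm_car F) : fm_val (- x) y = - fm_val x y.
  by rewrite -[X in fm_val _ X = _]scale1r -scaleN1r (sesq_scale sF) raddfN s1 mulN1r mulr1.
have F0 (a : A) : a = - a -> a = 0 by exact: (eqN0 h2).
exists (fun x => t x = x), (fun x => t x = - x); split.
- split; split; rewrite ?t0 ?oppr0 // => a x y tx ty; first by rewrite tL tx ty.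
  by rewrite tL tx ty scalerN opprD.
- move=> x; exists (h *: (x + t x)), (h *: (x - t x)); split.
  + by rewrite -[h *: _]addr0 tL t0 !addr0 tD tK addrC.
  + by rewrite -[h *: _]addr0 tL t0 !addr0 tD tN tK -scalerN opprB addrC.
  + by rewrite -scalerDr addrACA subrr addr0 -mulr2n -scaler_nat scalerA h2 scale1r.
- move=> x tx txN; have x2 : 2%:R *: x = 0 by rewrite scaler_nat mulr2n -{1}tx txN addNr.
  by rewrite -[x]scale1r -h2 -scalerA x2 scaler0.
- by move=> x y tx ty; apply: F0; rewrite -{1}tx tS ty.
- by move=> x y tx ty; apply: F0; rewrite -{1}[x]opprK -tx fN' tS ty fN opprK.
Qed.

Lemma hyperbolic_hyp_op (F : form_module A) : sesquilinear s F -> s 1 = 1 -> hyperbolic F ->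
  exists t, @hyp_op F t.
Proof.
move=> sF s1 [L [M [[[L0 LD] [M0 MD]] LM LM0 fL fM]]].
have [g gE] : exists g : fm_car F -> fm_car F * fm_car F,
    forall x, [/\ L (g x).1, M (g x).2 & x = (g x).1 + (g x).2].
  have H x : exists lm : fm_car F * fm_car F, [/\ L lm.1, M lm.2 & x = lm.1 + lm.2].
    by have [l [m H]] := LM x; exists (l, m).
  by have [g gE] := boolp.choice H; exists g.
have LN x : L x -> L (- x) by move=> Lx; rewrite -scaleN1r -[_ *: _]addr0; exact: LD.
have MN x : M x -> M (- x) by move=> Lx; rewrite -scaleN1r -[_ *: _]addr0; exact: MD.
have LA x y : L x -> L y -> L (x + y) by move=> Lx; rewrite -[x]scale1r; exact: LD.
have MA x y : M x -> M y -> M (x + y) by move=> Lx; rewrite -[x]scale1r; exact: MD.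
have uniq l m l' m' : L l -> L l' -> M m -> M m' -> l + m = l' + m' -> l = l' /\ m = m'.
  move=> Ll Ll' Mm Mm' E.
  have E' : l - l' = m' - m by apply/eqP; rewrite subr_eq addrAC eq_sym subr_eq E addrC.
  have z : l - l' = 0.
    apply: LM0; first exact/LA/LN.
    by rewrite E'; apply/MA/MN.
  split; first by apply/eqP; rewrite -subr_eq0 z.
  by apply/esym/eqP; rewrite -subr_eq0 -E' z.
have gLM l m : L l -> M m -> g (l + m) = (l, m).
  move=> Ll Mm; have [Lg Mg E] := gE (l + m).
  by have [E1 E2] := uniq _ _ _ _ Lg Ll Mg Mm (esym E); rewrite [LHS]surjective_pairing E1 E2.
have fN (x y : fm_car F) : fm_val x (- y) = - fm_val x y.
  by rewrite -[X in fm_val X _ = _]scale1r -scaleN1r (sesq_scale sF) s1 mul1r mulrN1.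
exists (fun x => (g x).1 - (g x).2); split.
- move=> a x y; have [Lx Mx xE] := gE x; have [Ly My yE] := gE y.
  have -> : a *: x + y = (a *: (g x).1 + (g y).1) + (a *: (g x).2 + (g y).2).
    by rewrite {1}xE {1}yE scalerDr addrACA.
  by rewrite gLM /=; [rewrite scalerBr opprD addrACA|exact: LD|exact: MD].
- move=> x; have [Lx Mx xE] := gE x; rewrite gLM ?opprK //=; exact: MN.
- move=> x y; have [Lx Mx xE] := gE x; have [Ly My yE] := gE y.
  have E1 := fL _ _ Lx Ly; have E2 := fM _ _ Mx My.
  have E3 := fM _ _ (MN _ Mx) My.
  rewrite [X in fm_val _ X = _]yE [X in _ = - fm_val X _]xE !(sesq_addl sF) !(sesq_addr sF) !fN E1 E2 E3.
  have -> : fm_val (- (g x).2) (g y).1 = - fm_val (g x).2 (g y).1.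
    by rewrite -[X in fm_val _ X = _]scale1r -scaleN1r (sesq_scale sF) raddfN s1 mulN1r mulr1.
  by ring.
Qed.

End HypOperator.

(** * Witt groups *)

Section WittGroupFacts.
Context {A : comNzRingType} {s : {additive A -> A}} {e : A}.
Local Notation space := (space s e).
Local Notation witt := (witt s e).
Local Notation witt0 := (witt0 s e).

Lemma witt_addr0 (x : witt) : witt_add x witt0 = x.
Proof. by rewrite witt_addC witt_add0. Qed.

Lemma witt_addrN (x : witt) : witt_add x (witt_opp x) = witt0.
Proof. by rewrite witt_addC witt_addN. Qed.

Lemma witt_addIr (k x y : witt) : witt_add x k = witt_add y k -> x = y.
Proof.
move=> E; rewrite -[x]witt_addr0 -(witt_addrN k) witt_addA E.
by rewrite -witt_addA witt_addrN witt_addr0.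
Qed.

Lemma witt_subr0_eq (x y : witt) : witt_add x (witt_opp y) = witt0 -> x = y.
Proof. by rewrite -(witt_addrN y) => /witt_addIr. Qed.

Lemma witt_isometric (S S' : space) : isometric S S' -> witt_class S = witt_class S'.
Proof.
move=> SS'; congr (witt_diff _ _); apply/cls_eq => //; exact: sp_iso_equivalence.
Qed.

Lemma iso_class_eq (S S' : space) : iso_class S = iso_class S' <-> isometric S S'.
Proof. apply: cls_eq; exact: sp_iso_equivalence. Qed.

Hypotheses (sK : involutive s) (s1 : s 1 = 1).

Definition neg_form (F : form_module A) : form_module A :=
  FormModule (fm_car F) (fun x y => - fm_val x y).

Lemma neg_sesquilinear F : sesquilinear s F -> sesquilinear s (neg_form F).
Proof.
move=> sF; split=> /= *; first by rewrite (sesq_addl sF) opprD.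
  by rewrite (sesq_addr sF) opprD.
by rewrite (sesq_scale sF) mulrN mulNr.
Qed.

Lemma neg_unimodular F : unimodular_hermitian s e F -> unimodular_hermitian s e (neg_form F).
Proof.
move=> uF; have [_ [sF hF] _] := uF; have [n [v [z dual]]] := unimodular_has_dual uF.
have sN := neg_sesquilinear sF.
apply: (has_dual_unimodular sK s1); first by split=> // x y /=; rewrite {1}hF raddfN mulrN.
exists n, v, (fun i => - z i) => x; rewrite {1}[x]dual; apply: eq_bigr => i _; congr (_ *: _).
rewrite /= -[x in RHS]scale1r -scaleN1r (sesq_scale sF) raddfN s1.
by rewrite mulN1r mulr1 opprK.
Qed.

Definition sp_neg (S : space) : space := Space (neg_unimodular (sp_prop S)).

Variable h : A.
Hypothesis h2 : h * 2%:R = 1.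

(** Exchanging the two summands is skew-adjoint; the Lagrangians are the diagonal and the
    antidiagonal. *)
Lemma sp_neg_hyperbolic (S : space) : hyperbolic (sp_sum S (sp_neg S)).
Proof.
have uN := orth_sum_unimodular_hermitian (sp_prop S) (sp_prop (sp_neg S)).
have [_ [sF _] _] := uN.
apply: (@hyp_op_hyperbolic _ _ _ h2 (orth_sum S (neg_form S))
  (fun x : fm_car S * fm_car S => (x.2, x.1)) sF s1).
by split=> [a x y|[x y]|x y] //=; ring.
Qed.

Lemma witt_class_neg (S : space) : witt_class (sp_neg S) = witt_opp (witt_class S).
Proof.
apply: (@witt_addIr (witt_class S)); rewrite witt_addN witt_addC -witt_class_sum.
exact/witt_class_hyperbolic/sp_neg_hyperbolic.
Qed.

Lemma witt_single (x : witt) : exists S, x = witt_class S.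
Proof.
have [S [S' ->]] := witt_generated x; exists (sp_sum S (sp_neg S')).
by rewrite witt_class_sum witt_class_neg.
Qed.

Lemma witt_class_eq (S S' : space) : hyperbolic (orth_sum S (neg_form S')) ->
  witt_class S = witt_class S'.
Proof.
move=> hS; apply: witt_subr0_eq; rewrite -witt_class_neg -witt_class_sum.
exact: witt_class_hyperbolic.
Qed.

(** The stabilising summand K of the Grothendieck group is absorbed by adding its negative as well,
    since K + (-K) is hyperbolic. *)
Lemma witt_class_eq0 (S : space) : witt_class S = witt0 ->
  exists H H' : space, [/\ hyperbolic H, hyperbolic H' & isometric (sp_sum S H) H'].
Proof.
move=> /witt_diff_eq[h0 [h0' [k [[H hH ->] [H' hH' ->]]]]] /=.
have [K ->] := iso_classP k; rewrite !iso_addE => /iso_class_eq E.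
pose KK := sp_sum K (sp_neg K).
exists (sp_sum H KK), (sp_sum H' KK); split.
- exact/orth_sum_hyperbolic/sp_neg_hyperbolic.
- exact/orth_sum_hyperbolic/sp_neg_hyperbolic.
apply/(iso_class_eq (sp_sum S (sp_sum H KK)) (sp_sum H' KK)); move: E => /iso_class_eq /(congr1 (fun c => iso_add c (iso_class (sp_neg K)))).
rewrite -!iso_addE (iso_addC (iso_class S)) !iso_add0 !iso_addA => ->.
by rewrite -!iso_addA.
Qed.

End WittGroupFacts.

Section InducedHom.
Context {A B : comNzRingType} {s : {additive A -> A}} {e : A}
  {s' : {additive B -> B}} {e' : B}.
Variable Phi : form_module A -> form_module B.
Hypothesis PhiU : forall F, unimodular_hermitian s e F -> unimodular_hermitian s' e' (Phi F).
Hypothesis PhiI : forall F G, unimodular_hermitian s e F -> unimodular_hermitian s e G ->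
  isometric F G -> isometric (Phi F) (Phi G).
Hypothesis PhiS : forall F G, unimodular_hermitian s e F -> unimodular_hermitian s e G ->
  isometric (Phi (orth_sum F G)) (orth_sum (Phi F) (Phi G)).
Hypothesis PhiH : forall F, unimodular_hermitian s e F -> hyperbolic F -> hyperbolic (Phi F).

Definition ind_space (S : space s e) : space s' e' := Space (PhiU (sp_prop S)).
Definition ind_iso (c : iso_classes s e) : witt s' e' := witt_class (ind_space (rep c)).

Lemma ind_isoE S : ind_iso (iso_class S) = witt_class (ind_space S).
Proof.
apply: witt_isometric; apply: PhiI; [exact: sp_prop|exact: sp_prop|].
apply/iso_class_eq; exact: repK.
Qed.

Lemma ind_isoD c d : ind_iso (iso_add c d) = witt_add (ind_iso c) (ind_iso d).
Proof.
have [S ->] := iso_classP c; have [S' ->] := iso_classP d.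
rewrite iso_addE !ind_isoE -witt_class_sum; apply: witt_isometric.
apply: PhiS; exact: sp_prop.
Qed.

Lemma ind_iso_hyp c : iso_hyp c -> ind_iso c = witt0 s' e'.
Proof.
move=> [S hS ->]; rewrite ind_isoE; apply: witt_class_hyperbolic.
by apply: PhiH => //; exact: sp_prop.
Qed.

Definition ind_witt (x : witt s e) : witt s' e' :=
  witt_add (ind_iso (rep x).1) (witt_opp (ind_iso (rep x).2)).

Lemma ind_witt_diff a b : ind_witt (witt_diff a b) = witt_add (ind_iso a) (witt_opp (ind_iso b)).
Proof.
rewrite /ind_witt; have [[a' b'] [-> [h [h' [k [hh hh' /= E]]]]]] := rep_witt_diff a b.
have := congr1 ind_iso E; rewrite !ind_isoD !(ind_iso_hyp hh) !(ind_iso_hyp hh') !witt_addr0.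
move=> /witt_addIr {}E.
apply: (@witt_addIr _ _ _ (witt_add (ind_iso b) (ind_iso b'))).
rewrite -witt_addA (witt_addC (ind_iso b)) (witt_addA (witt_opp _)) witt_addN witt_add0 -E.
rewrite (witt_addC (ind_iso b')) -(witt_addA _ (witt_opp _)) (witt_addA (witt_opp _)) witt_addN witt_add0.
by [].
Qed.

Lemma ind_witt_induced : witt_hom_induced_by Phi ind_witt.
Proof.
split=> [x y|S].
  have [a [b ->]] := witt_diffP x; have [c [d ->]] := witt_diffP y.
  rewrite witt_addE !ind_witt_diff !ind_isoD.
  have oppD (u v : witt s' e') : witt_opp (witt_add u v) = witt_add (witt_opp u) (witt_opp v).
    apply: (@witt_addIr _ _ _ (witt_add u v)); rewrite witt_addN (witt_addC u) -witt_addA.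
    by rewrite (witt_addA (witt_opp v)) witt_addN witt_add0 witt_addN.
  rewrite oppD -!witt_addA; congr witt_add; rewrite !witt_addA; congr witt_add.
  by rewrite witt_addC.
exists (PhiU (sp_prop S)); rewrite ind_witt_diff ind_isoE (ind_iso_hyp (@iso_hyp0 _ s e)).
suff -> : witt_opp (witt0 s' e') = witt0 s' e' by rewrite witt_addr0.
by apply: (@witt_addIr _ _ _ (witt0 s' e')); rewrite witt_addN witt_add0.
Qed.

End InducedHom.

(** * Transfer and base change *)

Section Transfer.
Context {R : comNzRingType} {T : comAlgType R} (lam : T) (d d' : R) (re im : T -> R).
Hypothesis qb : quad_basis lam d d' re im.
Variable h : R.
Hypothesis h2 : h * 2%:R = 1.

Lemma half_alg : h%:A * 2%:R = 1 :> T.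
Proof. by rewrite mulr_natr -scaler_nat scalerA mulrC h2 scale1r. Qed.

Section BaseChangeModule.
Variable V : lmodType R.
Local Notation W := (ext_scalars V T).

Definition bc_io (v : V) : W := v ⊗ 1.
Definition bc_re (w : W) : V := eval_sum (fun v t => re t *: v) (repr w).
Definition bc_im (w : W) : V := eval_sum (fun v t => im t *: v) (repr w).

Lemma re_bilinear : is_bilinear (fun (v : V) t => re t *: v).
Proof.
split=> [t|v] a x y; first by rewrite scalerDr !scalerA mulrC.
by rewrite !(qbE qb) scalerDl scalerA.
Qed.

Lemma im_bilinear : is_bilinear (fun (v : V) t => im t *: v).
Proof.
split=> [t|v] a x y; first by rewrite scalerDr !scalerA mulrC.
by rewrite !(qbE qb) scalerDl scalerA.
Qed.

Lemma bc_ioD x y : bc_io (x + y) = bc_io x + bc_io y.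
Proof.
rewrite /bc_io [RHS]tens_addE; apply/tens_sumP => N b [hl hr].
rewrite /eval_sum !big_cons !big_nil !addr0 /=.
by have := hl 1 1 x y; rewrite !scale1r.
Qed.

Lemma bc_ioZ a x : bc_io (a *: x) = a%:A *: bc_io x.
Proof.
rewrite /bc_io ext_scale_pure mulr1; apply/tens_sumP => N b [hl hr].
rewrite /eval_sum !big_cons !big_nil !addr0 /=.
have l0 : b 0 1 = 0 by have := hl 1 1 0 0; rewrite !scale1r addr0 => E; apply: addrI (etrans (esym E) (esym (addr0 _))).
have r0 : b x 0 = 0 by have := hr x 1 0 0; rewrite !scale1r addr0 => E; apply: addrI (etrans (esym E) (esym (addr0 _))).
have := hl 1 a x 0; rewrite addr0 l0 addr0 => ->.
by have := hr x a 1 0; rewrite addr0 r0 addr0 => ->.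
Qed.

Lemma bc_ext_mod : ext_mod lam bc_io bc_re bc_im.
Proof.
have bc0 : bc_io 0 = 0 by apply: (addrI (bc_io 0)); rewrite -bc_ioD !addr0.
split; [exact: bc_ioD|exact: bc_ioZ|move=> w|move=> x y|move=> x y].
- rewrite {1}[w]tensP /bc_re /bc_im /eval_sum !(big_morph _ bc_ioD bc0) scaler_sumr -big_split.
  apply: eq_bigr => -[v t] _ /=; rewrite !bc_ioZ scalerA -scalerDl /bc_io ext_scale_pure mulr1.
  by rewrite {1}(qb_eq qb t) -scalerAr mulr1.
- rewrite /bc_io ext_scale_pure mulr1 [_ + _]tens_addE /bc_re (eval_repr _ re_bilinear).
  by rewrite /eval_sum !big_cons big_nil !(qbE qb) scale1r scale0r !addr0.
- rewrite /bc_io ext_scale_pure mulr1 [_ + _]tens_addE /bc_im (eval_repr _ im_bilinear).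
  by rewrite /eval_sum !big_cons big_nil !(qbE qb) scale1r scale0r add0r addr0.
Qed.
End BaseChangeModule.

Section Involution.
(* For the two involutions at hand, [kap] is 1 or -1. *)
Variables (k : {additive T -> T}) (kap : R).
Hypotheses (kap2 : kap * kap = 1) (kre : forall t, re (k t) = re t) (kim : forall t, im (k t) = kap * im t).

Lemma inv_k1 : k 1 = 1.
Proof. by apply: (qb_ext qb); rewrite ?kre ?kim !(qbE qb) ?mulr0. Qed.

Lemma inv_kK : involutive k.
Proof. by move=> t; apply: (qb_ext qb); rewrite ?kre ?kim ?mulrA ?kap2 ?mul1r. Qed.

Lemma inv_kM s t : k (s * t) = k s * k t.
Proof.
apply: (qb_ext qb); rewrite ?kre ?kim !(qbE qb) !kre !kim; last by ring.
by lc (- d * im s * im t) kap2; ring.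
Qed.

Lemma inv_klam : k lam = kap *: lam.
Proof. by apply: (qb_ext qb); rewrite ?kre ?kim !(qbE qb) ?mulr0. Qed.

Lemma inv_kA a : k a%:A = a%:A.
Proof. by apply: (qb_ext qb); rewrite ?kre ?kim !(qbE qb) ?mulr0. Qed.

Section Trace.

Lemma trace_val (F : form_module T) (x y : fm_car F) :
  @fm_val _ (trace_form F) x y = 2%:R * re (fm_val x y).
Proof. exact: qb_alg_trace qb _. Qed.

Lemma trace_sym_space F : unimodular_hermitian k 1 F -> sym_space (@fm_val _ (trace_form F)).
Proof.
move=> uF; have [_ [sF hF] _] := uF; have [n [v [z dual]]] := unimodular_has_dual uF.
have scale_l a (x y : fm_car F) : fm_val (a *: x) y = k a * fm_val x y.
  by rewrite -{1}[y]scale1r (sesq_scale sF) mulr1.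
split=> [x y|x y w|a x y|].
- by rewrite !trace_val hF mul1r kre.
- by rewrite !trace_val (sesq_addl sF) !(qbE qb) mulrDr.
- rewrite !trace_val [X in fm_val X _](_ : _ = (a%:A : T) *: (x : fm_car F)) //.
  by rewrite scale_l inv_kA !(qbE qb); ring.
(* For the trace of T the basis dual to 1, lam is 1/2, lam/(2d). The map [k] compensates the
   involution applied to scalars in the first argument. *)
pose v' (i : 'I_(n + n)) : res_scalars (fm_car F) :=
  match split i with inl j => v j | inr j => lam *: (v j : fm_car F) end.
pose z' (i : 'I_(n + n)) : res_scalars (fm_car F) :=
  match split i with inl j => h%:A *: (z j : fm_car F)
  | inr j => ((h * d')%:A * k lam) *: (z j : fm_car F) end.
exists (n + n)%N, v', z' => x.
have sl (i : 'I_n) : split (lshift n i) = inl i := unsplitK (inl i).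
have sr (i : 'I_n) : split (rshift n i) = inr i := unsplitK (inr i).
rewrite big_split_ord /= {1}[x]dual -big_split /=; apply: eq_bigr => i _.
rewrite /v' /z' sl sr !(qb_alg_trace qb) !scale_l !inv_kM !inv_kA inv_kK.
have resE a (y : fm_car F) : (a *: (y : res_scalars (fm_car F))) = a%:A *: y :> fm_car F by [].
rewrite !resE scalerA -[RHS](scalerDl (v i : fm_car F)). apply: (congr1 (fun t : T => t *: (v i : fm_car F))); 
apply: (qb_ext qb); rewrite !(qbE qb).
  by lc (- re (fm_val (z i) x)) h2; ring.
lc (- im (fm_val (z i) x)) (qb_unit qb); lc (- d * d' * im (fm_val (z i) x)) h2; ring.
Qed.

Lemma trace_unimodular F : unimodular_hermitian k 1 F ->
  unimodular_hermitian (@idfun R) 1 (trace_form F).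
Proof. by move=> /trace_sym_space /sym_space_id. Qed.

End Trace.
End Involution.

Lemma trace_isometric (F G : form_module T) : isometric F G -> isometric (trace_form F) (trace_form G).
Proof.
move=> [u [bu uE]].
have u_lin : linear (u : res_scalars (fm_car F) -> res_scalars (fm_car G)).
  move=> a x y; exact: (linearP u a%:A).
by exists (mk_linear u_lin); split=> // x y /=; rewrite uE.
Qed.

Lemma trace_orth_sum (F G : form_module T) :
  isometric (trace_form (orth_sum F G)) (orth_sum (trace_form F) (trace_form G)).
Proof.
pose u (x : res_scalars (fm_car F * fm_car G)%type) : res_scalars (fm_car F) * res_scalars (fm_car G) := x.
have u_lin : linear u by [].
exists (mk_linear u_lin); split; first by exists id.
by move=> x y /=; rewrite raddfD.
Qed.

Lemma trace_hyperbolic (F : form_module T) : hyperbolic F -> hyperbolic (trace_form F).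
Proof.
move=> [L [M [[[L0 LD] [M0 MD]] LM LM0 fL fM]]]; exists L, M; split=> //.
- by split; split=> // a x y; [exact: LD|exact: MD].
- by move=> x y Lx Ly /=; rewrite fL // raddf0.
- by move=> x y Lx Ly /=; rewrite fM // raddf0.
Qed.

End Transfer.

Section BaseChange.
Context {R : comNzRingType} {T : comAlgType R} (lam : T) (d d' : R) (re im : T -> R).
Hypothesis qb : quad_basis lam d d' re im.
Variable h : R.
Hypothesis h2 : h * 2%:R = 1.
Variables (k : {additive T -> T}) (kap : R).
Hypotheses (kap2 : kap * kap = 1) (kre : forall t, re (k t) = re t) (kim : forall t, im (k t) = kap * im t).

Local Notation io V := (@bc_io R T V).
Local Notation vre V := (@bc_re R T re V).
Local Notation vim V := (@bc_im R T im V).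
Let em V : ext_mod lam (io V) (vre V) (vim V) := bc_ext_mod qb V.

Lemma bc_valE (F : form_module R) (x y : ext_scalars (fm_car F) T) : sym_space (@fm_val _ F) ->
  re (base_change_val k x y) =
    fm_val (vre _ x) (vre _ y) + kap * d * fm_val (vim _ x) (vim _ y) /\
  im (base_change_val k x y) = fm_val (vre _ x) (vim _ y) + kap * fm_val (vim _ x) (vre _ y).
Proof.
move=> Ff; rewrite /base_change_val /bc_re /bc_im /eval_sum.
elim: (repr x) => [|p s [IH1 IH2]].
  by rewrite !big_nil !(qbE qb) !(fE Ff) !mulr0 addr0.
rewrite !big_cons !(qbE qb) IH1 IH2 !(fE Ff).
suff [-> ->] : re (\sum_(q <- repr y) k p.2 * (fm_val p.1 q.1)%:A * q.2) =
    re p.2 * fm_val p.1 (\sum_(q <- repr y) re q.2 *: q.1)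
      + kap * d * im p.2 * fm_val p.1 (\sum_(q <- repr y) im q.2 *: q.1) /\
    im (\sum_(q <- repr y) k p.2 * (fm_val p.1 q.1)%:A * q.2) =
    re p.2 * fm_val p.1 (\sum_(q <- repr y) im q.2 *: q.1)
      + kap * im p.2 * fm_val p.1 (\sum_(q <- repr y) re q.2 *: q.1).
  by split; ring.
elim: (repr y) => [|q s' [IH1' IH2']]; first by rewrite !big_nil !(qbE qb) !(fE Ff) !mulr0 addr0.
rewrite !big_cons !(qbE qb) IH1' IH2' !kre !kim !(fE Ff); split; ring.
Qed.

Section Form.
Variable F : form_module R.
Hypothesis uF : unimodular_hermitian (@idfun R) 1 F.
Let Ff : sym_space (@fm_val _ F) := id_sym_space uF.
Local Notation BF := (scaled_base_change lam k F).

Lemma sbc_val (x y : fm_car BF) : fm_val x y = lam * base_change_val k x y.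
Proof. by []. Qed.

Lemma sbc_sesquilinear : sesquilinear k BF.
Proof.
split=> [x x' y|x y y'|a b x y]; rewrite !sbc_val -1?mulrDr; first last.
- rewrite mulrCA -!mulrA; congr (_ * _); rewrite !mulrA.
  apply: (qb_ext qb); rewrite !(qbE qb) ?(bc_valE _ _ Ff).1 ?(bc_valE _ _ Ff).2.
    rewrite !kre !kim !(emE qb (em _)) !(fE Ff).
    lc (- (d * im a * re b * fm_val (vim _ x) (vre _ y) + d * d * im a * im b * fm_val (vim _ x) (vim _ y))) kap2.
    by ring.
  rewrite !kre !kim !(emE qb (em _)) !(fE Ff).
  lc (- (d * im a * im b * fm_val (vim _ x) (vre _ y) + d * im a * re b * fm_val (vim _ x) (vim _ y))) kap2.
  by ring.
- congr (_ * _).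
  apply: (qb_ext qb); rewrite !(qbE qb) ?(bc_valE _ _ Ff).1 ?(bc_valE _ _ Ff).2;
  rewrite !(emE qb (em _)) !(fE Ff); ring.
- congr (_ * _).
  apply: (qb_ext qb); rewrite !(qbE qb) ?(bc_valE _ _ Ff).1 ?(bc_valE _ _ Ff).2;
  rewrite !(emE qb (em _)) !(fE Ff); ring.
Qed.

Lemma sbc_hermitian : hermitian k kap%:A BF.
Proof.
split=> [|x y]; first exact: sbc_sesquilinear.
rewrite !sbc_val; apply: (qb_ext qb); rewrite !(qbE qb) !kre !kim !(qbE qb);
rewrite !(bc_valE _ _ Ff).1 !(bc_valE _ _ Ff).2 !(fC Ff (vre _ y)) !(fC Ff (vim _ y)).
  by lc (- d * fm_val (vre _ x) (vim _ y)) kap2; ring.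
by lc (- (fm_val (vre _ x) (vre _ y) + kap * d * fm_val (vim _ x) (vim _ y))) kap2; ring.
Qed.

Lemma sbc_has_dual : has_dual BF.
Proof.
have [n [v [z dual]]] := sym_sp_dual Ff.
(* The scalar inverts the factor [lam] of the form; [k] compensates the involution on the first
   argument. *)
exists n, (fun i => io _ (v i)), (fun i => (k (d'%:A * lam)) *: io _ (z i)) => x.
transitivity (\sum_i (fm_val (z i) (vre _ x) *: 1 + fm_val (z i) (vim _ x) *: lam) *: io _ (v i)); last first.
  apply: eq_bigr => i _; congr (_ *: _).
  rewrite -[x in RHS]scale1r (sesq_scale sbc_sesquilinear) (inv_kK qb kap2 kre kim) mulr1 sbc_val.
  apply: (qb_ext qb); rewrite !(qbE qb) !(bc_valE _ _ Ff).1 !(bc_valE _ _ Ff).2 !(emE qb (em _)) !(fE Ff).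
    by lc (- fm_val (z i) (vre _ x)) (qb_unit qb); ring.
  by lc (- fm_val (z i) (vim _ x)) (qb_unit qb); ring.
rewrite {1}(em_eq (em _) x) {1}(dual (vre _ x)) {1}(dual (vim _ x)).
have io0 : io (fm_car F) 0 = 0 by rewrite -(scale0r 0) (em_scale (em _)) !scale0r.
rewrite !(big_morph _ (em_add (em _)) io0) scaler_sumr -big_split; apply: eq_bigr => i _ /=.
rewrite !(em_scale (em _)) scalerDl scalerA; congr (_ + _ *: _).
by rewrite -scalerAr mulr1.
Qed.

Lemma sbc_unimodular : unimodular_hermitian k kap%:A BF.
Proof.
exact: (has_dual_unimodular (inv_kK qb kap2 kre kim) (inv_k1 qb kre kim) sbc_hermitian sbc_has_dual).
Qed.

End Form.

Section Map.
Variables (V V' : lmodType R) (u : {linear V -> V'}).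

Definition bc_map (w : ext_scalars V T) : ext_scalars V' T :=
  io _ (u (vre _ w)) + lam *: io _ (u (vim _ w)).

Lemma bc_mapE w : vre _ (bc_map w) = u (vre _ w) /\ vim _ (bc_map w) = u (vim _ w).
Proof. by rewrite (em_re (em _)) (em_im (em _)). Qed.

Lemma bc_map_linear : linear bc_map.
Proof.
move=> a x y; have [E1 E2] := bc_mapE (a *: x + y).
have [E3 E4] := bc_mapE x; have [E5 E6] := bc_mapE y.
have [Z1 Z2] := emZ qb (em _) a (bc_map x).
have [D1 D2] := emD (em _) (a *: bc_map x) (bc_map y).
apply: (em_ext (em _)); rewrite ?E1 ?E2 ?D1 ?D2 ?Z1 ?Z2 !(emE qb (em _)) ?E3 ?E4 ?E5 ?E6.
  by rewrite !(linearD u) !(linearZ_LR u) !scaler0 !add0r !addr0.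
by rewrite !(linearD u) !(linearZ_LR u) !scaler0 !add0r !addr0.
Qed.
End Map.

Section Functor.

Lemma sbc_isometric F G : unimodular_hermitian (@idfun R) 1 F -> unimodular_hermitian (@idfun R) 1 G ->
  isometric F G -> isometric (scaled_base_change lam k F) (scaled_base_change lam k G).
Proof.
move=> uF uG [u [[v uK vK] uE]].
have v_lin : linear v by move=> a x y; apply: (can_inj uK); rewrite linearP !vK.
exists (mk_linear (bc_map_linear u)); split.
  exists (bc_map (mk_linear v_lin)) => w /=.
    have [E1 E2] := bc_mapE (mk_linear v_lin) (bc_map u w); have [E3 E4] := bc_mapE u w.
    by apply: (em_ext (em _)); rewrite ?E1 ?E2 ?E3 ?E4 /= uK.
  have [E1 E2] := bc_mapE (mk_linear v_lin) w; have [E3 E4] := bc_mapE u (bc_map (mk_linear v_lin) w).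
  by apply: (em_ext (em _)); rewrite ?E3 ?E4 ?E1 ?E2 /= vK.
move=> x y; rewrite !sbc_val /=; congr (_ * _); apply: (qb_ext qb);
rewrite ?(bc_valE _ _ (id_sym_space uF)).1 ?(bc_valE _ _ (id_sym_space uG)).1
  ?(bc_valE _ _ (id_sym_space uF)).2 ?(bc_valE _ _ (id_sym_space uG)).2.
  by rewrite !(bc_mapE _ _).1 !(bc_mapE _ _).2 !uE.
by rewrite !(bc_mapE _ _).1 !(bc_mapE _ _).2 !uE.
Qed.

Lemma sbc_orth_sum F G : unimodular_hermitian (@idfun R) 1 F -> unimodular_hermitian (@idfun R) 1 G ->
  isometric (scaled_base_change lam k (orth_sum F G))
    (orth_sum (scaled_base_change lam k F) (scaled_base_change lam k G)).
Proof.
move=> uF uG; have uFG := orth_sum_unimodular_hermitian uF uG.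
pose p1 : {linear (fm_car F * fm_car G)%type -> fm_car F} := fst.
pose p2 : {linear (fm_car F * fm_car G)%type -> fm_car G} := snd.
have u_lin : linear (fun w => (bc_map p1 w, bc_map p2 w)).
  by move=> a x y; rewrite !bc_map_linear.
exists (mk_linear u_lin); split.
  exists (fun w => io _ (vre _ w.1, vre _ w.2) + lam *: io _ (vim _ w.1, vim _ w.2)) => [w|[w w']].
    apply: (em_ext (em _)); rewrite ?(em_re (em _)) ?(em_im (em _)) /=.
      by rewrite  -surjective_pairing.
    by rewrite  -surjective_pairing.
  by congr (_, _); apply: (em_ext (em _)); rewrite ?(bc_mapE _ _).1 ?(bc_mapE _ _).2
    ?(em_re (em _)) ?(em_im (em _)).
move=> x y; rewrite !sbc_val /= -mulrDr; congr (_ * _); apply: (qb_ext qb); rewrite !(qbE qb).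
  rewrite (bc_valE _ _ (id_sym_space uF)).1 (bc_valE _ _ (id_sym_space uG)).1.
  rewrite (bc_valE _ _ (id_sym_space uFG)).1 !(bc_mapE _ _).1 !(bc_mapE _ _).2 /=; ring.
rewrite (bc_valE _ _ (id_sym_space uF)).2 (bc_valE _ _ (id_sym_space uG)).2.
rewrite (bc_valE _ _ (id_sym_space uFG)).2 !(bc_mapE _ _).1 !(bc_mapE _ _).2 /=; ring.
Qed.

Lemma sbc_hyperbolic F : unimodular_hermitian (@idfun R) 1 F -> hyperbolic F ->
  hyperbolic (scaled_base_change lam k F).
Proof.
move=> uF hF; have Ff := id_sym_space uF; have [_ [sF _] _] := uF.
have [t [t_lin tK tS]] := hyperbolic_hyp_op sF erefl hF.
have [_ [sB _] _] := sbc_unimodular uF.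
apply: (@hyp_op_hyperbolic _ _ _ (half_alg h2) (scaled_base_change lam k F)
  (bc_map (mk_linear t_lin)) sB (inv_k1 qb kre kim)).
split; [exact: bc_map_linear|move=> w|move=> x y].
  by apply: (em_ext (em _)); rewrite !(bc_mapE _ _).1 || rewrite !(bc_mapE _ _).2; rewrite /= tK.
rewrite !sbc_val -mulrN; congr (_ * _); apply: (qb_ext qb); rewrite !(qbE qb).
  by rewrite !(bc_valE _ _ Ff).1 !(bc_mapE _ _).1 !(bc_mapE _ _).2 /= !tS; ring.
by rewrite !(bc_valE _ _ Ff).2 !(bc_mapE _ _).1 !(bc_mapE _ _).2 /= !tS; ring.
Qed.

End Functor.
End BaseChange.

(** * From primitive idempotents to the whole ring *)

Section Core.
Context {R : comNzRingType} {I : finType} {K : I -> fieldType}.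
Context {chi : forall i, {rmorphism R -> K i}}.
Hypothesis res : residue_system chi.
Variable h : R.
Hypothesis h2 : h * 2%:R = 1.
Context {T : comAlgType R} {lam : T} {d d' : R} {re im : T -> R}.
Hypothesis qb : quad_basis lam d d' re im.
Let dd' := qb_unit qb.
Let two_n0 i := chi2 (chi := chi) h2 i.

(** The norm of [j] is an idempotent below [e]. If it is [e] then j = e; if it is 0, then the trace
    of [j] is again an idempotent below [e], and it can only be [e]. So j = e/2 + b lam with d b^2 =
    e/4, and [lam] acts on the complement e - j as the scalar - 2 d b. *)
Lemma proper_idem e (j : T) : primitive_idem e -> j * j = j -> e%:A * j = j -> j != 0 -> j != e%:A ->
  lam * (e%:A - j) = (- 2%:R * d * im j) *: (e%:A - j).
Proof.
move=> [ee e0 prim] jj ej j0 je.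
have [a aE] : exists a, a = re j by eexists.
have [b bE] : exists b, b = im j by eexists.
have R1 : a * a + d * b * b = a by have := congr1 re jj; rewrite !(qbE qb) -aE -bE.
have R2 : a * b + b * a = b by have := congr1 im jj; rewrite !(qbE qb) -aE -bE.
have ea : e * a = a by have := congr1 re ej; rewrite !(qbE qb) -aE -bE => E; lc 1 E; ring.
have eb : e * b = b by have := congr1 im ej; rewrite !(qbE qb) -aE -bE => E; lc 1 E; ring.
have [N NE] : exists N, N = a * a - d * b * b by eexists.
have NN : N * N = N.
  rewrite NE; lc (a * a + d * b * b + a) R1; lc (- d * (a * b + b * a + b)) R2; ring.
have Ne : N * e = N by rewrite NE; lc (a) ea; lc (- d * b) eb; ring.
have [N0|N1] := prim _ NN Ne; last first.
  case/eqP: je; have bN : b * N = 0.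
    by rewrite NE; lc a R2; lc (- b) R1; ring.
  have b0 : b = 0 by rewrite -eb mulrC -N1.
  have aE' : a = e by rewrite -N1 NE b0; lc (-1) R1; rewrite b0; ring.
  by apply: (qb_ext qb); rewrite !(qbE qb) -?aE -?bE ?aE' ?b0 ?mulr1 ?mulr0.
have aa : a * a = d * b * b by rewrite NE in N0; lc 1 N0; ring.
have [||a0|a1] := prim (2%:R * a).
- by lc (2%:R) R1; lc (2%:R) aa; ring.
- by lc (2%:R) ea; ring.
- case/eqP: j0; have a00 : a = 0 by rewrite -[a]mul1r -h2 -mulrA a0 mulr0.
  by apply: (qb_ext qb); rewrite !(qbE qb) -?aE -?bE // -R2 a00; ring.
apply: (qb_ext qb); rewrite !(qbE qb) -?aE -?bE.
  by lc (- (d * b)) a1; lc d eb; ring.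
by lc (- 1) R1; lc 1 aa; lc (-1) a1; ring.
Qed.

Section Scalar.
Context {Q : lmodType T} {g : Q -> Q -> T}.
Hypothesis Qg : sym_space g.
Local Notation V := (res_scalars Q).
Definition tr_val (x y : V) : R := 2%:R * re (g x y).
Definition lam_op (x : V) : V := lam *: (x : Q).
Hypothesis Vf : sym_space tr_val.

(** If [lam] acts as [t] at one residue field, then [p] vanishes at the point of T where lam = -t.
    The determinant argument of [proj_nonzero], carried out over T, gives an idempotent of eT that
    kills [p] and is neither 0 nor [e]; [p] lives on its complement, where [lam] is scalar by
    [proper_idem]. *)
Lemma scalar_res e p i t : primitive_idem e -> eproj (f := tr_val) e p ->
  (forall x, p (lam_op x) = lam_op (p x)) ->
  (exists x, p x != 0) -> chi i e = 1 ->
  (forall x y, chi i (tr_val (lam_op (p x)) y) = chi i t * chi i (tr_val (p x) y)) ->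
  exists t0 : R, forall x, lam_op (p x) = t0 *: p x.
Proof.
move=> prim hep plam p0 ei scal; have [hp ep] := hep.
have resE a (y : Q) : (a *: (y : V)) = a%:A *: y :> Q by [].
have lamE (x : V) : lam_op x = lam *: (x : Q) by [].
have pD (x y : Q) : p (x + y) = p x + p y :> Q := (proj_lin Vf hp).1.1.1 x y.
have pZ (a : T) (x : Q) : p (a *: x) = a *: (p x : Q).
  have H (u : Q) : a *: u = (re a *: (u : V) + im a *: lam_op u)%R.
    by rewrite {1}(qb_eq qb a) scalerDl -[im a *: lam]mulr_algl -scalerA.
  by rewrite (H x) (H (p x)) (proj_lin Vf hp).1.1.1 !(proj_lin Vf hp).1.1.2 plam.
have p00 : p 0 = 0 := (proj_lin Vf hp).2.
have [n [v [z dual]]] := sym_sp_dual Qg.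
pose E : 'M[T]_n := \matrix_(i, j) g (z i) (p (v j)).
have pE (x : Q) : p x = \sum_j g (z j) x *: (p (v j) : Q).
  rewrite {1}[x]dual; elim/big_rec2: _ => [//|j u w _ <-].
  by rewrite pD pZ.
have EE : E *m E = E.
  apply/matrixP => a b; rewrite !mxE -[in RHS](hp.2 (v b)) [in RHS]pE (fC Qg) (fsuml Qg).
  by apply: eq_bigr => j _; rewrite !mxE (fZl Qg) (fC Qg (p _)) mulrC.
have [dd dE] := idem_mx_det EE; set D := \det _ in dd dE.
have dp (x : Q) : D *: (p x : Q) = 0.
  rewrite [p x]dual scaler_sumr big1 // => j _; rewrite scalerA.
  suff -> : D * g (z j) (p x) = 0 by rewrite scale0r.
  rewrite pE (fC Qg) (fsuml Qg) mulr_sumr big1 // => a _.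
  have := congr1 (fun M : 'M_n => M j a) dE; rewrite !mxE => dEja.
  by rewrite (fZl Qg) mulrCA (fC Qg (p _)) dEja mulr0.
have lam2 (x : V) y : tr_val (lam_op x) y = 2%:R * (d * im (g x y)).
  by rewrite /tr_val lamE (fZl Qg) !(qbE qb); ring.
have scal2 (x y : V) : chi i d * chi i (im (g (p x) y)) = chi i t * chi i (re (g (p x) y)).
  have := scal x y; rewrite lam2 /tr_val !rmorphM rmorph_nat => H.
  by apply: (mulfI (two_n0 i)); lc 1 H; ring.
have scal3 (x y : V) : chi i (re (g (p x) y)) = chi i t * chi i (im (g (p x) y)).
  have := scal2 x (lam_op y); rewrite lamE (fZr Qg) !(qbE qb) !rmorphD !rmorphM rmorph0 rmorph1 => H.
  have d0 := chid (chi := chi) dd' i.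
  by apply: (mulfI d0); lc 1 H; ring.
have [x0 [y0 xy0]] := proj_nonzero Vf prim hep p0 ei.
have tt : chi i t * chi i t = chi i d.
  have G0 : chi i (re (g (p x0) y0)) != 0.
    by apply: contraNneq xy0 => G0; rewrite /tr_val rmorphM G0 mulr0.
  by apply: (mulIf G0); lc (- chi i d) (scal3 x0 y0); lc (- chi i t) (scal2 x0 y0); ring.
(* The point of T over the residue field [i] that sends lam to -t. *)
pose psi (a : T) : K i := chi i (re a) - chi i t * chi i (im a).
have psi_add : zmod_morphism psi.
  by move=> a b; rewrite /psi !(qbE qb) !rmorphB; ring.
have psi_mul : monoid_morphism psi.
  split=> [|a b]; rewrite /psi !(qbE qb) ?rmorph1 ?rmorph0 ?mulr0 ?subr0 //.
  by rewrite !rmorphD !rmorphM; lc (- chi i (im a) * chi i (im b)) tt; ring.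
pose psiR : {rmorphism T -> K i} := HB.pack psi
  (GRing.isZmodMorphism.Build _ _ psi psi_add) (GRing.isMonoidMorphism.Build _ _ psi psi_mul).
have psiG (x y : V) : psi (g (p x) y) = 0 by rewrite /psi scal3 subrr.
have D1 : psi D = 1.
  rewrite -[psi]/(psiR : T -> K i) -det_map_mx (_ : map_mx _ _ = 1%:M) ?det1 //; apply/matrixP => a b.
  by rewrite !mxE rmorphB (fC Qg) [psiR (g _ _)]psiG subr0 rmorph_nat.
have [x1 px1] := p0.
have ee := prim_ee prim.
have epx (x : V) : e%:A *: (p x : Q) = p x by rewrite -resE ep.
have key := proper_idem prim (j := e%:A * D).
have {key} key : lam * (e%:A - e%:A * D) = (- 2%:R * d * im (e%:A * D)) *: (e%:A - e%:A * D).
  apply: key.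
  - by rewrite mulrACA dd -scalerAl mul1r scalerA ee.
  - by rewrite mulrA -scalerAl mul1r scalerA ee.
  - apply: contraTneq isT => j0; have := congr1 psiR j0; rewrite rmorphM rmorph0 [psiR D]D1 mulr1.
    rewrite /= /psi !(qbE qb) mulr0 rmorph0 mulr0 subr0 mulr1 ei => /eqP.
    by rewrite oner_eq0.
  - apply: contraTneq isT => je; case/eqP: px1.
    by rewrite -epx -je -scalerA dp scaler0.
exists (- 2%:R * d * im (e%:A * D)) => x.
have xE : p x = (e%:A - e%:A * D) *: (p x : Q).
  by rewrite scalerBl -scalerA dp scaler0 subr0 epx.
rewrite resE lamE {1}xE scalerA key -[_ *: (_ - _)]mulr_algl -scalerA -xE //.
Qed.
End Scalar.
End Core.

Section Global.
Context {R : comNzRingType} {I : finType} {K : I -> fieldType}.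
Context {chi : forall i, {rmorphism R -> K i}}.
Hypothesis res : residue_system chi.
Variable h : R.
Hypothesis h2 : h * 2%:R = 1.

Section Form.
Context {V : lmodType R} {f : V -> V -> R}.
Hypothesis Vf : sym_space f.

Lemma hyp_ext p p' s : p =1 p' -> is_hyp f p s -> is_hyp f p' s.
Proof. by move=> /funext ->. Qed.

Lemma hyp_scale e p s : e * e = e -> is_hyp f p s ->
  is_hyp f (fun x => e *: p x) (fun x => e *: s x).
Proof.
move=> ee hps; split=> [x y|x|x]; first by rewrite !(fE Vf) (hyp_skew hps) mulrN.
  by rewrite (hyp_lin Vf hps) scalerA ee (hyp_sq hps).
by rewrite (hyp_lin Vf hps) scalerA ee (hyp_sp hps).
Qed.

Lemma id_eproj e : primitive_idem e -> eproj (f := f) e ( *:%R e).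
Proof.
move=> prim; have ee := prim_ee prim; split=> [|x]; last by rewrite scalerA ee.
by split=> [x y|x]; rewrite ?(fE Vf) // scalerA ee.
Qed.

Lemma orth_comp e e' (u u' : V -> V) : e * e' = 0 -> (forall a x, u (a *: x) = a *: u x) ->
  (forall x, e *: u x = u x) -> (forall x, e' *: u' x = u' x) -> forall x, u (u' x) = 0.
Proof. by move=> ee' uZ eu eu' x; rewrite -eu' uZ -eu scalerA mulrC ee' scale0r. Qed.

Lemma hyp0' (p : V -> V) : (forall x, p x = 0) -> is_hyp f p (fun=> 0).
Proof. by move=> p0; apply: hyp_ext (hyp0 Vf) => x; rewrite p0. Qed.

(** Results over primitive idempotents are glued by [idem_ind]: the pieces for orthogonal
    idempotents live on orthogonal summands, so their operators add up. *)
Theorem hyp_cancel_id s p s1 : is_hyp f id s -> is_hyp f p s1 ->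
  exists s', is_hyp f (fun x => x - p x) s'.
Proof.
move=> hs hp.
suff [s' hs'] : exists s', is_hyp f (fun x => 1 *: (x - p x)) s'.
  by exists s'; apply: hyp_ext hs' => x; rewrite scale1r.
pose P e := exists s', is_hyp f (fun x => e *: (x - p x)) s'.
apply: (idem_ind res (P := P)).
- by exists (fun=> 0); apply: hyp0' => x; rewrite scale0r.
- move=> e e' ee ee' eee' [t ht] [t' ht']; exists (fun x => t x + t' x).
  apply: hyp_ext (hyp_add Vf ht ht' _) => x; first by rewrite scalerDl.
  by rewrite (proj_lin Vf (hyp_proj hp)).1.1.2 -scalerBr scalerA eee' scale0r.
move=> e prim; have ee := prim_ee prim; have [hpa hpp] := hyp_proj hp.
have [||||x|s' hs'] := hyp_cancel res h2 prim Vf (q := *:%R e) (p := fun x => e *: p x)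
  (s := fun x => e *: s x) (s1 := fun x => e *: s1 x).
- exact: (hyp_scale ee hs).
- exact: id_eproj.
- exact: hyp_scale.
- split=> [|x]; last by rewrite scalerA ee.
  exact: (hyp_proj (hyp_scale ee hp)).
- by rewrite scalerA ee.
by exists s'; apply: hyp_ext hs' => x; rewrite scalerBr.
Qed.

Section Skew.
Variables (lam : V -> V) (d d' : R).
Hypothesis dd' : d * d' = 1.
Hypothesis lamS : forall x y, f (lam x) y = - f x (lam y).
Hypothesis lam2 : forall x, lam (lam x) = d *: x.

Let lamL := lam_lin Vf lamS.

Theorem skew_hyp_commute_id s : is_hyp f id s ->
  exists s', is_hyp f id s' /\ forall x, s' (lam x) = lam (s' x).
Proof.
move=> hs.
suff [s' [hs' E]] : exists s', is_hyp f ( *:%R 1) s' /\ forall x, s' (lam x) = lam (s' x).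
  by exists s'; split=> //; apply: hyp_ext hs' => x; rewrite scale1r.
pose P e := exists s', is_hyp f ( *:%R e) s' /\ forall x, s' (lam x) = lam (s' x).
apply: (idem_ind res (P := P)).
- exists (fun=> 0); split; last by rewrite lamL.
  by apply: hyp0' => x; rewrite scale0r.
- move=> e e' ee ee' eee' [t [ht tE]] [t' [ht' tE']]; exists (fun x => t x + t' x).
  split; last by move=> x; rewrite tE tE' lamL.
  apply: hyp_ext (hyp_add Vf ht ht' _) => x; first by rewrite scalerDl.
  by rewrite scalerA eee' scale0r.
move=> e prim; have ee := prim_ee prim.
apply: (skew_hyp_commute res h2 prim Vf dd' lamS lam2 (id_eproj prim) _ (hyp_scale ee hs)) => x.
by rewrite lamL.
Qed.

Theorem skew_diag_id : exists t : V -> V, [/\ forall x y, f (t x) y = f x (t y),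
  forall x, t (t x) = x & forall x, t (lam x) = - lam (t x)].
Proof.
pose P e := exists t : V -> V, [/\ forall x y, f (t x) y = f x (t y), forall x, t (t x) = e *: x,
  forall x, e *: t x = t x & forall x, t (lam x) = - lam (t x)].
suff [t [tA t2 _ tl]] : P 1 by exists t; split=> // x; rewrite t2 scale1r.
apply: (idem_ind res (P := P)).
- by exists (fun=> 0); split=> *; rewrite ?(fE Vf) ?lamL ?scale0r ?oppr0.
- move=> e e' ee ee' eee' [t [tA t2 te tl]] [t' [tA' t2' te' tl']]; exists (fun x => t x + t' x).
  have tL := adj_lin Vf tA; have tL' := adj_lin Vf tA'.
  have tt' := orth_comp eee' tL.1.1.2 te te'.
  have t't : forall x, t' (t x) = 0 by apply: (orth_comp _ tL'.1.1.2 te' te); rewrite mulrC.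
  split=> [x y|x|x|x]; first by rewrite !(fE Vf) tA tA'.
  + by rewrite tL tL' tt' t't t2 t2' addr0 add0r scalerDl.
  + have z1 : e *: t' x = 0 by rewrite -te' scalerA eee' scale0r.
    have z2 : e' *: t x = 0 by rewrite -te scalerA mulrC eee' scale0r.
    by rewrite scalerDl !scalerDr te te' z1 z2 addr0 add0r.
  + by rewrite tl tl' lamL opprD.
move=> e prim; have ee := prim_ee prim.
have [|t [tA t2 te tl]] := skew_diag res h2 prim Vf dd' lamS lam2 (id_eproj prim).
  by move=> x; rewrite lamL.
by exists t; split=> // x; rewrite -[RHS]te (adj_lin Vf tA).
Qed.

End Skew.

Theorem norm_hyp_sa_id d d' s : d * d' = 1 -> is_hyp (norm_form (f := f) d) id s ->
  exists J : V -> V, (forall x y, f (J x) y = f x (J y)) /\ forall x, J (J x) = d *: x.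
Proof.
move=> dd' hs.
pose P e := exists J : V -> V, [/\ forall x y, f (J x) y = f x (J y),
  forall x, J (J x) = d *: (e *: x) & forall x, e *: J x = J x].
suff [t [tA t2 _]] : P 1 by exists t; split=> // x; rewrite t2 scale1r.
have XF := norm_form_space Vf dd'.
apply: (idem_ind res (P := P)).
- by exists (fun=> 0); split=> *; rewrite ?(fE Vf) ?scale0r ?scaler0.
- move=> e e' ee ee' eee' [t [tA t2 te]] [t' [tA' t2' te']]; exists (fun x => t x + t' x).
  have tL := adj_lin Vf tA; have tL' := adj_lin Vf tA'.
  have tt' := orth_comp eee' tL.1.1.2 te te'.
  have t't : forall x, t' (t x) = 0 by apply: (orth_comp _ tL'.1.1.2 te' te); rewrite mulrC.
  split=> [x y|x|x]; first by rewrite !(fE Vf) tA tA'.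
  + by rewrite tL tL' tt' t't t2 t2' addr0 add0r scalerDl scalerDr.
  + have z1 : e *: t' x = 0 by rewrite -te' scalerA eee' scale0r.
    have z2 : e' *: t x = 0 by rewrite -te scalerA mulrC eee' scale0r.
    by rewrite scalerDl !scalerDr te te' z1 z2 addr0 add0r.
move=> e prim; have ee := prim_ee prim.
have hse : is_hyp (norm_form (f := f) d) (dbl ( *:%R e)) (fun x => e *: s x).
  split=> [x y|x|x].
  - by rewrite !(fE XF) (hyp_skew hs) mulrN.
  - by rewrite (hyp_lin XF hs) scalerA ee (hyp_sq hs).
  - have -> : dbl ( *:%R e) x = e *: x by [].
    by rewrite (hyp_lin XF hs) scalerA ee.
have [J [JA J2 Jp]] := norm_hyp_sa res h2 prim Vf dd' (id_eproj prim) hse.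
by exists J; split=> // x; rewrite -[RHS]Jp (adj_lin Vf JA).
Qed.

End Form.

Lemma split_hom (V : lmodType R) (f : V -> V -> R) (Vf : sym_space f) e p1 p2 :
  is_proj f p1 -> is_proj f p2 -> (forall x, e *: x = p1 x + p2 x) -> (forall x, p1 (p2 x) = 0) ->
  [/\ forall x, e *: p1 x = p1 x, forall x, e *: p2 x = p2 x & forall x, p2 (p1 x) = 0].
Proof.
move=> h1 h2' eE p12.
have p21 x : p2 (p1 x) = 0 by apply: (fext Vf) => u; rewrite h2'.1 h1.1 p12 !(fE Vf).
by split=> x //; rewrite eE ?p12 ?p21 ?h1.2 ?h2'.2 ?addr0 ?add0r.
Qed.

Context {T : comAlgType R} {lam : T} {d d' : R} {re im : T -> R}.
Hypothesis qb : quad_basis lam d d' re im.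
Let dd' := qb_unit qb.

Section SelfAdjoint.
Context {Q : lmodType T} {g : Q -> Q -> T}.
Hypothesis Qg : sym_space g.
Local Notation V := (res_scalars Q).
Local Notation f := (tr_val (re := re) (g := g)).
Local Notation lamq := (lam_op (lam := lam) (Q := Q)).
Hypothesis Vf : sym_space f.

Lemma lam_op_sa (x y : V) : f (lamq x) y = f x (lamq y).
Proof. by rewrite /tr_val /lam_op (fZl Qg) (fZr Qg). Qed.

Lemma lam_op2 (x : V) : lamq (lamq x) = d *: x.
Proof. by rewrite /lam_op scalerA (qb_sq qb). Qed.

Let lamL := adj_lin Vf lam_op_sa.

Theorem sa_hyp_split_id s : is_hyp f id s ->
  exists p1 p2 s1 s2 : V -> V, [/\ is_hyp f p1 s1 /\ is_hyp f p2 s2,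
    forall x, s1 (lamq x) = - lamq (s1 x), forall x, s2 (lamq x) = lamq (s2 x),
    forall x, x = p1 x + p2 x & forall x, p1 (p2 x) = 0].
Proof.
move=> hs.
pose P e := exists p1 p2 s1 s2 : V -> V, [/\ is_hyp f p1 s1 /\ is_hyp f p2 s2,
    forall x, s1 (lamq x) = - lamq (s1 x), forall x, s2 (lamq x) = lamq (s2 x),
    forall x, e *: x = p1 x + p2 x & forall x, p1 (p2 x) = 0].
suff [p1 [p2 [s1 [s2 [A1 A2 A3 A4 A5]]]]] : P 1.
  by exists p1, p2, s1, s2; split=> // x; rewrite -A4 scale1r.
apply: (idem_ind res (P := P)).
- exists (fun=> 0), (fun=> 0), (fun=> 0), (fun=> 0); split=> [|x|x|x|//].
  + by split; exact: (hyp0 Vf).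
  + by rewrite lamL oppr0.
  + by rewrite lamL.
  + by rewrite scale0r addr0.
- move=> e e' ee ee' eee' [p1 [p2 [s1 [s2 [[A1 B1] A2 A3 A4 A5]]]]].
  move=> [q1 [q2 [t1 [t2 [[C1 D1] C2 C3 C4 C5]]]]].
  have [ep1 ep2 p21] := split_hom Vf (hyp_proj A1) (hyp_proj B1) A4 A5.
  have [eq1 eq2 q21] := split_hom Vf (hyp_proj C1) (hyp_proj D1) C4 C5.
  have Z p hp := (@proj_lin _ _ f Vf p hp).1.1.2.
  have O := orth_comp eee'.
  exists (fun x => p1 x + q1 x), (fun x => p2 x + q2 x), (fun x => s1 x + t1 x), (fun x => s2 x + t2 x).
  split=> [|x|x|x|x].
  + split; first exact: (hyp_add Vf A1 C1 (O _ _ _ (Z _ (hyp_proj A1)) ep1 eq1)).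
    exact: (hyp_add Vf B1 D1 (O _ _ _ (Z _ (hyp_proj B1)) ep2 eq2)).
  + by rewrite A2 C2 lamL opprD.
  + by rewrite A3 C3 lamL.
  + by rewrite scalerDl A4 C4 addrACA.
  + rewrite (proj_lin Vf (hyp_proj A1)) (proj_lin Vf (hyp_proj C1)) A5 C5 addr0 add0r.
    rewrite (O _ _ _ (Z _ (hyp_proj A1)) ep1 eq2) add0r; apply: (orth_comp _ (Z _ (hyp_proj C1)) eq1 ep2).
    by rewrite mulrC.
move=> e prim; have ee := prim_ee prim.
have sr p i t := scalar_res (chi := chi) (p := p) (i := i) (t := t) h2 qb Qg Vf prim.
have [|p1 [p2 [s1 [s2 [A1 A2 A3 A4 A5]]]]] := sa_hyp_split res h2 prim Vf dd' lam_op_sa lam_op2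
  sr (id_eproj Vf prim) _ (hyp_scale Vf ee hs).
  by move=> x; rewrite lamL.
by exists p1, p2, s1, s2.
Qed.

End SelfAdjoint.

Section Extension.
Context {V : lmodType R} {W : lmodType T} {io : V -> W} {vre vim : W -> V}.
Hypothesis em : ext_mod lam io vre vim.
Context {f : V -> V -> R} {F : W -> W -> T}.
Hypotheses (Vf : sym_space f) (WF : sym_space F).
Hypothesis Fio : forall x y, F (io x) (io y) = (f x y)%:A.

Theorem ext_hyp_split_id s : is_hyp F id s ->
  exists p1 p2 J s2, [/\ is_cplx f d p1 J, is_hyp f p2 s2, forall x, x = p1 x + p2 x &
    forall x, p1 (p2 x) = 0].
Proof.
move=> hs; pose P e := cplx_split (d := d) (f := f) ( *:%R e).
suff [p1 [p2 [s1 [s2 [A1 A2 A3 A4]]]]] : P 1.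
  by exists p1, p2, s1, s2; split=> // x; rewrite -A3 scale1r.
apply: (idem_ind res (P := P)).
- exists (fun=> 0), (fun=> 0), (fun=> 0), (fun=> 0); split=> [||x|//].
  + exact: (cplx0 Vf).
  + exact: (hyp0 Vf).
  + by rewrite scale0r addr0.
- move=> e e' ee ee' eee' [p1 [p2 [s1 [s2 [A1 B1 A4 A5]]]]].
  move=> [q1 [q2 [t1 [t2 [C1 D1 C4 C5]]]]].
  have hp1 := cplx_proj Vf dd' A1; have hq1 := cplx_proj Vf dd' C1.
  have [ep1 ep2 p21] := split_hom Vf hp1 (hyp_proj B1) A4 A5.
  have [eq1 eq2 q21] := split_hom Vf hq1 (hyp_proj D1) C4 C5.
  have Z p hp := (@proj_lin _ _ f Vf p hp).1.1.2.
  have O := orth_comp eee'.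
  exists (fun x => p1 x + q1 x), (fun x => p2 x + q2 x), (fun x => s1 x + t1 x), (fun x => s2 x + t2 x).
  split=> [||x|x].
  + exact: (cplx_add Vf dd' A1 C1 (O _ _ _ (Z _ hp1) ep1 eq1)).
  + exact: (hyp_add Vf B1 D1 (O _ _ _ (Z _ (hyp_proj B1)) ep2 eq2)).
  + by rewrite scalerDl A4 C4 addrACA.
  + rewrite (proj_lin Vf hp1) (proj_lin Vf hq1) A5 C5 addr0 add0r.
    rewrite (O _ _ _ (Z _ hp1) ep1 eq2) add0r; apply: (orth_comp _ (Z _ hq1) eq1 ep2).
    by rewrite mulrC.
move=> e prim; have ee := prim_ee prim.
apply: (ext_hyp_split res h2 prim qb em Vf WF Fio (id_eproj Vf prim) (s := fun w => e%:A *: s w)).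
have -> : ext_op lam io vre vim ( *:%R e) = *:%R e%:A.
  apply/funext => w; have [E1 E2] := ext_opE em ( *:%R e) w.
  apply: (em_ext em); rewrite ?E1 ?E2 !(emE qb em) !(qbE qb).
    by rewrite !mulr0 scale0r addr0 mulr1.
  by rewrite !mulr0 scale0r addr0 mulr1.
have eeA : e%:A * e%:A = e%:A :> T by rewrite -scalerAl mul1r scalerA ee.
split=> [x y|x|x].
- by rewrite !(fE WF) (hyp_skew hs) mulrN.
- by rewrite (hyp_lin WF hs) scalerA eeA (hyp_sq hs).
- by rewrite (hyp_lin WF hs) scalerA eeA.
Qed.
End Extension.
End Global.

(** * Modules on images of projections *)

Section ImageModule.
Context {R : comNzRingType} {V : lmodType R}.

Record idem_op := IdemOp {
  idem_fun :> {linear V -> V};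
  idem_idem : forall x, idem_fun (idem_fun x) = idem_fun x }.

Definition im_mod (p : idem_op) : Type := {x : V | p x == x}.
HB.instance Definition _ (p : idem_op) := Choice.on (im_mod p).

Section Operations.
Variable p : idem_op.
Definition im_in (x : V) : im_mod p := exist _ (p x) (introT eqP (idem_idem p x)).
Lemma im_inE x : sval (im_in x) = p x. Proof. by []. Qed.
Lemma im_valE (x : im_mod p) : p (sval x) = sval x. Proof. exact/eqP/(svalP x). Qed.
Definition im_add (x y : im_mod p) := im_in (sval x + sval y).
Definition im_opp (x : im_mod p) := im_in (- sval x).
Definition im_zero := im_in 0.
Definition im_scale a (x : im_mod p) := im_in (a *: sval x).

Lemma im_addE x y : sval (im_add x y) = sval x + sval y.
Proof. by rewrite im_inE linearD !im_valE. Qed.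
Lemma im_scaleE a x : sval (im_scale a x) = a *: sval x.
Proof. by rewrite im_inE linearZ_LR im_valE. Qed.
Lemma im_inj (x y : im_mod p) : sval x = sval y -> x = y.
Proof. exact: val_inj. Qed.
Lemma im_addA : associative im_add.
Proof. by move=> x y z; apply: im_inj; rewrite !im_addE addrA. Qed.
Lemma im_addC : commutative im_add.
Proof. by move=> x y; apply: im_inj; rewrite !im_addE addrC. Qed.
Lemma im_add0 : left_id im_zero im_add.
Proof. by move=> x; apply: im_inj; rewrite im_addE im_inE raddf0 add0r. Qed.
Lemma im_addN : left_inverse im_zero im_opp im_add.
Proof. by move=> x; apply: im_inj; rewrite im_addE (im_inE (- _)) (linearN (idem_fun p)) im_valE addNr (im_inE 0) (linear0 (idem_fun p)). Qed.
End Operations.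

HB.instance Definition _ (p : idem_op) :=
  GRing.isZmodule.Build (im_mod p) (@im_addA p) (@im_addC p) (@im_add0 p) (@im_addN p).

Section Scale.
Variable p : idem_op.
Lemma im_scalerA a b (x : im_mod p) : im_scale a (im_scale b x) = im_scale (a * b) x.
Proof. by apply: im_inj; rewrite !im_scaleE scalerA. Qed.
Lemma im_scale1r : left_id 1 (@im_scale p).
Proof. by move=> x; apply: im_inj; rewrite im_scaleE scale1r. Qed.
Lemma im_scalerDr : right_distributive (@im_scale p) +%R.
Proof. by move=> a x y; apply: im_inj; rewrite !(im_addE, im_scaleE) scalerDr. Qed.
Lemma im_scalerDl (x : im_mod p) : {morph (@im_scale p)^~ x : a b / a + b}.
Proof. by move=> a b; apply: im_inj; rewrite !(im_addE, im_scaleE) scalerDl. Qed.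
End Scale.

HB.instance Definition _ (p : idem_op) := GRing.Zmodule_isLmodule.Build R (im_mod p)
  (@im_scalerA p) (@im_scale1r p) (@im_scalerDr p) (@im_scalerDl p).

Lemma im_svalD (p : idem_op) (x y : im_mod p) : sval (x + y) = sval x + sval y.
Proof. exact: im_addE. Qed.
Lemma im_svalZ (p : idem_op) a (x : im_mod p) : sval (a *: x) = a *: sval x.
Proof. exact: im_scaleE. Qed.
Lemma im_inD (p : idem_op) x y : im_in p (x + y) = im_in p x + im_in p y.
Proof. by apply: im_inj; rewrite im_svalD !im_inE linearD. Qed.
Lemma im_inZ (p : idem_op) a x : im_in p (a *: x) = a *: im_in p x.
Proof. by apply: im_inj; rewrite im_svalZ !im_inE linearZ_LR. Qed.
Lemma im_in_sum (p : idem_op) (J : Type) (r : seq J) (P : pred J) (F : J -> V) :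
  im_in p (\sum_(i <- r | P i) F i) = \sum_(i <- r | P i) im_in p (F i).
Proof.
apply: (big_morph _ (im_inD p)).
by congr (im_in p _).
Qed.
Lemma im_svalK (p : idem_op) (x : im_mod p) : im_in p (sval x) = x.
Proof. by apply: im_inj; rewrite im_inE im_valE. Qed.

(* The dual basis is only required to see the image of [p]. *)
Lemma im_sym_space (p : idem_op) (f : V -> V -> R) (F : V -> V -> R) :
  (forall x y, F x y = F y x) -> (forall x y z, F (x + y) z = F x z + F y z) ->
  (forall a x y, F (a *: x) y = a * F x y) -> sym_space f ->
  (exists u : V -> V, forall z x, p x = x -> F (p (u z)) x = f z x) ->
  sym_space (fun x y : im_mod p => F (sval x) (sval y)).
Proof.
move=> FC FD FZ Vf [u uE]; split=> [x y|x y z|a x y|].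
- exact: FC.
- by rewrite im_svalD FD.
- by rewrite im_svalZ FZ.
have [n [v [z dual]]] := sym_sp_dual Vf.
exists n, (fun i => im_in p (v i)), (fun i => im_in p (u (z i))) => x.
rewrite -{1}[x]im_svalK {1}[sval x]dual im_in_sum; apply: eq_bigr => i _.
by rewrite im_inZ im_inE uE ?im_valE.
Qed.

End ImageModule.
Arguments idem_op {R} V.

(** * Modules over T from an operator with square d *)

Section CplxModule.
Context {R : comNzRingType} {T : comAlgType R} {V : lmodType R}.

Record cplx_str := CplxStr {
  cs_lam : T; cs_d : R; cs_d' : R; cs_re : T -> R; cs_im : T -> R;
  cs_qb : quad_basis cs_lam cs_d cs_d' cs_re cs_im;
  cs_J : {linear V -> V};
  cs_JJ : forall x, cs_J (cs_J x) = cs_d *: x }.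

Definition cplx_mod (J : cplx_str) : Type := V.
HB.instance Definition _ (J : cplx_str) := GRing.Zmodule.on (cplx_mod J).

Section Scale.
Variable J : cplx_str.
Let qb := cs_qb J.
Definition cplx_scale (t : T) (x : cplx_mod J) : cplx_mod J :=
  cs_re J t *: (x : V) + cs_im J t *: cs_J J x.
Lemma cplx_scalerA a b x : cplx_scale a (cplx_scale b x) = cplx_scale (a * b) x.
Proof.
rewrite /cplx_scale !(qbE qb) (linearD (cs_J J)) !(linearZ_LR (cs_J J)) cs_JJ !scalerDr !scalerA addrACA.
rewrite [X in _ + X]addrC addrACA -!scalerDl; congr (_ *: _ + _ *: _); ring.
Qed.
Lemma cplx_scale1r : left_id 1 cplx_scale.
Proof. by move=> x; rewrite /cplx_scale !(qbE qb) scale1r scale0r addr0. Qed.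
Lemma cplx_scalerDr : right_distributive cplx_scale +%R.
Proof. by move=> a x y; rewrite /cplx_scale (linearD (cs_J J)) !scalerDr addrACA. Qed.
Lemma cplx_scalerDl x : {morph cplx_scale^~ x : a b / a + b}.
Proof. by move=> a b; rewrite /cplx_scale !(qbE qb) !scalerDl addrACA. Qed.
End Scale.

HB.instance Definition _ (J : cplx_str) := GRing.Zmodule_isLmodule.Build T (cplx_mod J)
  (@cplx_scalerA J) (@cplx_scale1r J) (@cplx_scalerDr J) (@cplx_scalerDl J).

Variables (J : cplx_str) (h : R) (f : V -> V -> R).
Hypothesis h2 : h * 2%:R = 1.
Hypothesis Vf : sym_space f.

(** The form over T with trace form [f]: the trace of its value at (x, y) determines the real part,
    and the trace of its value at (x, lam y) determines the imaginary part. *)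
Definition cplx_form : form_module T := FormModule (cplx_mod J)
  (fun x y => (h * f x y)%:A + (h * cs_d' J * f x (cs_J J y)) *: cs_lam J).

Variables (k : {additive T -> T}) (kap : R).
Hypotheses (kap2 : kap * kap = 1) (kre : forall t, cs_re J (k t) = cs_re J t)
  (kim : forall t, cs_im J (k t) = kap * cs_im J t).
Hypothesis Jadj : forall x y, f (cs_J J x) y = kap * f x (cs_J J y).
Let qb := cs_qb J.

Lemma cplx_form_unimodular : unimodular_hermitian k 1 cplx_form.
Proof.
have scE t (x : cplx_mod J) : t *: x = cs_re J t *: (x : V) + cs_im J t *: cs_J J x :> V by [].
apply: (has_dual_unimodular (inv_kK qb kap2 kre kim) (inv_k1 qb kre kim)).
  split; first split=> [x x' y|x y y'|a b x y] /=.
  - by apply: (qb_ext qb); rewrite !(qbE qb) !(fE Vf); ring.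
  - by apply: (qb_ext qb); rewrite !(qbE qb) (linearD (cs_J J)) !(fE Vf); ring.
  - rewrite !scE; apply: (qb_ext qb); rewrite !(qbE qb) !kre !kim.
      rewrite (linearD (cs_J J)) !(linearZ_LR (cs_J J)) cs_JJ !(fE Vf) !Jadj cs_JJ !(fE Vf).
      lc (- h * cs_re J b * cs_im J a * kap * f x (cs_J J y)) (qb_unit qb).
      by lc (- h * cs_re J a * cs_im J b * f x (cs_J J y)) (qb_unit qb); ring.
    rewrite (linearD (cs_J J)) !(linearZ_LR (cs_J J)) cs_JJ !(fE Vf) !Jadj cs_JJ !(fE Vf).
    lc (h * cs_re J a * cs_im J b * f x y) (qb_unit qb).
    by lc (h * cs_re J b * cs_im J a * kap * f x y) (qb_unit qb); ring.
  - move=> x y; rewrite mul1r /=; apply: (qb_ext qb); rewrite ?kre ?kim !(qbE qb) !(fC Vf y) ?Jadj.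
      by ring.
    by lc (- (h * cs_d' J * f x (cs_J J y))) kap2; ring.
have [n [v [z dual]]] := sym_sp_dual Vf.
exists n, v, z => x.
have E (i : 'I_n) : fm_val (z i : fm_car cplx_form) x *: (v i : cplx_mod J) =
    h *: (f (z i) x *: v i) + (h * cs_d' J) *: cs_J J (f (z i) (cs_J J x) *: v i) :> V.
  rewrite scE /= !(qbE qb) (linearZ_LR (cs_J J)) !scalerA; congr (_ *: _ + _ *: _); ring.
transitivity (\sum_i (h *: (f (z i) x *: v i) +
    (h * cs_d' J) *: cs_J J (f (z i) (cs_J J x) *: v i)) : V); last first.
  by apply: eq_bigr => i _; rewrite E.
have -> : \sum_i (h *: (f (z i) x *: v i) + (h * cs_d' J) *: cs_J J (f (z i) (cs_J J x) *: v i))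
    = h *: (x : V) + (h * cs_d' J) *: cs_J J (cs_J J x).
  by rewrite big_split -!scaler_sumr -(linear_sum (cs_J J)) -!dual.
have -> : h *: (x : V) + (h * cs_d' J) *: cs_J J (cs_J J x) = (h + h * cs_d' J * cs_d J) *: (x : V).
  by rewrite cs_JJ scalerA -scalerDl.
have -> : h + h * cs_d' J * cs_d J = 1 by lc 1 h2; lc h (qb_unit qb); ring.
by rewrite (scale1r (x : V)).
Qed.

Lemma cplx_trace_isometric : isometric (trace_form cplx_form) (FormModule V f).
Proof.
have u_lin : linear (fun x : res_scalars (cplx_mod J) => (x : V)).
  move=> a x y; have E : @cplx_scale J a%:A x = a *: (x : V).
    by rewrite /cplx_scale !(qbE qb) ?mulr1 ?mulr0 scale0r addr0.
  exact: (congr1 (fun u : V => u + (y : V)) E).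
exists (mk_linear u_lin); split; first by exists id.
move=> x y /=; rewrite (qb_alg_trace qb) !(qbE qb).
by lc (- f x y) h2; ring.
Qed.

End CplxModule.
Arguments cplx_str {R} T V.

(** * Exactness *)

Section HypForm.
Context {A : comNzRingType}.
Variable h : A.
Hypothesis h2 : h * 2%:R = 1.

Lemma hyperbolic_is_hyp (F : form_module A) : unimodular_hermitian (@idfun A) 1 F ->
  hyperbolic F -> exists s, is_hyp (@fm_val A F) id s.
Proof.
move=> uF hF; have [_ [sF _] _] := uF.
by have [t [_ tK tS]] := hyperbolic_hyp_op sF erefl hF; exists t.
Qed.

Lemma is_hyp_hyperbolic (F : form_module A) s : unimodular_hermitian (@idfun A) 1 F ->
  is_hyp (@fm_val A F) id s -> hyperbolic F.
Proof.
move=> uF hs; have Vf := id_sym_space uF; have [_ [sF _] _] := uF.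
apply: (@hyp_op_hyperbolic _ _ _ h2 F s sF erefl); split.
- by move=> a x y; rewrite !(hyp_lin Vf hs).
- exact: hyp_sq hs.
- exact: hyp_skew hs.
Qed.

Lemma isometric_hyperbolic (F G : form_module A) : isometric F G -> hyperbolic G -> hyperbolic F.
Proof.
move=> [u [[v uK vK] uE]] [L [M [[[L0 LD] [M0 MD]] LM LM0 fL fM]]].
exists (fun x => L (u x)), (fun x => M (u x)); split.
- by split; split=> [|a x y Lx Ly]; rewrite ?linear0 ?linearP //; [exact: LD|exact: MD].
- move=> x; have [l [m [Ll Mm E]]] := LM (u x); exists (v l), (v m); rewrite !vK; split=> //.
  by apply: (can_inj uK); rewrite linearD !vK.
- by move=> x Lx Mx; apply: (can_inj uK); rewrite linear0; exact: LM0.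
- by move=> x y Lx Ly; rewrite -uE fL.
- by move=> x y Lx Ly; rewrite -uE fM.
Qed.

(* The graph of an isometry from [W] onto the image of [p1] is a Lagrangian of [p1 - W]. *)
Lemma hyp_glue (Q W : lmodType A) (g : Q -> Q -> A) (F : W -> W -> A) (pi : W -> Q) (si : Q -> W)
    (p1 p2 s2 : Q -> Q) : sym_space g -> sym_space F ->
  (forall w x, F w (si x) = g (pi w) x) -> (forall w, si (pi w) = w) ->
  (forall x, pi (si x) = p1 x) -> is_hyp g p2 s2 -> (forall x, x = p1 x + p2 x) ->
  (forall x, p1 (p2 x) = 0) ->
  is_hyp (fun z z' : Q * W => g z.1 z'.1 - F z.2 z'.2) id (fun z => (pi z.2 + s2 z.1, si z.1)).
Proof.
move=> Qg WF adj siK piK hs pE p12.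
have adj' x w : F (si x) w = g x (pi w) by rewrite (fC WF) adj (fC Qg).
have p1a x y : g (p1 x) y = g x (p1 y) by rewrite -!piK -adj adj'.
have siD x y : si (x + y) = si x + si y.
  by apply: (fext WF) => w; rewrite !(fE WF) !adj' !(fE Qg).
have p1pi w : p1 (pi w) = pi w by rewrite -piK siK.
have p2pi w : p2 (pi w) = 0.
  by apply: (addrI (pi w)); rewrite -{1}(p1pi w) -pE addr0.
have s2pi w : s2 (pi w) = 0 by rewrite -(hyp_sp hs) p2pi (hyp_lin Qg hs).
have sis2 x : si (s2 x) = 0.
  apply: (fext WF) => w; rewrite adj' (f0l WF) -p1pi -p1a -(hyp_ps hs) p12.
  by rewrite (f0l Qg).
split=> [x y|[x w]|x] //=.
- by rewrite !(fE Qg) adj adj' (hyp_skew hs); ring.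
- rewrite siD siK sis2 addr0 (hyp_lin Qg hs) s2pi add0r (hyp_sq hs) piK -pE //.
Qed.

(** [W] contains [H] as an orthogonal summand through [si], and [t] respects it. The operator [s1]
    is used on X + H and [t] on the complement of [H] in [W], so a stabilising [H] may be replaced
    by any such [W]. *)
Lemma hyp_enlarge (X H W : lmodType A) (f : X -> X -> A) (g : H -> H -> A) (F : W -> W -> A)
    (pi : W -> H) (si : H -> W) s1 t : sym_space f -> sym_space g -> sym_space F ->
  (forall x w, F (si x) w = g x (pi w)) -> (forall x, pi (si x) = x) ->
  is_hyp (fun z z' : X * H => f z.1 z'.1 + g z.2 z'.2) id s1 -> is_hyp F id t ->
  (forall w, t (si (pi w)) = si (pi (t w))) ->
  exists s, is_hyp (fun z z' : X * W => f z.1 z'.1 + F z.2 z'.2) id s.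
Proof.
move=> Xf Hg WF adj piK hs1 ht tpi.
have adj' w x : F w (si x) = g (pi w) x by rewrite (fC WF) adj (fC Hg).
have siD x y : si (x + y) = si x + si y.
  by apply: (fext WF) => w; rewrite !(fE WF) !adj !(fE Hg).
have piD x y : pi (x + y) = pi x + pi y.
  by apply: (fext Hg) => w; rewrite !(fE Hg) -!adj' !(fE WF).
have piN x : pi (- x) = - pi x.
  by apply: (fext Hg) => w; rewrite !(fE Hg) -!adj' !(fE WF).
exists (fun z => ((s1 (z.1, pi z.2)).1, si (s1 (z.1, pi z.2)).2 + (t z.2 - si (pi (t z.2))))).
split=> [[x w] [y w']|[x w]|x] //=.
- have E := hyp_skew hs1 (x, pi w) (y, pi w'); rewrite /= in E.
  have E2 : g (pi (t w)) (pi w') = - g (pi w) (pi (t w')).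
    by rewrite -!adj -tpi (hyp_skew ht) adj.
  rewrite !(fE WF) !adj !adj' (hyp_skew ht) E2.
  by lc 1 E; ring.
- have -> : pi (si (s1 (x, pi w)).2 + (t w - si (pi (t w)))) = (s1 (x, pi w)).2.
    by rewrite !piD piN !piK subrr addr0.
  rewrite -surjective_pairing (hyp_sq hs1) /=; congr (_, _).
  set y := (s1 _).2.
  have E1 : t (si y) = si (pi (t (si y))) by rewrite -tpi piK.
  have -> : t (si y + (t w - si (pi (t w)))) = t (si y) + (w - si (pi w)).
    by rewrite !(hyp_lin WF ht) tpi !(hyp_sq ht).
  have si0 : si 0 = 0 by apply: (fext WF) => u; rewrite adj (f0l Hg) (f0l WF).
  have -> : si (pi (t (si y) + (w - si (pi w)))) = t (si y).
    by rewrite !piD piN piK subrr addr0 -E1.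
  by rewrite [t _ + _]addrC addrK addrC subrK.
Qed.

End HypForm.

Section ScaleForm.
Context {A : comNzRingType} {V : lmodType A} {f : V -> V -> A}.
Lemma is_hyp_scale_form c p s : is_hyp f p s -> is_hyp (fun x y => c * f x y) p s.
Proof. by move=> hs; split; [move=> x y; rewrite (hyp_skew hs) mulrN|exact: hyp_sq hs|exact: hyp_sp hs]. Qed.
End ScaleForm.

Section Stable.
Context {R : comNzRingType} {I : finType} {K : I -> fieldType}.
Context {chi : forall i, {rmorphism R -> K i}}.
Hypothesis res : residue_system chi.
Variable h : R.
Hypothesis h2 : h * 2%:R = 1.

Lemma stably_hyperbolic (X H : form_module R) : unimodular_hermitian (@idfun R) 1 X ->
  unimodular_hermitian (@idfun R) 1 H -> hyperbolic H -> hyperbolic (orth_sum X H) ->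
  exists s, is_hyp (@fm_val R X) id s.
Proof.
move=> uX uH hH hXH; have uXH := orth_sum_unimodular_hermitian uX uH.
have [s hs] := hyperbolic_is_hyp uXH hXH; have [t ht] := hyperbolic_is_hyp uH hH.
have Xf := id_sym_space uX; have Hf := id_sym_space uH; have XHf := id_sym_space uXH.
have hp : is_hyp (@fm_val R (orth_sum X H)) (fun z => (0, z.2)) (fun z => (0, t z.2)).
  split=> [x y|x|x] //=; first by rewrite !(fE Xf) (hyp_skew ht) !add0r.
  by rewrite (hyp_sq ht).
have [s' hs'] := hyp_cancel_id res h2 XHf hs hp.
have s2 z : (s' z).2 = 0.
  have E := congr1 snd (hyp_ps hs' z); rewrite -E; exact: subrr.
have E z : s' z = ((s' z).1, 0) by rewrite {1}[s' z]surjective_pairing s2.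
exists (fun x => (s' (x, 0)).1); split=> [x y|x|x] //.
- by have := hyp_skew hs' (x, 0) (y, 0); rewrite /= !(f0l Hf) !(f0r Hf) !addr0.
- rewrite -E (hyp_sq hs') /=; exact: subr0.
Qed.

Lemma witt_zero_hyp (S : space (@idfun R) 1) : witt_class S = witt0 _ _ ->
  exists s, is_hyp (@fm_val R S) id s.
Proof.
move=> S0; have idK : involutive (@idfun R) by [].
have [H [H' [hH hH' iso]]] := witt_class_eq0 idK erefl h2 S0.
apply: (stably_hyperbolic (sp_prop S) (sp_prop H) hH).
exact: isometric_hyperbolic iso hH'.
Qed.
End Stable.

Lemma induced_class (A B : comNzRingType) (s : {additive A -> A}) (e : A)
    (s' : {additive B -> B}) (e' : B) Phi (f : witt s e -> witt s' e') :
  witt_hom_induced_by Phi f ->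
  forall (S : space s e) (hS : unimodular_hermitian s' e' (Phi S)),
    f (witt_class S) = witt_class (Space hS).
Proof.
by move=> [_ fE'] S hS; have [hS' ->] := fE' S; congr (witt_class (Space _)); exact: Prop_irrelevance.
Qed.

(** * Operators and isometries over T from data over R *)

Section Exact.
Context {R : comNzRingType} {I : finType} {K : I -> fieldType}.
Context {chi : forall i, {rmorphism R -> K i}}.
Hypothesis res : residue_system chi.
Variable h : R.
Hypothesis h2 : h * 2%:R = 1.
Context {T : comAlgType R} {lam : T} {d d' : R} {re im : T -> R}.
Hypothesis qb : quad_basis lam d d' re im.
Let dd' := qb_unit qb.
Let hT := half_alg (T := T) h2.

Local Notation io V := (@bc_io R T V).
Local Notation vre V := (@bc_re R T re V).
Local Notation vim V := (@bc_im R T im V).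
Let em V : ext_mod lam (io V) (vre V) (vim V) := bc_ext_mod qb V.

Local Notation mu := (d'%:A * lam).

Lemma mu_lam : mu * lam = 1.
Proof.
by rewrite -mulrA (qb_sq qb) -scalerAl mul1r scalerA mulrC dd' scale1r.
Qed.

Lemma mu_re : re mu = 0 /\ im mu = d'.
Proof. by rewrite !(qbE qb); split; ring. Qed.

Section Involution.
Variables (k : {additive T -> T}) (kap : R).
Hypotheses (kap2 : kap * kap = 1) (kre : forall t, re (k t) = re t) (kim : forall t, im (k t) = kap * im t).
Let kK := inv_kK qb kap2 kre kim.
Let k1 := inv_k1 qb kre kim.

Lemma sesq_lamr e (F : form_module T) (x y : fm_car F) : unimodular_hermitian k e F ->
  fm_val x (lam *: y) = lam * fm_val x y.
Proof.
by move=> [_ [sF _] _]; rewrite -[X in fm_val X _ = _]scale1r (sesq_scale sF) k1 mul1r mulrC.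
Qed.

Lemma sesq_laml e (F : form_module T) (x y : fm_car F) : unimodular_hermitian k e F ->
  fm_val (lam *: x) y = kap *: (lam * fm_val x y).
Proof.
move=> [_ [sF _] _]; rewrite -[X in fm_val _ X = _]scale1r (sesq_scale sF) mulr1.
by rewrite (inv_klam qb kre kim) scalerAl.
Qed.

Lemma T_linear (V W : lmodType T) (u : V -> W) : (forall x y, u (x + y) = u x + u y) ->
  (forall a : R, forall x, u (a%:A *: x) = a%:A *: u x) ->
  (forall x, u (lam *: x) = lam *: u x) -> linear u.
Proof.
move=> uD uZ ul a x y; rewrite uD; congr (_ + _).
rewrite (qb_eq qb a) !scalerDl uD uZ -[im a *: lam]mulr_algl -!scalerA uZ ul //.
Qed.

(** The trace form sees only real parts; evaluating it at (x, lam y) recovers the imaginary part, so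
    skewness passes from the trace form to the form over T. *)
Lemma lift_hyp F (s : fm_car F -> fm_car F) : unimodular_hermitian k 1 F ->
  is_hyp (@fm_val _ (trace_form F)) id s -> (forall x, s (lam *: x) = lam *: s x) ->
  @hyp_op _ F s.
Proof.
move=> uF hs sl; have Vf := trace_sym_space qb h2 kap2 kre kim uF.
split; [|exact: hyp_sq hs|].
  by apply: T_linear => [x y|a x|x]; [exact: (hyp_lin Vf hs).1.1.1|exact: (hyp_lin Vf hs).1.1.2|].
have E x y : re (fm_val (s x) y) = - re (fm_val x (s y)).
  have := hyp_skew hs x y; rewrite !(trace_val qb) => E.
  by lc h E; lc (- (re (fm_val (s x) y) + re (fm_val x (s y)))) h2; ring.
move=> x y; apply: (qb_ext qb); rewrite !(qbE qb) //.
have := E x (lam *: y); rewrite sl !(sesq_lamr _ _ uF) !(qbE qb) => E'.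
by lc d' E'; lc (- (im (fm_val (s x) y) + im (fm_val x (s y)))) dd'; ring.
Qed.

(** The operator is [J] tensored with lam^{-1}. With [J] the multiplication by lam on a trace form,
    this shows that a transfer followed by the scaled base change is zero, for both involutions. *)
Lemma sbc_cplx_hyperbolic (F : form_module R) (J : {linear fm_car F -> fm_car F}) :
  unimodular_hermitian (@idfun R) 1 F -> (forall x, J (J x) = d *: x) ->
  (forall x y, fm_val (J x) y = - (kap * fm_val x (J y))) ->
  hyperbolic (scaled_base_change lam k F).
Proof.
move=> uF JJ JS; have Vf := id_sym_space uF.
have uB := sbc_unimodular qb kap2 kre kim uF; have [_ [sB _] _] := uB.
have sE (w : ext_scalars (fm_car F) T) :
    vre _ (mu *: bc_map lam re im J w) = J (vim _ w) /\
    vim _ (mu *: bc_map lam re im J w) = d' *: J (vre _ w).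
  rewrite (emZ qb (em _) _ _).1 (emZ qb (em _) _ _).2 mu_re.1 mu_re.2 dd'.
  by rewrite (bc_mapE qb J w).1 (bc_mapE qb J w).2 !scale0r !add0r scale1r.
apply: (@hyp_op_hyperbolic _ _ _ hT (scaled_base_change lam k F)
  (fun w => mu *: bc_map lam re im J w) sB k1).
split=> [a x y|w|x y].
- by rewrite (bc_map_linear qb J) scalerDr !scalerA mulrC.
- have [E1 E2] := sE w; have [E3 E4] := sE (mu *: bc_map lam re im J w).
  apply: (em_ext (em _)); rewrite ?E3 ?E4 ?E1 ?E2 ?(linearZ_LR J) JJ ?scalerA.
    by rewrite mulrC dd' scale1r.
  by rewrite mulrC dd' scale1r.
- rewrite !sbc_val -mulrN; congr (_ * _).
  have [E1 E2] := sE x; have [E3 E4] := sE y.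
  apply: (qb_ext qb); rewrite !(qbE qb) ?(bc_valE qb kre kim _ _ Vf).1 ?(bc_valE qb kre kim _ _ Vf).2.
    rewrite E1 E2 E3 E4 !(fE Vf) !JS.
    lc (kap * fm_val (vim _ x) (J (vre _ y))) dd'; lc (- fm_val (vre _ x) (J (vim _ y))) kap2.
    by lc (- kap * kap * fm_val (vre _ x) (J (vim _ y))) dd'; ring.
  rewrite E1 E2 E3 E4 !(fE Vf) !JS.
  by lc (- d' * fm_val (vre _ x) (J (vre _ y))) kap2; ring.
Qed.

Section Image.
Variables (e : T) (F : form_module T).
Hypothesis uF : unimodular_hermitian k e F.
Variables (p : idem_op (res_scalars (fm_car F))) (fL : im_mod p -> im_mod p -> R).
Hypothesis Lf : sym_space fL.
Hypothesis FL : forall l l' : im_mod p, fm_val (sval l : fm_car F) (sval l') = lam * (fL l l')%:A.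
Hypothesis pl : forall l : im_mod p, p (lam *: (sval l : fm_car F)) = 0.
Local Notation L := (FormModule (im_mod p) fL).
Local Notation BL := (scaled_base_change lam k L).

(** The T-linear extension of the inclusion of an R-submodule L on which the form takes values in
    lam R; it identifies the scaled base change of L with L + lam L. *)
Definition img_in (w : ext_scalars (im_mod p) T) : fm_car F :=
  (sval (vre _ w) : fm_car F) + lam *: (sval (vim _ w) : fm_car F).
(** The lam-coordinate of [x] is found by projecting lam^{-1} x, as [p] kills lam L. *)
Definition img_out (x : fm_car F) : ext_scalars (im_mod p) T :=
  io _ (im_in p x) + lam *: io _ (im_in p (d'%:A *: (lam *: x))).

Let resE b (y : res_scalars (fm_car F)) : b *: y = b%:A *: (y : fm_car F) :> fm_car F. Proof. by []. Qed.

Let pD (x y : fm_car F) : p (x + y) = (p x : fm_car F) + p y :> fm_car F. Proof. exact: (linearD p). Qed.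

Let pZ b (x : fm_car F) : p (b%:A *: x) = b%:A *: (p x : fm_car F) :> fm_car F.
Proof. exact: (linearZ_LR p b (x : res_scalars (fm_car F))). Qed.

Let valD (l l' : im_mod p) : sval (l + l') = (sval l : fm_car F) + sval l' :> fm_car F.
Proof. exact: (@im_svalD R (res_scalars (fm_car F)) p l l'). Qed.

Let valZ b (l : im_mod p) : sval (b *: l) = b%:A *: (sval l : fm_car F) :> fm_car F.
Proof. exact: (@im_svalZ R (res_scalars (fm_car F)) p b l). Qed.

Lemma img_linear : linear img_in.
Proof.
apply: T_linear => [x y|a x|x]; rewrite /img_in !(emE qb (em _)) ?(qbE qb) ?mulr0 ?mulr1 ?scale0r ?addr0.
- by rewrite !valD scalerDr addrACA.
- by rewrite !valZ scalerDr !scalerA mulrC.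
- by rewrite valZ scalerDr scalerA (qb_sq qb) addrC.
Qed.

Lemma img_outK w : img_out (img_in w) = w.
Proof.
have plam (l : im_mod p) : p (lam *: (sval l : fm_car F)) = 0 :> fm_car F := pl l.
have pv (l : im_mod p) : p (sval l) = sval l :> fm_car F := im_valE l.
apply: (em_ext (em _)); rewrite ?(em_re (em _)) ?(em_im (em _)); apply: im_inj; rewrite im_inE.
  by rewrite /img_in pD plam pv addr0.
rewrite /img_in scalerDr [lam *: (lam *: _)]scalerA (qb_sq qb) scalerDr pD pZ plam scaler0 add0r.
by rewrite scalerA -scalerAl mul1r scalerA mulrC dd' scale1r scale1r pv.
Qed.

Lemma img_inK x : img_in (img_out x) = (p x : fm_car F) + lam *: (p (d'%:A *: (lam *: x)) : fm_car F).
Proof. by rewrite /img_in (em_re (em _)) (em_im (em _)) !im_inE. Qed.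

Lemma img_isom w w' : fm_val (img_in w) (img_in w') = @fm_val _ BL w w'.
Proof.
have [_ [sF _] _] := uF.
rewrite sbc_val /img_in !(sesq_addl sF) !(sesq_addr sF) !(sesq_lamr _ _ uF) !(sesq_laml _ _ uF).
rewrite !FL.
have [E1 E2] := bc_valE qb kre kim w w' (F := L) Lf; rewrite /= in E1 E2.
apply: (qb_ext qb); rewrite !(qbE qb) E1 E2; ring.
Qed.

End Image.
End Involution.
End Exact.

Lemma ext_mod_prod (R : comNzRingType) (T : comAlgType R) (lam : T) (V V' : lmodType R)
    (W W' : lmodType T) io vre vim io' vre' vim' :
  @ext_mod R T lam V W io vre vim -> @ext_mod R T lam V' W' io' vre' vim' ->
  @ext_mod R T lam (V * V')%type (W * W')%type (fun x => (io x.1, io' x.2))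
    (fun w => (vre w.1, vre' w.2)) (fun w => (vim w.1, vim' w.2)).
Proof.
move=> em em'; split=> [[x x'] [y y']|a [x x']|[w w']|[x x'] [y y']|[x x'] [y y']] /=.
- by rewrite (em_add em) (em_add em').
- by rewrite (em_scale em) (em_scale em').
- by congr (_, _); [exact: em_eq em w|exact: em_eq em' w'].
- by rewrite (em_re em) (em_re em').
- by rewrite (em_im em) (em_im em').
Qed.

(** * Preimages for the maps of the sequence *)

Section Cores.
Context {R : comNzRingType} {I : finType} {K : I -> fieldType}.
Context {chi : forall i, {rmorphism R -> K i}}.
Hypothesis res : residue_system chi.
Variable h : R.
Hypothesis h2 : h * 2%:R = 1.
Context {T : comAlgType R} {lam : T} {d d' : R} {re im : T -> R}.
Hypothesis qb : quad_basis lam d d' re im.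
Let dd' := qb_unit qb.
Let hT := half_alg (T := T) h2.

Local Notation io V := (@bc_io R T V).
Local Notation vre V := (@bc_re R T re V).
Local Notation vim V := (@bc_im R T im V).
Let em V : ext_mod lam (io V) (vre V) (vim V) := bc_ext_mod qb V.

Lemma id_kap2 : 1 * 1 = 1 :> R. Proof. exact: mulr1. Qed.
Lemma id_kre t : re (idfun t) = re t. Proof. by []. Qed.
Lemma id_kim t : im (idfun t) = 1 * im t. Proof. by rewrite mul1r. Qed.
Lemma st_kap2 : (-1) * (-1) = 1 :> R. Proof. by rewrite mulrNN mulr1. Qed.
Lemma st_kre t : re (std_inv T t) = re t. Proof. exact: (std_inv_re qb). Qed.
Lemma st_kim t : im (std_inv T t) = -1 * im t. Proof. by rewrite (std_inv_im qb) mulN1r. Qed.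

Definition uh_trace1 := trace_unimodular qb h2 (k := std_inv T) st_kap2 st_kre st_kim.
Definition uh_trace2 := trace_unimodular qb h2 (k := @idfun T) id_kap2 id_kre id_kim.

Lemma uh_bc1 F : unimodular_hermitian (@idfun R) 1 F ->
  unimodular_hermitian (@idfun T) 1 (scaled_base_change lam idfun F).
Proof. by move=> uF; have := sbc_unimodular qb (k := @idfun T) id_kap2 id_kre id_kim uF; rewrite scale1r. Qed.

Lemma uh_bc2 F : unimodular_hermitian (@idfun R) 1 F ->
  unimodular_hermitian (std_inv T) (-1) (scaled_base_change lam (std_inv T) F).
Proof. by move=> uF; have := sbc_unimodular qb (k := std_inv T) st_kap2 st_kre st_kim uF; rewrite scaleN1r. Qed.

Local Notation mu := (d'%:A * lam).

Let mu_l : mu * lam = 1 := mu_lam qb.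

(* Division by [lam] turns a (-1)-hermitian form into a hermitian one. *)
Lemma uh_scale F : unimodular_hermitian (std_inv T) (-1) F ->
  unimodular_hermitian (std_inv T) 1 (scale_form mu F).
Proof.
move=> uF; have [_ [sF hF] _] := uF; have [n [v [z dual]]] := unimodular_has_dual uF.
have kK := inv_kK qb st_kap2 st_kre st_kim; have k1 := inv_k1 qb st_kre st_kim.
have kM s t : std_inv T (s * t) = std_inv T s * std_inv T t := inv_kM qb st_kap2 st_kre st_kim s t.
have kA a : std_inv T a%:A = a%:A := inv_kA qb st_kre st_kim a.
have kl : std_inv T lam = -1 *: lam := inv_klam qb st_kre st_kim.
have kmu : std_inv T mu = - mu.
  by rewrite kM kA kl scaleN1r mulrN.
apply: (has_dual_unimodular kK k1).
  split; first split=> /= [x x' y|x y y'|a b x y].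
  - by rewrite (sesq_addl sF) mulrDr.
  - by rewrite (sesq_addr sF) mulrDr.
  - by rewrite (sesq_scale sF); ring.
  by move=> x y; rewrite mul1r /= kM kmu {1}hF /=; ring.
exists n, v, (fun i => (- lam) *: z i) => x; rewrite {1}[x]dual; apply: eq_bigr => i _; congr (_ *: _).
rewrite /= -[X in _ = _ * fm_val _ X]scale1r (sesq_scale sF) mulr1 raddfN /= kl.
by rewrite scaleN1r opprK mulrA mu_l mul1r.
Qed.

Lemma scale_hyperbolic (c : T) F : hyperbolic F -> hyperbolic (scale_form c F).
Proof.
move=> [L [M [sub dec cap fL fM]]]; exists L, M; split=> // x y Lx Ly /=; first by rewrite fL ?mulr0.
by rewrite fM ?mulr0.
Qed.

Lemma lam_adj (k : {additive T -> T}) kap (kre : forall t, re (k t) = re t)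
    (kim : forall t, im (k t) = kap * im t) F (x y : fm_car F) : unimodular_hermitian k 1 F ->
  @fm_val _ (trace_form F) (lam *: x) y = kap * @fm_val _ (trace_form F) x (lam *: y).
Proof.
move=> uF; rewrite !(trace_val qb) (sesq_laml qb kre kim _ _ uF) (sesq_lamr qb kre kim _ _ uF).
by rewrite (qbZ qb _ _).1; ring.
Qed.

Lemma lin_pack (V W : lmodType R) (u : V -> W) : (forall x y, u (x + y) = u x + u y) ->
  (forall a x, u (a *: x) = a *: u x) -> linear u.
Proof. by move=> uD uZ a x y; rewrite uD uZ. Qed.

Lemma res_lam_linear (Q : lmodType T) : linear (fun x : res_scalars Q => lam *: (x : Q) : res_scalars Q).
Proof.
move=> a x y; rewrite [X in lam *: X](_ : _ = a%:A *: (x : Q) + y) // scalerDr scalerA mulrC -scalerA //.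
Qed.

(** Dividing by lam makes the form hermitian, and [skew_diag_id] provides an involution [t]
    anticommuting with lam. With L its fixed module, the space is L + lam L, and since L is
    orthogonal to lam L for the trace form, the original form on L has values in lam R. *)
Lemma core5 S : unimodular_hermitian (std_inv T) (-1) S ->
  exists L, unimodular_hermitian (@idfun R) 1 L /\
    isometric (scaled_base_change lam (std_inv T) L) S.
Proof.
move=> uS; have uG := uh_scale uS; set G := scale_form mu S in uG.
have Vf := id_sym_space (uh_trace1 uG); set f := @fm_val _ (trace_form G) in Vf.
pose lm : res_scalars (fm_car S) -> res_scalars (fm_car S) := fun x => lam *: (x : fm_car S).
have lS x y : f (lm x) y = - f x (lm y).
  by rewrite /f (lam_adj (F := G) st_kre st_kim x y uG) mulN1r.
have l2 x : lm (lm x) = d *: x by rewrite /lm scalerA (qb_sq qb).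
have [t [tA t2 tl]] := skew_diag_id res h2 Vf dd' lS l2.
have tL := adj_lin Vf tA; have lL := lam_lin Vf lS.
pose e1 x := h *: (x + t x).
have e_lin : linear e1.
  apply: lin_pack => [x y|a x]; rewrite /e1 tL; first by rewrite addrACA scalerDr.
  by rewrite -scalerDr !scalerA mulrC.
have half2 (x : res_scalars (fm_car S)) : h *: (x + x) = x.
  by rewrite -mulr2n -scaler_nat scalerA h2 scale1r.
have e_idem x : e1 (e1 x) = e1 x.
  by rewrite {1}/e1 {2}/e1 tL tL t2 (addrC (t x)) -/(e1 x) half2.
pose p := IdemOp (idem_fun := mk_linear e_lin) e_idem.
have tp x : p x = x -> t x = x.
  by move=> <-; rewrite /= /e1 tL tL t2 addrC.
have eA x y : f (e1 x) y = f x (e1 y) by rewrite /e1 !(fE Vf) tA.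
pose fL (x y : im_mod p) := h * f (sval x) (sval y).
have Lf : sym_space fL.
  apply: (im_sym_space (F := fun x y => h * f x y) _ _ _ Vf).
  - by move=> x y; rewrite (fC Vf).
  - by move=> x y z; rewrite (fDl Vf) mulrDr.
  - by move=> a x y; rewrite (fZl Vf); ring.
  - exists (fun z => 2%:R *: z) => z x px; rewrite [p _]/(e1 _) eA [e1 x]px (fZl Vf) mulrA h2 mul1r //.
exists (FormModule (im_mod p) fL); split; first exact: sym_space_id.
have ptl x : p x = x -> p (lm x) = 0.
  by move=> px; rewrite [p _]/(e1 _) /e1 tl (tp x px) subrr scaler0.
have FL (l l' : im_mod p) : fm_val (sval l : fm_car S) (sval l') = lam * (fL l l')%:A.
  have fE' x y : f x y = 2%:R * re (mu * fm_val (x : fm_car S) y).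
    by rewrite /f (trace_val qb).
  have z0 : f (sval l) (lm (sval l')) = 0.
    have [pl pl'] := (im_valE l, im_valE l').
    by rewrite -[sval l in LHS]pl [p _]/(e1 _) eA [e1 _](ptl _ pl') (f0r Vf).
  move: z0; rewrite fE' /lm (sesq_lamr qb st_kre st_kim _ _ uS) mulrA mu_l mul1r => z0.
  apply: (qb_ext qb); rewrite !(qbE qb) /fL ?fE'.
    have z1 : re (fm_val (sval l : fm_car S) (sval l')) = 0.
      by lc h z0; lc (- re (fm_val (sval l : fm_car S) (sval l'))) h2; ring.
    by rewrite z1; ring.
  rewrite !(qbE qb); set b := im _; lc (- b) dd'; lc (- d * d' * b) h2; ring.
have uL := img_linear qb (p := p).
pose u := mk_linear uL.
exists u; split; last first.
  by move=> w w'; rewrite /= (img_isom qb st_kre st_kim uS Lf FL).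
exists (img_out (lam := lam) (d' := d') (F := S) p) => w.
  by apply: (img_outK qb) => l; apply: ptl; exact: im_valE.
rewrite /= (img_inK qb).
have -> : lam *: (p (d'%:A *: (lam *: w)) : fm_car S) = h *: ((w : res_scalars (fm_car S)) - t w) :> res_scalars (fm_car S).
  have -> : p (d'%:A *: (lam *: w)) = d' *: e1 (lm w) := linearZ_LR (mk_linear e_lin) d' (lm w).
  have -> : d' *: e1 (lm w) = (d' * h) *: (lm w - lm (t w)) by rewrite /e1 tl scalerA.
  rewrite -[LHS]/(lm _) !lL !l2 -scalerBr !scalerA.
  by have -> : d' * h * d = h by lc h dd'; ring.
rewrite -[RHS]half2 -[LHS]/(e1 w + h *: _) /e1 -scalerDr addrACA subrr addr0 //.
Qed.
End Cores.

Section Cores.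
Context {R : comNzRingType} {I : finType} {K : I -> fieldType}.
Context {chi : forall i, {rmorphism R -> K i}}.
Hypothesis res : residue_system chi.
Variable h : R.
Hypothesis h2 : h * 2%:R = 1.
Context {T : comAlgType R} {lam : T} {d d' : R} {re im : T -> R}.
Hypothesis qb : quad_basis lam d d' re im.
Let dd' := qb_unit qb.
Let hT := half_alg (T := T) h2.

Local Notation io V := (@bc_io R T V).
Local Notation vre V := (@bc_re R T re V).
Local Notation vim V := (@bc_im R T im V).
Let em V : ext_mod lam (io V) (vre V) (vim V) := bc_ext_mod qb V.
Local Notation mu := (d'%:A * lam).
Let mu_l : mu * lam = 1 := mu_lam qb.
Let ikap2 := @id_kap2 R.
Let ikre := @id_kre R T re.
Let ikim := @id_kim R T im.
Let skap2 := @st_kap2 R.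
Let skre := st_kre qb.
Let skim := st_kim qb.

(** Instead of cancelling [H] over T, the space [X] is enlarged by the trace form of lam^{-1} H.
    This form is hyperbolic over R and its base change contains [H] as an orthogonal summand, so the
    base change of the enlarged space is itself hyperbolic. The part with an operator of square [d]
    in [ext_hyp_split_id] then becomes [Q]. *)
Lemma core2 X H : unimodular_hermitian (@idfun R) 1 X -> unimodular_hermitian (@idfun T) 1 H ->
  hyperbolic H -> hyperbolic (orth_sum (scaled_base_change lam idfun X) H) ->
  exists K Q, [/\ unimodular_hermitian (@idfun R) 1 K, hyperbolic K,
    unimodular_hermitian (std_inv T) 1 Q & hyperbolic (orth_sum (orth_sum X K) (neg_form (trace_form Q)))].
Proof.
move=> uX uH hH hXH; have Xf := id_sym_space uX; have Hg := id_sym_space uH.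
set g := @fm_val _ H in Hg.
have uB := uh_bc1 qb uX; have BXf := id_sym_space uB.
have [s1 hs1] := hyperbolic_is_hyp (orth_sum_unimodular_hermitian uB uH) hXH.
have [sg hsg] := hyperbolic_is_hyp uH hH.
have sgL := hyp_lin Hg hsg.
pose Hm := scale_form mu H.
have uHm : unimodular_hermitian (@idfun T) 1 Hm := sym_space_id (sym_space_scale mu_l Hg).
pose KK := trace_form Hm.
have uK : unimodular_hermitian (@idfun R) 1 KK := uh_trace2 h2 qb uHm.
have hK : hyperbolic KK := trace_hyperbolic (scale_hyperbolic mu hH).
have Kf := id_sym_space uK; set fK := @fm_val _ KK in Kf.
have uBK := uh_bc1 qb uK; have BKf := id_sym_space uBK.
have gl (x y : fm_car H) : g (lam *: x) y = lam * g x y by exact: (fZl Hg).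
have glr (x y : fm_car H) : g x (lam *: y) = lam * g x y by exact: (fZr Hg).
have fKE (x y : fm_car H) : fK x y = 2%:R * im (g x y).
  rewrite /fK (trace_val qb) /= !(qbE qb); lc (2%:R * im (g x y)) dd'; ring.
have sgr a (x : res_scalars (fm_car H)) : sg (a *: x) = a *: (sg x : res_scalars (fm_car H)) := sgL.1.1.2 _ x.
have sg_lin : linear (sg : res_scalars (fm_car H) -> res_scalars (fm_car H)).
  by apply: lin_pack => [x y|a x]; [exact: sgL.1.1.1|exact: sgr].
pose W := ext_scalars (res_scalars (fm_car H)) T.
pose t : W -> W := bc_map lam re im (mk_linear sg_lin).
have tE w : vre _ (t w) = sg (vre _ w) /\ vim _ (t w) = sg (vim _ w) := bc_mapE qb _ w.
pose pi (w : W) : fm_car H := (vre _ w : fm_car H) + lam *: (vim _ w : fm_car H).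
(* The multiplication map [pi] is split by the separability idempotent of T over R, half of 1 tensor
   1 plus lam^{-1} tensor lam. *)
pose si (x : fm_car H) : W :=
  io (res_scalars (fm_car H)) (h%:A *: x) + lam *: io (res_scalars (fm_car H)) ((h * d')%:A *: (lam *: x)).
have siE x : vre _ (si x) = h%:A *: x :> fm_car H /\ vim _ (si x) = (h * d')%:A *: (lam *: x) :> fm_car H.
  by rewrite /si (em_re (em _)) (em_im (em _)).
have BKE (w w' : W) : @fm_val _ (scaled_base_change lam idfun KK) w w' =
    lam * base_change_val (F := KK) idfun w w' by [].
have ht : is_hyp (@fm_val _ (scaled_base_change lam idfun KK)) id t.
  have skK (x y : fm_car H) : fK (sg x) y = - fK x (sg y).
    have gS : g (sg x) y = - g x (sg y) := hyp_skew hsg x y.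
    by rewrite !fKE gS (qbN qb _).2 mulrN.
  split=> [w w'|w|w] //.
    have [E1 E2] := tE w; have [E3 E4] := tE w'.
    rewrite !BKE -mulrN; congr (_ * _); apply: (qb_ext qb); rewrite !(qbE qb).
      by rewrite !(bc_valE qb ikre ikim _ _ Kf).1 E1 E2 E3 E4 -!/fK !skK; ring.
    by rewrite !(bc_valE qb ikre ikim _ _ Kf).2 E1 E2 E3 E4 -!/fK !skK; ring.
  have [E1 E2] := tE w; have [E3 E4] := tE (t w).
  by apply: (em_ext (em _)); rewrite ?E3 ?E4 ?E1 ?E2; exact: (hyp_sq hsg).
have piK x : pi (si x) = x.
  rewrite /pi (siE x).1 (siE x).2 !scalerA -scalerDl -[RHS]scale1r; congr (_ *: _).
  apply: (qb_ext qb); rewrite !(qbE qb); last by ring.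
  by lc h dd'; lc 1 h2; ring.
have adj x w : @fm_val _ (scaled_base_change lam idfun KK) (si x) w = g x (pi w).
  rewrite BKE /pi (fDr Hg) glr; apply: (qb_ext qb); rewrite !(qbE qb).
    rewrite (bc_valE qb ikre ikim _ _ Kf).1 (bc_valE qb ikre ikim _ _ Kf).2 -!/fK (siE x).1 (siE x).2 !fKE !(fZl Hg) !(qbE qb).
    lc (d * im (g x (vim _ w))) h2; lc (2%:R * h * re (g x (vre _ w))) dd'.
    by lc (re (g x (vre _ w))) h2; ring.
  rewrite (bc_valE qb ikre ikim _ _ Kf).1 (bc_valE qb ikre ikim _ _ Kf).2 -!/fK (siE x).1 (siE x).2 !fKE !(fZl Hg) !(qbE qb).
  lc (im (g x (vre _ w))) h2; lc (2%:R * h * re (g x (vim _ w))) dd'.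
  by lc (re (g x (vim _ w))) h2; ring.
have sgl (x : fm_car H) a : sg (a *: x) = a *: sg x by exact: sgL.1.1.2.
have tsi x : t (si x) = si (sg x).
  have [E1 E2] := tE (si x); have [E3 E4] := siE x; have [E5 E6] := siE (sg x).
  by apply: (em_ext (em _)); rewrite ?E1 ?E2 ?E3 ?E4 ?E5 ?E6 !sgl.
have pit w : pi (t w) = sg (pi w).
  by have [E1 E2] := tE w; rewrite /pi E1 E2 sgL.1.1.1 sgl.
have tpi w : t (si (pi w)) = si (pi (t w)) by rewrite tsi pit.
have [s hs] := hyp_enlarge BXf Hg BKf adj piK hs1 ht tpi.
have XKf := sym_space_prod Xf Kf.
have WWf := sym_space_prod BXf BKf.
(* Division by lam turns the scaled base change into a form extending the one over R, as
   [ext_hyp_split_id] requires. *)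
have WF := sym_space_scale mu_l WWf.
have hs' := is_hyp_scale_form mu hs.
have emP := ext_mod_prod (em (fm_car X)) (em (res_scalars (fm_car H))).
have [|p1 [p2 [J [s2 [hJ hs2 pE p12]]]]] := ext_hyp_split_id res h2 qb emP XKf WF _ hs'.
  move=> [x x'] [y y'] /=; rewrite -mulrDr mulrA mu_l mul1r.
  apply: (qb_ext qb); rewrite !(qbE qb).
    by rewrite (bc_valE qb ikre ikim _ _ Xf).1 (bc_valE qb ikre ikim _ _ Kf).1 !(emE qb (em _)) -!/fK !(fE Xf) !(fE Kf); ring.
  by rewrite (bc_valE qb ikre ikim _ _ Xf).2 (bc_valE qb ikre ikim _ _ Kf).2 !(emE qb (em _)) -!/fK !(fE Xf) !(fE Kf); ring.
have hp1 := cplx_proj XKf dd' hJ; have p1L := proj_lin XKf hp1; have JL := cplx_lin XKf hJ.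
have p1_lin : linear p1 by move=> a x y; rewrite !p1L.
pose p := IdemOp (idem_fun := mk_linear p1_lin) hp1.2.
have Lf : sym_space (fun x y : im_mod p => fm_val (sval x).1 (sval y).1 + fK (sval x).2 (sval y).2).
  apply: (im_sym_space (F := fun x y => fm_val x.1 y.1 + fK x.2 y.2) _ _ _ XKf).
  - exact: sym_spC XKf.
  - exact: sym_spD XKf.
  - exact: sym_spZ XKf.
  - exists id => z x px; have E : p1 x = x := px.
    by have := hp1.1 z x; rewrite E.
set fL := (fun _ _ => _) in Lf.
pose JL' (x : im_mod p) : im_mod p := im_in p (J (sval x)).
have JLE x : sval (JL' x) = J (sval x) by exact: (cplx_pJ XKf dd' hJ).
have JL_lin : linear JL'.
  by move=> a x y; apply: im_inj; rewrite JLE !im_svalD !im_svalZ !JLE !JL.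
have JLJ x : JL' (JL' x) = d *: x.
  by apply: im_inj; rewrite !JLE im_svalZ (cplx_sq hJ); congr (_ *: _); exact: (im_valE x).
pose JS := @CplxStr R T (im_mod p) lam d d' re im qb (mk_linear JL_lin) JLJ.
pose Q := cplx_form JS h fL.
have uQ : unimodular_hermitian (std_inv T) 1 Q.
  apply: (cplx_form_unimodular (J := JS) h2 Lf skap2 skre skim) => x y.
  by rewrite mulN1r /fL !JLE; exact: (cplx_skew hJ).
exists KK, Q; split=> //.
have [u [bu uE]] : isometric (trace_form Q) (FormModule (im_mod p) fL) := @cplx_trace_isometric _ _ _ JS h fL h2.
have idK : involutive (@idfun R) by [].
have uXK := orth_sum_unimodular_hermitian uX uK.
have uLL := sym_space_id Lf.
have [_ iso_sym _] := @isometric_equivalence R.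
have isoQ : isometric (orth_sum (orth_sum X KK) (neg_form (trace_form Q)))
    (orth_sum (orth_sum X KK) (neg_form (FormModule (im_mod p) fL))).
  apply: orth_sum_isometric; first by exists idfun; split=> //; exists id.
  by exists u; split=> // x y; exact: (congr1 -%R (uE x y)).
apply: (isometric_hyperbolic isoQ).
have adjL (w : im_mod p) x : fL w (im_in p x) = @fm_val _ (orth_sum X KK) (sval w) x.
  have E : p1 (sval w) = sval w := im_valE w.
  by have H0 := hp1.1 (sval w) x; rewrite E in H0; exact: esym H0.
have G := hyp_glue XKf Lf adjL (@im_svalK _ _ p) (fun x => erefl : sval (im_in p x) = p1 x) hs2 pE p12.
exact: (is_hyp_hyperbolic h2 (orth_sum_unimodular_hermitian uXK (neg_unimodular idK erefl uLL)) G).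
Qed.
End Cores.

Section Cores.
Context {R : comNzRingType} {I : finType} {K : I -> fieldType}.
Context {chi : forall i, {rmorphism R -> K i}}.
Hypothesis res : residue_system chi.
Variable h : R.
Hypothesis h2 : h * 2%:R = 1.
Context {T : comAlgType R} {lam : T} {d d' : R} {re im : T -> R}.
Hypothesis qb : quad_basis lam d d' re im.
Let dd' := qb_unit qb.
Let hT := half_alg (T := T) h2.

Local Notation io V := (@bc_io R T V).
Local Notation vre V := (@bc_re R T re V).
Local Notation vim V := (@bc_im R T im V).
Let em V : ext_mod lam (io V) (vre V) (vim V) := bc_ext_mod qb V.
Local Notation mu := (d'%:A * lam).
Let mu_l : mu * lam = 1 := mu_lam qb.
Let ikap2 := @id_kap2 R.
Let ikre := @id_kre R T re.
Let ikim := @id_kim R T im.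
Let skap2 := @st_kap2 R.
Let skre := st_kre qb.
Let skim := st_kim qb.

(** The summand on which the hyperbolic operator commutes with lam is hyperbolic over T. On the
    other one the eigenspaces of [s1] are L and lam L; as L is isotropic for the trace form, the
    form over T takes values in lam R on L, and this summand is a scaled base change. *)
Lemma core3 S s : unimodular_hermitian (@idfun T) 1 S -> is_hyp (@fm_val _ (trace_form S)) id s ->
  exists L, unimodular_hermitian (@idfun R) 1 L /\
    hyperbolic (orth_sum S (neg_form (scaled_base_change lam idfun L))).
Proof.
move=> uS hs; have Qg := id_sym_space uS; have Vf := id_sym_space (uh_trace2 h2 qb uS).
have trE : @fm_val _ (trace_form S) = tr_val (re := re) (g := @fm_val _ S).
  by apply/funext => x; apply/funext => y; rewrite (trace_val qb).
rewrite trE in hs Vf; set f := tr_val in hs Vf.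
have [p1 [p2 [s1 [s2 [[hp1 hp2] s1l s2l pE p12]]]]] := sa_hyp_split_id res h2 qb Qg Vf hs.
rewrite -/f in hp1 hp2; set lm := lam_op in s1l s2l.
have lA x y : f (lm x) y = f x (lm y) by exact: (lam_op_sa Qg).
have l2 x : lm (lm x) = d *: x by exact: (lam_op2 qb).
have lL := adj_lin Vf lA; have pL := proj_lin Vf (hyp_proj hp1); have sL := hyp_lin Vf hp1.
have fE' x y : f x y = 2%:R * re (fm_val (x : fm_car S) y) by [].
have flE x y : f x (lm y) = 2%:R * (d * im (fm_val (x : fm_car S) y)).
  by rewrite fE' /lm /lam_op (sesq_lamr qb ikre ikim _ _ uS) !(qbE qb); ring.
have gext c (x y x' y' : res_scalars (fm_car S)) : f x y = c * f x' y' -> f x (lm y) = c * f x' (lm y') ->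
    fm_val (x : fm_car S) y = c *: fm_val (x' : fm_car S) y'.
  rewrite !fE' -/lm [re (fm_val _ (lm y))](_ : _ = d * im (fm_val (x : fm_car S) y)); last first.
    by rewrite /lm /lam_op (sesq_lamr qb ikre ikim _ _ uS) !(qbE qb); ring.
  rewrite [re (fm_val _ (lm y'))](_ : _ = d * im (fm_val (x' : fm_car S) y')); last first.
    by rewrite /lm /lam_op (sesq_lamr qb ikre ikim _ _ uS) !(qbE qb); ring.
  move=> E1 E2; apply: (qb_ext qb); rewrite !(qbE qb).
    set a := re _ in E1 *; set b := re _ in E1 *.
    by lc h E1; lc (- (a - c * b)) h2; ring.
  set a := im _ in E2 *; set b := im _ in E2 *.
  by lc (h * d') E2; lc (- (a - c * b)) dd'; lc (- d * d' * (a - c * b)) h2; ring.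
have p1l x : p1 (lm x) = lm (p1 x) by rewrite -!(hyp_sq hp1) s1l sL s1l opprK.
pose e1 x := h *: (p1 x + s1 x).
have e_lin : linear e1.
  apply: lin_pack => [x y|a x]; rewrite /e1 pL sL; first by rewrite addrACA scalerDr.
  by rewrite -scalerDr !scalerA mulrC.
have half2 (x : res_scalars (fm_car S)) : h *: (x + x) = x.
  by rewrite -mulr2n -scaler_nat scalerA h2 scale1r.
have p1e x : p1 (e1 x) = e1 x by rewrite /e1 pL pL (hyp_proj hp1).2 (hyp_ps hp1).
have s1e x : s1 (e1 x) = e1 x by rewrite /e1 sL sL (hyp_sp hp1) (hyp_sq hp1) addrC.
have e_idem x : e1 (e1 x) = e1 x by rewrite {1}/e1 p1e s1e half2.
pose p := IdemOp (idem_fun := mk_linear e_lin) e_idem.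
(* If the value of the form at l, l' is lam c with c in R, then the trace form at lam l, l' is 2 d
   c. *)
pose fL (x y : im_mod p) := h * d' * f (lm (sval x)) (sval y).
have el x : e1 (lm x) = h *: (lm (p1 x) - lm (s1 x)) by rewrite /e1 p1l s1l.
have Lf : sym_space fL.
  apply: (im_sym_space (F := fun x y => h * d' * f (lm x) y) _ _ _ Vf).
  - by move=> x y; rewrite lA (fC Vf).
  - by move=> x y z; rewrite lL (fDl Vf) mulrDr.
  - by move=> a x y; rewrite lL (fZl Vf); ring.
  exists (fun z => 2%:R *: lm z) => z x px; rewrite [p _]/(e1 _) lA.
  have [p1x s1x] : p1 x = x /\ s1 x = x by rewrite -px p1e s1e.
  have -> : f (e1 (2%:R *: lm z)) (lm x) = f (2%:R *: lm z) (lm x).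
    rewrite {1}/e1 (fZl Vf) (fDl Vf) (hyp_proj hp1).1 (hyp_skew hp1) p1l s1l p1x s1x (fNr Vf) opprK.
    by lc (f (2%:R *: lm z) (lm x)) h2; ring.
  rewrite (fZl Vf) lA l2 (fZr Vf).
  by lc (2%:R * h * f z x) dd'; lc (f z x) h2; ring.
have ptl x : p x = x -> p (lm x) = 0.
  move=> px; have -> : p (lm x) = h *: (lm (p1 x) - lm (s1 x)) := el x.
  have [-> ->] : p1 x = x /\ s1 x = x by rewrite -px p1e s1e.
  by rewrite subrr scaler0.
have FL (l l' : im_mod p) : fm_val (sval l : fm_car S) (sval l') = lam * (fL l l')%:A.
  have [pl pl'] := (im_valE l, im_valE l').
  have sl (u : im_mod p) : s1 (sval u) = sval u by rewrite -[in LHS](im_valE u) s1e [RHS](esym (im_valE u)).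
  have z0 : f (sval l) (sval l') = 0.
    by apply: (eqN0 h2); rewrite -{1}(sl l) (hyp_skew hp1) sl.
  apply: (qb_ext qb); rewrite !(qbE qb) /fL.
    have zre : re (fm_val (sval l : fm_car S) (sval l')) = 0.
      by move: z0; rewrite fE'; set a := re _ => z0; lc h z0; lc (- a) h2; ring.
    by rewrite zre; ring.
  rewrite lA flE; set b := im _.
  by lc (- b) dd'; lc (- d * d' * b) h2; ring.
have uL := sym_space_id Lf.
have uB := uh_bc1 qb uL; have WF := id_sym_space uB.
exists (FormModule (im_mod p) fL); split=> //.
have ptl' (l : im_mod p) : p (lam *: (sval l : fm_car S)) = 0 by apply: ptl; exact: im_valE.
pose pi := @img_in R T lam re im S p; pose si := @img_out R T lam d' S p.
have isom w w' := img_isom qb ikre ikim uS Lf FL w w'.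
have siK w : si (pi w) = w by exact: (img_outK qb).
have piK x : pi (si x) = p1 x.
  rewrite /pi /si (img_inK qb).
  have -> : p (d'%:A *: (lam *: x)) = d' *: e1 (lm x) := linearZ_LR (mk_linear e_lin) d' (lm x).
  rewrite el -[lam *: _]/(lm _).
  have -> : lm (d' *: (h *: (lm (p1 x) - lm (s1 x)))) = h *: (p1 x - s1 x).
    by rewrite !lL !l2 -scalerBr !scalerA; congr (_ *: _); lc h dd'; ring.
  by rewrite -[LHS]/(e1 x + h *: _) /e1 -scalerDr addrACA subrr addr0 half2.
have p1g x y : fm_val (p1 x : fm_car S) y = fm_val (x : fm_car S) (p1 y).
  rewrite -[RHS]scale1r; apply: gext; rewrite mul1r ?(hyp_proj hp1).1 // p1l //.
have p1pi w : p1 (pi w) = pi w by rewrite -piK siK.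
have hs2 : is_hyp (@fm_val _ S) p2 s2.
  split; [move=> x y|exact: hyp_sq hp2|exact: hyp_sp hp2].
  by rewrite -scaleN1r; apply: gext; rewrite mulN1r (hyp_skew hp2) // s2l.
have adj w x : @fm_val _ (scaled_base_change lam idfun (FormModule (im_mod p) fL)) w (si x)
    = fm_val (pi w) x.
  by rewrite -isom -/pi piK -p1g p1pi.
have idK : involutive (@idfun T) by [].
have uN := neg_unimodular idK erefl uB.
apply: (is_hyp_hyperbolic hT (orth_sum_unimodular_hermitian uS uN)).
exact: (hyp_glue Qg WF adj siK piK hs2 pE p12).
Qed.
End Cores.

Section Cores.
Context {R : comNzRingType} {I : finType} {K : I -> fieldType}.
Context {chi : forall i, {rmorphism R -> K i}}.
Hypothesis res : residue_system chi.
Variable h : R.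
Hypothesis h2 : h * 2%:R = 1.
Context {T : comAlgType R} {lam : T} {d d' : R} {re im : T -> R}.
Hypothesis qb : quad_basis lam d d' re im.
Let dd' := qb_unit qb.
Let hT := half_alg (T := T) h2.

Local Notation io V := (@bc_io R T V).
Local Notation vre V := (@bc_re R T re V).
Local Notation vim V := (@bc_im R T im V).
Let em V : ext_mod lam (io V) (vre V) (vim V) := bc_ext_mod qb V.
Local Notation mu := (d'%:A * lam).
Let mu_l : mu * lam = 1 := mu_lam qb.
Let ikap2 := @id_kap2 R.
Let ikre := @id_kre R T re.
Let ikim := @id_kim R T im.
Let skap2 := @st_kap2 R.
Let skre := st_kre qb.
Let skim := st_kim qb.

(** Dividing by lam and taking traces turns the stably hyperbolic base change into a stably
    hyperbolic space over R, where cancellation is available. That space is twice the norm form of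
    [X], so [norm_hyp_sa_id] gives a self-adjoint operator with square [d], that is, a T-module
    structure on [X]. *)
Lemma core4 X H : unimodular_hermitian (@idfun R) 1 X -> unimodular_hermitian (std_inv T) (-1) H ->
  hyperbolic H -> hyperbolic (orth_sum (scaled_base_change lam (std_inv T) X) H) ->
  exists Q, unimodular_hermitian (@idfun T) 1 Q /\ isometric (trace_form Q) X.
Proof.
move=> uX uH hH hXH; have Xf := id_sym_space uX; set B := scaled_base_change _ _ X in hXH.
have uB : unimodular_hermitian (std_inv T) (-1) B := uh_bc2 qb uX.
have uXX := uh_trace1 h2 qb (uh_scale qb uB); have uHH := uh_trace1 h2 qb (uh_scale qb uH).
have hHH := trace_hyperbolic (scale_hyperbolic mu hH).
have hsum : hyperbolic (orth_sum (scale_form mu B) (scale_form mu H)).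
  have [L [M [sub dec cap fL fM]]] := hXH; exists L, M; split=> // x y Lx Ly /=; rewrite -mulrDr.
    by have /= -> := fL _ _ Lx Ly; rewrite mulr0.
  by have /= -> := fM _ _ Lx Ly; rewrite mulr0.
have [_ iso_sym _] := @isometric_equivalence R.
have hsum' := isometric_hyperbolic (iso_sym _ _ (trace_orth_sum _ _)) (trace_hyperbolic hsum).
have [s hs] := stably_hyperbolic res h2 uXX uHH hHH hsum'.
have XXf := id_sym_space uXX.
pose mk (u : fm_car X * fm_car X) : ext_scalars (fm_car X) T := io _ u.1 + lam *: io _ u.2.
pose um (w : ext_scalars (fm_car X) T) := (vre _ w, vim _ w).
have mkK u : um (mk u) = u by rewrite /um /mk (em_re (em _)) (em_im (em _)) -surjective_pairing.
have umK w : mk (um w) = w by rewrite /mk /= -(em_eq (em _)).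
have nE (w w' : ext_scalars (fm_car X) T) : norm_form (f := @fm_val _ X) d (um w) (um w') =
    h * @fm_val _ (trace_form (scale_form mu B)) w w'.
  rewrite (trace_val qb) /= [mu * _]mulrA mu_l mul1r (bc_valE qb skre skim w w' Xf).1 /norm_form /=.
  by lc (- (fm_val (vre _ w) (vre _ w') - d * fm_val (vim _ w) (vim _ w'))) h2; ring.
have hs' : is_hyp (norm_form (f := @fm_val _ X) d) id (fun u => um (s (mk u))).
  split=> [u v|u|u] //; last by rewrite umK (hyp_sq hs) mkK.
  by rewrite -{1}[v]mkK -{2}[u]mkK !nE (hyp_skew hs) mulrN.
have [J [JA JJ]] := norm_hyp_sa_id res h2 Xf dd' hs'.
have J_lin : linear J by move=> a x y; rewrite !(adj_lin Xf JA).
pose JS := @CplxStr R T (fm_car X) lam d d' re im qb (mk_linear J_lin) JJ.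
exists (cplx_form JS h (@fm_val _ X)); split; last exact: (@cplx_trace_isometric _ _ _ JS h _ h2).
by apply: (cplx_form_unimodular (J := JS) h2 Xf ikap2 ikre ikim) => x y; rewrite mul1r JA.
Qed.
End Cores.

(** * Existence of the generator *)

Section AlgebraAlong.
Context {R : comNzRingType} {K : comNzRingType} (ch : {rmorphism R -> K}).
(** [K] as an R-algebra along [ch]; the argument keeps algebras along different maps apart. *)
Definition alg_along (_ : {rmorphism R -> K}) : Type := K.
Local Notation Ka := (alg_along ch).
HB.instance Definition _ := GRing.ComNzRing.on Ka.
Definition along_scale (a : R) (x : Ka) : Ka := ch a * x.
Fact along_scalerA a b v : along_scale a (along_scale b v) = along_scale (a * b) v.
Proof. by rewrite /along_scale rmorphM mulrA. Qed.
Fact along_scale1r : left_id 1 along_scale.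
Proof. by move=> v; rewrite /along_scale rmorph1 mul1r. Qed.
Fact along_scalerDr : right_distributive along_scale +%R.
Proof. by move=> a x y; rewrite /along_scale mulrDr. Qed.
Fact along_scalerDl v : {morph along_scale^~ v : a b / a + b}.
Proof. by move=> a b; rewrite /along_scale rmorphD mulrDl. Qed.
HB.instance Definition _ := GRing.Zmodule_isLmodule.Build R Ka
  along_scalerA along_scale1r along_scalerDr along_scalerDl.
Fact along_scaleAl (a : R) (x y : Ka) : a *: (x * y) = (a *: x) * y.
Proof. exact: mulrA. Qed.
HB.instance Definition _ := GRing.Lmodule_isLalgebra.Build R Ka along_scaleAl.
Fact along_scaleAr (a : R) (x y : Ka) : a *: (x * y) = x * (a *: y).
Proof. exact: mulrCA. Qed.
HB.instance Definition _ := GRing.Lalgebra_isAlgebra.Build R Ka along_scaleAr.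
HB.instance Definition _ := GRing.ComNzRing.on Ka.
End AlgebraAlong.

Section Dual.
Context {K : fieldType}.
(** The dual numbers over [K]: the pair (a, b) stands for a + b eps with eps^2 = 0. *)
Definition dualn : Type := (K * K)%type.
HB.instance Definition _ := GRing.Zmodule.on dualn.
Definition dualn_one : dualn := (1, 0).
Definition dualn_mul (x y : dualn) : dualn := (x.1 * y.1, x.1 * y.2 + x.2 * y.1).
Fact dualn_mulA : associative dualn_mul.
Proof. by move=> x y z; rewrite /dualn_mul /=; congr (_, _); ring. Qed.
Fact dualn_mulC : commutative dualn_mul.
Proof. by move=> x y; rewrite /dualn_mul /=; congr (_, _); ring. Qed.
Fact dualn_mul1 : left_id dualn_one dualn_mul.
Proof. by move=> [x y]; rewrite /dualn_mul /=; congr (_, _); ring. Qed.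
Fact dualn_mulD : left_distributive dualn_mul +%R.
Proof.
move=> [x x'] [y y'] [z z'].
transitivity ((x * z + y * z, (x * z' + x' * z) + (y * z' + y' * z)) : dualn) => //.
transitivity (((x + y) * z, (x + y) * z' + (x' + y') * z) : dualn) => //.
by congr (_, _); ring.
Qed.
Fact dualn_10 : dualn_one != 0.
Proof. by rewrite xpair_eqE oner_eq0. Qed.
HB.instance Definition _ := GRing.Zmodule_isComNzRing.Build dualn
  dualn_mulA dualn_mulC dualn_mul1 dualn_mulD dualn_10.
Definition dualn_inj (x : K) : dualn := (x, 0).
Fact dualn_inj_add : zmod_morphism dualn_inj.
Proof. by move=> x y; transitivity ((x - y, 0 - 0) : dualn) => //; rewrite subrr. Qed.
Fact dualn_inj_mul : monoid_morphism dualn_inj.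
Proof.
split=> // x y; transitivity ((x * y, x * 0 + 0 * y) : dualn) => //.
by rewrite mulr0 mul0r addr0.
Qed.
HB.instance Definition _ := GRing.isZmodMorphism.Build K dualn dualn_inj dualn_inj_add.
HB.instance Definition _ := GRing.isMonoidMorphism.Build K dualn dualn_inj dualn_inj_mul.
End Dual.
Arguments dualn K : clear implicits.

Section Fibre.
Context {R : comNzRingType} {T : comAlgType R} {F : fieldType} (ch : {rmorphism R -> F}).
Local Notation Ka := (alg_along ch).
Local Notation tio := (@bc_io R Ka T).

Lemma fibre_eval (c : {scalar T}) x : tio x = 0 -> ch (c x) = 0.
Proof.
move=> x0; pose b (v : T) (k : Ka) : Ka := (ch (c v) : Ka) * k.
have hb : is_bilinear b.
  split=> [k|v] a y z; rewrite /b.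
    rewrite linearP rmorphD rmorphM mulrDl; congr (_ + _).
    exact: (esym (mulrA (ch a) (ch (c y)) k)).
  by rewrite mulrDr; congr (_ + _); exact: (mulrCA (ch (c v)) (ch a) y).
have io0 : tio 0 = 0 by apply: (addrI (tio 0)); rewrite -bc_ioD !addr0.
have := eval_repr_pure x (1 : Ka) hb; rewrite -[x ⊗ 1]/(tio x) x0 -io0.
rewrite (eval_repr_pure 0 (1 : Ka) hb) /b raddf0 rmorph0 mul0r => E.
by rewrite -[ch (c x)]mulr1; exact: (esym E).
Qed.

Lemma fibre_zero : tio 1 = 0 -> forall x, tio x = 0.
Proof.
have io0 : tio 0 = 0 by apply: (addrI (tio 0)); rewrite -bc_ioD !addr0.
rewrite -{1}io0 => /tens_sumP H x; rewrite -io0; apply/tens_sumP => N b [hl hr].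
have hb' : is_bilinear (fun v k => b (x * v) k).
  by split=> [k|v] a y z; [rewrite mulrDr -scalerAr hl|exact: hr].
by have := H N _ hb'; rewrite /eval_sum !big_seq1 /= mulr1 mulr0.
Qed.

(** [dt] is the determinant of two vectors in the fibre of [T], identified with F^2. A vector whose
    determinants with the basis 1, t both vanish is zero in the fibre. *)
Lemma fibre_det : constant_rank T 2 -> exists dt : T -> T -> F,
  [/\ forall a x y z, dt (a *: x + y) z = ch a * dt x z + dt y z, forall x y, dt x y = - dt y x,
    exists t, dt 1 t != 0 & forall t x, dt 1 t != 0 -> dt x t = 0 -> dt 1 x = 0 ->
      forall c : {scalar T}, ch (c x) = 0].
Proof.
move=> rk; have [|f [g fK gK]] := rk Ka.
  by move=> x x0; exists ((x : F)^-1); exact: (mulVf (x0 : (x : F) != 0)).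
pose p (w : ext_scalars T Ka) : F := f w 0 0.
pose q (w : ext_scalars T Ka) : F := f w 0 1.
have pD w w' : p (w + w') = p w + p w' by rewrite /p linearD mxE.
have qD w w' : q (w + w') = q w + q w' by rewrite /q linearD mxE.
have pZ (k : Ka) w : p (k *: w) = (k : F) * p w by rewrite /p linearZ mxE.
have qZ (k : Ka) w : q (k *: w) = (k : F) * q w by rewrite /q linearZ mxE.
have p0 : p 0 = 0 by rewrite /p linear0 mxE.
have q0 : q 0 = 0 by rewrite /q linear0 mxE.
have pq0 w : p w = 0 -> q w = 0 -> w = 0.
  move=> pw qw; rewrite -[w]fK -[RHS]fK; congr g; apply/rowP => j; rewrite linear0 [RHS]mxE.
  have [->|->] : j = 0 \/ j = 1 by case: j => [[|[|//]] jj]; [left|right]; exact: val_inj.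
    exact: pw.
  exact: qw.
have ioZ a (x : T) : tio (a *: x) = (ch a : Ka) *: tio x.
  by rewrite bc_ioZ; congr (_ *: _); exact: (mulr1 (ch a)).
exists (fun x y => p (tio x) * q (tio y) - q (tio x) * p (tio y)); split.
- by move=> a x y z; rewrite bc_ioD ioZ pD qD pZ qZ; ring.
- by move=> x y; ring.
(* If 1 had zero determinant with every vector, it would vanish in the fibre, and multiplication
   would make the whole fibre zero, contrary to its dimension. *)
- apply: contrapT => nt.
  have H t : p (tio 1) * q (tio t) = q (tio 1) * p (tio t).
    by apply/eqP; rewrite -subr_eq0; apply/negPn/negP => t0; apply: nt; exists t.
  have H' w : p (tio 1) * q w = q (tio 1) * p w.
    rewrite [w]tensP; elim/big_rec: _ => [|[x k] w' _ IH]; first by rewrite p0 q0 !mulr0.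
    rewrite pD qD !mulrDr IH; congr (_ + _) => /=.
    have -> : x ⊗ k = k *: tio x by rewrite /bc_io ext_scale_pure mulr1.
    by rewrite pZ qZ mulrCA H mulrCA.
  have e1 : p (g (\row_j (if j == 0 then 1 else 0))) = 1 by rewrite /p gK mxE.
  have e2 : q (g (\row_j (if j == 0 then 1 else 0))) = 0 by rewrite /q gK mxE.
  have e3 : p (g (\row_j (if j == 0 then 0 else 1))) = 0 by rewrite /p gK mxE.
  have e4 : q (g (\row_j (if j == 0 then 0 else 1))) = 1 by rewrite /q gK mxE.
  have q1 : q (tio 1) = 0 by have := H' (g (\row_j (if j == 0 then 1 else 0))); rewrite e1 e2 mulr0 mulr1.
  have p1 : p (tio 1) = 0 by have := H' (g (\row_j (if j == 0 then 0 else 1))); rewrite e3 e4 mulr0 mulr1.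
  have z := fibre_zero (pq0 _ p1 q1).
  have w0 w : w = 0 :> ext_scalars T Ka.
    rewrite [w]tensP big1 // => -[x k] _ /=.
    have -> : x ⊗ k = k *: tio x by rewrite /bc_io ext_scale_pure mulr1.
    by rewrite z scaler0.
  by move/eqP: e1; rewrite (w0 (g _)) p0 eq_sym oner_eq0.
- move=> t x t0 xt x1 c; apply: fibre_eval; apply: pq0.
    apply: (mulIf t0); rewrite mul0r; lc (p (tio 1)) xt; lc (p (tio t)) x1; ring.
  apply: (mulIf t0); rewrite mul0r; lc (q (tio 1)) xt; lc (q (tio t)) x1; ring.
Qed.
End Fibre.

Section Existence.
Context {R : comNzRingType} {I : finType} {K : I -> fieldType}.
Context {chi : forall i, {rmorphism R -> K i}}.
Hypothesis res : residue_system chi.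
Variable h : R.
Hypothesis h2 : h * 2%:R = 1.
Context {T : comAlgType R}.

Lemma crt_values (a : forall i, K i) : exists r, forall i, chi i r = a i.
Proof.
have H i : exists x, chi i x = a i by exact: (res_surj res).
have [r rE] := crt res (fun i => projT1 (cid (H i))).
by exists r => i; rewrite rE; exact: projT2 (cid (H i)).
Qed.

(* [1] and [t] generate [T] by Nakayama, and the projection onto their span is the
   identity because it is so modulo each maximal ideal. *)
Lemma quadratic_coords : fg_projective T -> constant_rank T 2 ->
  exists (t : T) (A B : {scalar T}), (forall x, x = (A x)%:A + B x *: t) /\
    forall a b, A (a%:A + b *: t) = a /\ B (a%:A + b *: t) = b.
Proof.
move=> proj rk.
pose dt i := projT1 (cid (fibre_det (chi i) rk)).
have dtl i : forall a x y z, dt i (a *: x + y) z = chi i a * dt i x z + dt i y z.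
  by have [] := projT2 (cid (fibre_det (chi i) rk)).
have dtN i : forall x y, dt i x y = - dt i y x by have [] := projT2 (cid (fibre_det (chi i) rk)).
have dtex i : exists t, dt i 1 t != 0 by have [] := projT2 (cid (fibre_det (chi i) rk)).
have dtz i : forall t x, dt i 1 t != 0 -> dt i x t = 0 -> dt i 1 x = 0 ->
    forall c : {scalar T}, chi i (c x) = 0 by have [] := projT2 (cid (fibre_det (chi i) rk)).
move: (dt) dtl dtN dtex dtz => {}dt dtl dtN dtex dtz.
have dt0 i z : dt i 0 z = 0.
  have E := dtl i 1 0 0 z; rewrite rmorph1 mul1r scaler0 addr0 in E.
  by apply: (addrI (dt i 0 z)); rewrite -E addr0.
have dtD i x y z : dt i (x + y) z = dt i x z + dt i y z.
  by have := dtl i 1 x y z; rewrite rmorph1 mul1r scale1r.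
have dtZ i a x z : dt i (a *: x) z = chi i a * dt i x z.
  by have := dtl i a x 0 z; rewrite !addr0 dt0 addr0.
have dtxx i x : dt i x x = 0.
  have /eqP := dtN i x x; rewrite -subr_eq0 opprK -mulr2n -mulr_natl mulf_eq0.
  by rewrite (negPf (chi2 (chi := chi) h2 i)) => /eqP.
have [eps epsE] := res_delta res.
pose t := \sum_i eps i *: projT1 (cid (dtex i)).
have dt1 i : dt i 1 t != 0.
  have tE := projT2 (cid (dtex i)).
  suff -> : dt i 1 t = dt i 1 (projT1 (cid (dtex i))) by [].
  rewrite !(dtN i 1) /t; congr (- _).
  rewrite (big_morph (fun x => dt i x 1) (fun x y => dtD i x y 1) (dt0 i 1)).
  rewrite (bigD1 i) //= dtZ epsE eqxx mul1r big1 ?addr0 // => j ji.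
  by rewrite dtZ epsE (negPf ji) mul0r.
have [[n v c cE]] := fg_projective_coord_system proj.
have aE j : exists a, forall i, chi i a = dt i (v j) t / dt i 1 t := crt_values (fun i => dt i (v j) t / dt i 1 t).
have bE j : exists b, forall i, chi i b = dt i 1 (v j) / dt i 1 t := crt_values (fun i => dt i 1 (v j) / dt i 1 t).
have [a {}aE] := boolp.choice aE; have [b {}bE] := boolp.choice bE.
(* By the choice of [a] and [b] with Cramer's rule, [w j] vanishes in every fibre. *)
pose w j := v j - (a j)%:A - b j *: t.
have wc i j (f : {scalar T}) : chi i (f (w j)) = 0.
  apply: (dtz i t _ (dt1 i)).
    by rewrite /w -!scaleNr !dtD !dtZ dtxx mulr0 addr0 rmorphN aE mulNr divfK ?dt1 // subrr.
  rewrite dtN /w -!scaleNr !dtD !dtZ dtxx mulr0 addr0 (dtN i t 1) rmorphN bE mulrNN divfK ?dt1 //.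
  by rewrite (dtN i 1 (v j)) subrr oppr0.
pose M : 'M[R]_n := \matrix_(j, k) c k (w j).
(* The determinant trick of Nakayama's lemma: [M] vanishes at all residue fields, so det(1 - M) is 1
   there and hence a unit. *)
have [D DE] : exists D, D = \det (1%:M - M) by eexists.
have [D' DD'] : exists D', D' * D = 1.
  apply: (res_unit res) => i; rewrite DE -det_map_mx (_ : map_mx _ _ = 1%:M) ?det1 ?oner_neq0 //.
  by apply/matrixP => j k; rewrite !mxE rmorphB wc subr0 rmorph_nat.
pose N := \adj (1%:M - M).
have vN l : D *: v l = (\sum_j N l j * a j)%:A + (\sum_j N l j * b j) *: t.
  have E1 j : \sum_k (1%:M - M) j k *: v k = (a j)%:A + b j *: t.
    transitivity (v j - \sum_k c k (w j) *: v k); last first.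
        by rewrite -cE /w -[v j - _ - _]addrA -opprD subKr.
    rewrite (eq_bigr (fun k => (j == k)%:R *: v k - c k (w j) *: v k)); last first.
      by move=> k _; rewrite !mxE scalerBl.
    rewrite sumrB; congr (_ - _); rewrite (bigD1 j) //= eqxx scale1r big1 ?addr0 // => k kj.
    by rewrite eq_sym (negPf kj) scale0r.
  transitivity (\sum_j N l j *: ((a j)%:A + b j *: t)); last first.
    rewrite !scaler_suml -big_split; apply: eq_bigr => j _ /=.
    by rewrite scalerDr !scalerA.
  rewrite (eq_bigr (fun j => \sum_k (N l j * (1%:M - M) j k) *: v k)); last first.
    by move=> j _; rewrite -E1 scaler_sumr; apply: eq_bigr => k _; rewrite scalerA.
  rewrite exchange_big /= (eq_bigr (fun k => (D%:M : 'M[R]_n) l k *: v k)); last first.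
    move=> k _; rewrite -scaler_suml; congr (_ *: _).
    by rewrite DE -mul_adj_mx mxE.
  rewrite (bigD1 l) //= mxE eqxx big1 ?addr0 ?mulr1n // => k kl.
  by rewrite mxE eq_sym (negPf kl) scale0r.
pose a' l := D' * \sum_j N l j * a j; pose b' l := D' * \sum_j N l j * b j.
have vE l : v l = (a' l)%:A + b' l *: t.
  by rewrite -!(scalerA D') -scalerDr -vN scalerA DD' scale1r.
have A_lin : scalar (fun x : T => \sum_l c l x * a' l).
  move=> r x y; rewrite mulr_sumr -big_split; apply: eq_bigr => l _ /=.
  by rewrite linearP mulrDl mulrA.
have B_lin : scalar (fun x : T => \sum_l c l x * b' l).
  move=> r x y; rewrite mulr_sumr -big_split; apply: eq_bigr => l _ /=.
  by rewrite linearP mulrDl mulrA.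
pose A := mk_scalar A_lin; pose B := mk_scalar B_lin.
have xE x : x = (A x)%:A + B x *: t.
  rewrite {1}[x]cE /A /B /= !scaler_suml -big_split; apply: eq_bigr => l _ /=.
  by rewrite -(scalerA _ (a' l)) -(scalerA _ (b' l)) -scalerDr -vE.
exists t, A, B; split=> //.
have ABi i (p q : R) : p%:A + q *: t = 0 -> chi i p = 0 /\ chi i q = 0.
  move=> E; have E1 := dt0 i t; have E2 := dt0 i 1; move: E1 E2; rewrite -E !dtD !dtZ !dtxx !mulr0 addr0 add0r.
  rewrite (dtN i t 1) => /eqP; rewrite mulf_eq0 (negPf (dt1 i)) orbF => /eqP -> /eqP.
  by rewrite mulf_eq0 oppr_eq0 (negPf (dt1 i)) orbF => /eqP ->.
have ker (p q : R) : p%:A + q *: t = 0 -> p = 0 /\ q = 0.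
  move=> E.
  have EA : p * A 1 + q * A t = 0 by rewrite -!linearZ -linearD E linear0.
  have EB : p * B 1 + q * B t = 0 by rewrite -!linearZ -linearD E linear0.
  (* The matrix of the coordinates of 1 and [t] is the identity at each residue field, because 1 and
     [t] are independent in each fibre; its determinant is therefore a unit. *)
  have [U UE] : exists U, U * (A 1 * B t - B 1 * A t) = 1.
    apply: (res_unit res) => i.
    have K1 : (A 1 - 1)%:A + B 1 *: t = 0 by rewrite scalerBl addrAC -xE scale1r subrr.
    have K2 : (A t)%:A + (B t - 1) *: t = 0 by rewrite scalerBl addrA -xE scale1r subrr.
    have [E1 E2] := ABi i _ _ K1; have [E3 E4] := ABi i _ _ K2.
    rewrite rmorphB !rmorphM E2 mul0r subr0.
    have -> : chi i (A 1) = 1 by apply/eqP; rewrite -subr_eq0 -(rmorph1 (chi i)) -rmorphB E1.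
    have -> : chi i (B t) = 1 by apply/eqP; rewrite -subr_eq0 -(rmorph1 (chi i)) -rmorphB E4.
    by rewrite mul1r oner_neq0.
  split.
    by rewrite -[p]mul1r -UE; lc (U * B t) EA; lc (- U * A t) EB; ring.
  by rewrite -[q]mul1r -UE; lc (- U * B 1) EA; lc (U * A 1) EB; ring.
move=> p q; pose x := p%:A + q *: t.
have [E1 E2] : A x - p = 0 /\ B x - q = 0.
  by apply: ker; rewrite !scalerBl addrACA -xE -opprD subrr.
by split; apply/eqP; rewrite -subr_eq0 ?E1 ?E2.
Qed.

(** Completing the square for the generator [t] gives lam with lam^2 = d in R. If [d] vanished at a
    residue field, the fibre would be K[lam]/(lam^2), whose map to K has several lifts to the dual
    numbers, against the uniqueness of lifts for an étale algebra. *)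
Theorem exists_quadratic_generator : quadratic_etale T -> exists lam : T, quadratic_generator lam.
Proof.
move=> [proj fe rk]; have [t [A [B [xE ABE]]]] := quadratic_coords proj rk.
have [u0 u0E] : exists u, u = A (t * t) by eexists.
have [u1 u1E] : exists u, u = B (t * t) by eexists.
have tt : t * t = u0%:A + u1 *: t by rewrite u0E u1E -xE.
(* A quarter of the discriminant of the quadratic equation for [t]. *)
pose d := u0 + h * h * u1 * u1.
pose lam : T := t - (h * u1)%:A.
have h22 : h * u1 + h * u1 = u1 by lc u1 h2; ring.
have lam2 : lam * lam = d%:A.
  rewrite /lam mulrBl !mulrBr tt -!scalerAl -!scalerAr !mulr1 !mul1r scalerA /d scalerDl.
  rewrite -{1}h22 scalerDl; set x := u0%:A; set y := (h * u1) *: t.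
  have -> : h * h * u1 * u1 = h * u1 * (h * u1) by ring.
  by rewrite opprB addrA [x + (y + y)]addrA addrK addrAC addrK.
have dec (x : T) : x = (A x + h * u1 * B x)%:A + B x *: lam.
  rewrite /lam scalerBr scalerDl scalerA (mulrC (B x)) [X in _ + X]addrC -addrA addrA.
  by rewrite addrA addrK -xE.
have co a b : A (a%:A + b *: lam) + h * u1 * B (a%:A + b *: lam) = a /\ B (a%:A + b *: lam) = b.
  have -> : a%:A + b *: lam = (a - h * u1 * b)%:A + b *: t.
    by rewrite /lam scalerBr scalerBl scalerA (mulrC b) addrA addrAC.
  by have [-> ->] := ABE (a - h * u1 * b) b; split=> //; ring.
pose re x := A x + h * u1 * B x.
have coM s s' : re (s * s') = re s * re s' + d * B s * B s' /\ B (s * s') = re s * B s' + B s * re s'.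
  have E : s * s' = (re s * re s' + d * B s * B s')%:A + (re s * B s' + B s * re s') *: lam.
    have aM a b : (a * b)%:A = a%:A * b%:A :> T by rewrite -scalerAl mul1r scalerA.
    have sE : s = (re s)%:A + (B s)%:A * lam by rewrite mulr_algl -dec.
    have sE' : s' = (re s')%:A + (B s')%:A * lam by rewrite mulr_algl -dec.
    rewrite -(mulr_algl (_ + _) lam) !scalerDl !aM {1}sE {1}sE'.
    move: ((re s)%:A) ((B s)%:A) ((re s')%:A) ((B s')%:A) (d%:A) lam2 => P Q P' Q' D lam2.
    by lc (Q * Q') lam2; ring.
  by rewrite /re; have [E1 E2] := co (re s * re s' + d * B s * B s') (re s * B s' + B s * re s'); rewrite -E in E1 E2.
exists lam; split; last first.
  move=> x; exists (re x, B x); split=> [|[a b] E]; first exact: dec.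
  by have [E1 E2] := co a b; rewrite E /re E1 E2.
exists d; last by rewrite expr2.
apply: (res_unit res) => i; apply/eqP => d0.
have re1 : re 1 = 1 /\ B 1 = 0.
  by have := co 1 0; rewrite scale0r addr0 scale1r.
have reD s s' : re (s - s') = re s - re s' by rewrite /re !linearB /=; ring.
have reZ a s : re (a *: s) = a * re s by rewrite /re !linearZ /=; ring.
clearbody re.
pose Ka := alg_along (chi i).
pose chD : {rmorphism R -> dualn (K i)} := (@dualn_inj (K i)) \o chi i.
pose Da := alg_along chD.
pose g0 (x : T) : Ka := chi i (re x).
have g_add : zmod_morphism g0 by move=> x y; rewrite /g0 reD rmorphB.
have g_mul : monoid_morphism g0.
  split=> [|x y]; rewrite /g0 ?re1.1 ?rmorph1 // (coM x y).1 rmorphD !rmorphM d0 !mul0r addr0 //.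
have g_scal : scalable g0 by move=> a x; rewrite /g0 reZ rmorphM.
pose g : {lrmorphism T -> Ka} := HB.pack g0 (GRing.isZmodMorphism.Build _ _ g0 g_add)
  (GRing.isMonoidMorphism.Build _ _ g0 g_mul) (GRing.isScalable.Build _ _ _ _ g0 g_scal).
pose p0 (x : Da) : Ka := x.1.
have p_add : zmod_morphism p0 by [].
have p_mul : monoid_morphism p0 by [].
have p_scal : scalable p0 by [].
pose p : {lrmorphism Da -> Ka} := HB.pack p0 (GRing.isZmodMorphism.Build _ _ p0 p_add)
  (GRing.isMonoidMorphism.Build _ _ p0 p_mul) (GRing.isScalable.Build _ _ _ _ p0 p_scal).
(* Every [c] gives a lift, sending lam to c eps; those for 1 and 0 are different. *)
have lift (c : K i) : exists k : {lrmorphism T -> Da}, p \o k =1 g /\ (k lam : dualn (K i)).2 = c.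
  pose k0 (x : T) : Da := (chi i (re x), c * chi i (B x)).
  have k_add : zmod_morphism k0.
    move=> x y; transitivity ((chi i (re x) - chi i (re y), c * chi i (B x) - c * chi i (B y)) : dualn (K i)) => //.
    by rewrite /k0 reD linearB !rmorphB /= mulrBr.
  have k_mul : monoid_morphism k0.
    split=> [|x y].
      by rewrite /k0 re1.1 re1.2 rmorph1 rmorph0 mulr0.
    transitivity ((chi i (re x) * chi i (re y), chi i (re x) * (c * chi i (B y)) + c * chi i (B x) * chi i (re y)) : dualn (K i)) => //.
    rewrite /k0 (coM x y).1 (coM x y).2 !rmorphD !rmorphM d0 !mul0r addr0.
    by congr (_, _); ring.
  have k_scal : scalable k0.
    move=> a x; transitivity ((chi i a * chi i (re x), chi i a * (c * chi i (B x)) + 0 * chi i (re x)) : dualn (K i)) => //.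
    rewrite /k0 reZ linearZ !rmorphM /= ?rmorphM; congr (_, _); ring.
  pose k : {lrmorphism T -> Da} := HB.pack k0 (GRing.isZmodMorphism.Build _ _ k0 k_add)
    (GRing.isMonoidMorphism.Build _ _ k0 k_mul) (GRing.isScalable.Build _ _ _ _ k0 k_scal).
  exists k.
  split=> //=; have [_ E] := co 0 1; rewrite scale0r add0r scale1r in E.
  by rewrite /k0 /= E rmorph1 mulr1.
have [||k [kE kU]] := fe Da Ka p g.
- by move=> x; exists ((x : K i, 0) : dualn (K i)).
- move=> [x x'] [y y'] /= x0 y0; rewrite /p0 /= in x0 y0; rewrite x0 y0.
  by transitivity ((0 * 0, 0 * y' + x' * 0) : dualn (K i)) => //; rewrite !mul0r mulr0 addr0.
have [k1 [k1E k1c]] := lift 1; have [k2 [k2E k2c]] := lift 0.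
have := oner_neq0 (K i); rewrite -k1c (kU k1 k1E) -(kU k2 k2E) k2c eqxx //.
Qed.
End Existence.

(** * The exact sequence of Witt groups *)

Section Sequence.
Context {R : comNzRingType} {I : finType} {K : I -> fieldType}.
Context {chi : forall i, {rmorphism R -> K i}}.
Hypothesis res : residue_system chi.
Variable h : R.
Hypothesis h2 : h * 2%:R = 1.
Context {T : comAlgType R} {lam : T} {d d' : R} {re im : T -> R}.
Hypothesis qb : quad_basis lam d d' re im.
Let dd' := qb_unit qb.
Let hT := half_alg (T := T) h2.
Let ikap2 := @id_kap2 R.
Let ikre := @id_kre R T re.
Let ikim := @id_kim R T im.
Let skap2 := @st_kap2 R.
Let skre := st_kre qb.
Let skim := st_kim qb.
Let stK : involutive (std_inv T) := inv_kK qb skap2 skre skim.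
Let st1 : std_inv T 1 = 1 := inv_k1 qb skre skim.
Let idK : involutive (@idfun T). Proof. by []. Qed.
Let idKR : involutive (@idfun R). Proof. by []. Qed.

Variables (tr1 : witt (std_inv T) 1 -> witt (@idfun R) 1)
  (lrho1 : witt (@idfun R) 1 -> witt (@idfun T) 1)
  (tr2 : witt (@idfun T) 1 -> witt (@idfun R) 1)
  (lrho2 : witt (@idfun R) 1 -> witt (std_inv T) (-1)).
Hypotheses (tr1I : witt_hom_induced_by (@trace_form R T) tr1)
  (lrho1I : witt_hom_induced_by (scaled_base_change lam idfun) lrho1)
  (tr2I : witt_hom_induced_by (@trace_form R T) tr2)
  (lrho2I : witt_hom_induced_by (scaled_base_change lam (std_inv T)) lrho2).

Let tr1E S := induced_class tr1I (uh_trace1 h2 qb (sp_prop S)).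
Let tr2E S := induced_class tr2I (uh_trace2 h2 qb (sp_prop S)).
Let lrho1E S := induced_class lrho1I (uh_bc1 qb (sp_prop S)).
Let lrho2E S := induced_class lrho2I (uh_bc2 qb (sp_prop S)).

(** A hyperbolic operator for the trace form can be made to commute with lam, hence T-linear, and it
    is then skew-adjoint for the hermitian form itself. *)
Lemma tr1_inj : injective tr1.
Proof.
move=> x y E; apply: witt_subr0_eq.
have [S SE] := witt_single stK st1 hT (witt_add x (witt_opp y)).
have tr0 : tr1 (witt_class S) = witt0 _ _.
  by rewrite -SE tr1I.1 (witt_homN _ tr1I.1) E witt_addrN.
rewrite tr1E in tr0; rewrite SE; apply: witt_class_hyperbolic.
have [s hs] := witt_zero_hyp res h2 tr0.
have uS := sp_prop S; have [_ [sF _] _] := uS.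
have Vf := id_sym_space (uh_trace1 h2 qb uS).
pose lm (x : res_scalars (fm_car S)) : res_scalars (fm_car S) := lam *: (x : fm_car S).
have lS (u v : res_scalars (fm_car S)) : @fm_val _ (trace_form S) (lm u) v = - @fm_val _ (trace_form S) u (lm v).
  by rewrite (lam_adj qb skre skim (F := S) u v uS) mulN1r.
have l2 u : lm (lm u) = d *: u by rewrite /lm scalerA (qb_sq qb).
have [s' [hs' sl]] := skew_hyp_commute_id res h2 Vf dd' lS l2 hs.
apply: (@hyp_op_hyperbolic _ _ _ hT S s' sF st1).
exact: (lift_hyp h2 qb skap2 skre skim uS hs' sl).
Qed.

Lemma exact_at_first : witt_exact tr1 lrho1.
Proof.
move=> y; split=> [l0|[x <-]].
  have [S SE] := witt_single idKR erefl h2 y; rewrite SE lrho1E in l0.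
  have [H [H' [hH hH' iso]]] := witt_class_eq0 idK erefl hT l0.
  have [KK [Q [uK hK uQ hyp]]] := core2 res h2 qb (sp_prop S) (sp_prop H) hH (isometric_hyperbolic iso hH').
  exists (witt_class (Space uQ)); rewrite tr1E SE.
  have <- : witt_class (sp_sum S (Space uK)) = witt_class S.
    by rewrite witt_class_sum (witt_class_hyperbolic (S := Space uK) hK) witt_addr0.
  by apply: esym; exact: (witt_class_eq (S := sp_sum S (Space uK)) (S' := Space (uh_trace1 h2 qb uQ)) idKR erefl h2 hyp).
have [S ->] := witt_single stK st1 hT x; rewrite tr1E lrho1E; apply: witt_class_hyperbolic => /=.
have uS := sp_prop S.
apply: (@sbc_cplx_hyperbolic _ _ h2 _ _ _ _ _ _ qb idfun 1 ikap2 ikre ikim (trace_form S)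
  (mk_linear (@res_lam_linear R T lam (fm_car S)))).
- exact: (uh_trace1 h2 qb uS).
- by move=> u /=; rewrite scalerA (qb_sq qb).
- by move=> u v; rewrite (lam_adj qb skre skim (F := S) u v uS) mulN1r mul1r.
Qed.

Lemma exact_at_second : witt_exact lrho1 tr2.
Proof.
move=> y; split=> [t0|[x <-]].
  have [S SE] := witt_single idK erefl hT y; rewrite SE tr2E in t0.
  have [s hs] := witt_zero_hyp res h2 t0.
  have [L [uL hyp]] := core3 res h2 qb (sp_prop S) hs.
  exists (witt_class (Space uL)); rewrite lrho1E SE; apply: esym.
  exact: (witt_class_eq (S' := Space (uh_bc1 qb uL)) idK erefl hT hyp).
have [S ->] := witt_single idKR erefl h2 x; rewrite lrho1E tr2E; apply: witt_class_hyperbolic => /=.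
have uS := sp_prop S; have Sf := id_sym_space uS.
have uT := uh_trace2 h2 qb (uh_bc1 qb uS).
have em := bc_ext_mod qb (fm_car S).
(* Conjugation changes the sign of the lam-coordinate of the base changed form, which is what the
   trace sees after scaling by lam. *)
pose t (w : ext_scalars (fm_car S) T) : ext_scalars (fm_car S) T :=
  bc_io (bc_re re w) - lam *: bc_io (bc_im im w).
have tE w : bc_re re (t w) = bc_re re w /\ bc_im im (t w) = - bc_im im w.
  by rewrite /t !(emE qb em) scaler0 subr0 add0r ?sub0r.
suff hs : is_hyp (@fm_val _ (trace_form (scaled_base_change lam idfun S))) id t.
  exact: (is_hyp_hyperbolic h2 uT hs).
split=> [w w'|w|w] //.
  rewrite !(trace_val qb) /= !(qbE qb) !(bc_valE qb ikre ikim _ _ Sf).1 !(bc_valE qb ikre ikim _ _ Sf).2.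
  by rewrite (tE w).1 (tE w).2 (tE w').1 (tE w').2 !(fE Sf); ring.
by apply: (em_ext em); rewrite ?(tE _).1 ?(tE _).2 ?(tE _).1 ?(tE _).2 ?opprK.
Qed.

Lemma exact_at_third : witt_exact tr2 lrho2.
Proof.
move=> y; split=> [l0|[x <-]].
  have [S SE] := witt_single idKR erefl h2 y; rewrite SE lrho2E in l0.
  have [H [H' [hH hH' iso]]] := witt_class_eq0 stK st1 hT l0.
  have [Q [uQ isoQ]] := core4 res h2 qb (sp_prop S) (sp_prop H) hH (isometric_hyperbolic iso hH').
  by exists (witt_class (Space uQ)); rewrite tr2E SE; apply: witt_isometric.
have [S ->] := witt_single idK erefl hT x; rewrite tr2E lrho2E; apply: witt_class_hyperbolic => /=.
have uS := sp_prop S.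
apply: (@sbc_cplx_hyperbolic _ _ h2 _ _ _ _ _ _ qb (std_inv T) (-1) skap2 skre skim (trace_form S)
  (mk_linear (@res_lam_linear R T lam (fm_car S)))).
- exact: (uh_trace2 h2 qb uS).
- by move=> u /=; rewrite scalerA (qb_sq qb).
- by move=> u v; rewrite (lam_adj qb ikre ikim (F := S) u v uS) mul1r mulN1r opprK.
Qed.

Lemma lrho2_surj y : exists x, lrho2 x = y.
Proof.
have [S ->] := witt_single stK st1 hT y.
have [L [uL iso]] := core5 res h2 qb (sp_prop S).
by exists (witt_class (Space uL)); rewrite lrho2E; apply: witt_isometric.
Qed.

End Sequence.

Theorem corollary8p3 (R : comNzRingType) (T : comAlgType R)
    (R_semilocal : semilocal R) (R_two : is_unit (2%:R : R))
    (T_etale : quadratic_etale T) :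
  (exists lam : T, quadratic_generator lam) /\
  forall lam : T, quadratic_generator lam ->
    exists (tr1 : witt (std_inv T) 1 -> witt (@idfun R) 1)
           (lrho1 : witt (@idfun R) 1 -> witt (@idfun T) 1)
           (tr2 : witt (@idfun T) 1 -> witt (@idfun R) 1)
           (lrho2 : witt (@idfun R) 1 -> witt (std_inv T) (-1)),
      [/\ witt_hom_induced_by (@trace_form R T) tr1,
          witt_hom_induced_by (scaled_base_change lam idfun) lrho1,
          witt_hom_induced_by (@trace_form R T) tr2
        & witt_hom_induced_by (scaled_base_change lam (std_inv T)) lrho2] /\
      [/\ injective tr1, witt_exact tr1 lrho1, witt_exact lrho1 tr2,
          witt_exact tr2 lrho2 & forall y, exists x, lrho2 x = y].
Proof.
have [h h2] := R_two; have [I [K [chi res]]] := semilocal_residue_system R_semilocal.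
split; first exact: (exists_quadratic_generator res h2 T_etale).
move=> lam gen; have [d [d' [re [im qb]]]] := quadratic_generator_basis gen.
have I1 := ind_witt_induced (fun F => @uh_trace1 _ _ h2 _ _ _ _ _ _ qb F)
  (fun F G _ _ => @trace_isometric _ _ F G) (fun F G _ _ => @trace_orth_sum _ _ F G)
  (fun F _ => @trace_hyperbolic _ _ F).
have I2 := ind_witt_induced (fun F => @uh_bc1 _ _ _ _ _ _ _ qb F)
  (sbc_isometric qb (@id_kre R T re) (@id_kim R T im)) (sbc_orth_sum qb (@id_kre R T re) (@id_kim R T im))
  (sbc_hyperbolic qb h2 (@id_kap2 R) (@id_kre R T re) (@id_kim R T im)).
have I3 := ind_witt_induced (fun F => @uh_trace2 _ _ h2 _ _ _ _ _ _ qb F)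
  (fun F G _ _ => @trace_isometric _ _ F G) (fun F G _ _ => @trace_orth_sum _ _ F G)
  (fun F _ => @trace_hyperbolic _ _ F).
have I4 := ind_witt_induced (fun F => @uh_bc2 _ _ _ _ _ _ _ qb F)
  (sbc_isometric qb (st_kre qb) (st_kim qb)) (sbc_orth_sum qb (st_kre qb) (st_kim qb))
  (sbc_hyperbolic qb h2 (@st_kap2 R) (st_kre qb) (st_kim qb)).
do 4 eexists; split; first by split; [exact: I1|exact: I2|exact: I3|exact: I4].
split.
- exact: (tr1_inj res h2 qb I1).
- exact: (exact_at_first res h2 qb I1 I2).
- exact: (exact_at_second res h2 qb I2 I3).
- exact: (exact_at_third res h2 qb I3 I4).
- exact: (lrho2_surj res h2 qb I4).
Qed.
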